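(* Let $a\in[0,\infty)$, $T>0$, and $R>R_0:=e^{(3e)^{-1}}(1+a)^{\frac13}>1$. Let $P=\partial_x^3+a\,\partial_x$ and $$\mathcal R_R:=\{y\in C^0([-1,0]):\ \exists z\in H(D(0,R)),\ y=z|_{[-1,0]},\ \text{and } (P^ny)(0)=\partial_x(P^ny)(0)=0\ \ \forall n\ge0\}.$$ Let $y_1\in\mathcal R_R$. Then there exists a control input $u\in G^3([0,T])$ such that the solution $y=y(x,t)$ of the system $$\begin{cases}\partial_t y+\partial_x^3 y+a\,\partial_x y=0, & x\in(-1,0),\ t\in(0,T),\\ y(0,t)=\partial_x y(0,t)=0, & t\in(0,T),\\ y(-1,t)=u(t), & t\in(0,T),\\ y(x,0)=0, & x\in(-1,0),\end{cases}$$ satisfies $y(\cdot,T)=y_1$. Furthermore, $y\in G^{1,3}([-1,0]\times[0,T])$.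
   Context: $\mathbb N=\{0,1,2,\dots\}$. $D(z_0,R)=\{z\in\mathbb C:\ |z-z_0|<R\}$, and $H(D(z_0,R))$ is the set of holomorphic functions on $D(z_0,R)$. $P^0=\mathrm{Id}$, $P^n=P\circ P^{n-1}$. For $s\ge 0$, $G^s([t_1,t_2])$ (functions Gevrey of order $s$) is the set of $u\in C^\infty([t_1,t_2])$ for which there are constants $C\ge 0$, $R>0$ with $|\partial_t^n u(t)|\le C\,(n!)^s/R^n$ for all $n\in\mathbb N$, $t\in[t_1,t_2]$. $G^{s_1,s_2}([x_1,x_2]\times[t_1,t_2])$ (functions Gevrey of order $s_1$ in $x$ and $s_2$ in $t$) is the set of $y\in C^\infty([x_1,x_2]\times[t_1,t_2])$ for which there are constants $C,R_1,R_2>0$ with $|\partial_x^{n_1}\partial_t^{n_2}y(x,t)|\le C\,(n_1!)^{s_1}(n_2!)^{s_2}/(R_1^{n_1}R_2^{n_2})$ for all $n_1,n_2\in\mathbb N$ and all $(x,t)$ in the rectangle. Functions $y$, $y_1$, $u$ are real-valued. ''Solution'' is meant in the usual semigroup sense: let $Aw=-w'''-aw'$ with domain $D(A)=\{w\in H^3(-1,0):\ w(-1)=w(0)=w'(0)=0\}$, which generates a contraction semigroup $(e^{tA})_{t\ge0}$ on $L^2(-1,0)$. For $u\in C^1([0,T])$ and initial datum $y_0\in L^2(-1,0)$, the solution is $y(x,t)=u(t)x^2+w(x,t)$, where $w\in C([0,T],L^2(-1,0))$ is the mild solution of $w_t=Aw-u'(t)x^2-2a\,u(t)x$, $w(\cdot,0)=y_0-u(0)x^2$.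 *)

(* Defs.v *)
From HB Require Import structures.
From mathcomp Require Import all_boot all_order all_algebra complex.
From mathcomp Require Import all_classical all_reals all_analysis.
From mathcomp Require Import measurable_realfun.

Set Implicit Arguments.
Unset Strict Implicit.
Unset Printing Implicit Defensive.

Import Order.TTheory GRing.Theory Num.Theory numFieldNormedType.Exports.

Local Open Scope classical_set_scope.
Local Open Scope ring_scope.
Local Open Scope complex_scope.

Section one_variable_calculus.
Context {R : realType}.
Implicit Types (A : set R) (f u : R -> R).

(* Derivatives relative to a set, so that they are one-sided at the endpoints
   of a closed interval.  [derive_on A f x] only carries information under
   [derivable_on A f x]. *)
Definition diff_quotient f (x : R) : R -> R :=
  fun h => (f h - f x) / (h - x).

Definition derivable_on A f (x : R) : Prop :=
  cvg (diff_quotient f x @ within A x^').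

Definition derive_on A f : R -> R :=
  fun x => lim (diff_quotient f x @ within A x^').

Definition smooth_on (t1 t2 : R) u : Prop :=
  forall (n : nat) (t : R), `[t1, t2]%classic t ->
    derivable_on `[t1, t2] (iter n (derive_on `[t1, t2]) u) t.

Definition gevrey (s t1 t2 : R) u : Prop :=
  smooth_on t1 t2 u /\
  exists C r : R, [/\ 0 <= C, 0 < r &
    forall (n : nat) (t : R), `[t1, t2]%classic t ->
      `|iter n (derive_on `[t1, t2]) u t| <= C * (n`!%:R `^ s) / r ^+ n].

Definition C1_on (t1 t2 : R) u : Prop :=
  (forall t : R, `[t1, t2]%classic t -> derivable_on `[t1, t2] u t) /\
  {within `[t1, t2], continuous (derive_on `[t1, t2] u)}.

End one_variable_calculus.

Section two_variable_calculus.
Context {R : realType}.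
Variables x1 x2 t1 t2 : R.
Implicit Types y : R -> R -> R.

Definition dx y : R -> R -> R := fun x t => derive_on `[x1, x2] (y^~ t) x.
Definition dt y : R -> R -> R := fun x t => derive_on `[t1, t2] (y x) t.

Fixpoint Ck2 (k : nat) y : Prop :=
  {within `[x1, x2] `*` `[t1, t2], continuous (fun p : R * R => y p.1 p.2)} /\
  match k with
  | 0%N => True
  | k'.+1 =>
      [/\ forall x t : R, `[x1, x2]%classic x -> `[t1, t2]%classic t ->
            derivable_on `[x1, x2] (y^~ t) x /\ derivable_on `[t1, t2] (y x) t,
          Ck2 k' (dx y)
        & Ck2 k' (dt y)]
  end.

Definition smooth2 y : Prop := forall k : nat, Ck2 k y.

Definition gevrey2 (s1 s2 : R) y : Prop :=
  smooth2 y /\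
  exists C r1 r2 : R, [/\ 0 < C, 0 < r1, 0 < r2 &
    forall (n1 n2 : nat) (x t : R),
      `[x1, x2]%classic x -> `[t1, t2]%classic t ->
      `|iter n1 dx (iter n2 dt y) x t|
        <= C * (n1`!%:R `^ s1) * (n2`!%:R `^ s2) / (r1 ^+ n1 * r2 ^+ n2)].

End two_variable_calculus.

Section reachable_space.
Context {R : realType}.

(* Complex differentiability at every point of the open disc.  [^o] selects the
   structure of one-dimensional normed space of the complex numbers over
   themselves, so that the increments in [derivable] are complex. *)
Definition holomorphic_on_disc (z0 : R[i]) (r : R) (f : R[i] -> R[i]) : Prop :=
  forall z : R[i], `|z - z0| < r%:C ->
    derivable (f : R[i]^o -> R[i]^o) z (1 : R[i]^o).

Definition Pop (a : R) (y : R -> R) : R -> R :=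
  fun x => iter 3 (derive_on `[-1, 0]) y x + a * derive_on `[-1, 0] y x.

Definition R0 (a : R) : R := expR ((3 * expR 1)^-1) * (1 + a) `^ (3^-1).

Lemma R0_gt1 (a : R) : 0 <= a -> 1 < R0 a.
Proof.
move=> a0; apply: (@lt_le_trans _ _ (expR ((3 * expR 1)^-1))).
  by rewrite expR_gt1 invr_gt0 mulr_gt0// expR_gt0.
rewrite ler_peMr ?expR_ge0//.
rewrite -[leLHS](congr1 (fun f => f (3^-1)) (powR1 R)).
by rewrite ge0_ler_powR ?nnegrE ?invr_ge0 ?lerDl ?addr_ge0.
Qed.

Definition reachR (a r : R) : set (R -> R) := [set y : R -> R |
  {within `[(-1 : R), 0], continuous y} /\
  exists f : R[i] -> R[i],
    [/\ holomorphic_on_disc 0 r f,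
        forall x : R, `[-1, 0]%classic x -> f x%:C = (y x)%:C
      & forall n : nat,
          iter n (Pop a) y 0 = 0 /\ derive_on `[-1, 0] (iter n (Pop a) y) 0 = 0]].

End reachable_space.

Section L2_space.
Context {R : realType}.

Definition unit_itv : set (measurableTypeR R) := `](-1)%R, 0%R[%classic.

Lemma measurable_unit_itv : measurable unit_itv.
Proof. exact: measurable_itv. Qed.

Lemma lebesgue_unit_itv_lty : ((@lebesgue_measure R) unit_itv < +oo)%E.
Proof. by rewrite lebesgue_measure_itv/=; case: ifPn => _; rewrite ?ltry. Qed.

(* Lebesgue measure on ]-1, 0[, seen as a measure on the whole line. *)
Definition leb : {finite_measure set (measurableTypeR R) -> \bar R} :=
  mfrestr measurable_unit_itv lebesgue_unit_itv_lty.

Lemma Lfun_expn (n : nat) : (fun x : R => x ^+ n) \in Lfun leb 2%:E.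
Proof.
have mf : measurable_fun [set: measurableTypeR R] (fun x : R => x ^+ n).
  exact: exprn_measurable.
rewrite inE/=; apply/andP; split; rewrite inE//=.
rewrite /finite_norm unlock poweR_lty//.
apply: (@le_lt_trans _ _ (\int[leb]_x (cst 1 x))%E); last first.
  by rewrite integral_cst//= mul1e; exact: fin_num_fun_lty.
apply: ae_ge0_le_integral => //=.
- apply/measurable_EFinP.
  apply: (measurableT_comp (measurable_powR _)).
  exact: measurableT_comp.
- exists (~` unit_itv); split.
  + by apply: measurableC; exact: measurable_unit_itv.
  + by rewrite /leb/= /mfrestr /mrestr setICl measure0.
  + move=> x /=; apply: contra_not; rewrite /unit_itv/= in_itv/=.
    move=> /andP[x1 x0] _; rewrite lee_fin.
    rewrite -[leRHS](congr1 (fun f => f 2) (powR1 R)).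
    rewrite ge0_ler_powR ?nnegrE// normrX exprn_ile1// ler_norml (ltW x1)/=.
    exact: le_trans (ltW x0) _.
Qed.

(* Elements of L2 are square integrable functions, not classes: equalities
   between them are stated almost everywhere, and [L2norm] is a seminorm. *)
Definition L2 : Type := LfunType leb (lee1n 2).

Definition L2norm (f : L2) : R := fine 'N[leb]_2%:E[EFin \o f].

Definition L2expn (n : nat) : L2 := Lfun_Sub (lee1n 2) (Lfun_expn n).

Definition eqL2 (f g : R -> R) : Prop := f = g %[ae leb].

Definition cvgL2 (F : set_system R) (f : R -> L2) (l : L2) : Prop :=
  L2norm (f t - l) @[t --> F] --> 0.

Definition test_function (phi : R -> R) : Prop :=
  (forall (n : nat) (x : R), derivable (derive1n n phi) x 1) /\
  exists b c : R, [/\ -1 < b, c < 0 &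
    forall x : R, ~ `[b, c]%classic x -> phi x = 0].

Definition weak_derivative (f g : L2) : Prop :=
  forall phi : R -> R, test_function phi ->
    \int[leb]_x (f x * derive1 phi x) = - \int[leb]_x (g x * phi x).

(* Value at a point of [-1, 0] of the continuous representative. *)
Definition trace (f : L2) (x l : R) : Prop :=
  exists c : R -> R,
    [/\ {within `[(-1 : R), 0], continuous c}, eqL2 f c & c x = l].

(* Graph of A w = - w''' - a w', with domain the w in H^3(-1, 0) such that
   w(-1) = w(0) = w'(0) = 0. *)
Definition graphA (a : R) (w g : L2) : Prop :=
  exists w1 w2 w3 : L2,
    [/\ [/\ weak_derivative w w1, weak_derivative w1 w2
          & weak_derivative w2 w3],
        [/\ trace w (-1) 0, trace w 0 0 & trace w1 0 0]
      & eqL2 g (- w3 - a *: w1)].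

Definition contraction_semigroup (S : R -> L2 -> L2) : Prop :=
  [/\ forall (t b : R) (f g : L2), 0 <= t ->
        eqL2 (S t (b *: f + g)) (b *: S t f + S t g),
      forall (t : R) (f : L2), 0 <= t -> L2norm (S t f) <= L2norm f,
      forall f : L2, eqL2 (S 0 f) f,
      forall (s t : R) (f : L2), 0 <= s -> 0 <= t ->
        eqL2 (S (s + t) f) (S s (S t f))
    & forall f : L2, cvgL2 0^'+ (S^~ f) f].

Definition generator (S : R -> L2 -> L2) (f g : L2) : Prop :=
  cvgL2 0^'+ (fun t => t^-1 *: (S t f - f)) g.

Definition semigroup_generated_by_A (a : R) (S : R -> L2 -> L2) : Prop :=
  contraction_semigroup S /\
  forall f g : L2, generator S f g <-> graphA a f g.

(* Riemann integral over [b, c] of an L2-valued function; in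
   [mild_solution] the integrand is continuous. *)
Definition is_integralL2 (g : R -> L2) (b c : R) (l : L2) : Prop :=
  forall e : R, 0 < e -> exists d : R, 0 < d /\
    forall (n : nat) (s xi : nat -> R),
      s 0%N = b -> s n = c ->
      (forall i : nat, (i < n)%N ->
         s i <= xi i <= s i.+1 /\ s i.+1 - s i < d) ->
      L2norm (\sum_(i < n) (s i.+1 - s i) *: g (xi i) - l) < e.

(* w in C([0, T], L2) and w(t) = S(t) w0 + \int_0^t S(t - s) h(s) ds. *)
Definition mild_solution (S : R -> L2 -> L2) (T : R) (h : R -> L2) (w0 : L2)
    (w : R -> L2) : Prop :=
  forall t : R, `[0, T]%classic t ->
    cvgL2 (within `[0, T] (nbhs t)) w (w t) /\
    is_integralL2 (fun s => S (t - s) (h s)) 0 t (w t - S t w0).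

(* As elements of L2 the y(., t) are only determined almost everywhere. *)
Definition is_solution (S : R -> L2 -> L2) (a T : R) (u : R -> R) (y0 : L2)
    (y : R -> R -> R) : Prop :=
  C1_on 0 T u /\
  exists w : R -> L2,
    mild_solution S T
      (fun t => - derive_on `[0, T] u t *: L2expn 2
                - (2 * a * u t) *: L2expn 1)
      (y0 - u 0 *: L2expn 2) w /\
    forall t : R, `[0, T]%classic t ->
      eqL2 (y^~ t) (fun x => u t * x ^+ 2 + w t x).

End L2_space.

Arguments L2 : clear implicits.

(* Main.v *)
(* After reversing time, a solution z of z_t = z_xxx + a z_x with z = z_x = 0 at x = 0
   has to be found that goes from y1 to 0.

   Let G(l, x) solve G''' + a G' = l G with G = G' = 0 and G'' = 1 at x = 0.  The
   superposition E(x, t) of the exp(l t) G(l, x), with l = (tau r)^3 and weight W(r) on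
   0 < r < oo, solves this boundary value problem.  When tau turns just beyond the ray
   of angle -pi/6, the exponentials decay for t > 0, while an energy estimate bounds
   |G(l, x)| on [-1, 0] by exp(kap r) with kap close to 1.  Holomorphy of y1 on a disc
   of radius > 1 lets one choose W, as a contour integral, decaying faster than
   exp(- kap r), and such that the jets at x = 0 of E(., 0) are those of y1; both being
   analytic, E(., 0) = y1.  This works for every r > 1.

   Multiplying the flat output E_xx(0, t), which is Gevrey of order 1 for t > 0, by a
   cutoff of order 2 vanishing for t <= T/2 and equal to 1 to infinite order at T, one
   gets the flat output of a solution E2 which vanishes at t = 0 and coincides with E
   at t = T.  Then z = E - E2, and the control is read off at x = -1.  *)

(* Where the rate 1 comes from: at [mu = 1/3] the three cube roots of lambda = (tau r)^3 are r times
   numbers with real parts 1, 0 and -1, so G grows like exp(r) at x = -1, while Re lambda = 0. A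
   slightly larger [mu] gives Re lambda < 0 at the price of a rate slightly above 1. On the other
   side, analyticity of y1 in a disc of radius rho > 1 makes A_n = (d_x^2 P^n y1)(0) / (3n+2)! of
   size rho^(-3n), and W must satisfy int W lambda^n dr = (3n+2)! A_n. As int r^m exp(-p r) dr = m!
   / p^(m+1), one integrates sum A_m z^(3m+3) against exp(-z tau r) over |z| = P, with 1 < P < rho.
   On a full circle this exponential would grow somewhere; but the A_m are real and the exponents
   multiples of 3, so the arc 0 <= arg z <= pi/3 suffices, and at [mu = 1/3] it is exactly the arc
   where Re(z tau) >= P. Nothing makes E vanish in finite time, hence the correction E2. A flat
   output of Gevrey order below 3 has a series in x that converges everywhere; the one of E is only
   controlled to order 3 down to t = 0, which is why the cutoff lives on t >= T/2. *)
Require Import Defs.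
From mathcomp Require Import all_boot all_order all_algebra complex ring lra zify.
From mathcomp Require Import all_classical all_reals all_analysis.
From mathcomp Require Import measurable_realfun.

Set Implicit Arguments.
Unset Strict Implicit.
Unset Printing Implicit Defensive.

Import Order.TTheory GRing.Theory Num.Theory numFieldNormedType.Exports.
Local Open Scope classical_set_scope.
Local Open Scope ring_scope.

(** * Derivatives with quadratic remainder *)

Section quad.
Context {R : realType}.
Implicit Types (A : set R) (f g : R -> R).

(* [g] is the derivative of [f] on [A], up to a uniform quadratic error.  This
   form is one-sided at the endpoints of an interval and passes to series and to
   integrals depending on a parameter. *)
Definition quad A f g (M : R) : Prop :=
  forall x y, A x -> A y -> `|f y - f x - (y - x) * g x| <= M * (y - x) ^+ 2.

(** A nondegenerate interval has no isolated point; properness of this filter is what makes the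
    one-sided [lim] unique. *)
Lemma within_dnbhs_proper (c d x : R) : c < d -> `[c, d]%classic x ->
  ProperFilter (within `[c, d] x^').
Proof.
move=> cd /=; rewrite in_itv/= => /andP[cx xd].
split; last exact: within_filter.
rewrite /within /= => /nbhs_ballP[e /= e0 xe].
have [y [yx xy cyd]] : exists y, [/\ y != x, `|x - y| < e & c <= y <= d].
  have e20 : 0 < e / 2 by rewrite divr_gt0.
  have e2e : e / 2 < e by rewrite ltr_pdivrMr// ltr_pMr// ltr1n.
  have [xltd|xged] := ltP x d.
    exists (x + Num.min (e / 2) (d - x)).
    have m0 : 0 < Num.min (e / 2) (d - x) by rewrite lt_min e20/= subr_gt0.
    split.
    - by rewrite gt_eqF// ltrDl.
    - rewrite opprD addrA subrr sub0r normrN gtr0_norm//.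
      by rewrite (le_lt_trans _ e2e)// ge_min lexx.
    - rewrite (le_trans cx) ?lerDl ?(ltW m0)//= -lerBrDl.
      by rewrite ge_min lexx orbT.
  have cltx : c < x by apply: lt_le_trans cd xged.
  exists (x - Num.min (e / 2) (x - c)).
  have m0 : 0 < Num.min (e / 2) (x - c) by rewrite lt_min e20/= subr_gt0.
  split.
  - by rewrite lt_eqF// ltrBlDr ltrDl.
  - rewrite opprB addrCA subrr addr0 gtr0_norm//.
    by rewrite (le_lt_trans _ e2e)// ge_min lexx.
  - rewrite (le_trans _ xd) ?gerBl ?(ltW m0)// andbT lerBrDr -lerBrDl.
    by rewrite ge_min lexx orbT.
apply: (xe y) => //=.
Qed.

Lemma quad_cvg (c d : R) f g M x : c < d -> `[c, d]%classic x ->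
  quad `[c, d] f g M -> diff_quotient f x @ within `[c, d] x^' --> g x.
Proof.
move=> cd cdx q; have PF := within_dnbhs_proper cd cdx.
apply/cvgrPdist_le => e e0; rewrite /within/=.
pose N := `|M| + 1; have N0 : 0 < N by rewrite ltr_wpDl.
apply/nbhs_ballP; exists (e / N); first by rewrite /= divr_gt0.
move=> y /= xy yx cdy; rewrite /diff_quotient.
have yx0 : y - x != 0 by rewrite subr_eq0.
have -> : g x - (f y - f x) / (y - x) =
  - ((f y - f x - (y - x) * g x) / (y - x)) by field.
rewrite normrN normrM normfV ler_pdivrMr ?normr_gt0//.
rewrite (le_trans (q _ _ cdx cdy))// -real_normK ?num_real// expr2 mulrA.
rewrite ler_pM2r ?normr_gt0// (@le_trans _ _ (N * `|y - x|))//.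
  by rewrite ler_wpM2r// (le_trans (ler_norm _))// lerDl.
by rewrite mulrC -ler_pdivlMr// distrC ltW.
Qed.

Lemma quad_derivable_on (c d : R) f g M x : c < d -> `[c, d]%classic x ->
  quad `[c, d] f g M -> derivable_on `[c, d] f x.
Proof.
move=> cd cdx q; apply/cvg_ex; exists (g x); exact: quad_cvg q.
Qed.

Lemma quad_derive_on (c d : R) f g M x : c < d -> `[c, d]%classic x ->
  quad `[c, d] f g M -> derive_on `[c, d] f x = g x.
Proof.
move=> cd cdx q; have PF := within_dnbhs_proper cd cdx.
apply: cvg_lim => //; exact: quad_cvg q.
Qed.

Lemma quad_eq A f g f' g' M : (forall x, A x -> f x = f' x) ->
  (forall x, A x -> g x = g' x) -> quad A f g M -> quad A f' g' M.
Proof. by move=> ff' gg' q x y Ax Ay; rewrite -!ff'// -gg'//; exact: q. Qed.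

Lemma quad_lipschitz (c d : R) f g M B : quad `[c, d] f g M ->
  (forall x, `[c, d]%classic x -> `|g x| <= B) ->
  forall x y, `[c, d]%classic x -> `[c, d]%classic y ->
  `|f y - f x| <= (B + `|M| * (d - c)) * `|y - x|.
Proof.
move=> q gB x y cdx cdy.
have -> : f y - f x = (f y - f x - (y - x) * g x) + (y - x) * g x by ring.
rewrite (le_trans (ler_normD _ _))// [leLHS]addrC [leRHS]mulrDl lerD//.
  by rewrite normrM mulrC ler_wpM2r// gB.
rewrite (le_trans (q _ _ cdx cdy))// -real_normK ?num_real// expr2 mulrA.
rewrite ler_wpM2r// (@le_trans _ _ (`|M| * `|y - x|)) ?ler_wpM2r ?ler_norm//.
rewrite ler_wpM2l//; move: cdx cdy => /=; rewrite !in_itv/= => /andP[cx xd] /andP[cy yd].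
by rewrite ler_norml; apply/andP; split; lra.
Qed.

Lemma quad_continuous (c d : R) f g M B : quad `[c, d] f g M ->
  (forall x, `[c, d]%classic x -> `|g x| <= B) ->
  {within `[c, d], continuous f}.
Proof.
move=> q gB; apply/subspace_continuousP => x cdx.
apply/cvgrPdist_le => e e0; rewrite /within/=.
pose N := `|B + `|M| * (d - c)| + 1; have N0 : 0 < N by rewrite ltr_wpDl.
apply/nbhs_ballP; exists (e / N); first by rewrite /= divr_gt0.
move=> y /= xy cdy; rewrite distrC.
rewrite (le_trans (quad_lipschitz q gB cdx cdy))//.
rewrite (@le_trans _ _ (N * `|y - x|)) ?ler_wpM2r//.
  by rewrite (le_trans (ler_norm _))// lerDl.
by rewrite mulrC -ler_pdivlMr// distrC ltW.
Qed.

Lemma quad_is_derive (c d : R) f g M x : x \in `]c, d[ ->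
  quad `[c, d] f g M -> is_derive x 1 f (g x).
Proof.
rewrite in_itv/= => /andP[cx xd] q.
have fg : (fun h => h^-1 *: (f (h *: 1 + x) - f x)) @ 0^' --> g x.
  apply/cvgrPdist_le => e e0; rewrite /within/=.
  pose N := `|M| + 1; have N0 : 0 < N by rewrite ltr_wpDl.
  apply/nbhs_ballP; exists (Num.min (e / N) (Num.min (x - c) (d - x))).
    by rewrite /= !lt_min divr_gt0//= !subr_gt0 cx xd.
  move=> h /=; rewrite /ball/= sub0r normrN !lt_min => /andP[he] /andP[hc hd] h0.
  have hE : h *: 1 + x = h + x by rewrite /GRing.scale/= mulr1.
  have cdh : `[c, d]%classic (h *: 1 + x).
    rewrite /= in_itv/= hE; move: hc hd; rewrite !ltr_norml.
    by move=> /andP[? ?] /andP[? ?]; apply/andP; split; lra.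
  have cdx : `[c, d]%classic x by rewrite /= in_itv/= !ltW.
  have := q _ _ cdx cdh; rewrite !hE !addrK => qh.
  rewrite /GRing.scale/=.
  have -> : g x - h^-1 * (f (h + x) - f x) =
    - ((f (h + x) - f x - h * g x) / h) by field.
  rewrite normrN normrM normfV ler_pdivrMr ?normr_gt0//.
  rewrite (le_trans qh)// -real_normK ?num_real// expr2 mulrA.
  rewrite ler_pM2r ?normr_gt0// (@le_trans _ _ (N * `|h|))//.
    by rewrite ler_wpM2r// (le_trans (ler_norm _))// lerDl.
  by rewrite mulrC -ler_pdivlMr// ltW.
split; first by apply/cvg_ex; exists (g x).
by apply: cvg_lim.
Qed.

Lemma quadD A f g f' g' M M' : quad A f g M -> quad A f' g' M' ->
  quad A (f \+ f') (g \+ g') (M + M').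
Proof.
move=> q q' x y Ax Ay /=.
have -> : f y + f' y - (f x + f' x) - (y - x) * (g x + g' x) =
  (f y - f x - (y - x) * g x) + (f' y - f' x - (y - x) * g' x) by ring.
by rewrite (le_trans (ler_normD _ _))// [leRHS]mulrDl lerD ?q ?q'.
Qed.

Lemma quadZ A f g M (b : R) : quad A f g M ->
  quad A (fun x => b * f x) (fun x => b * g x) (`|b| * M).
Proof.
move=> q x y Ax Ay /=.
have -> : b * f y - b * f x - (y - x) * (b * g x) =
  b * (f y - f x - (y - x) * g x) by ring.
by rewrite normrM -mulrA ler_wpM2l ?q.
Qed.

(** The product rule leaves the cross term of the two increments, which [K] controls: on a general
    set [A] no Lipschitz bound is at hand. *)
Lemma quadM A f g f' g' M M' B B' K : quad A f g M -> quad A f' g' M' ->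
  (forall x, A x -> `|f x| <= B) -> (forall x, A x -> `|f' x| <= B') ->
  (forall x y, A x -> A y -> `|f y - f x| * `|f' y - f' x| <= K * (y - x) ^+ 2) ->
  quad A (f \* f') (fun x => g x * f' x + f x * g' x) (`|M| * B' + `|M'| * B + K).
Proof.
move=> q q' fB fB' fK x y Ax Ay /=.
have -> : f y * f' y - f x * f' x - (y - x) * (g x * f' x + f x * g' x) =
  (f y - f x - (y - x) * g x) * f' x + (f' y - f' x - (y - x) * g' x) * f x
  + (f y - f x) * (f' y - f' x) by ring.
rewrite [leRHS]mulrDl (le_trans (ler_normD _ _))// lerD//; last by rewrite normrM fK.
rewrite [leRHS]mulrDl (le_trans (ler_normD _ _))// lerD// normrM mulrAC ler_pM//.
- rewrite (le_trans (q _ _ Ax Ay))// ler_wpM2r ?sqr_ge0 ?ler_norm//.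
- exact: fB'.
- rewrite (le_trans (q' _ _ Ax Ay))// ler_wpM2r ?sqr_ge0 ?ler_norm//.
- exact: fB.
Qed.

(** Mean value theorem twice: it yields a point z between x and y with slope [f' z], then compares
    [f' z] with [f' x], z being no farther from x than y is. *)
Lemma deriv_quad (c d : R) (f f' f'' : R -> R) M :
  (forall x, `[c, d]%classic x -> is_derive x 1 f (f' x)) ->
  (forall x, `[c, d]%classic x -> is_derive x 1 f' (f'' x)) ->
  (forall x, `[c, d]%classic x -> `|f'' x| <= M) ->
  quad `[c, d] f f' M.
Proof.
move=> ff' f'f'' f''M.
have cts (h h' : R -> R) x y : (forall x, `[c, d]%classic x -> is_derive x 1 h (h' x)) ->
    c <= x -> y <= d -> {within `[x, y], continuous h}.
  move=> hh' cx yd; apply/continuous_in_subspaceT => z.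
  rewrite inE/= in_itv/= => /andP[xz zy].
  have : is_derive z 1 h (h' z) by apply: hh'; rewrite /= in_itv/=; apply/andP; split; lra.
  by move=> [/derivable1_diffP/differentiable_continuous].
have mvt (h h' : R -> R) x y : (forall x, `[c, d]%classic x -> is_derive x 1 h (h' x)) ->
    c <= x -> x <= y -> y <= d ->
    exists2 z, z \in `[x, y] & h y - h x = h' z * (y - x).
  move=> hh' cx xy yd; have hc := cts _ _ _ _ hh' cx yd.
  suff dh : forall z, z \in `]x, y[%R -> is_derive z 1 h (h' z).
    have [z zI E] := MVT_segment xy dh hc.
    by exists z.
  move=> z; rewrite in_itv/= => /andP[xz zy]; apply: hh'.
  by rewrite /= in_itv/=; apply/andP; split; lra.
have M0 : forall x, `[c, d]%classic x -> 0 <= M.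
  by move=> x /f''M; exact: le_trans.
move=> x y cdx cdy; have M0' := M0 _ cdx.
move: cdx cdy; rewrite /= !in_itv/= => /andP[cx xd] /andP[cy yd].
have key (z : R) : c <= z <= d -> `|z - x| <= `|y - x| ->
    `|f' z - f' x| <= M * `|y - x|.
  move=> /andP[cz zd] zyx.
  have [xz|zx] := leP x z.
    have [u uI ->] := mvt _ _ _ _ f'f'' cx xz zd.
    rewrite normrM ler_pM// f''M//=; move: uI; rewrite !in_itv/= => /andP[? ?].
    by apply/andP; split; lra.
  have [u uI] := mvt _ _ _ _ f'f'' cz (ltW zx) xd.
  rewrite distrC => ->; rewrite normrM ler_pM//; last by rewrite distrC.
  rewrite f''M//=; move: uI; rewrite !in_itv/= => /andP[? ?].
  by apply/andP; split; lra.
have [z zI ->] : exists2 z, c <= z <= d /\ `|z - x| <= `|y - x| &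
    f y - f x = f' z * (y - x).
  have [xy|yx] := leP x y.
    have [u + uE] := mvt _ _ _ _ ff' cx xy yd.
    rewrite in_itv/= => /andP[? ?]; exists u => //.
    split; first by apply/andP; split; lra.
    by rewrite !ger0_norm ?subr_ge0//; lra.
  have [u + uE] := mvt _ _ _ _ ff' cy (ltW yx) xd.
  rewrite in_itv/= => /andP[? ?]; exists u => //.
  split; first by apply/andP; split; lra.
    by rewrite !ler0_norm ?subr_le0//; lra.
  by rewrite -[LHS]opprB uE; ring.
have -> : f' z * (y - x) - (y - x) * f' x = (f' z - f' x) * (y - x) by ring.
rewrite normrM -real_normK ?num_real// expr2 mulrA ler_wpM2r//.
by apply: key; case: zI.
Qed.

End quad.

(** * Sequences of explicit successive derivatives, in one and two variables *)

Section families.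
Context {R : realType}.

Definition family (A : set R) (phi : nat -> R -> R) : Prop :=
  forall k, exists M, quad A (phi k) (phi k.+1) M.

(** The filter [within A x^'] sees only points of [A], and the quotient moreover uses the value at
    x, whence [A x]. This is what lets iterated derivatives be identified by induction from values
    on [A] alone. *)
Lemma derive_on_eq (A : set R) (f g : R -> R) x : A x ->
  (forall y, A y -> f y = g y) -> derive_on A f x = derive_on A g x.
Proof.
move=> Ax fg; rewrite /derive_on; congr lim.
have nE (h h' : R -> R) : (forall y, A y -> h y = h' y) ->
    diff_quotient h x @ within A x^' `=>` diff_quotient h' x @ within A x^'.
  move=> hh' U; rewrite /nbhs/= /within/= => hU.
  near=> y => Ay; rewrite /diff_quotient !hh'//; exact: (near hU y _ Ay).
rewrite predeqE => U; split; apply: nE => // y Ay; by rewrite fg.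
Unshelve. all: by end_near.
Qed.

Lemma derivable_on_eq (A : set R) (f g : R -> R) x : A x ->
  (forall y, A y -> f y = g y) -> derivable_on A f x -> derivable_on A g x.
Proof.
move=> Ax fg /cvg_ex[l fl]; apply/cvg_ex; exists l.
apply: cvg_trans fl => U; rewrite /nbhs/= /within/= => hU.
near=> y => Ay; rewrite /diff_quotient -!fg//; exact: (near hU y _ Ay).
Unshelve. all: by end_near.
Qed.

Section one_var.
Variables (c d : R) (phi : nat -> R -> R) (u : R -> R).
Hypotheses (cd : c < d) (fam : family `[c, d] phi).
Hypothesis u0 : forall x, `[c, d]%classic x -> u x = phi 0%N x.

Lemma family_derive_on k x : `[c, d]%classic x ->
  derive_on `[c, d] (phi k) x = phi k.+1 x.
Proof. by move=> cdx; have [M q] := fam k; exact: quad_derive_on q. Qed.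

Lemma family_iter_derive_on k x : `[c, d]%classic x ->
  iter k (derive_on `[c, d]) u x = phi k x.
Proof.
elim: k x => [|k IH] x cdx /=; first exact: u0.
by rewrite (derive_on_eq cdx IH) family_derive_on.
Qed.

Lemma family_smooth_on : smooth_on c d u.
Proof.
move=> k x cdx; have [M q] := fam k.
apply: (derivable_on_eq (f := phi k)) => //.
  by move=> y cdy; rewrite family_iter_derive_on.
exact: quad_derivable_on q.
Qed.

Lemma family_gevrey s C K : 0 <= C -> 0 < K ->
  (forall n x, `[c, d]%classic x -> `|phi n x| <= C * (n`!%:R `^ s) * K ^+ n) ->
  gevrey s c d u.
Proof.
move=> C0 K0 H; split; first exact: family_smooth_on.
exists C, K^-1; split => //; first by rewrite invr_gt0.
by move=> n x cdx; rewrite family_iter_derive_on// exprVn invrK; exact: H.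
Qed.

End one_var.

Section two_var.
Variables (x1 x2 t1 t2 : R) (D : nat -> nat -> R -> R -> R).
Hypotheses (x12 : x1 < x2) (t12 : t1 < t2).

(** Each remainder is uniform in the other variable; with the bounds of the third clause this gives
    equi-Lipschitz sections, hence joint continuity. *)
Definition family2 : Prop :=
  [/\ forall k n, exists M, forall t, `[t1, t2]%classic t ->
        quad `[x1, x2] (D k n ^~ t) (D k.+1 n ^~ t) M,
      forall k n, exists M, forall x, `[x1, x2]%classic x ->
        quad `[t1, t2] (D k n x) (D k n.+1 x) M
    & forall k n, exists B, forall x t, `[x1, x2]%classic x ->
        `[t1, t2]%classic t -> `|D k n x t| <= B].

Hypothesis fam : family2.

Lemma family2_continuous k n :
  {within `[x1, x2] `*` `[t1, t2], continuous (fun p : R * R => D k n p.1 p.2)}.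
Proof.
case: fam => famx famt bnd.
have [Mx qx] := famx k n; have [Mt qt] := famt k n.
have [Bx bx] := bnd k.+1 n; have [Bt bt] := bnd k n.+1.
apply/subspace_continuousP => -[x t] [/= Xx Tt].
apply/cvgrPdist_le => e e0; rewrite /within/=.
pose Lx := `|Bx + `|Mx| * (x2 - x1)| + 1.
pose Lt := `|Bt + `|Mt| * (t2 - t1)| + 1.
have Lx0 : 0 < Lx by rewrite ltr_wpDl.
have Lt0 : 0 < Lt by rewrite ltr_wpDl.
have e20 : 0 < e / 2 by rewrite divr_gt0.
apply/nbhs_ballP; exists (Num.min (e / 2 / Lx) (e / 2 / Lt)).
  by rewrite /= lt_min !divr_gt0.
move=> [x' t'] [/= xx' tt'] [/= Xx' Tt'].
move: xx' tt'; rewrite /ball/= !lt_min => /andP[xx' _] /andP[_ tt'].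
have -> : D k n x t - D k n x' t' =
  (D k n x t - D k n x' t) + (D k n x' t - D k n x' t') by ring.
rewrite (le_trans (ler_normD _ _))// [leRHS](splitr e) lerD//.
  have := quad_lipschitz (qx _ Tt) (fun x Xx => bx x t Xx Tt) Xx' Xx.
  move/le_trans; apply.
  rewrite (@le_trans _ _ (Lx * `|x - x'|)) ?ler_wpM2r//.
    by rewrite (le_trans (ler_norm _))// lerDl.
  by rewrite mulrC -ler_pdivlMr// ltW.
have := quad_lipschitz (qt _ Xx') (fun t Tt => bt x' t Xx' Tt) Tt' Tt.
move/le_trans; apply.
rewrite (@le_trans _ _ (Lt * `|t - t'|)) ?ler_wpM2r//.
  by rewrite (le_trans (ler_norm _))// lerDl.
by rewrite mulrC -ler_pdivlMr// ltW.
Qed.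

Let rect_eq (y : R -> R -> R) k n := forall x t, `[x1, x2]%classic x ->
  `[t1, t2]%classic t -> y x t = D k n x t.

Lemma family2_dx y k n : rect_eq y k n -> rect_eq (dx x1 x2 y) k.+1 n.
Proof.
case: fam => famx _ _ yE x t Xx Tt; have [M q] := famx k n.
rewrite /dx (derive_on_eq (g := D k n ^~ t)) => // [|x' Xx']; last exact: yE.
exact: (quad_derive_on (g := D k.+1 n ^~ t)) (q _ Tt).
Qed.

Lemma family2_dt y k n : rect_eq y k n -> rect_eq (dt t1 t2 y) k n.+1.
Proof.
case: fam => _ famt _ yE x t Xx Tt; have [M q] := famt k n.
rewrite /dt (derive_on_eq (g := D k n x)) => // [|t' Tt']; last exact: yE.
exact: (quad_derive_on (g := D k n.+1 x)) (q _ Xx).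
Qed.

(** Mixed derivatives taken in any order are covered at once, because [D] depends only on how many
    derivatives of each kind were taken. *)
Lemma family2_Ck2 m y k n : rect_eq y k n -> Ck2 x1 x2 t1 t2 m y.
Proof.
have [famx famt _] := fam.
elim: m y k n => [|m IH] y k n yE /=; split => //.
- apply: (@subspace_eq_continuous _ _ _ (fun p : R * R => D k n p.1 p.2)).
    by move=> [x t]; rewrite inE => -[/= Xx Tt]; rewrite /from_subspace/= yE.
  exact: family2_continuous.
- apply: (@subspace_eq_continuous _ _ _ (fun p : R * R => D k n p.1 p.2)).
    by move=> [x t]; rewrite inE => -[/= Xx Tt]; rewrite /from_subspace/= yE.
  exact: family2_continuous.
- split; [|exact: IH (family2_dx yE)|exact: IH (family2_dt yE)].
  move=> x t Xx Tt; have [M q] := famx k n; have [N q'] := famt k n; split.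
    apply: (derivable_on_eq (f := D k n ^~ t)) => // [x' Xx'|].
      by rewrite /= yE.
    exact: quad_derivable_on (q _ Tt).
  apply: (derivable_on_eq (f := D k n x)) => // [t' Tt'|].
    by rewrite /= yE.
  exact: quad_derivable_on (q' _ Xx).
Qed.

Lemma family2_gevrey2 s1 s2 y C K1 K2 : rect_eq y 0 0 -> 0 < C -> 0 < K1 -> 0 < K2 ->
  (forall k n x t, `[x1, x2]%classic x -> `[t1, t2]%classic t ->
   `|D k n x t| <= C * (k`!%:R `^ s1) * (n`!%:R `^ s2) * (K1 ^+ k * K2 ^+ n)) ->
  gevrey2 x1 x2 t1 t2 s1 s2 y.
Proof.
move=> yE C0 K10 K20 H; split; first by move=> m; exact: family2_Ck2 yE.
exists C, K1^-1, K2^-1; split; rewrite ?invr_gt0// => k n x t Xx Tt.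
have -> : iter k (dx x1 x2) (iter n (dt t1 t2) y) x t = D k n x t.
  suff : rect_eq (iter k (dx x1 x2) (iter n (dt t1 t2) y)) k n by exact.
  elim: k => [|k IH]; last exact: family2_dx.
  by elim: n => [|n IH]; last exact: family2_dt.
by rewrite !exprVn invfM !invrK; exact: H.
Qed.

End two_var.
End families.

(** * Absolutely convergent series *)

Section sums.
Context {R : realType}.
Implicit Types (u v : nat -> R).

(** The bound is a parameter, so that estimates uniform in x, t or r go through sums unchanged. *)
Definition asum u (B : R) : Prop := forall n, \sum_(k < n) `|u k| <= B.

Definition sumR u : R := limn (series u).

Lemma asum_ge0 u B : asum u B -> 0 <= B.
Proof. by move=> /(_ 0%N); rewrite big_ord0. Qed.

Lemma asum_cvg u B : asum u B -> series u @ \oo --> sumR u.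
Proof.
move=> uB; apply: (normed_cvg (u_ := u)).
rewrite -[X in cvgn X]/(series (fun k => `|u k|)).
apply: nondecreasing_is_cvgn.
  by apply/nondecreasing_seqP => n; rewrite !seriesEord/= big_ord_recr/= lerDl.
by exists B => _ [n _ <-]; rewrite seriesEord/= uB.
Qed.

Lemma asum_le u B : asum u B -> `|sumR u| <= B.
Proof.
move=> uB; have cu := asum_cvg uB.
have : (fun n => `|series u n|) @ \oo --> `|sumR u| by exact: cvg_norm.
move=> cn; rewrite -(cvg_lim _ cn)//; apply: limr_le.
  by apply/cvg_ex; exists `|sumR u|.
near=> n; rewrite seriesEord/= (le_trans (ler_norm_sum _ _ _))//; exact: uB.
Unshelve. all: by end_near.
Qed.

Lemma sumR_cvg u l : series u @ \oo --> l -> sumR u = l.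
Proof. by move=> ul; exact: cvg_lim. Qed.

Lemma asum_dom u v B : (forall k, `|u k| <= v k) -> asum v B -> asum u B.
Proof.
move=> uv vB n; rewrite (le_trans _ (vB n))// ler_sum// => k _.
by rewrite (le_trans (uv k))// ler_norm.
Qed.

Lemma asumD u v B B' : asum u B -> asum v B' ->
  asum (fun k => u k + v k) (B + B').
Proof.
move=> uB vB' n.
rewrite (@le_trans _ _ (\sum_(k < n) (`|u k| + `|v k|)))//.
  by apply: ler_sum => k _; exact: ler_normD.
rewrite big_split/=; apply: lerD; [exact: uB|exact: vB'].
Qed.

Lemma asumZ u B c : asum u B -> asum (fun k => c * u k) (`|c| * B).
Proof.
move=> uB n; under eq_bigr do rewrite normrM.
rewrite -mulr_sumr ler_wpM2l//; exact: uB.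
Qed.

Lemma sumRD u v B B' : asum u B -> asum v B' ->
  sumR (fun k => u k + v k) = sumR u + sumR v.
Proof.
move=> uB vB'; apply: sumR_cvg.
have -> : series (fun k => u k + v k) = series u \+ series v.
  by apply/funext => n; rewrite /= !seriesEord/= big_split.
by apply: cvgD; [exact: asum_cvg uB|exact: asum_cvg vB'].
Qed.

Lemma sumRZ u B c : asum u B -> sumR (fun k => c * u k) = c * sumR u.
Proof.
move=> uB; apply: sumR_cvg.
have -> : series (fun k => c * u k) = (fun n => c * series u n).
  by apply/funext => n; rewrite /= !seriesEord/= mulr_sumr.
by apply: cvgMr; exact: asum_cvg uB.
Qed.

Lemma asumS u B : asum u B -> asum (fun k => u k.+1) B.
Proof.
move=> uB n; rewrite (le_trans _ (uB n.+1))// big_ord_recl/= lerDr.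
exact: normr_ge0.
Qed.

Lemma sumRS u B : asum u B -> sumR u = u 0%N + sumR (fun k => u k.+1).
Proof.
move=> uB; apply: sumR_cvg; rewrite -cvg_shiftS.
have -> : [sequence series u n.+1]_n = (fun n => u 0%N + series (fun k => u k.+1) n).
  by apply/funext => n; rewrite /= !seriesEord/= big_ord_recl.
by apply: cvgD; [exact: cvg_cst|exact: asum_cvg (asumS uB)].
Qed.

Lemma sumR0 : sumR (fun _ => 0) = 0.
Proof.
apply: sumR_cvg; have -> : series (fun _ => 0) = (fun _ => 0 : R).
  by apply/funext => n; rewrite seriesEord/= big1.
exact: cvg_cst.
Qed.

Lemma eq_sumR u v : u =1 v -> sumR u = sumR v.
Proof. by move=> /funext ->. Qed.

Lemma asum_geometric (c q : R) : 0 <= c -> 0 <= q < 1 ->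
  asum (fun k => c * q ^+ k) (c / (1 - q)).
Proof.
move=> c0 /andP[q0 q1] n.
under eq_bigr do rewrite ger0_norm ?mulr_ge0 ?exprn_ge0//.
rewrite -mulr_sumr ler_wpM2l// -[leRHS]mul1r ler_pdivlMr ?subr_gt0//.
have := subrX1 q n; rewrite -opprB -[q - 1]opprB mulNr => /oppr_inj.
by rewrite mulrC => <-; rewrite gerBl exprn_ge0.
Qed.

(** The remainder of the sum is the sum of the remainders, so summable constants replace any uniform
    convergence argument. *)
Lemma quad_series (A : set R) (f g : nat -> R -> R) (M : nat -> R) B B' B'' :
  (forall j, quad A (f j) (g j) (M j)) -> asum M B ->
  (forall x, A x -> asum (f ^~ x) B') -> (forall x, A x -> asum (g ^~ x) B'') ->
  quad A (fun x => sumR (f ^~ x)) (fun x => sumR (g ^~ x)) B.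
Proof.
move=> q MB fB gB x y Ax Ay.
have -> : sumR (f^~ y) - sumR (f^~ x) - (y - x) * sumR (g^~ x) =
    sumR (fun j => f j y + (-1 * f j x + - (y - x) * g j x)).
  have a1 := asumZ (-1) (fB _ Ax).
  have a2 := asumZ (- (y - x)) (gB _ Ax).
  have a3 := asumD a1 a2.
  rewrite (sumRD (fB _ Ay) a3) (sumRD a1 a2).
  rewrite (sumRZ _ (fB _ Ax)) (sumRZ _ (gB _ Ax)); ring.
apply: asum_le => n; rewrite mulrC.
rewrite (@le_trans _ _ (\sum_(k < n) (y - x) ^+ 2 * `|M k|))//; last first.
  rewrite -mulr_sumr ler_wpM2l ?sqr_ge0//; exact: MB.
apply: ler_sum => k _.
have -> : f k y + (-1 * f k x + - (y - x) * g k x) =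
  f k y - f k x - (y - x) * g k x by ring.
rewrite (le_trans (q k _ _ Ax Ay))// mulrC ler_wpM2l ?sqr_ge0 ?ler_norm//.
Qed.

End sums.

(** * Factorial inequalities *)

Section factorial_bounds.
Context {R : realType}.
Implicit Types (p q n k : nat).

Lemma fact_ge1 n : 1 <= n`!%:R :> R.
Proof. by rewrite ler1n fact_gt0. Qed.

Lemma fact_gt0R n : 0 < n`!%:R :> R.
Proof. by rewrite ltr0n fact_gt0. Qed.

(** The ratio (p+q)! / (p! q!) is a binomial coefficient, and its product with d^p is a single term
    of the expansion of (1 + d)^(p+q). *)
Lemma fact_addn_le (d : R) p q : 0 <= d ->
  (p + q)`!%:R * d ^+ p <= p`!%:R * q`!%:R * (1 + d) ^+ (p + q).
Proof.
move=> d0; rewrite -[in leLHS](bin_fact (leq_addr q p)) addKn.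
rewrite !natrM mulrC mulrCA [leRHS]mulrC mulrA ler_wpM2r ?mulr_ge0//.
rewrite exprDn.
have pq : (p < (p + q).+1)%N by rewrite ltnS leq_addr.
rewrite (bigD1 (Ordinal pq)) => //=.
rewrite expr1n mul1r -[X in _ <= X + _]mulr_natl lerDl sumr_ge0// => i _.
by rewrite mulrn_wge0// mulr_ge0// ?exprn_ge0// expr1n.
Qed.

(** One term of the exponential series is at most its sum. This is how powers are traded for
    factorials against a little exponential decay. *)
Lemma expr_le_fact_exp (x : R) n : 0 <= x -> x ^+ n <= n`!%:R * expR x.
Proof.
move=> x0; rewrite mulrC -ler_pdivrMr ?fact_gt0R//.
apply: (@le_trans _ _ (series (exp_coeff x) n.+1)).
  rewrite seriesEord/= big_ord_recr/= lerDr sumr_ge0// => i _.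
  by rewrite divr_ge0 ?exprn_ge0.
apply: nondecreasing_cvgn_le; last exact: is_cvg_series_exp_coeff.
apply/nondecreasing_seqP => m; rewrite !seriesEord/= big_ord_recr/= lerDl.
by rewrite divr_ge0 ?exprn_ge0.
Qed.

Lemma fact3S n : (3 * n.+1)`! = ((3 * n).+3 * ((3 * n).+2 * ((3 * n).+1 * (3 * n)`!)))%N.
Proof. by rewrite mulnS !factS. Qed.

(** A time derivative costs three space derivatives; this turns the resulting (3n)! into the n!^3 of
    Gevrey order 3. *)
Lemma fact3_le n : (3 * n)`!%:R <= 27%:R ^+ n * n`!%:R ^+ 3 :> R.
Proof.
rewrite -!natrX -natrM ler_nat; elim: n => // n IH.
rewrite fact3S factS expnS [in leqRHS]expnMn.
have -> : (27 * 27 ^ n * (n.+1 ^ 3 * n`! ^ 3) =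
  (3 * n).+3 * (3 * n.+1 * (3 * n.+1 * (27 ^ n * n`! ^ 3))))%N.
  by rewrite -[(3 * n).+3]/(3 + 3 * n)%N -mulnS !expnS; ring.
by rewrite !leq_mul// mulnS; lia.
Qed.

Lemma fact3_ge n : n`!%:R ^+ 3 <= (3 * n)`!%:R :> R.
Proof.
rewrite -!natrX ler_nat; elim: n => // n IH.
rewrite fact3S factS expnMn.
have -> : (n.+1 ^ 3 * n`! ^ 3 = n.+1 * (n.+1 * (n.+1 * n`! ^ 3)))%N.
  by rewrite !expnS; ring.
by rewrite !leq_mul//; lia.
Qed.

End factorial_bounds.

(** * Taylor series with factorially bounded coefficients *)

Section taylor_series.
Context {R : realType}.
Implicit Types (g : nat -> R) (L rho C : R).

Definition mono (j : nat) (x : R) : R := x ^+ j / j`!%:R.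
Definition dmono (j : nat) (x : R) : R := if j is i.+1 then mono i x else 0.

(** The coefficients are the derivatives at 0, so that differentiating amounts to shifting [g]. *)
Definition TS g (x : R) : R := sumR (fun j => g j * mono j x).

Lemma is_derive_mono (j : nat) (x : R) : is_derive x 1 (mono j) (dmono j x).
Proof.
have -> : mono j = (j`!%:R)^-1 \*: (id ^+ j : R -> R).
  by apply/funext => y; rewrite /mono /GRing.scale/= mulrC exprfctE.
apply: is_derive_eq; rewrite /dmono; case: j => [|i].
  by rewrite mul0r scale0r scaler0.
rewrite /mono /GRing.scale/= mulr1 factS natrM; field.
by rewrite ?pnatr_eq0 -?lt0n ?fact_gt0 /= addrC natr1 pnatr_eq0.
Qed.

Lemma mono_le j L x : `|x| <= L -> `|mono j x| <= L ^+ j / j`!%:R.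
Proof.
move=> xL; rewrite /mono normrM normfV [`|_%:R|]ger0_norm// ler_wpM2r// normrX.
by rewrite lerXn2r// nnegrE// (le_trans _ xL).
Qed.

Lemma itvN_norm L x : `[- L, L]%classic x -> `|x| <= L.
Proof. by rewrite /= in_itv/= ler_norml. Qed.

Lemma quad_mono L j : quad `[- L, L] (mono j) (dmono j)
  (if j is i.+2 then L ^+ i / i`!%:R else 0).
Proof.
case: j => [|j].
  have -> : mono 0 = cst 1 by apply/funext => x; rewrite /mono expr0 divr1.
  have -> : dmono 0 = cst 0 by [].
  by move=> x y _ _ /=; rewrite subrr mulr0 subr0 normr0 mul0r.
have h1 x : `[- L, L]%classic x -> is_derive x 1 (mono j.+1) (mono j x).
  by move=> _; exact: (is_derive_mono j.+1).
have h2 x : `[- L, L]%classic x -> is_derive x 1 (mono j) (dmono j x).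
  by move=> _; exact: is_derive_mono.
apply: (deriv_quad h1 h2) => x /itvN_norm xL; case: j {h1 h2} => [|i] /=.
  by rewrite normr0.
exact: mono_le.
Qed.

Lemma asum_domn (u v : nat -> R) B : (forall k, `|u k| <= `|v k|) ->
  asum v B -> asum u B.
Proof. by move=> uv vB n; rewrite (le_trans _ (vB n))// ler_sum. Qed.

Lemma asum_shiftr (u : nat -> R) (B : R) : asum (fun k => u k.+1) B -> asum u (`|u 0%N| + B).
Proof.
move=> uB [|n]; first by rewrite big_ord0 addr_ge0// (asum_ge0 uB).
by rewrite big_ord_recl lerD2l; exact: uB.
Qed.

Section radius.
Variables (L rho : R).
Hypotheses (L0 : 0 < L) (Lrho : L < rho).

(** Chosen so that [(1 + d) * L] is the midpoint of [L] and [rho]: [fact_addn_le] then splits (k+j)!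
    at the cost of (1 + d)^(k+j) / d^k, and the series in j keeps a ratio [q] below 1. *)
Let d := (rho / L - 1) / 2.
Let q := (1 + d) * L / rho.

Let rho0 : 0 < rho. Proof. exact: lt_trans Lrho. Qed.

Let d0 : 0 < d.
Proof. by rewrite divr_gt0// subr_gt0 ltr_pdivlMr// mul1r. Qed.

Let q1 : 0 <= q < 1.
Proof.
apply/andP; split; first by rewrite divr_ge0 ?mulr_ge0 ?(ltW L0) ?(ltW rho0)// addr_ge0// ltW.
rewrite /q /d ltr_pdivrMr// mul1r.
have -> : (1 + (rho / L - 1) / 2) * L = (L + rho) / 2.
  by field; rewrite gt_eqF.
by rewrite ltr_pdivrMr// mulr_natr mulr2n ltrD2r.
Qed.

Definition TS_K : R := (1 + d) / (d * rho).
Definition TS_B : R := (1 - q)^-1.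

Lemma TS_K_gt0 : 0 < TS_K.
Proof. apply: divr_gt0; [exact: addr_gt0|exact: mulr_gt0]. Qed.

Lemma TS_B_gt0 : 0 < TS_B.
Proof. by case/andP: q1 => _ ?; rewrite invr_gt0 subr_gt0. Qed.

Lemma TS_asum C g k : 0 <= C -> (forall j, `|g j| <= C * (j`!%:R / rho ^+ j)) ->
  asum (fun j => g (k + j)%N * (L ^+ j / j`!%:R)) (C * TS_B * (k`!%:R * TS_K ^+ k)).
Proof.
move=> C0 gC.
have -> : C * TS_B * (k`!%:R * TS_K ^+ k) = C * (k`!%:R * TS_K ^+ k) / (1 - q).
  by rewrite mulrAC.
apply: asum_dom (asum_geometric _ q1); last first.
  by rewrite mulr_ge0// mulr_ge0// exprn_ge0// ltW// TS_K_gt0.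
move=> j; have Lj : 0 <= L ^+ j / j`!%:R by rewrite divr_ge0// exprn_ge0// ltW.
rewrite normrM [`|L ^+ j / _|]ger0_norm//.
rewrite -ler_pdivlMr ?divr_gt0 ?exprn_gt0 ?fact_gt0R//.
rewrite (le_trans (gC _))// -!mulrA ler_wpM2l//.
have := fact_addn_le k j (ltW d0); rewrite -ler_pdivlMr ?exprn_gt0// => h.
rewrite ler_pdivrMr ?exprn_gt0// (le_trans h)//.
rewrite /TS_K /q; move: h d0; move: (d) => e h e0.
rewrite !exprMn !exprVn !exprD !exprMn le_eqVlt; apply/orP; left; apply/eqP.
field; rewrite !expf_neq0 ?gt_eqF//=; exact: fact_gt0R.
Qed.

Lemma TS_asum_le C g k x : 0 <= C -> (forall j, `|g j| <= C * (j`!%:R / rho ^+ j)) ->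
  `|x| <= L ->
  asum (fun j => g (k + j)%N * mono j x) (C * TS_B * (k`!%:R * TS_K ^+ k)).
Proof.
move=> C0 gC xL n; rewrite (le_trans _ (TS_asum k C0 gC n))// ler_sum// => j _.
rewrite [leLHS]normrM [leRHS]normrM ler_wpM2l// (le_trans (mono_le j xL))//.
exact: ler_norm.
Qed.

Lemma TS_bound C g k x : 0 <= C -> (forall j, `|g j| <= C * (j`!%:R / rho ^+ j)) ->
  `|x| <= L -> `|TS (fun j => g (k + j)%N) x| <= C * TS_B * (k`!%:R * TS_K ^+ k).
Proof. by move=> C0 gC xL; apply: asum_le; exact: TS_asum_le. Qed.

Lemma TS_quad C g k : 0 <= C -> (forall j, `|g j| <= C * (j`!%:R / rho ^+ j)) ->
  quad `[- L, L] (TS (fun j => g (k + j)%N)) (TS (fun j => g (k.+1 + j)%N))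
    (C * TS_B * ((k.+2)`!%:R * TS_K ^+ k.+2)).
Proof.
move=> C0 gC.
pose M j := `|g (k + j)%N| * (if j is i.+2 then L ^+ i / i`!%:R else 0).
have aM : asum M (C * TS_B * ((k.+2)`!%:R * TS_K ^+ k.+2)).
  set B := (X in asum M X).
  have -> : B = `|M 0%N| + (`|M 1%N| + B) by rewrite /M !mulr0 !normr0 !add0r.
  (* The monomials of degree 0 and 1 have no second derivative; after dropping them the constants
     form the majorant of the series shifted by two. *)
  apply: asum_shiftr; apply: asum_shiftr.
  apply: asum_domn (TS_asum k.+2 C0 gC) => j; rewrite /M/= !normrM normr_id.
  by rewrite !addnS !addSn.
have fB x : `[- L, L]%classic x ->
    asum (fun j => g (k + j)%N * mono j x) (C * TS_B * (k`!%:R * TS_K ^+ k)).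
  by move=> /itvN_norm xL; exact: TS_asum_le.
have gE x j : g (k + j.+1)%N * dmono j.+1 x = g (k.+1 + j)%N * mono j x.
  by rewrite addnS addSn.
have gB x : `[- L, L]%classic x -> asum (fun j => g (k + j)%N * dmono j x)
    (`|g (k + 0)%N * dmono 0 x| + C * TS_B * ((k.+1)`!%:R * TS_K ^+ k.+1)).
  move=> /itvN_norm xL; apply: asum_shiftr.
  have := TS_asum_le k.+1 C0 gC xL; apply: asum_domn => j.
  by rewrite gE.
apply: (@quad_eq _ _ (TS (fun j => g (k + j)%N))
  (fun x => sumR (fun j => g (k + j)%N * dmono j x))) => // [x xL|].
  have := gB _ xL; rewrite /= mulr0 normr0 add0r => gBx.
  rewrite (sumRS gBx) mulr0 add0r; apply: eq_sumR => j; exact: gE.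
apply: (quad_series _ aM fB) => [j|x xL].
  by apply: quadZ; exact: quad_mono.
have := gB _ xL; rewrite /= mulr0 normr0 add0r; exact.
Qed.

End radius.

Lemma TS0 g : TS g 0 = g 0%N.
Proof.
apply: sumR_cvg.
rewrite -cvg_shiftS; have -> : [sequence series (fun j => g j * mono j 0) n.+1]_n = (fun _ => g 0%N).
  apply/funext => n; rewrite /= seriesEord/= big_ord_recl big1 ?addr0.
    by rewrite /mono expr0 divr1 mulr1.
  by move=> i _; rewrite /mono exprS mul0r mul0r mulr0.
exact: cvg_cst.
Qed.

Lemma TS_family L rho C g : 0 < L -> L < rho -> 0 <= C ->
  (forall j, `|g j| <= C * (j`!%:R / rho ^+ j)) ->
  family `[- L, L] (fun k => TS (fun j => g (k + j)%N)).
Proof.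
move=> L0 Lr C0 gC k.
exists (C * TS_B L rho * ((k.+2)`!%:R * TS_K L rho ^+ k.+2)); exact: TS_quad.
Qed.

End taylor_series.

(** * Uniqueness for functions with factorially bounded derivatives *)

Section analytic_uniqueness.
Context {R : realType}.
Variables (c d : R) (phi : nat -> R -> R) (C K : R).
Hypothesis fam : family `[c, d] phi.
Hypotheses (C0 : 0 <= C) (K0 : 0 < K).
Hypothesis bnd : forall k x, `[c, d]%classic x ->
  `|phi k x| <= C * (k`!%:R * K ^+ k).

Lemma quad_nonincreasing (a b : R) (f g : R -> R) M B : quad `[a, b] f g M ->
  (forall x, `[a, b]%classic x -> `|g x| <= B) ->
  (forall x, `[a, b]%classic x -> g x <= 0) -> a <= b -> f b <= f a.
Proof.
move=> q gB g0 ab; have [z zI E] : exists2 z, z \in `[a, b]%R & f b - f a = g z * (b - a).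
  have [ab'|->] : a < b \/ a = b.
    by move: ab; rewrite le_eqVlt => /orP[/eqP|]; [right|left].
  apply: MVT_segment => //; last exact: quad_continuous q gB.
  by move=> x xI; exact: quad_is_derive q.
  by exists b; rewrite ?in_itv/= ?lexx// !subrr mulr0.
by rewrite -subr_le0 E mulr_le0_ge0 ?g0// subr_ge0.
Qed.

(** Taylor's bound at a point p where all derivatives vanish, by induction on m: for a sign s, the
    function [A * mono m.+1 (p - y) - s * phi k y] of y has nonpositive derivative on [x, p] and is
    0 at p. *)
Let step (p : R) : c <= p <= d -> (forall k, phi k p = 0) ->
  forall m k x, c <= x <= p ->
  `|phi k x| <= C * ((k + m)`!%:R * K ^+ (k + m)) * mono m (p - x).
Proof.
move=> /andP[cp pd] phi0; elim=> [|m IH] k x /andP[cx xp].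
  rewrite /mono expr0 divr1 mulr1 addn0; apply: bnd.
  by rewrite /= in_itv/= cx (le_trans xp).
have sub y : `[x, p]%classic y -> `[c, d]%classic y.
  by rewrite /= !in_itv/= => /andP[? ?]; apply/andP; split; lra.
set A := C * _.
have A0 : 0 <= A by rewrite mulr_ge0// mulr_ge0// exprn_ge0// ltW.
have [M qphi] := fam k.
have {}qphi : quad `[x, p] (phi k) (phi k.+1) M.
  by move=> y z /sub Sy /sub Sz; exact: qphi.
have mono_ge0 j y : `[x, p]%classic y -> 0 <= mono j (p - y).
  by rewrite /= in_itv/= => /andP[_ ?]; rewrite divr_ge0// exprn_ge0// subr_ge0.
have [N qm] : exists N, quad `[x, p] (fun y => mono m.+1 (p - y)) (fun y => - mono m (p - y)) N.
  have [N qN] : exists N, quad `[- (p - x), p - x] (mono m.+1) (dmono m.+1) N.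
    by eexists; exact: quad_mono.
  exists N => y z; rewrite /= !in_itv/= => /andP[xy yp] /andP[xz zp].
  have I1 : `[- (p - x), p - x]%classic (p - y).
    by rewrite /= in_itv/=; apply/andP; split; lra.
  have I2 : `[- (p - x), p - x]%classic (p - z).
    by rewrite /= in_itv/=; apply/andP; split; lra.
  have := qN _ _ I1 I2; rewrite [dmono _ _]/=.
  have -> : p - z - (p - y) = - (z - y) by ring.
  by rewrite sqrrN mulNr mulrN.
have mle j y : `[x, p]%classic y -> `|mono j (p - y)| <= (p - x) ^+ j / j`!%:R.
  move=> Iy; apply: mono_le; move: Iy; rewrite /= in_itv/= => /andP[? ?].
  by rewrite ger0_norm; lra.
have phile y : `[x, p]%classic y -> `|phi k.+1 y| <= A * mono m (p - y).
  move=> Iy; move: (Iy); rewrite /= in_itv/= => /andP[xy yp].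
  rewrite /A -addSnnS; apply: IH.
  by rewrite yp (le_trans cx).
have final (s : R) : s = 1 \/ s = -1 -> s * phi k x <= A * mono m.+1 (p - x).
  move=> s1; have := quadD (quadZ A qm) (quadZ (- s) qphi).
  move/quad_nonincreasing => /(_ (2 * (A * ((p - x) ^+ m / m`!%:R)))) H.
  have {H} : A * mono m.+1 (p - p) + - s * phi k p <= A * mono m.+1 (p - x) + - s * phi k x.
    have sn y : `|- s * phi k.+1 y| = `|phi k.+1 y|.
      by case: s1 => ->; rewrite normrM ?normrN normr1 mul1r.
    apply: H => // y Iy.
      rewrite (le_trans (ler_normD _ _))// mulr2n mulrDl !mul1r lerD//.
        by rewrite mulrN normrN normrM ger0_norm// ler_wpM2l// mle.
      rewrite sn (le_trans (phile _ Iy))// ler_wpM2l//.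
      by rewrite (le_trans (ler_norm _))// mle.
    rewrite /= mulrN addrC subr_le0 (le_trans _ (phile _ Iy))// -sn; exact: ler_norm.
  rewrite subrr phi0 mulr0 addr0 /mono exprS mul0r mul0r mulr0 => H.
  by rewrite -subr_ge0 -mulNr.
rewrite ler_norml; apply/andP; split; last by have := final 1; rewrite mul1r; apply; left.
by rewrite lerNl -mulN1r; apply: final; right.
Qed.

(** As (k+m)! <= k! m! 2^(k+m), within distance 1 / (4K) of p the bound of [step] is at most a
    constant times 2^(-m), for every m. *)
Let local_zero (p : R) : c <= p <= d -> (forall k, phi k p = 0) ->
  forall k x, c <= x <= p -> p - x <= (4 * K)^-1 -> phi k x = 0.
Proof.
move=> pI phi0 k x xI pxK.
have K40 : 0 < 4 * K by rewrite mulr_gt0.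
apply/eqP; rewrite -normr_eq0 eq_le normr_ge0 andbT.
set A := C * (k`!%:R * (2 * K) ^+ k).
have kA m : `|phi k x| <= geometric A (2^-1) m.
  rewrite (le_trans (step pI phi0 m k xI))//.
  have pxm : mono m (p - x) <= (4 * K)^-1 ^+ m / m`!%:R.
    rewrite ler_wpM2r// lerXn2r// nnegrE ?invr_ge0 ?(ltW K40)// subr_ge0.
    by case/andP: xI.
  have CK0 : 0 <= C * ((k + m)`!%:R * K ^+ (k + m)).
    by rewrite mulr_ge0// mulr_ge0// exprn_ge0// ltW.
  rewrite (le_trans (ler_wpM2l CK0 pxm))// /A /geometric/= -!mulrA ler_wpM2l//.
  have := @fact_addn_le R 1 k m ler01; rewrite expr1n mulr1 => kmle.
  have X0 : 0 <= K ^+ (k + m) * ((4 * K)^-1 ^+ m / m`!%:R).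
    by rewrite mulr_ge0 ?exprn_ge0 ?(ltW K0)// divr_ge0// exprn_ge0// invr_ge0 ltW.
  rewrite (le_trans (ler_wpM2r X0 kmle))// le_eqVlt; apply/orP; left; apply/eqP.
  rewrite !exprD !exprVn !exprMn -[1 + 1]/(2%:R).
  have -> : (4 : R) ^+ m = 2 ^+ m * 2 ^+ m by rewrite -exprMn; congr (_ ^+ _); ring.
  field; rewrite !expf_neq0 ?gt_eqF//; exact: fact_gt0R.
have h1 : `|2^-1 : R| < 1 by rewrite ger0_norm ?invr_ge0// invf_lt1 ?ltr1n.
have cg := cvg_geometric A h1; rewrite -(cvg_lim _ cg)//.
apply: limr_ge; first by apply/cvg_ex; exists 0.
by near=> m; exact: kA.
Unshelve. all: by end_near.
Qed.

Lemma analytic_zero : (forall k, phi k d = 0) ->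
  forall x, `[c, d]%classic x -> phi 0%N x = 0.
Proof.
move=> phi0 x; rewrite /= in_itv/= => /andP[cx xd].
(* The length of a step depends only on [K], so finitely many steps to the left of d reach any
   point. *)
pose h := (4 * K)^-1; have h0 : 0 < h by rewrite invr_gt0 mulr_gt0.
have H n : forall y k, c <= y <= d -> d - y <= n%:R * h -> phi k y = 0.
  elim: n => [|n IH] y k /andP[cy yd] dyn.
    have -> : y = d by move: dyn; rewrite mul0r; lra.
    exact: phi0.
  have [dyn'|dyn'] := leP (d - y) (n%:R * h); first by apply: IH; rewrite ?cy.
  have n0 : 0 <= n%:R * h by rewrite mulr_ge0// ltW.
  move: dyn; rewrite -natr1 mulrDl mul1r => dyn.
  apply: (@local_zero (d - n%:R * h)).
  - by apply/andP; split; lra.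
  - by move=> j; apply: IH; [apply/andP; split|]; lra.
  - by apply/andP; split; lra.
  - by rewrite -/h; lra.
have [n hn] : exists n : nat, d - x <= n%:R * h.
  exists (Num.truncn ((d - x) / h)).+1; rewrite -ler_pdivrMr// ltW//.
  exact: truncnS_gt.
by apply: (H n); rewrite ?cx.
Qed.

End analytic_uniqueness.

(** * Integrals over intervals and Goursat's lemma *)

Section interval_integral.
Context {R : realType}.
Implicit Types (f g : R -> R) (a b : R).

Notation mu := (@lebesgue_measure R).

Definition Int a b f : R := \int[mu]_(x in `[a, b]) f x.

Lemma cts_integrable a b f : {within `[a, b], continuous f} ->
  mu.-integrable `[a, b] (EFin \o f).
Proof. by move=> cf; apply: continuous_compact_integrable => //; exact: segment_compact. Qed.

Lemma within_sub (A B : set R) f : A `<=` B ->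
  {within B, continuous f} -> {within A, continuous f}.
Proof. by move=> AB; exact: continuous_subspaceW. Qed.

Lemma Int_add a m b f : a <= m -> m <= b -> {within `[a, b], continuous f} ->
  Int a b f = Int a m f + Int m b f.
Proof.
move=> am mb cf; rewrite /Int.
have := @Rintegral_itvB R f (BLeft a) (BRight b) m (cts_integrable cf).
rewrite !bnd_simp => /(_ am mb) h.
rewrite -(@Rintegral_itv_obnd_cbnd _ m (BRight b) f).
  by rewrite -h addrC subrK.
apply: (integrableS _ _ _ (cts_integrable cf)) => //.
by apply: subset_itvr; rewrite bnd_simp.
Qed.

Lemma eq_Int a b f g : (forall x, a <= x <= b -> f x = g x) -> Int a b f = Int a b g.
Proof.
move=> fg; apply: eq_Rintegral => x; rewrite inE/= in_itv/=; exact: fg.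
Qed.

Lemma IntD a b f g : {within `[a, b], continuous f} -> {within `[a, b], continuous g} ->
  Int a b (fun x => f x + g x) = Int a b f + Int a b g.
Proof. by move=> cf cg; rewrite /Int RintegralD//; exact: cts_integrable. Qed.

Lemma IntB a b f g : {within `[a, b], continuous f} -> {within `[a, b], continuous g} ->
  Int a b (fun x => f x - g x) = Int a b f - Int a b g.
Proof. by move=> cf cg; rewrite /Int RintegralB//; exact: cts_integrable. Qed.

Lemma IntZ a b f c : {within `[a, b], continuous f} ->
  Int a b (fun x => c * f x) = c * Int a b f.
Proof. by move=> cf; rewrite /Int RintegralZl//; exact: cts_integrable. Qed.

Lemma Int_cst a b (c : R) : a <= b -> Int a b (fun=> c) = c * (b - a).
Proof.
move=> ab; rewrite /Int Rintegral_cst//= lebesgue_measure_itv/= lte_fin.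
by move: ab; rewrite le_eqVlt => /orP[/eqP ->|ab]; rewrite ?ltxx ?subrr// ab.
Qed.

Lemma Int_le_bound a b f M : a <= b -> {within `[a, b], continuous f} ->
  (forall x, a <= x <= b -> `|f x| <= M) -> `|Int a b f| <= M * (b - a).
Proof.
move=> ab cf fM; rewrite -Int_cst// (le_trans (le_normr_Rintegral _ _))//.
  exact: cts_integrable.
apply: le_Rintegral => //.
- apply: cts_integrable => x; apply: continuous_comp; [exact: cf|exact: norm_continuous].
- apply: cts_integrable => x; exact: cst_continuous.
Qed.

Lemma Int_FTC a b f (F : R -> R) : a <= b -> {within `[a, b], continuous f} ->
  (forall x : R, is_derive x 1 F (f x)) -> Int a b f = F b - F a.
Proof.
move=> + cf FF; rewrite le_eqVlt => /orP[/eqP <-|ab].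
  by rewrite /Int set_itv1 Rintegral_set1 subrr.
have cF x : {for x, continuous F}.
  by apply: differentiable_continuous; apply/derivable1_diffP; case: (FF x).
rewrite /Int /Rintegral (@continuous_FTC2 _ f F)//.
- split.
  + by move=> x _; case: (FF x).
  + by apply: cvg_at_right_filter; exact: cF.
  + by apply: cvg_at_left_filter; exact: cF.
- by move=> x _; rewrite derive1E; case: (FF x).
Qed.

End interval_integral.

Lemma itv_dist {R : realType} (u v x y : R) :
  u <= x <= v -> u <= y <= v -> `|x - y| <= v - u.
Proof. by move=> /andP[? ?] /andP[? ?]; rewrite ler_norml; apply/andP; split; lra. Qed.

(** * Bisection of rectangles *)

Section rect_induction.
Context {R : realType}.

(** Compactness by bisection: were the whole rectangle bad, some quarter would be bad, and so on;
    the nested bad rectangles shrink to a point, against the local hypothesis there. It serves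
    Goursat's lemma and the boundedness of holomorphic functions. *)
Lemma rect_induction (Good : R -> R -> R -> R -> Prop) (a b c d : R) :
  a <= b -> c <= d ->
  (forall a b c d, Good a ((a + b) / 2) c ((c + d) / 2) ->
    Good ((a + b) / 2) b c ((c + d) / 2) -> Good a ((a + b) / 2) ((c + d) / 2) d ->
    Good ((a + b) / 2) b ((c + d) / 2) d -> Good a b c d) ->
  (forall x y, a <= x <= b -> c <= y <= d -> exists2 e, 0 < e &
    forall a' b' c' d', a <= a' <= x -> x <= b' <= b -> c <= c' <= y -> y <= d' <= d ->
     b' - a' < e -> d' - c' < e -> Good a' b' c' d') ->
  Good a b c d.
Proof.
move=> ab cd quarter local; apply: contrapT => bad.
pose w (n : nat) := (b - a) / 2 ^+ n; pose h (n : nat) := (d - c) / 2 ^+ n.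
have wS n : w n = 2 * w n.+1 by rewrite /w exprS; field; rewrite expf_neq0.
have hS n : h n = 2 * h n.+1 by rewrite /h exprS; field; rewrite expf_neq0.
have w0 n : 0 <= w n by rewrite divr_ge0 ?subr_ge0// exprn_ge0.
have h0 n : 0 <= h n by rewrite divr_ge0 ?subr_ge0// exprn_ge0.
pose B n (p : R * R) := ~ Good p.1 (p.1 + w n) p.2 (p.2 + h n).
(* A point stands for the lower left corner of a rectangle of generation n. The relation is made
   total, a good p being sent to itself, so that a sequence can be chosen. *)
pose T n (p q : R * R) := [/\ p.1 <= q.1, q.1 + w n.+1 <= p.1 + w n,
   p.2 <= q.2, q.2 + h n.+1 <= p.2 + h n & (B n p -> B n.+1 q)].
have ex n p : exists q, T n p q.
  have [Bp|nBp] := pselect (B n p); last first.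
    by exists p; split=> //=; rewrite ?lerD2l; have := wS n; have := w0 n.+1;
      have := hS n; have := h0 n.+1; lra.
  have [q [q1 q2 Bq]] : exists q : R * R, [/\ q.1 = p.1 \/ q.1 = p.1 + w n.+1,
      q.2 = p.2 \/ q.2 = p.2 + h n.+1 & B n.+1 q].
    apply: contrapT => H; apply: Bp.
    have m1 : (p.1 + (p.1 + w n)) / 2 = p.1 + w n.+1 by rewrite wS; field.
    have m2 : (p.2 + (p.2 + h n)) / 2 = p.2 + h n.+1 by rewrite hS; field.
    have e1 : p.1 + w n = p.1 + w n.+1 + w n.+1 by rewrite wS; ring.
    have e2 : p.2 + h n = p.2 + h n.+1 + h n.+1 by rewrite hS; ring.
    apply: quarter; rewrite m1 m2 ?e1 ?e2; apply: contrapT => G; apply: H.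
    - by exists (p.1, p.2); split; [left|left|].
    - by exists (p.1 + w n.+1, p.2); split; [right|left|].
    - by exists (p.1, p.2 + h n.+1); split; [left|right|].
    - by exists (p.1 + w n.+1, p.2 + h n.+1); split; [right|right|].
  exists q; split=> //.
  - by case: q1 => ->; rewrite ?lerDl.
  - by case: q1 => ->; rewrite (wS n); have := w0 n.+1; lra.
  - by case: q2 => ->; rewrite ?lerDl.
  - by case: q2 => ->; rewrite (hS n); have := h0 n.+1; lra.
pose nx n p := projT1 (cid (ex n p)).
pose s := fix s n := if n is m.+1 then nx m (s m) else (a, c).
have sT n : T n (s n) (s n.+1) by rewrite /= /nx; case: cid.
have Bs n : B n (s n).
  elim: n => [|n IH]; last by case: (sT n) => _ _ _ _; apply.
  by rewrite /B /w /h expr0 !divr1/= !subrKC.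
have lo n m : (s n).1 <= (s (n + m)%N).1 /\ (s n).2 <= (s (n + m)%N).2.
  elim: m => [|m [IH1 IH2]]; first by rewrite addn0.
  rewrite addnS; case: (sT (n + m)%N) => h1 _ h2 _ _.
  by split; [exact: le_trans h1|exact: le_trans h2].
have hi n m : (s (n + m)%N).1 + w (n + m)%N <= (s n).1 + w n /\
    (s (n + m)%N).2 + h (n + m)%N <= (s n).2 + h n.
  elim: m => [|m [IH1 IH2]]; first by rewrite addn0.
  rewrite addnS; case: (sT (n + m)%N) => _ h1 _ h2 _.
  by split; [exact: le_trans h1 IH1|exact: le_trans h2 IH2].
have key n m : (s m).1 <= (s n).1 + w n /\ (s m).2 <= (s n).2 + h n.
  have [nm|mn] := leqP n m.
    have := hi n (m - n)%N; rewrite subnKC// => -[h1 h2].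
    by split; [apply: le_trans h1|apply: le_trans h2]; rewrite lerDl.
  have := lo m (n - m)%N; rewrite subnKC ?(ltnW mn)// => -[h1 h2].
  by split; [apply: (le_trans h1)|apply: (le_trans h2)]; rewrite lerDl.
pose x := sup [set (s n).1 | n in setT]; pose y := sup [set (s n).2 | n in setT].
have xI n : (s n).1 <= x <= (s n).1 + w n.
  apply/andP; split.
    apply: ub_le_sup; last by exists n.
    by exists ((s 0%N).1 + w 0%N) => _ [m _ <-]; case: (key 0%N m).
  apply: ge_sup; first by exists (s 0%N).1; exists 0%N.
  by move=> _ [m _ <-]; case: (key n m).
have yI n : (s n).2 <= y <= (s n).2 + h n.
  apply/andP; split.
    apply: ub_le_sup; last by exists n.
    by exists ((s 0%N).2 + h 0%N) => _ [m _ <-]; case: (key 0%N m).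
  apply: ge_sup; first by exists (s 0%N).2; exists 0%N.
  by move=> _ [m _ <-]; case: (key n m).
have w0E : w 0%N = b - a by rewrite /w expr0 divr1.
have h0E : h 0%N = d - c by rewrite /h expr0 divr1.
have xab : a <= x <= b by have := xI 0%N; rewrite w0E/= subrKC.
have ycd : c <= y <= d by have := yI 0%N; rewrite h0E/= subrKC.
have [e e0 He] := local x y xab ycd.
have small (L : R) : 0 <= L -> exists n : nat, forall m, (n <= m)%N -> L / 2 ^+ m < e.
  move=> L0; exists (Num.truncn (L / e)).+1 => m nm.
  rewrite ltr_pdivrMr ?exprn_gt0// mulrC -ltr_pdivrMr//.
  rewrite (lt_le_trans (truncnS_gt _))//.
  rewrite (@le_trans _ _ m%:R) ?ler_nat// -natrX ler_nat ltnW// ltn_expl//.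
have [n1 H1] := small (b - a) ltac:(by rewrite subr_ge0).
have [n2 H2] := small (d - c) ltac:(by rewrite subr_ge0).
pose n := maxn n1 n2; apply: (Bs n).
have [/= l1 l2] := lo 0%N n; have [/= u1 u2] := hi 0%N n.
rewrite w0E h0E !add0n in l1 l2 u1 u2.
have /andP[x1 x2] := xI n; have /andP[y1 y2] := yI n.
apply: He; rewrite ?l1 ?l2 ?x1 ?x2 ?y1 ?y2//=.
- by move: u1; rewrite subrKC.
- by move: u2; rewrite subrKC.
- by rewrite addrAC subrr add0r H1// leq_maxl.
- by rewrite addrAC subrr add0r H2// leq_maxr.
Qed.

End rect_induction.

(** * Goursat's lemma for a real form P dx + Q dy *)

Section goursat.
Context {R : realType}.
Variables (P Q : R -> R -> R).

Definition circ (a b c d : R) : R :=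
  Int a b (fun x => P x c - P x d) + Int c d (fun y => Q b y - Q a y).

(** Differentiability at one point with equal cross derivatives P_y = Q_x = [p2]. Nothing is asked
    of the continuity of the derivatives. *)
Definition closed_at (a b c d x y : R) : Prop :=
  exists p1 p2 q2 : R, forall e, 0 < e -> exists2 dl, 0 < dl &
    forall x' y', a <= x' <= b -> c <= y' <= d -> `|x' - x| < dl -> `|y' - y| < dl ->
      `|P x' y' - P x y - p1 * (x' - x) - p2 * (y' - y)| <= e * (`|x' - x| + `|y' - y|) /\
      `|Q x' y' - Q x y - p2 * (x' - x) - q2 * (y' - y)| <= e * (`|x' - x| + `|y' - y|).

Lemma closed_at_cvg a b c d x y : closed_at a b c d x y ->
  forall e, 0 < e -> exists2 dl, 0 < dl &
    forall x' y', a <= x' <= b -> c <= y' <= d -> `|x' - x| < dl -> `|y' - y| < dl ->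
      `|P x' y' - P x y| <= e /\ `|Q x' y' - Q x y| <= e.
Proof.
move=> [p1 [p2 [q2 H]]] e e0; have [dl dl0 Hd] := H 1 ltr01.
pose N := 2 + (`|p1| + `|p2| + `|q2|) * 2.
have N0 : 0 < N by rewrite ltr_wpDr// mulr_ge0// !addr_ge0.
exists (Num.min dl (e / N)); first by rewrite lt_min dl0 divr_gt0.
move=> x' y' xI yI; rewrite !lt_min => /andP[xd xe] /andP[yd ye].
have [HP HQ] := Hd _ _ xI yI xd yd.
have bnd (u v p q : R) : `|u - v - p * (x' - x) - q * (y' - y)| <= 1 * (`|x' - x| + `|y' - y|) ->
    `|p| + `|q| <= `|p1| + `|p2| + `|q2| -> `|u - v| <= e.
  move=> h pq.
  have -> : u - v = (u - v - p * (x' - x) - q * (y' - y)) + (p * (x' - x) + q * (y' - y)) by ring.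
  have eN : e = e / N * N by field; rewrite gt_eqF.
  set E := e / N in xe ye eN; rewrite eN.
  have E0 : 0 < E by rewrite divr_gt0.
  rewrite (le_trans (ler_normD _ _))//.
  have h2 : `|p * (x' - x) + q * (y' - y)| <= (`|p| + `|q|) * E.
    by rewrite (le_trans (ler_normD _ _))// !normrM mulrDl lerD// ler_wpM2l// ltW.
  have h3 : (`|p| + `|q|) * E <= (`|p1| + `|p2| + `|q2|) * E by rewrite ler_wpM2r// ltW.
  have h4 : 0 <= (`|p1| + `|p2| + `|q2|) * E by rewrite mulr_ge0 ?addr_ge0// ltW.
  rewrite /N; move: h h2 h3 h4; rewrite mul1r; set S := `|p1| + _ + _.
  have -> : E * (2 + S * 2) = 2 * E + 2 * (S * E) by ring.
  lra.
split; [apply: (bnd _ _ _ _ HP)|apply: (bnd _ _ _ _ HQ)].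
  by rewrite lerDl.
by rewrite -addrA lerDr.
Qed.

Section rectangle.
Variables (a b c d : R).
Hypothesis cl : forall x y, a <= x <= b -> c <= y <= d -> closed_at a b c d x y.

Lemma closed_ctsP (y : R) : c <= y <= d -> {within `[a, b], continuous (P ^~ y)}.
Proof.
move=> yI; apply/subspace_continuousP => x; rewrite /= in_itv/= => xI.
apply/cvgrPdist_le => e e0; have [dl dl0 H] := closed_at_cvg (cl xI yI) e0.
rewrite /within/=; apply/nbhs_ballP; exists dl => //= x' xx'.
rewrite in_itv/= => xI'; rewrite distrC.
by have [] := H x' y xI' yI; rewrite ?subrr ?normr0// distrC.
Qed.

Lemma closed_ctsQ (x : R) : a <= x <= b -> {within `[c, d], continuous (Q x)}.
Proof.
move=> xI; apply/subspace_continuousP => y; rewrite /= in_itv/= => yI.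
apply/cvgrPdist_le => e e0; have [dl dl0 H] := closed_at_cvg (cl xI yI) e0.
rewrite /within/=; apply/nbhs_ballP; exists dl => //= y' yy'.
rewrite in_itv/= => yI'; rewrite distrC.
by have [] := H x y' xI yI'; rewrite ?subrr ?normr0// distrC.
Qed.

Lemma circE a' b' c' d' : a <= a' -> a' <= b' -> b' <= b ->
  c <= c' -> c' <= d' -> d' <= d ->
  circ a' b' c' d' = Int a' b' (P ^~ c') - Int a' b' (P ^~ d') +
    (Int c' d' (Q b') - Int c' d' (Q a')).
Proof.
move=> aa ab bb cc cd dd; rewrite /circ.
have subP y : c <= y <= d -> {within `[a', b'], continuous (P ^~ y)}.
  move=> yI; apply: within_sub (closed_ctsP yI) => x.
  by rewrite /= !in_itv/= => /andP[x1 x2]; rewrite (le_trans aa)// (le_trans x2).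
have subQ x : a <= x <= b -> {within `[c', d'], continuous (Q x)}.
  move=> xI; apply: within_sub (closed_ctsQ xI) => y.
  by rewrite /= !in_itv/= => /andP[x1 x2]; rewrite (le_trans cc)// (le_trans x2).
by rewrite !IntB//; [apply: subQ|apply: subQ|apply: subP|apply: subP];
  apply/andP; split; lra.
Qed.

Lemma circ_quarter a' m b' c' n d' : a <= a' -> a' <= m -> m <= b' -> b' <= b ->
  c <= c' -> c' <= n -> n <= d' -> d' <= d ->
  circ a' b' c' d' = circ a' m c' n + circ m b' c' n + circ a' m n d' + circ m b' n d'.
Proof.
move=> aa am mb bb cc cn nd dd.
have ab' := le_trans am mb; have cd' := le_trans cn nd.
have subP y : c <= y <= d -> {within `[a', b'], continuous (P ^~ y)}.
  move=> yI; apply: within_sub (closed_ctsP yI) => x.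
  by rewrite /= !in_itv/= => /andP[x1 x2]; rewrite (le_trans aa)// (le_trans x2).
have subQ x : a <= x <= b -> {within `[c', d'], continuous (Q x)}.
  move=> xI; apply: within_sub (closed_ctsQ xI) => y.
  by rewrite /= !in_itv/= => /andP[x1 x2]; rewrite (le_trans cc)// (le_trans x2).
have aa' := le_trans aa am; have bb' := le_trans mb bb.
have cc' := le_trans cc cn; have dd' := le_trans nd dd.
rewrite !circE//.
have cI : c <= c' <= d by rewrite cc (le_trans cd').
have dI : c <= d' <= d by rewrite dd andbT (le_trans cc).
have aI : a <= a' <= b by rewrite aa (le_trans ab').
have bI : a <= b' <= b by rewrite bb andbT (le_trans aa).
rewrite (Int_add am mb (subP c' cI)) (Int_add am mb (subP d' dI)).
rewrite (Int_add cn nd (subQ b' bI)) (Int_add cn nd (subQ a' aI)).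
ring.
Qed.

Lemma mid_itv (u v : R) : u <= v -> u <= (u + v) / 2 <= v.
Proof. by move=> uv; apply/andP; split; lra. Qed.

(** The bound 2 e (width + height)^2 passes from four quarters to the whole, since 4 (1/2)^2 = 1.
    Near each point it holds for every e, because affine closed forms have zero circulation. *)
Theorem goursat : a <= b -> c <= d -> circ a b c d = 0.
Proof.
move=> ab cd; apply/eqP; rewrite -normr_eq0 eq_le normr_ge0 andbT.
apply/ler_addgt0Pl => e' e'0; rewrite addr0.
pose N := 2 * ((b - a) + (d - c)) ^+ 2 + 1.
have N0 : 0 < N by rewrite ltr_wpDl// mulr_ge0// sqr_ge0.
pose e := e' / N; have e0 : 0 < e by rewrite divr_gt0.
suff : `|circ a b c d| <= 2 * e * ((b - a) + (d - c)) ^+ 2.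
  move/le_trans; apply; have -> : e' = e * N by rewrite /e; field; rewrite gt_eqF.
  by rewrite -mulrA mulrCA ler_wpM2l ?(ltW e0)// lerDl.
have := @rect_induction R (fun a' b' c' d' => a <= a' -> a' <= b' -> b' <= b ->
  c <= c' -> c' <= d' -> d' <= d ->
  `|circ a' b' c' d'| <= 2 * e * ((b' - a') + (d' - c')) ^+ 2) a b c d ab cd.
apply=> //.
- move=> a' b' c' d'; set m := (a' + b') / 2; set n := (c' + d') / 2.
  move=> G1 G2 G3 G4 aa ab' bb cc cd' dd.
  have /andP[am mb] : a' <= m <= b' by exact: mid_itv.
  have /andP[cn nd] : c' <= n <= d' by exact: mid_itv.
  have am' := le_trans aa am; have mb' := le_trans mb bb.
  have cn' := le_trans cc cn; have nd' := le_trans nd dd.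
  have ma : m <= b by exact: mb'.
  rewrite (circ_quarter aa am mb bb cc cn nd dd).
  have G1' := G1 aa am mb' cc cn nd'.
  have G2' := G2 am' mb bb cc cn nd'.
  have G3' := G3 aa am mb' cn' nd dd.
  have G4' := G4 am' mb bb cn' nd dd.
  have e1 : m - a' = (b' - a') / 2 by rewrite /m; field.
  have e2 : b' - m = (b' - a') / 2 by rewrite /m; field.
  have e3 : n - c' = (d' - c') / 2 by rewrite /n; field.
  have e4 : d' - n = (d' - c') / 2 by rewrite /n; field.
  rewrite e1 e3 in G1'; rewrite e2 e3 in G2'; rewrite e1 e4 in G3'; rewrite e2 e4 in G4'.
  rewrite (le_trans (ler_normD _ _))// (le_trans (lerD (ler_normD _ _) (lexx _)))//.
  rewrite (le_trans (lerD (lerD (ler_normD _ _) (lexx _)) (lexx _)))//.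
  have -> : 2 * e * (b' - a' + (d' - c')) ^+ 2 =
    (2 * e * ((b' - a') / 2 + (d' - c') / 2) ^+ 2) * 4 by field.
  move: G1' G2' G3' G4'; move: (2 * e * _) => E; clear; lra.
- clear ab cd e'0; move=> x y xI yI; have [p1 [p2 [q2 H]]] := cl xI yI.
  have [dl dl0 {}H] := H e e0; exists dl => // a' b' c' d'.
  move=> /andP[aa ax] /andP[xb bb] /andP[cc cy] /andP[yd dd] wd hd _ ab' _ _ cd' _.
  have subP y' : c <= y' <= d -> {within `[a', b'], continuous (P ^~ y')}.
    move=> yI'; apply: within_sub (closed_ctsP yI') => x'.
    by rewrite /= !in_itv/= => /andP[x1 x2]; rewrite (le_trans aa)// (le_trans x2).
  have subQ x' : a <= x' <= b -> {within `[c', d'], continuous (Q x')}.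
    move=> xI'; apply: within_sub (closed_ctsQ xI') => y'.
    by rewrite /= !in_itv/= => /andP[x1 x2]; rewrite (le_trans cc)// (le_trans x2).
  have cI : c <= c' <= d by apply/andP; split; lra.
  have dI : c <= d' <= d by apply/andP; split; lra.
  have aI : a <= a' <= b by apply/andP; split; lra.
  have bI : a <= b' <= b by apply/andP; split; lra.
  have cP : {within `[a', b'], continuous (fun x => P x c' - P x d')}.
    by move=> z; apply: cvgB; [exact: subP|exact: subP].
  have cQ : {within `[c', d'], continuous (fun y => Q b' y - Q a' y)}.
    by move=> z; apply: cvgB; [exact: subQ|exact: subQ].
  have ccst (k u v : R) : {within `[u, v], continuous (fun=> k)}.
    by move=> z; exact: cst_continuous.
  (* The subtracted constants cancel between the two integrals; they remove the affine part, so each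
     integrand is at most 2 e (w + h). *)
  have -> : circ a' b' c' d' =
    Int a' b' (fun x => P x c' - P x d' - p2 * (c' - d')) +
    Int c' d' (fun y => Q b' y - Q a' y - p2 * (b' - a')).
    by rewrite (IntB cP (ccst _ _ _)) (IntB cQ (ccst _ _ _)) !Int_cst// /circ; ring.
  set w := b' - a'; set h := d' - c'.
  have w0 : 0 <= w by rewrite subr_ge0.
  have h0 : 0 <= h by rewrite subr_ge0.
  have -> : 2 * e * (w + h) ^+ 2 = (2 * e * (w + h)) * w + (2 * e * (w + h)) * h by ring.
  rewrite (le_trans (ler_normD _ _))// lerD//.
    apply: Int_le_bound => //; first by move=> z; apply: cvgB; [exact: cP|exact: cst_continuous].
    move=> x' /andP[ax' xb'].
    have x'I : a <= x' <= b by rewrite (le_trans aa)//= (le_trans xb').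
    have xd : `|x' - x| <= w by apply: itv_dist; apply/andP; split.
    have cyd : `|c' - y| <= h by apply: itv_dist; apply/andP; split.
    have dyd : `|d' - y| <= h by apply: itv_dist; apply/andP; split.
    have [H1 _] := H x' c' x'I cI (le_lt_trans xd wd) (le_lt_trans cyd hd).
    have [H2 _] := H x' d' x'I dI (le_lt_trans xd wd) (le_lt_trans dyd hd).
    have -> : P x' c' - P x' d' - p2 * (c' - d') =
      (P x' c' - P x y - p1 * (x' - x) - p2 * (c' - y)) -
      (P x' d' - P x y - p1 * (x' - x) - p2 * (d' - y)) by ring.
    rewrite (le_trans (ler_normB _ _))// -mulrA mulr2n mulrDl mul1r.
    by rewrite lerD// (le_trans H1, le_trans H2)// ler_wpM2l ?(ltW e0)// lerD.
  apply: Int_le_bound => //; first by move=> z; apply: cvgB; [exact: cQ|exact: cst_continuous].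
  move=> y' /andP[cy' yd'].
  have y'I : c <= y' <= d by rewrite (le_trans cc)//= (le_trans yd').
  have yd2 : `|y' - y| <= h by apply: itv_dist; apply/andP; split.
  have axd : `|a' - x| <= w by apply: itv_dist; apply/andP; split.
  have bxd : `|b' - x| <= w by apply: itv_dist; apply/andP; split.
  have [_ H1] := H b' y' bI y'I (le_lt_trans bxd wd) (le_lt_trans yd2 hd).
  have [_ H2] := H a' y' aI y'I (le_lt_trans axd wd) (le_lt_trans yd2 hd).
  have -> : Q b' y' - Q a' y' - p2 * (b' - a') =
    (Q b' y' - Q x y - p2 * (b' - x) - q2 * (y' - y)) -
    (Q a' y' - Q x y - p2 * (a' - x) - q2 * (y' - y)) by ring.
  rewrite (le_trans (ler_normB _ _))// -mulrA mulr2n mulrDl mul1r.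
  by rewrite lerD// (le_trans H1, le_trans H2)// ler_wpM2l ?(ltW e0)// lerD.
Qed.

End rectangle.
End goursat.

(** * Mild solutions *)

Section L2_norm.
Context {R : realType}.
Implicit Types (f g : L2 R).

Lemma L2norm_ge0 f : 0 <= L2norm f.
Proof. by rewrite /L2norm fine_ge0// Lnorm_ge0. Qed.

Lemma L2normD f g : L2norm (f + g) <= L2norm f + L2norm g.
Proof. exact: ler_LnormD. Qed.

Lemma L2normZ (c : R) f : L2norm (c *: f) = `|c| * L2norm f.
Proof. by apply: EFin_inj; rewrite EFinM !finite_norm_fine LnormZ. Qed.

Lemma L2normN f : L2norm (- f) = L2norm f.
Proof. by rewrite -scaleN1r L2normZ normrN normr1 mul1r. Qed.

Lemma L2normB f g : L2norm (f - g) <= L2norm f + L2norm g.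
Proof. by rewrite (le_trans (L2normD _ _))// L2normN. Qed.

Lemma L2norm0 : L2norm (0 : L2 R) = 0.
Proof. by rewrite -(scale0r (0 : L2 R)) L2normZ normr0 mul0r. Qed.

Lemma L2distC f g : L2norm (f - g) = L2norm (g - f).
Proof. by rewrite -L2normN opprB. Qed.

Lemma L2_fun_add f g x : (f + g : L2 R) x = f x + g x. Proof. by []. Qed.
Lemma L2_fun_opp f x : (- f : L2 R) x = - f x. Proof. by []. Qed.
Lemma L2_fun_scale (c : R) f x : (c *: f : L2 R) x = c * f x. Proof. by []. Qed.
Lemma L2_fun_zero x : (0 : L2 R) x = 0. Proof. by []. Qed.

Definition L2_funE := (L2_fun_add, L2_fun_opp, L2_fun_scale, L2_fun_zero).

Lemma L2ext f g : (forall x, f x = g x) -> f = g.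
Proof. by move=> fg; apply/LfuneqP. Qed.

Lemma measurable_L2norm_fun f :
  measurable_fun [set: measurableTypeR R] (fun x => (`|f x| `^ 2)%:E).
Proof.
apply/measurable_EFinP; apply: (measurableT_comp (measurable_powR _)).
exact: measurableT_comp.
Qed.

Lemma eqL2_norm f g : eqL2 f g -> L2norm (f - g) = 0.
Proof.
move=> fg; rewrite -L2norm0 /L2norm; congr fine; rewrite unlock/=.
congr (_ `^ _)%E; apply: ae_eq_integral.
- exact: measurableT.
- exact: (measurable_L2norm_fun (f - g)).
- exact: (measurable_L2norm_fun 0).
apply: (@filterS _ _ (ae_filter_ringOfSetsType leb)) fg => x fgx _ /=; congr (_ `^ _)%:E; congr (`|_|).
rewrite -[LHS]/(f x - g x) fgx ?subrr//.
Qed.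

Lemma L2norm_mono f g : (forall x, unit_itv x -> `|f x| <= `|g x|) -> L2norm f <= L2norm g.
Proof.
move=> fg; rewrite /L2norm -lee_fin !finite_norm_fine unlock/=.
apply: gt0_ler_poweR; rewrite ?invr_gt0 ?in_itv/= ?leey ?integral_ge0//.
apply: ae_ge0_le_integral => //.
- exact: measurable_L2norm_fun.
- exact: measurable_L2norm_fun.
exists (~` unit_itv); split.
- by apply: measurableC; exact: measurable_unit_itv.
- by rewrite /leb/= /mfrestr /mrestr setICl measure0.
- move=> x /=; apply: contra_not => ux _.
  by rewrite lee_fin ge0_ler_powR ?nnegrE// fg.
Qed.

Lemma Lfun_bounded (f : R -> R) (M : R) : measurable_fun [set: measurableTypeR R] f ->
  (forall x, `|f x| <= M) -> f \in Lfun leb 2%:E.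
Proof.
move=> mf fM; rewrite inE/=; apply/andP; split; rewrite inE//=.
rewrite /finite_norm unlock poweR_lty//.
apply: (@le_lt_trans _ _ (\int[leb]_x (cst (M `^ 2)%:E x))%E); last first.
  have lT : (leb (setT : set (measurableTypeR R)) < +oo)%E by exact: fin_num_fun_lty.
  by rewrite integral_cst// lte_mul_pinfty ?lee_fin ?powR_ge0.
apply: ge0_le_integral => //=.
- apply/measurable_EFinP; apply: (measurableT_comp (measurable_powR _)).
  exact: measurableT_comp.
- move=> x _; have M0 := le_trans (normr_ge0 _) (fM x).
  by rewrite lee_fin ge0_ler_powR ?nnegrE.
Qed.

End L2_norm.

(** * Contraction semigroups and their generators, up to null sets *)

Section semigroup.
Context {R : realType}.
Variable S : R -> L2 R -> L2 R.
Hypothesis cS : contraction_semigroup S.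
Implicit Types (f g v : L2 R).
Local Notation N := L2norm.

(** The semigroup laws hold only almost everywhere. They are recorded as vanishing distances, and
    the computations below insert these zero terms instead of rewriting. *)
Lemma sg_linear t (b : R) f g : 0 <= t -> N (S t (b *: f + g) - (b *: S t f + S t g)) = 0.
Proof. by case: cS => H _ _ _ _ t0; apply: eqL2_norm; exact: H. Qed.

Lemma sg_contract t f : 0 <= t -> N (S t f) <= N f.
Proof. by case: cS => _ H _ _ _; exact: H. Qed.

Lemma sg_0 f : N (S 0 f - f) = 0.
Proof. by case: cS => _ _ H _ _; apply: eqL2_norm; exact: H. Qed.

Lemma sg_add s t f : 0 <= s -> 0 <= t -> N (S (s + t) f - S s (S t f)) = 0.
Proof. by case: cS => _ _ _ H _ s0 t0; apply: eqL2_norm; exact: H. Qed.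

Lemma N_eq0_le f g : N (f - g) = 0 -> N f <= N g.
Proof.
move=> fg; have -> : f = (f - g) + g by rewrite subrK.
by rewrite (le_trans (L2normD _ _))// fg add0r.
Qed.

Lemma sg_sub t f g : 0 <= t -> N (S t f - S t g - S t (f - g)) = 0.
Proof.
move=> t0; have := @sg_linear t (-1) g f t0.
rewrite !scaleN1r L2distC addrC -addrA => <-.
by congr N; apply: L2ext => x; rewrite !L2_funE [- g + f]addrC; ring.
Qed.

Lemma sg_lipschitz t f g : 0 <= t -> N (S t f - S t g) <= N (f - g).
Proof.
by move=> t0; rewrite (le_trans (N_eq0_le (sg_sub f g t0)))// sg_contract.
Qed.

Lemma sg_sub_scale t (c : R) f g v : 0 <= t ->
  N (S t f - S t g - c *: S t v) <= N (f - g - c *: v).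
Proof.
move=> t0; apply: le_trans (sg_contract _ t0).
have h1 := sg_sub f g t0; have h2 := @sg_linear t (- c) v (f - g) t0.
set A := S t (_ - c *: v).
have -> : S t f - S t g - c *: S t v = A +
   ((S t f - S t g - S t (f - g)) - (S t (- c *: v + (f - g)) - (- c *: S t v + S t (f - g)))).
  have -> : - c *: v + (f - g) = f - g - c *: v.
    by apply: L2ext => x; rewrite !L2_funE; ring.
  by apply: L2ext => x; rewrite /A !L2_funE; ring.
rewrite (le_trans (L2normD _ _))// (le_trans (lerD (lexx _) (L2normB _ _)))//.
by rewrite h1 h2 !addr0.
Qed.

Lemma gen_eps v g : generator S v g -> forall e, 0 < e -> exists2 d, 0 < d &
  forall t, 0 < t -> t < d -> N (S t v - v - t *: g) <= t * e.
Proof.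
move=> /cvgrPdist_lt H e e0; have := H e e0.
rewrite /at_right/= /within/= => /nbhs_ballP[d /= d0 Hd]; exists d => // t t0 td.
have : ball 0 d t by rewrite /ball/= sub0r normrN gtr0_norm.
move=> /Hd /(_ t0); rewrite sub0r normrN ger0_norm ?L2norm_ge0// => /ltW Ht.
have -> : S t v - v - t *: g = t *: (t^-1 *: (S t v - v) - g).
  by rewrite scalerBr scalerA divff ?gt_eqF// scale1r.
by rewrite L2normZ gtr0_norm// ler_wpM2l// ltW.
Qed.

Lemma subdivide (t d : R) : 0 <= t -> 0 < d -> exists n : nat, exists2 h, 0 <= h < d & t = n%:R * h.
Proof.
move=> t0 d0; pose n := (Num.truncn (t / d)).+1; exists n; exists (t / n%:R).
  rewrite divr_ge0//= ltr_pdivrMr ?ltr0n// -ltr_pdivrMl// mulrC.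
  exact: truncnS_gt.
by rewrite mulrCA divff ?mulr1// pnatr_eq0.
Qed.

Lemma gen_step v g h k e : 0 <= h -> 0 <= k -> N (S h v - v - h *: g) <= h * e ->
  N (S (k + h) v - S k v - h *: S k g) <= h * e.
Proof.
move=> h0 k0; apply: le_trans; apply: le_trans (sg_sub_scale h (S h v) v g k0).
have hA := sg_add v k0 h0.
have -> : S (k + h) v - S k v - h *: S k g =
   (S (k + h) v - S k (S h v)) + (S k (S h v) - S k v - h *: S k g).
  by apply: L2ext => x; rewrite !L2_funE; ring.
by rewrite (le_trans (L2normD _ _))// hA add0r.
Qed.

(** Cut [0, t] into equal steps h. Contractivity transports the expansion at time 0 to each node k,
    so every increment is within h times a small error of [h *: S k g], of norm at most h * N g. *)
Lemma gen_lip v g t : generator S v g -> 0 <= t -> N (S t v - v) <= t * N g.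
Proof.
move=> gvg t0; apply/ler_addgt0Pr => e e0.
have e1 : 0 < e / (t + 1) by rewrite divr_gt0// ltr_wpDl.
have [d d0 Hd] := gen_eps gvg e1.
have [n [h /andP[h0 hd] tE]] := subdivide t0 d0.
have Hh : N (S h v - v - h *: g) <= h * (e / (t + 1)).
  move: h0; rewrite le_eqVlt => /predU1P[<-|h0]; last exact: Hd.
  by rewrite scale0r subr0 sg_0 mul0r.
suff H m : N (S (m%:R * h) v - v) <= m%:R * h * (N g + e / (t + 1)).
  rewrite tE (le_trans (H n))// -tE mulrDr lerD2l mulrCA ler_piMr ?(ltW e0)//.
  by rewrite ler_pdivrMr ?mul1r ?lerDl// ltr_wpDl.
elim: m => [|m IH]; first by rewrite !mul0r sg_0.
have m0 : 0 <= m%:R * h by rewrite mulr_ge0.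
have := gen_step h0 m0 Hh; have -> : m%:R * h + h = m.+1%:R * h by rewrite -natr1; ring.
set k := m%:R * h in IH m0 *; set k' := _.+1%:R * h => H.
have -> : S k' v - v = (S k' v - S k v - h *: S k g) + h *: S k g + (S k v - v).
  by apply: L2ext => x; rewrite !L2_funE; ring.
rewrite (le_trans (L2normD _ _))// (le_trans (lerD (L2normD _ _) IH))//.
rewrite L2normZ (ger0_norm h0).
have HS : h * N (S k g) <= h * N g by rewrite ler_wpM2l// sg_contract.
rewrite (le_trans (lerD (lerD H HS) (lexx _)))//.
rewrite le_eqVlt; apply/orP; left; apply/eqP.
by rewrite /k' /k -natr1; ring.
Qed.

(** Same subdivision as in [gen_lip], but each increment is compared with [h *: g]; replacing
    [S k g] by g costs h * K. *)
Lemma gen_taylor v g t K : generator S v g -> 0 <= t ->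
  (forall s, 0 <= s <= t -> N (S s g - g) <= K) -> N (S t v - v - t *: g) <= t * K.
Proof.
move=> gvg t0 HK; apply/ler_addgt0Pr => e e0.
have e1 : 0 < e / (t + 1) by rewrite divr_gt0// ltr_wpDl.
have [d d0 Hd] := gen_eps gvg e1.
have [n [h /andP[h0 hd] tE]] := subdivide t0 d0.
have Hh : N (S h v - v - h *: g) <= h * (e / (t + 1)).
  move: h0; rewrite le_eqVlt => /predU1P[<-|h0]; last exact: Hd.
  by rewrite scale0r subr0 sg_0 mul0r.
suff H m : (m <= n)%N -> N (S (m%:R * h) v - v - (m%:R * h) *: g) <= m%:R * h * (K + e / (t + 1)).
  have := H n (leqnn n); rewrite -tE => /le_trans; apply; rewrite mulrDr lerD2l mulrCA ler_piMr ?(ltW e0)//.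
  by rewrite ler_pdivrMr ?mul1r ?lerDl// ltr_wpDl.
elim: m => [_|m IH mn]; first by rewrite !mul0r scale0r subr0 sg_0.
have {}IH := IH (ltnW mn).
have m0 : 0 <= m%:R * h by rewrite mulr_ge0.
have mt : m%:R * h <= t by rewrite tE ler_wpM2r// ler_nat ltnW.
have := gen_step h0 m0 Hh; have -> : m%:R * h + h = m.+1%:R * h by rewrite -natr1; ring.
have kE : m.+1%:R * h = m%:R * h + h by rewrite -natr1; ring.
move: IH m0 mt kE; set k := m%:R * h; set k' := _.+1%:R * h => IH m0 mt kE H.
have -> : S k' v - v - k' *: g = (S k' v - S k v - h *: S k g) + h *: (S k g - g) + (S k v - v - k *: g).
  by rewrite kE; apply: L2ext => x; rewrite !L2_funE; ring.
rewrite (le_trans (L2normD _ _))// (le_trans (lerD (L2normD _ _) IH))//.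
rewrite L2normZ (ger0_norm h0).
have HS : h * N (S k g - g) <= h * K by rewrite ler_wpM2l// HK// m0.
rewrite (le_trans (lerD (lerD H HS) (lexx _)))//.
rewrite le_eqVlt; apply/orP; left; apply/eqP.
by rewrite kE; ring.
Qed.

Section mild.
(** [wt] is the time derivative of [w], [h] the source and [g2] the image of [wt] under the
    generator. That [wt] lies in the domain makes [S q (wt s) - wt s] of size q * M, uniformly in
    s. *)
Variables (T M : R) (w wt g2 h : R -> L2 R) (w0 : L2 R).
Hypothesis M0 : 0 <= M.
Hypothesis Aw : forall s, 0 <= s <= T -> generator S (w s) (wt s - h s).
Hypothesis Awt : forall s, 0 <= s <= T -> generator S (wt s) (g2 s).
Hypothesis wq : forall s s', 0 <= s -> s <= s' -> s' <= T ->
  N (w s' - w s - (s' - s) *: wt s) <= M * (s' - s) ^+ 2.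
Hypothesis wtM : forall s, 0 <= s <= T -> N (wt s) <= M.
Hypothesis g2M : forall s, 0 <= s <= T -> N (g2 s) <= M.
Hypothesis hM : forall s s', 0 <= s -> s <= s' -> s' <= T -> N (h s - h s') <= M * (s' - s).
Hypothesis hS : forall e, 0 < e -> exists2 d, 0 < d &
  forall s k, 0 <= s <= T -> 0 <= k -> k < d -> N (S k (h s) - h s) <= e.

Lemma w_cts t : 0 <= t <= T -> cvgL2 (within `[0, T] (nbhs t)) w (w t).
Proof.
move=> /andP[t0 tT].
have lip s s' : 0 <= s -> s <= s' -> s' <= T -> N (w s' - w s) <= (M + M * T) * (s' - s).
  move=> s0 ss sT; have -> : w s' - w s = (w s' - w s - (s' - s) *: wt s) + (s' - s) *: wt s.
    by rewrite subrK.
  rewrite (le_trans (L2normD _ _))// (le_trans (lerD (wq s0 ss sT) (lexx _)))//.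
  rewrite L2normZ ger0_norm ?subr_ge0// [leLHS]addrC [leRHS]mulrDl lerD//.
    by rewrite mulrC ler_wpM2r ?subr_ge0// wtM// s0 (le_trans ss).
  rewrite expr2 mulrA ler_wpM2r ?subr_ge0// ler_wpM2l//.
  by rewrite lerBlDr ler_wpDr.
set L := M + M * T in lip.
have L0 : 0 <= L by rewrite addr_ge0// mulr_ge0// (le_trans t0).
apply/cvgrPdist_lt => e e0; rewrite /within/=; apply/nbhs_ballP.
exists (e / (L + 1)) => /=; first by rewrite divr_gt0// ltr_wpDl.
move=> s /=; rewrite /ball/= => ts; rewrite in_itv/= => /andP[s0 sT].
rewrite sub0r normrN ger0_norm ?L2norm_ge0//.
have : N (w s - w t) <= L * `|t - s|.
  have [st|ts'] := leP s t.
    by rewrite L2distC ger0_norm ?subr_ge0// lip.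
  by rewrite distrC ger0_norm ?subr_ge0 ?(ltW ts')// lip// ltW.
move=> /le_lt_trans; apply; move: ts; rewrite ltr_pdivlMr ?ltr_wpDl// => H.
by apply: le_lt_trans H; rewrite mulrC ler_wpM2l// lerDl.
Qed.

(* The increments of s |-> S (t - s) (w s) match the integrand up to o(s' - s). *)
Lemma mild_piece e d s s' xi t : 0 <= s -> s <= xi -> xi <= s' -> s' <= t -> t <= T ->
  s' - s < d -> M * d <= e ->
  (forall s k, 0 <= s <= T -> 0 <= k -> k < d -> N (S k (h s) - h s) <= e) ->
  N ((s' - s) *: S (t - xi) (h xi) - (S (t - s') (w s') - S (t - s) (w s))) <= (s' - s) * (5 * e).
Proof.
move=> s0 sx xs st tT; set k := s' - s => kd Md He.
have ss : s <= s' := le_trans sx xs.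
have k0 : 0 <= k by rewrite subr_ge0.
have sT : 0 <= s <= T by rewrite s0 (le_trans ss)// (le_trans st).
have xT : 0 <= xi <= T by rewrite (le_trans s0)//= (le_trans xs)// (le_trans st).
have Mk : M * k <= e by apply: le_trans Md; rewrite ler_wpM2l// ltW.
have t0 : 0 <= t - s' by rewrite subr_ge0.
have x0 : 0 <= s' - xi by rewrite subr_ge0.
have h1 := sg_add (w s) t0 k0.
have h2 := sg_add (h xi) t0 x0.
have h3 := sg_sub_scale k (w s') (S k (w s)) (S (s' - xi) (h xi)) t0.
have tE : t - s' + k = t - s by rewrite /k; ring.
have tE2 : t - s' + (s' - xi) = t - xi by ring.
rewrite tE in h1; rewrite tE2 in h2.
have q1 : N (w s' - w s - k *: wt s) <= k * e.
  by rewrite (le_trans (wq s0 ss (le_trans st tT)))// -/k expr2 mulrA mulrC ler_wpM2l.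
have q2 : N (S k (w s) - w s - k *: (wt s - h s)) <= k * (2 * e).
  apply: gen_taylor => //; first exact: Aw.
  move=> q /andP[q0 qk].
  have a1 := sg_sub (wt s) (h s) q0.
  have -> : S q (wt s - h s) - (wt s - h s) = (S q (wt s) - wt s) - (S q (h s) - h s) - (S q (wt s) - S q (h s) - S q (wt s - h s)).
    by apply: L2ext => x; rewrite !L2_funE; ring.
  rewrite (le_trans (L2normB _ _))// a1 addr0 (le_trans (L2normB _ _))//.
  have b1 : N (S q (wt s) - wt s) <= e.
    rewrite (le_trans (gen_lip (Awt sT) q0))// mulrC; apply: le_trans Mk.
    by apply: ler_pM => //; [exact: L2norm_ge0|exact: g2M].
  have b2 : N (S q (h s) - h s) <= e by apply: He => //; exact: le_lt_trans kd.
  by rewrite (le_trans (lerD b1 b2))// mulr_natl mulr2n.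
have q3 : N (h s - S (s' - xi) (h xi)) <= 2 * e.
  have -> : h s - S (s' - xi) (h xi) = (h s - h xi) - (S (s' - xi) (h xi) - h xi).
    by apply: L2ext => x; rewrite !L2_funE; ring.
  have -> : 2 * e = e + e by ring.
  rewrite (le_trans (L2normB _ _))// lerD//.
    rewrite (le_trans (hM s0 sx _))//; first by case/andP: xT.
    by apply: le_trans Mk; rewrite ler_wpM2l// lerD2r.
  by apply: He => //; apply: le_lt_trans kd; rewrite lerD2l lerN2.
have q4 : N (w s' - S k (w s) - k *: S (s' - xi) (h xi)) <= k * (5 * e).
  have -> : w s' - S k (w s) - k *: S (s' - xi) (h xi) =
    (w s' - w s - k *: wt s) - (S k (w s) - w s - k *: (wt s - h s)) + k *: (h s - S (s' - xi) (h xi)).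
    by apply: L2ext => x; rewrite !L2_funE; ring.
  rewrite (le_trans (L2normD _ _))// (le_trans (lerD (L2normB _ _) (lexx _)))//.
  rewrite L2normZ (ger0_norm k0).
  rewrite (le_trans (lerD (lerD q1 q2) (ler_wpM2l k0 q3)))//.
  by rewrite -!mulrDr; have -> : e + 2 * e + 2 * e = 5 * e by ring.
have -> : k *: S (t - xi) (h xi) - (S (t - s') (w s') - S (t - s) (w s)) =
   k *: (S (t - xi) (h xi) - S (t - s') (S (s' - xi) (h xi)))
   + (S (t - s) (w s) - S (t - s') (S k (w s)))
   - (S (t - s') (w s') - S (t - s') (S k (w s)) - k *: S (t - s') (S (s' - xi) (h xi))).
  by apply: L2ext => x; rewrite !L2_funE; ring.
rewrite (le_trans (L2normB _ _))// (le_trans (lerD (L2normD _ _) (le_trans h3 q4)))//.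
by rewrite L2normZ h1 h2 mulr0 !add0r.
Qed.

(** Summing [mild_piece] over a subdivision telescopes q |-> S (t - q) (w q) between S t w0 and w t,
    up to terms of zero norm. No differentiation of vector-valued functions is involved. *)
Lemma mild_solution_of : 0 <= T -> N (w 0 - w0) = 0 -> mild_solution S T h w0 w.
Proof.
move=> T0 w00 t; rewrite /= in_itv/= => /andP[t0 tT].
split; first by apply: w_cts; rewrite t0.
(* The pieces add up to t * (5 * e1), which is then strictly below e for all t <= T. *)
move=> e e0; pose e1 := e / (5 * (T + 1)).
have T1 : 0 < T + 1 by rewrite ltr_wpDl.
have e10 : 0 < e1 by rewrite divr_gt0// mulr_gt0.
have [d d0 Hd] := hS e10.
pose d' := Num.min d (e1 / (M + 1)).
have M1 : 0 < M + 1 by rewrite ltr_wpDl.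
have d'0 : 0 < d' by rewrite lt_min d0 divr_gt0.
have Md : M * d' <= e1.
  apply: (@le_trans _ _ (M * (e1 / (M + 1)))).
    by rewrite ler_wpM2l// ge_min lexx orbT.
  by rewrite mulrCA ler_piMr ?(ltW e10)// ler_pdivrMr// mul1r lerDl.
have Hd' s k : 0 <= s <= T -> 0 <= k -> k < d' -> N (S k (h s) - h s) <= e1.
  by move=> a1 a2 a3; apply: Hd => //; apply: lt_le_trans a3 _; rewrite ge_min lexx.
exists d'; split=> // n s xi s00 snt Hs.
have mono k m : (k + m <= n)%N -> s k <= s (k + m)%N.
  elim: m => [|m IH]; first by rewrite addn0.
  rewrite addnS => km; apply: le_trans (IH (ltnW km)) _.
  by have [/andP[a1 a2] _] := Hs _ km; exact: le_trans a2.
have s0 k : (k <= n)%N -> 0 <= s k.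
  by move=> kn; rewrite -s00; apply: (mono 0%N k).
have st k : (k <= n)%N -> s k <= t.
  by move=> kn; rewrite -snt -(subnKC kn); apply: mono; rewrite subnKC.
pose F q := S (t - q) (w q).
have H m : (m <= n)%N ->
  N (\sum_(i < m) (s i.+1 - s i) *: S (t - xi i) (h (xi i)) - (F (s m) - F 0)) <= s m * (5 * e1).
  elim: m => [_|m IH mn].
    by rewrite big_ord0 s00 subrr subr0 L2norm0 mul0r.
  have {}IH := IH (ltnW mn).
  have [/andP[a1 a2] a3] := Hs _ mn.
  have P := @mild_piece e1 d' (s m) (s m.+1) (xi m) t (s0 _ (ltnW mn)) a1 a2 (st _ mn) tT a3 Md Hd'.
  rewrite big_ord_recr/=.
  set X := \sum_(i < m) _ in IH *; set Y := (_ - s m) *: _ in P *.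
  have -> : X + Y - (F (s m.+1) - F 0) = (X - (F (s m) - F 0)) + (Y - (F (s m.+1) - F (s m))).
    by apply: L2ext => x; rewrite !L2_funE; ring.
  rewrite (le_trans (L2normD _ _))// (le_trans (lerD IH P))//.
  by rewrite -mulrDl addrC subrK.
have := H n (leqnn n); rewrite snt /F subrr subr0.
set X := \sum_(i < n) _ => HX.
have -> : X - (w t - S t w0) = (X - (S 0 (w t) - S t (w 0))) + (S 0 (w t) - w t) - (S t (w 0) - S t w0).
  by apply: L2ext => x; rewrite !L2_funE; ring.
have c1 : N (S t (w 0) - S t w0) = 0.
  have := sg_lipschitz (w 0) w0 t0; rewrite w00 => H0.
  by apply/eqP; rewrite eq_le H0 L2norm_ge0.
apply: le_lt_trans (L2normB _ _) _; rewrite c1 addr0.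
apply: le_lt_trans (L2normD _ _) _; rewrite sg_0 addr0.
apply: le_lt_trans HX _; have -> : t * (5 * e1) = e * (t / (T + 1)) by rewrite /e1; field; rewrite gt_eqF.
by rewrite gtr_pMr// ltr_pdivrMr// mul1r ltr_pwDr.
Qed.

End mild.

End semigroup.

(** * Jets at the origin *)

Section coefficient_recursions.
Context {R : realType}.
Implicit Types (a b : R).

(* If [c k] is the k-th derivative of y at a point, then [popc a c n k] is the
   k-th derivative of P^n y there. *)
Fixpoint popc a (c : nat -> R) (n k : nat) : R :=
  if n is m.+1 then popc a c m k.+3 + a * popc a c m k.+1 else c k.

Lemma family_popc a (A : set R) (phi : nat -> R -> R) n : family A phi ->
  family A (fun k x => popc a (phi ^~ x) n k).
Proof.
move=> fam; elim: n => [//|n IH] k /=.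
have [M hM] := IH k.+3; have [M' hM'] := IH k.+1.
by exists (M + `|a| * M'); exact: (quadD hM (quadZ a hM')).
Qed.

Lemma iter_Pop a (phi : nat -> R -> R) (y : R -> R) n :
  family `[-1, 0] phi -> (forall x, `[-1, 0]%classic x -> y x = phi 0%N x) ->
  forall x, `[-1, 0]%classic x ->
  iter n (Pop a) y x = popc a (phi ^~ x) n 0 /\
  derive_on `[-1, 0] (iter n (Pop a) y) x = popc a (phi ^~ x) n 1.
Proof.
move=> fam y0; have N10 : (-1 : R) < 0 by rewrite ltrN10.
have step m : (forall x, `[-1, 0]%classic x -> iter m (Pop a) y x = popc a (phi ^~ x) m 0) ->
    forall k x, `[-1, 0]%classic x ->
    iter k (derive_on `[-1, 0]) (iter m (Pop a) y) x = popc a (phi ^~ x) m k.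
  by move=> H k x xA; apply: (family_iter_derive_on N10 (family_popc a m fam)).
have H m : forall x, `[-1, 0]%classic x -> iter m (Pop a) y x = popc a (phi ^~ x) m 0.
  elim: m => [//|m IH] x xA; rewrite iterS {1}/Pop.
  have /= h1 := step m IH 1%N x xA.
  have /= h3 := step m IH 3%N x xA.
  by rewrite h3 h1.
by move=> x xA; split; [exact: H|exact: (step n (H n) 1%N)].
Qed.

(* A bounded sequence whose successive ratios exceed 1 + b / ((k + 1) (k + 2)):
   it absorbs the factors lost at each step of the recursions below. *)
Definition lam_seq b (k : nat) : R := expR (b * (1 - k.+1%:R^-1)).

Lemma lam_seq_ge0 b k : 0 <= lam_seq b k. Proof. exact: expR_ge0. Qed.

Lemma lam_seq_le b k : 0 <= b -> lam_seq b k <= expR b.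
Proof. by move=> b0; rewrite ler_expR ler_piMr// gerBl invr_ge0. Qed.

(** From 1 + x <= exp x, as 1/(k+1) - 1/(k+2) = 1/((k+1)(k+2)). *)
Lemma lam_seqS b k : 0 <= b ->
  lam_seq b k * (1 + b / (k.+1%:R * k.+2%:R)) <= lam_seq b k.+1.
Proof.
move=> b0; have := expR_ge1Dx (b / (k.+1%:R * k.+2%:R)).
move=> /(ler_wpM2l (lam_seq_ge0 b k)) /le_trans; apply.
rewrite /lam_seq -expRD ler_expR le_eqVlt; apply/orP; left; apply/eqP.
rewrite -[k.+2%:R]natr1; have : 0 < k.+1%:R :> R by [].
by move: (k.+1%:R : R) => N N0; field; rewrite !gt_eqF// ltr_pwDl.
Qed.

Lemma lam_seq_mono b k : 0 <= b -> lam_seq b k <= lam_seq b k.+1.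
Proof.
move=> b0; apply: le_trans (lam_seqS k b0); rewrite ler_peMr ?lam_seq_ge0// lerDl.
by rewrite divr_ge0// mulr_ge0.
Qed.

(** Two derivatives fewer gain the factor rho^2 / ((m+2)(m+3)). These factors are summable along the
    recursion, so the term in [a] of P costs a constant in all and no loss of radius. *)
Lemma fact_ratio (rho : R) m : 0 < rho ->
  m.+1`!%:R / rho ^+ m.+1 = m.+3`!%:R / rho ^+ m.+3 * (rho ^+ 2 / (m.+2%:R * m.+3%:R)).
Proof.
move=> rho0; rewrite (factS m.+2) (factS m.+1) !natrM.
rewrite (exprS _ m.+2) (exprS _ m.+1); field.
by rewrite ?expf_neq0 ?gt_eqF// ?pnatr_eq0 -?[1]/1%:R -?natrD ?pnatr_eq0.
Qed.

(** The factor [lam_seq] advances with n and absorbs the first-order term at each step, because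
    (m+2)(m+3) >= (n+1)(n+2) for m = k + 3n. *)
Lemma popc_bound a rho C (c : nat -> R) n k : 0 <= a -> 0 < rho -> 0 <= C ->
  (forall j, `|c j| <= C * (j`!%:R / rho ^+ j)) ->
  `|popc a c n k| <= C * lam_seq (a * rho ^+ 2) n * ((k + 3 * n)`!%:R / rho ^+ (k + 3 * n)).
Proof.
move=> a0 rho0 C0 cb; elim: n k => [|n IH] k /=.
  rewrite muln0 addn0 (le_trans (cb k))// ler_wpM2r ?divr_ge0 ?exprn_ge0 ?(ltW rho0)//.
  by rewrite /lam_seq invr1 subrr mulr0 expR0 mulr1.
have b0 : 0 <= a * rho ^+ 2 by rewrite mulr_ge0// exprn_ge0// ltW.
rewrite (le_trans (ler_normD _ _))// normrM (ger0_norm a0).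
rewrite (le_trans (lerD (IH _) (ler_wpM2l a0 (IH _))))//.
have -> : (k.+3 + 3 * n = (k + 3 * n).+3)%N by lia.
have -> : (k.+1 + 3 * n = (k + 3 * n).+1)%N by lia.
have -> : (k + 3 * n.+1 = (k + 3 * n).+3)%N by lia.
set m := (k + 3 * n)%N; rewrite (fact_ratio m rho0).
set X := m.+3`!%:R / _; set L := lam_seq _ n.
have X0 : 0 <= X by rewrite divr_ge0 ?exprn_ge0 ?(ltW rho0).
apply: (@le_trans _ _ (C * (L * (1 + a * rho ^+ 2 / (m.+2%:R * m.+3%:R))) * X)).
  by rewrite le_eqVlt; apply/orP; left; apply/eqP; ring.
rewrite ler_wpM2r// ler_wpM2l//; apply: le_trans (lam_seqS n b0).
rewrite ler_wpM2l ?lam_seq_ge0// lerD2l ler_wpM2l// lef_pV2 ?posrE ?mulr_gt0 ?ltr0n//.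
by rewrite -!natrM ler_nat leq_mul// /m; lia.
Qed.

(* The derivatives d_x^k d_t^n z at x = 0 of a solution of z_t = z_xxx + a z_x with
   z = z_x = 0 at x = 0, when [w n] is the n-th derivative of the flat output z_xx
   at x = 0. *)
Fixpoint flatc a (w : nat -> R) (k n : nat) : R :=
  match k with
  | 0 => 0 | 1 => 0 | 2 => w n
  | (k'.+1 as k1).+2 => flatc a w k' n.+1 - a * flatc a w k1 n
  end.

Lemma flatcS a w k n : flatc a w k.+3 n = flatc a w k n.+1 - a * flatc a w k.+1 n.
Proof. by []. Qed.

(** Three consecutive rows determine the next three. This identifies the jets of two solutions
    having the same flat output, and shows that a zero flat output has zero jets. *)
Lemma flatc_unique a (f : nat -> nat -> R) (w : nat -> R) :
  (forall n, [/\ f 0%N n = 0, f 1%N n = 0 & f 2%N n = w n]) ->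
  (forall k n, f k.+3 n = f k n.+1 - a * f k.+1 n) ->
  forall k n, f k n = flatc a w k n.
Proof.
move=> f0 fS k; suff : forall n, [/\ f k n = flatc a w k n, f k.+1 n = flatc a w k.+1 n
  & f k.+2 n = flatc a w k.+2 n] by move=> H n; case: (H n).
elim: k => [//|k IH] n; have [_ h1 h2] := IH n; split => //.
by have [h3 _ _] := IH n.+1; rewrite fS flatcS h3 h1.
Qed.

Lemma flatc_bound a rho C w : 0 <= a -> 0 < rho -> 0 <= C ->
  (forall n, `|w n| <= C * ((3 * n).+2`!%:R / rho ^+ (3 * n).+2)) ->
  forall k n, `|flatc a w k n| <= C * expR (a * rho ^+ 2) * ((k + 3 * n)`!%:R / rho ^+ (k + 3 * n)).
Proof.
move=> a0 rho0 C0 wb k n; have b0 : 0 <= a * rho ^+ 2 by rewrite mulr_ge0// exprn_ge0// ltW.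
pose L k := lam_seq (a * rho ^+ 2) k.
pose X k : R := k`!%:R / rho ^+ k.
have X0 j : 0 <= X j by rewrite divr_ge0 ?exprn_ge0 ?(ltW rho0).
have L1 j : 1 <= L j by rewrite (le_trans _ (expR_ge1Dx _))// lerDl mulr_ge0// subr_ge0 invf_le1 ?ler1n.
suff : forall j, (forall n, `|flatc a w j n| <= C * L j * X (j + 3 * n)%N) /\
   (forall n, `|flatc a w j.+1 n| <= C * L j.+1 * X (j.+1 + 3 * n)%N) /\
   (forall n, `|flatc a w j.+2 n| <= C * L j.+2 * X (j.+2 + 3 * n)%N).
  move=> /(_ k) [/(_ n) H _]; apply: le_trans H _.
  by rewrite ler_wpM2r ?ler_wpM2l ?lam_seq_le// X0.
elim=> [|j [IH0 [IH1 IH2]]].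
  split; [|split] => m.
  - by rewrite normr0 mulr_ge0 ?X0// mulr_ge0// lam_seq_ge0.
  - by rewrite normr0 mulr_ge0 ?X0// mulr_ge0// lam_seq_ge0.
  - by rewrite (le_trans (wb m))// ler_wpM2r ?X0// ler_peMr// L1.
split; [|split] => // m; rewrite flatcS.
rewrite (le_trans (ler_normB _ _))// normrM (ger0_norm a0).
rewrite (le_trans (lerD (IH0 _) (ler_wpM2l a0 (IH1 _))))//.
have -> : (j + 3 * m.+1 = (j + 3 * m).+3)%N by lia.
have -> : (j.+3 + 3 * m = (j + 3 * m).+3)%N by lia.
have -> : (j.+1 + 3 * m = (j + 3 * m).+1)%N by lia.
set q := (j + 3 * m)%N; rewrite {2}/X (fact_ratio q rho0) -/(X q.+3).
apply: (@le_trans _ _ (C * (L j.+1 * (1 + a * rho ^+ 2 / (q.+2%:R * q.+3%:R))) * X q.+3)).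
  have : C * L j * X q.+3 <= C * L j.+1 * X q.+3 by rewrite ler_wpM2r ?ler_wpM2l// lam_seq_mono.
  by move=> /(fun h => lerD h (lexx _)) /le_trans; apply; rewrite le_eqVlt; apply/orP; left; apply/eqP; ring.
rewrite ler_wpM2r ?X0// ler_wpM2l//; apply: le_trans (lam_seq_mono _ b0).
apply: le_trans (lam_seqS j.+1 b0).
rewrite ler_wpM2l ?lam_seq_ge0// lerD2l ler_wpM2l// lef_pV2 ?posrE ?mulr_gt0 ?ltr0n//.
by rewrite -!natrM ler_nat leq_mul// /q; lia.
Qed.

End coefficient_recursions.

(** * Gevrey cutoff functions *)

Section family_calculus.
Context {R : realType}.

Lemma quad_sub (A B : set R) f g (M : R) : A `<=` B -> quad B f g M -> quad A f g M.
Proof. by move=> AB q x y Ax Ay; apply: q; exact: AB. Qed.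

Lemma quad_le (A : set R) f g (M M' : R) : M <= M' -> quad A f g M -> quad A f g M'.
Proof. by move=> MM q x y Ax Ay; apply: le_trans (q _ _ Ax Ay) _; rewrite ler_wpM2r// sqr_ge0. Qed.

(** The constant contained in [family] is only known to exist; the mean value theorem supplies an
    explicit one, which can then be summed over a series. *)
Lemma family_quad (c d : R) (phi : nat -> R -> R) k B :
  (forall k, exists B, forall x, `[c, d]%classic x -> `|phi k x| <= B) ->
  family `[c, d] phi -> (forall x, `[c, d]%classic x -> `|phi k.+2 x| <= B) ->
  quad `[c, d] (phi k) (phi k.+1) B.
Proof.
move=> bnd fam HB.
have cts j : {within `[c, d], continuous (phi j)}.
  by have [M hM] := fam j; have [B' hB'] := bnd j.+1; exact: quad_continuous hM hB'.
have dv j x : x \in `]c, d[ -> is_derive x 1 (phi j) (phi j.+1 x).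
  by move=> xI; have [M hM] := fam j; exact: quad_is_derive xI hM.
have mvt j x y : c <= x -> x <= y -> y <= d ->
    exists2 s, x <= s <= y & phi j y - phi j x = phi j.+1 s * (y - x).
  move=> cx xy yd;
  have h1 s : s \in `]x, y[ -> is_derive s 1 (phi j) (phi j.+1 s).
    rewrite in_itv/= => /andP[xs sy]; apply: dv.
    by rewrite in_itv/= (le_lt_trans cx xs) (lt_le_trans sy yd).
  have h2 : {within `[x, y], continuous (phi j)}.
    apply: continuous_subspaceW (cts j) => s /=; rewrite !in_itv/= => /andP[xs sy].
    by rewrite (le_trans cx xs) (le_trans sy yd).
  have [s sI e] := MVT_segment xy h1 h2.
  by exists s.
have B0 x : `[c, d]%classic x -> 0 <= B by move=> /HB; exact: le_trans.
have lip s x : `[c, d]%classic s -> `[c, d]%classic x -> `|phi k.+1 s - phi k.+1 x| <= B * `|s - x|.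
  move=> sI xI; move: (sI) (xI); rewrite /= !in_itv/= => /andP[cs sd] /andP[cx xd].
  wlog xs : s x sI xI cs sd cx xd / x <= s.
    move=> H; have [xs|sx] := leP x s; first exact: H.
    by rewrite distrC [`|s - x|]distrC; apply: H => //; exact: ltW.
  have [t /andP[xt ts] ->] := mvt k.+1 x s cx xs sd.
  rewrite normrM ler_wpM2r// HB//= in_itv/= (le_trans cx xt).
  exact: le_trans ts sd.
move=> x y xI yI; move: (xI) (yI); rewrite /= !in_itv/= => /andP[cx xd] /andP[cy yd].
have [xy|yx] := leP x y.
  have [s /andP[xs sy] ->] := mvt k x y cx xy yd.
  rewrite [_ * (y - x)]mulrC -mulrBr normrM.
  have sI : `[c, d]%classic s by rewrite /= in_itv/= (le_trans cx xs) (le_trans sy yd).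
  apply: (@le_trans _ _ (`|y - x| * (B * `|y - x|))).
    rewrite ler_wpM2l// (le_trans (lip _ _ sI xI))// ler_wpM2l ?(B0 x)//.
    by rewrite !ger0_norm ?subr_ge0// lerD2r.
  by rewrite mulrCA -expr2 -normrX ger0_norm// sqr_ge0.
have [s /andP[ys sx] e] := mvt k y x cy (ltW yx) xd.
have sI : `[c, d]%classic s by rewrite /= in_itv/= (le_trans cy ys) (le_trans sx xd).
have -> : phi k y - phi k x - (y - x) * phi k.+1 x = (y - x) * (phi k.+1 s - phi k.+1 x).
  have -> : phi k y - phi k x = phi k.+1 s * (y - x) by rewrite -[LHS]opprB e; ring.
  by ring.
rewrite normrM; apply: (@le_trans _ _ (`|y - x| * (B * `|y - x|))).
  rewrite ler_wpM2l// (le_trans (lip _ _ sI xI))// ler_wpM2l ?(B0 x)//.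
  by rewrite distrC [`|y - x|]distrC !ger0_norm ?subr_ge0 ?(ltW yx)// lerD2l lerN2.
by rewrite mulrCA -expr2 -normrX ger0_norm// sqr_ge0.
Qed.

(* The n-th derivative of the product of [phi i] and [psi j], in families of
   successive derivatives. *)
Fixpoint prodd (phi psi : nat -> R -> R) (n i j : nat) (t : R) : R :=
  if n is m.+1 then prodd phi psi m i.+1 j t + prodd phi psi m i j.+1 t
  else phi i t * psi j t.

Lemma family_prodd (c d : R) (phi psi : nat -> R -> R) i j :
  (forall k, exists B, forall x, `[c, d]%classic x -> `|phi k x| <= B) ->
  (forall k, exists B, forall x, `[c, d]%classic x -> `|psi k x| <= B) ->
  family `[c, d] phi -> family `[c, d] psi ->
  family `[c, d] (fun n => prodd phi psi n i j).
Proof.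
move=> bphi bpsi fphi fpsi n; elim: n i j => [|n IH] i j.
  have [M hM] := fphi i; have [M' hM'] := fpsi j.
  have [B hB] := bphi i; have [B' hB'] := bpsi j.
  have [B1 hB1] := bphi i.+1; have [B1' hB1'] := bpsi j.+1.
  eexists; apply: (quadM hM hM' hB hB') => x y xA yA.
  have h := quad_lipschitz hM hB1 xA yA; have h' := quad_lipschitz hM' hB1' xA yA.
  apply: le_trans (ler_pM _ _ h h') _ => //.
  by rewrite mulrACA -expr2 -normrX [`|_ ^+ 2|]ger0_norm ?sqr_ge0.
have [M hM] := IH i.+1 j; have [M' hM'] := IH i j.+1.
by exists (M + M'); exact: quadD hM hM'.
Qed.

(** Both branches of the recursion raise i + j by one, whence a factor 2K per step in place of
    Leibniz sums; at the bottom, i! j! <= (i+j)!. *)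
Lemma prodd_bound (phi psi : nat -> R -> R) (C C' K t : R) n i j : 1 <= K -> 0 <= C -> 0 <= C' ->
  (forall k, `|phi k t| <= C * (K ^+ k * k`!%:R ^+ 2)) ->
  (forall k, `|psi k t| <= C' * (K ^+ k * k`!%:R ^+ 2)) ->
  `|prodd phi psi n i j t| <= C * C' * ((2 * K) ^+ n * K ^+ (i + j) * (n + i + j)`!%:R ^+ 2).
Proof.
move=> K1 C0 C0' hphi hpsi; have K0 := le_trans ler01 K1.
elim: n i j => [|n IH] i j /=.
  rewrite normrM (le_trans (ler_pM _ _ (hphi i) (hpsi j)))//.
  rewrite add0n expr0 mul1r exprD mulrACA ler_wpM2l ?mulr_ge0// mulrACA ler_wpM2l ?mulr_ge0 ?exprn_ge0//.
  rewrite -exprMn lerXn2r ?nnegrE// ?mulr_ge0// -natrM ler_nat.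
  by rewrite -(bin_fact (leq_addr j i)) addKn leq_pmull// bin_gt0 leq_addr.
rewrite (le_trans (ler_normD _ _))// (le_trans (lerD (IH _ _) (IH _ _)))//.
rewrite !addnS !addSn [(2 * K) ^+ n.+1]exprS [K ^+ (i + j).+1]exprS.
rewrite le_eqVlt; apply/orP; left; apply/eqP; ring.
Qed.

Lemma prodd_0r (phi psi : nat -> R -> R) t n i j : (forall k, psi (j + k)%N t = 0) ->
  prodd phi psi n i j t = 0.
Proof.
elim: n i j => [|n IH] i j H /=; first by rewrite -(addn0 j) H mulr0.
by rewrite !IH ?addr0// => k; rewrite addSnnS.
Qed.

Lemma prodd_1r (phi psi : nat -> R -> R) t n i : psi 0%N t = 1 -> (forall k, psi k.+1 t = 0) ->
  prodd phi psi n i 0 t = phi (i + n)%N t.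
Proof.
move=> h0 hS; elim: n i => [|n IH] i /=; first by rewrite h0 mulr1 addn0.
by rewrite IH addSnnS [X in _ + X]prodd_0r ?addr0// => k; rewrite hS.
Qed.

End family_calculus.

(** * The flat function exp(-1/t) and its Gevrey order *)

Section flat_exponential.
Context {R : realType}.

(** The functions t^(-k) exp(-1/t), extended by 0. Their span is stable under differentiation, so
    higher derivatives obey a recursion on the index. *)
Definition fe (k : nat) (t : R) : R := if 0 < t then t^-1 ^+ k * expR (- t^-1) else 0.

(** This is [expr_le_fact_exp] at 1/t with exponent k + j: vanishing at 0 to every order j, with the
    factorial made explicit. *)
Lemma fe_bound k j t : 0 <= t -> `|fe k t| <= (k + j)`!%:R * t ^+ j.
Proof.
move=> t0; rewrite /fe; case: ifP => [t1|_]; last by rewrite normr0 mulr_ge0 ?exprn_ge0.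
rewrite ger0_norm ?mulr_ge0 ?expR_ge0 ?exprn_ge0 ?invr_ge0//.
have h := @expr_le_fact_exp _ t^-1 (k + j) (eqbRL (invr_ge0 _) t0).
rewrite exprD [X in _ * X]exprVn ler_pdivrMr ?exprn_gt0// in h.
by rewrite expRN ler_pdivrMr ?expR_gt0// mulrAC.
Qed.

Lemma fe_le k t : `|fe k t| <= k`!%:R.
Proof.
have [t0|t0] := leP 0 t; first by have := fe_bound k 0 t0; rewrite expr0 mulr1 addn0.
by rewrite /fe ltNge (ltW t0) normr0.
Qed.

Lemma fe_npos k t : t <= 0 -> fe k t = 0.
Proof. by move=> t0; rewrite /fe ltNge t0. Qed.

Definition fe1 k (t : R) : R := fe k.+2 t - k%:R * fe k.+1 t.

Lemma is_derive_pos k (t : R) : 0 < t ->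
  is_derive t 1 (fun t => t^-1 ^+ k * expR (- t^-1)) (fe1 k t).
Proof.
move=> t0; have tn : t != 0 by rewrite gt_eqF.
have dV : is_derive t 1 (fun s : R => s^-1) (- t^-1 ^+ 2).
  have h := @is_deriveV R id t 1 1 tn (is_derive_id t 1).
  by apply: (is_derive_eq h); rewrite /GRing.scale/= mulr1 exprVn.
have dE : is_derive t 1 (fun s : R => expR (- s^-1)) (expR (- t^-1) * - - t^-1 ^+ 2).
  by apply: (@is_derive1_comp _ expR (fun s : R => - s^-1)); exact: is_deriveN.
have dX : is_derive t 1 (fun s : R => s^-1 ^+ k) (k%:R * t^-1 ^+ k.-1 * - t^-1 ^+ 2).
  have -> : (fun s : R => s^-1 ^+ k) = (fun s : R => s^-1) ^+ k.
    by apply/funext => y; rewrite exprfctE.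
  apply: (is_derive_eq (is_deriveX k dV)); case: k => [|j]; first by rewrite ?(mul0r, scale0r, scaler0).
  by rewrite /GRing.scale/= mulr_natl.
apply: (is_derive_eq (is_deriveM dX dE)).
rewrite /fe1 /fe t0 /GRing.scale/= opprK; case: k {dX} => [|j]; last by rewrite !exprS; ring.
by rewrite !mul0r subr0 mulr0 addr0 expr0 expr2; ring.
Qed.

(** When 0 separates x from y, or when x <= 0, vanishing to second order at 0 gives the estimate,
    with constant [M1]. Taylor's formula, with constant [M2], is applied only between positive
    points. *)
Lemma fe_quad L k : exists M, quad `[- L, L] (fe k) (fe1 k) M.
Proof.
pose M2 : R := (k.+4)`!%:R + k.+2%:R * (k.+3)`!%:R + k%:R * ((k.+3)`!%:R + k.+1%:R * (k.+2)`!%:R).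
pose M1 : R := (k.+2)`!%:R + ((k.+3)`!%:R + k%:R * (k.+2)`!%:R).
have M20 : 0 <= M2 by do ![exact: ler0n | apply: addr_ge0 | apply: mulr_ge0 | done].
have M10 : 0 <= M1 by do ![exact: ler0n | apply: addr_ge0 | apply: mulr_ge0 | done].
have k20 : (k.+2)`!%:R <= M1 by rewrite lerDl addr_ge0// mulr_ge0.
exists (M1 + M2) => x y _ _.
have [x0|x0] := leP x 0.
  have f1 : fe1 k x = 0 by rewrite /fe1 (fe_npos k.+2 x0) (fe_npos k.+1 x0) mulr0 subrr.
  rewrite f1 (fe_npos k x0) mulr0 !subr0.
  have [y0|y0] := leP y 0; first by rewrite fe_npos// normr0 mulr_ge0 ?sqr_ge0 ?addr_ge0.
  apply: le_trans (fe_bound k 2 (ltW y0)) _; rewrite addn2.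
  apply: ler_pM; rewrite ?sqr_ge0//; first by rewrite (le_trans k20)// lerDl.
  by rewrite lerXn2r ?nnegrE ?subr_ge0 ?(ltW y0)// ?(le_trans x0 (ltW y0))// lerDl oppr_ge0.
have [y0|y0] := leP y 0.
  rewrite (fe_npos _ y0) sub0r.
  have xy : x <= `|y - x|.
    by rewrite distrC ger0_norm ?subr_ge0 ?(le_trans y0 (ltW x0))// lerDl oppr_ge0.
  have h1 : `|fe k x| <= (k.+2)`!%:R * `|y - x| ^+ 2.
    apply: le_trans (fe_bound k 2 (ltW x0)) _; rewrite addn2 ler_wpM2l//.
    by rewrite lerXn2r// nnegrE ltW.
  have h2 : `|fe1 k x| <= ((k.+3)`!%:R + k%:R * (k.+2)`!%:R) * `|y - x|.
    rewrite /fe1 (le_trans (ler_normB _ _))// normrM normr_nat mulrDl lerD//.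
      by apply: le_trans (fe_bound k.+2 1 (ltW x0)) _; rewrite addn1 expr1 ler_wpM2l.
    rewrite -mulrA ler_wpM2l//; apply: le_trans (fe_bound k.+1 1 (ltW x0)) _.
    by rewrite addn1 expr1 ler_wpM2l.
  rewrite (le_trans (ler_normB _ _))// normrN normrM.
  rewrite (le_trans (lerD h1 (ler_wpM2l (normr_ge0 _) h2)))//.
  have -> : (k.+2)`!%:R * `|y - x| ^+ 2 + `|y - x| * (((k.+3)`!%:R + k%:R * (k.+2)`!%:R) * `|y - x|) =
      M1 * `|y - x| ^+ 2 by rewrite /M1; ring.
  by rewrite -normrX ger0_norm ?sqr_ge0// ler_wpM2r ?sqr_ge0// lerDl.
have d0 j t : `[Num.min x y, Num.max x y]%classic t ->
    is_derive t 1 (fun t => t^-1 ^+ j * expR (- t^-1)) (fe1 j t).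
  rewrite /= in_itv/= => /andP[mt _]; apply: is_derive_pos; apply: lt_le_trans mt.
  by rewrite lt_min x0.
pose f j (t : R) := t^-1 ^+ j * expR (- t^-1).
have fE j t : `[Num.min x y, Num.max x y]%classic t -> fe j t = f j t.
  rewrite /= in_itv/= => /andP[mt _]; rewrite /fe (lt_le_trans _ mt)// lt_min x0 y0//.
have d1 t : `[Num.min x y, Num.max x y]%classic t ->
    is_derive t 1 (fun t => f k.+2 t - k%:R * f k.+1 t) (fe1 k.+2 t - k%:R * fe1 k.+1 t).
  by move=> tI; exact: is_deriveB (d0 _ t tI) (is_deriveZ _ (d0 _ t tI)).
have d0' t : `[Num.min x y, Num.max x y]%classic t ->
    is_derive t 1 (f k) (f k.+2 t - k%:R * f k.+1 t).
  by move=> tI; apply: (is_derive_eq (d0 k t tI)); rewrite /fe1 !fE.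
have b2 t : `[Num.min x y, Num.max x y]%classic t -> `|fe1 k.+2 t - k%:R * fe1 k.+1 t| <= M2.
  move=> _; rewrite /fe1 (le_trans (ler_normB _ _))// lerD//.
    by rewrite (le_trans (ler_normB _ _))// normrM normr_nat lerD ?fe_le// ler_wpM2l// fe_le.
  rewrite normrM normr_nat ler_wpM2l// (le_trans (ler_normB _ _))// lerD ?fe_le//.
  by rewrite normrM normr_nat ler_wpM2l// fe_le.
have q := deriv_quad d0' d1 b2.
have xI : `[Num.min x y, Num.max x y]%classic x by rewrite /= in_itv/= ge_min le_max lexx.
have yI : `[Num.min x y, Num.max x y]%classic y by rewrite /= in_itv/= ge_min le_max lexx !orbT.
have := q x y xI yI; rewrite /fe1 !fE// => /le_trans; apply.
by rewrite ler_wpM2r ?sqr_ge0// lerDr.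
Qed.

(* The n-th derivative of [fe k]. *)
Fixpoint fed (n k : nat) (t : R) : R :=
  if n is m.+1 then fed m k.+2 t - k%:R * fed m k.+1 t else fe k t.

Lemma fed_family L k : family `[- L, L] (fun n => fed n k).
Proof.
move=> n; elim: n k => [|n IH] k; first exact: fe_quad.
have [M hM] := IH k.+2; have [M' hM'] := IH k.+1.
exists (M + `|- k%:R| * M'); apply: quad_eq (quadD hM (quadZ (- k%:R) hM')) => x _ /=;
  by rewrite mulNr.
Qed.

Lemma fed_npos n k t : t <= 0 -> fed n k t = 0.
Proof.
move=> t0; elim: n k => [|n IH] k /=; first exact: fe_npos.
by rewrite !IH mulr0 subrr.
Qed.

(** A derivative raises the index by at most 2, and the coefficient k is absorbed by the larger
    factorial. The resulting (2n)! is what makes the order equal to 2. *)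
Lemma fed_le n k t : `|fed n k t| <= 2 ^+ n * (k + 2 * n)`!%:R.
Proof.
elim: n k => [|n IH] k /=; first by rewrite muln0 addn0 expr0 mul1r fe_le.
rewrite (le_trans (ler_normB _ _))// normrM normr_nat.
rewrite (le_trans (lerD (IH _) (ler_wpM2l _ (IH _))))//.
have -> : (k + 2 * n.+1 = (k + 2 * n).+2)%N by lia.
have -> : (k.+2 + 2 * n = (k + 2 * n).+2)%N by lia.
have -> : (k.+1 + 2 * n = (k + 2 * n).+1)%N by lia.
have -> : 2 ^+ n.+1 * (k + 2 * n).+2`!%:R = 2 ^+ n * (k + 2 * n).+2`!%:R + 2 ^+ n * (k + 2 * n).+2`!%:R :> R.
  by rewrite exprS; ring.
rewrite lerD2l mulrCA ler_wpM2l ?exprn_ge0// -natrM ler_nat factS leq_mul//; lia.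
Qed.

Lemma fact2_le n : (2 * n)`!%:R <= 4 ^+ n * n`!%:R ^+ 2 :> R.
Proof.
elim: n => [|n IH]; first by rewrite muln0 fact0 expr0 expr1n mulr1.
have -> : (2 * n.+1 = (2 * n).+2)%N by lia.
rewrite !factS !natrM [4 ^+ n.+1]exprS.
have -> : 4 * 4 ^+ n * (n.+1%:R * n`!%:R) ^+ 2 = (2 * n.+1%:R) * ((2 * n.+1%:R) * (4 ^+ n * n`!%:R ^+ 2)) :> R by ring.
rewrite -(natrM _ 2 n.+1).
by apply: ler_pM; rewrite ?mulr_ge0 ?ler_nat//; [lia|apply: ler_pM; rewrite ?ler_nat//; lia].
Qed.

Lemma fed_gevrey n t : `|fed n 0 t| <= 1 * (8 ^+ n * n`!%:R ^+ 2).
Proof.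
apply: le_trans (fed_le n 0 t) _; rewrite add0n mul1r.
apply: le_trans (ler_wpM2l (exprn_ge0 n (ler0n _ 2)) (fact2_le n)) _.
by rewrite mulrA -exprMn -natrM.
Qed.

Lemma fed0_gt0 t : 0 < t -> 0 < fed 0 0 t.
Proof. by move=> t0; rewrite /= /fe t0 expr0 mul1r expR_gt0. Qed.

End flat_exponential.

(** * The cutoff function *)

Section cutoff.
Context {R : realType}.

Lemma quad_reparam (A B : set R) f g (M e s : R) : e ^+ 2 = 1 -> quad B f g M ->
  (forall x, A x -> B (e * x + s)) ->
  quad A (fun x => f (e * x + s)) (fun x => e * g (e * x + s)) M.
Proof.
move=> e2 q AB x y Ax Ay; have := q _ _ (AB x Ax) (AB y Ay).
have -> : e * y + s - (e * x + s) = e * (y - x) by ring.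
by rewrite exprMn e2 mul1r; set X := f _ - f _; rewrite [e * (y - x)]mulrC -mulrA.
Qed.

Lemma quad_Int (T : R) (f : R -> R) L : {within `[0, T], continuous f} ->
  (forall x y, `[0, T]%classic x -> `[0, T]%classic y -> `|f y - f x| <= L * `|y - x|) ->
  quad `[0, T] (fun t => Int 0 t f) f L.
Proof.
move=> fc lip.
have piece u v z : 0 <= u -> u <= v -> v <= T -> u <= z <= v ->
    `|Int u v f - (v - u) * f z| <= L * (v - u) * (v - u).
  move=> u0 uv vT /andP[uz zv].
  have fc' : {within `[u, v], continuous f}.
    apply: continuous_subspaceW fc => x /=; rewrite !in_itv/= => /andP[ux xv].
    by rewrite (le_trans u0 ux) (le_trans xv vT).
  have cc : {within `[u, v], continuous (fun=> f z)}.
    by apply: continuous_subspaceT => x; exact: cvg_cst.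
  have zT : `[0, T]%classic z by rewrite /= in_itv/= (le_trans u0 uz) (le_trans zv vT).
  rewrite [(v - u) * f z]mulrC -(Int_cst _ uv) -IntB//; apply: Int_le_bound => //.
    apply/subspace_continuousP => s sI; apply: cvgB; last exact: cvg_cst.
    by have /subspace_continuousP := fc'; apply.
  move=> s /andP[us sv].
  have sT : `[0, T]%classic s by rewrite /= in_itv/= (le_trans u0 us) (le_trans sv vT).
  apply: le_trans (lip _ _ zT sT) _.
  have L0 : 0 <= L * `|s - z| := le_trans (normr_ge0 _) (lip _ _ zT sT).
  (* The sign of [L] is not assumed. When s = z it is read off the Lipschitz bound between u and v,
     and the case u = v is trivial. *)
  have [->|sz] := eqVneq s z.
    rewrite subrr normr0 mulr0; move: L0; have [->|uv'] := eqVneq u v.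
      by rewrite subrr mulr0.
    move=> _; have uT : `[0, T]%classic u by rewrite /= in_itv/= u0 (le_trans uv vT).
    have vT' : `[0, T]%classic v by rewrite /= in_itv/= (le_trans u0 uv) vT.
    have := le_trans (normr_ge0 _) (lip _ _ uT vT').
    by rewrite ger0_norm// subr_ge0.
  have L0' : 0 <= L by move: L0; rewrite pmulr_lge0// normr_gt0 subr_eq0.
  by rewrite ler_wpM2l//; apply: itv_dist; rewrite ?us ?sv ?uz ?zv.
move=> x y; rewrite /= !in_itv/= => /andP[x0 xT] /andP[y0 yT].
have sub z : z <= T -> {within `[0, z], continuous f}.
  move=> zT; apply: continuous_subspaceW fc => s /=; rewrite !in_itv/= => /andP[-> sz].
  exact: le_trans sz zT.
have [xy|yx] := leP x y.
  rewrite (Int_add x0 xy (sub y yT)) [Int 0 x f + _]addrC addrK expr2 mulrA.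
  by apply: piece; rewrite ?lexx.
rewrite (Int_add y0 (ltW yx) (sub x xT)) opprD addrA subrr sub0r.
have -> : - Int y x f - (y - x) * f x = - (Int y x f - (x - y) * f x) by ring.
rewrite normrN; have -> : (y - x) ^+ 2 = (x - y) * (x - y) by ring.
by rewrite mulrA; apply: piece; rewrite ?lexx ?(ltW yx).
Qed.

Variable T : R.
Hypothesis T0 : 0 < T.

(** The bump [p 0] is exp(-1/(t - T/2)) exp(-1/(T - t)) on ]T/2, T[, flat at both ends, and [theta]
    is its normalised primitive. The signs in [psi] come from the reflection t |-> T - t. *)
Let phi (j : nat) (t : R) : R := fed j 0 (1 * t + (- (T / 2))).
Let psi (j : nat) (t : R) : R := (-1) ^+ j * fed j 0 ((-1) * t + T).
Let p n := prodd phi psi n 0 0.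

Let phi_fam : family `[0, T] phi.
Proof.
move=> k; have [M hM] := fed_family T 0 k; exists M.
have h := @quad_reparam `[0, T] _ _ _ M 1 (- (T / 2)) (expr1n _ 2) hM.
have {}h : quad `[0, T] (fun x => fed k 0 (1 * x + - (T / 2))) (fun x => 1 * fed k.+1 0 (1 * x + - (T / 2))) M.
  apply: h => x; rewrite /= !in_itv/= => /andP[x0 xT].
  by apply/andP; split; have := T0; lra.
by apply: quad_eq h => x _ //; rewrite mul1r.
Qed.

Let psi_fam : family `[0, T] psi.
Proof.
move=> k; have [M hM] := fed_family T 0 k; exists (`|(-1) ^+ k| * M).
have s1 : (-1) ^+ 2 = 1 :> R by rewrite sqrrN expr1n.
have h := @quad_reparam `[0, T] _ _ _ M (-1) T s1 hM.
have {}h : quad `[0, T] (fun x => fed k 0 (-1 * x + T)) (fun x => -1 * fed k.+1 0 (-1 * x + T)) M.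
  apply: h => x; rewrite /= !in_itv/= => /andP[x0 xT].
  by apply/andP; split; have := T0; lra.
apply: quad_eq (quadZ ((-1) ^+ k) h) => x _ //.
by rewrite /psi exprS mulrA [_ * -1]mulrC.
Qed.

Let phi_le j t : `|phi j t| <= 1 * (8 ^+ j * j`!%:R ^+ 2).
Proof. exact: fed_gevrey. Qed.

Let psi_le j t : `|psi j t| <= 1 * (8 ^+ j * j`!%:R ^+ 2).
Proof. by rewrite /psi normrM normrX normrN normr1 expr1n [leLHS]mul1r; exact: fed_gevrey. Qed.

Let p_le n t : `|p n t| <= 16 ^+ n * n`!%:R ^+ 2.
Proof.
have h18 : 1 <= 8 :> R by rewrite ler1n.
have := @prodd_bound _ phi psi 1 1 8 t n 0 0 h18 ler01 ler01 (phi_le ^~ t) (psi_le ^~ t).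
have e : 2 * 8 = 16 :> R by rewrite -natrM.
by rewrite !addn0 expr0 !mulr1 mul1r e.
Qed.

Let p_fam : family `[0, T] p.
Proof.
have b1 k : exists B, forall x, `[0, T]%classic x -> `|phi k x| <= B.
  by exists (1 * (8 ^+ k * k`!%:R ^+ 2)) => x _; exact: phi_le.
have b2 k : exists B, forall x, `[0, T]%classic x -> `|psi k x| <= B.
  by exists (1 * (8 ^+ k * k`!%:R ^+ 2)) => x _; exact: psi_le.
exact: (family_prodd 0 0 b1 b2 phi_fam psi_fam).
Qed.

Let p_lip : exists L, forall x y, `[0, T]%classic x -> `[0, T]%classic y -> `|p 0 y - p 0 x| <= L * `|y - x|.
Proof.
have [M hM] := p_fam 0; exists (16 ^+ 1 * 1`!%:R ^+ 2 + `|M| * (T - 0)).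
by move=> x y xI yI; apply: quad_lipschitz hM _ x y xI yI => s _; exact: (p_le 1).
Qed.

Let p_cts : {within `[0, T], continuous (p 0)}.
Proof.
by have [M hM] := p_fam 0; apply: quad_continuous hM _ => x _; exact: (p_le 1).
Qed.

Let p_ge0 t : 0 <= p 0 t.
Proof.
rewrite /p /= /psi expr0 mul1r; have f0 s : 0 <= fed 0 0 s :> R.
  by have [/fed_npos->//|/fed0_gt0/ltW] := leP s 0.
by rewrite mulr_ge0 ?f0.
Qed.

Let Int_ge0 (a b : R) f : (forall x, a <= x <= b -> 0 <= f x) -> 0 <= Int a b f.
Proof. by move=> f0; apply: Rintegral_ge0 => x; rewrite /= in_itv/=; exact: f0. Qed.

Let mass_gt0 : 0 < Int 0 T (p 0).
Proof.
(* Between these points both t - T/2 and T - t are at least T/8, which bounds the bump below by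
   [m]. *)
pose u := 5 * T / 8; pose v := 7 * T / 8.
have u0 : 0 <= u by rewrite /u; have := T0; lra.
have uv : u < v by rewrite /u /v; have := T0; lra.
have vT : v <= T by rewrite /v; have := T0; lra.
have cs x y : 0 <= x -> y <= T -> {within `[x, y], continuous (p 0)}.
  move=> x0 yT; apply: continuous_subspaceW p_cts => s /=; rewrite !in_itv/= => /andP[xs sy].
  by rewrite (le_trans x0 xs) (le_trans sy yT).
rewrite (Int_add u0 (le_trans (ltW uv) vT) (cs 0 T (lexx _) (lexx _))).
rewrite (Int_add (ltW uv) vT (cs u T u0 (lexx _))).
apply: ltr_wpDl; first by apply: Int_ge0 => x _; exact: p_ge0.
apply: ltr_pwDl; last by apply: Int_ge0 => x _; exact: p_ge0.
pose m := expR (- (8 / T)) * expR (- (8 / T)).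
have m0 : 0 < m by rewrite mulr_gt0 ?expR_gt0.
have fem s : T / 8 <= s -> expR (- (8 / T)) <= fed 0 0 s.
  move=> Ts; have T8 : 0 < T / 8 by rewrite divr_gt0.
  have s0 := lt_le_trans T8 Ts.
  rewrite /= /fe s0 expr0 mul1r ler_expR lerN2.
  have -> : 8 / T = (T / 8)^-1 by rewrite invfM invrK mulrC.
  by rewrite lef_pV2.
have -> : Int u v (p 0) = Int u v (fun x => p 0 x - m) + m * (v - u).
  rewrite IntB; first by rewrite (Int_cst _ (ltW uv)) subrK.
    by apply: cs => //; exact: le_trans vT _.
  by apply: continuous_subspaceT => x; exact: cvg_cst.
apply: ltr_wpDl; last by rewrite mulr_gt0 ?subr_gt0.
apply: Int_ge0 => x /andP[ux xv].
rewrite subr_ge0 /p /= /psi expr0 mul1r; apply: ler_pM; rewrite ?expR_ge0//.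
  by apply: fem; rewrite mul1r; rewrite /u in ux; have := T0; lra.
by apply: fem; rewrite mulN1r; rewrite /v in xv; have := T0; lra.
Qed.

Let k := (Int 0 T (p 0))^-1.

Definition theta (n : nat) (t : R) : R :=
  if n is m.+1 then k * p m t else k * Int 0 t (p 0).

Lemma theta_family : family `[0, T] theta.
Proof.
case=> [|n] /=.
  have [L hL] := p_lip; exists (`|k| * L).
  by apply: quadZ; exact: quad_Int p_cts hL.
have [M hM] := p_fam n; exists (`|k| * M); exact: quadZ.
Qed.

Let p_eq0 n t : t <= T / 2 -> p n t = 0.
Proof.
move=> tT; have f0 i : phi i t = 0.
  by rewrite /phi; apply: fed_npos; rewrite mul1r subr_le0.
suff H i j : prodd phi psi n i j t = 0 by exact: H.
elim: n i j => [|n IH] i j /=; first by rewrite f0 mul0r.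
by rewrite !IH addr0.
Qed.

Lemma theta_eq0 n t : 0 <= t -> t <= T / 2 -> theta n t = 0.
Proof.
move=> t0 tT; case: n => [|n] /=; last by rewrite p_eq0 ?mulr0.
rewrite (_ : Int 0 t (p 0) = 0) ?mulr0//.
rewrite -[RHS](mul0r (t - 0)) -(Int_cst 0 t0); apply: eq_Int => x /andP[_ xt].
by apply: p_eq0; exact: le_trans xt tT.
Qed.

Lemma theta_T0 : theta 0 T = 1.
Proof. by apply: mulVf; rewrite gt_eqF// mass_gt0. Qed.

Lemma theta_TS n : theta n.+1 T = 0.
Proof.
rewrite /= /p prodd_0r ?mulr0// => j.
by rewrite /psi add0n fed_npos ?mulr0// mulN1r addrC subrr.
Qed.

Lemma theta_bound : exists C, 0 <= C /\
  forall n t, 0 <= t <= T -> `|theta n t| <= C * (16 ^+ n * n`!%:R ^+ 2).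
Proof.
exists (`|k| * (1 + T)); split; first by rewrite mulr_ge0// addr_ge0// ltW.
move=> [|n] t /andP[t0 tT] /=; rewrite normrM -mulrA ler_wpM2l//.
  rewrite expr0 expr1n !mulr1; apply: (@le_trans _ _ (1 * (t - 0))).
    apply: Int_le_bound => //.
      apply: continuous_subspaceW p_cts => s /=; rewrite !in_itv/= => /andP[-> st].
      exact: le_trans st tT.
    by move=> x _; have := p_le 0 x; rewrite expr0 mul1r expr1n.
  by rewrite mul1r subr0 (le_trans tT)// lerDr.
apply: le_trans (p_le n t) _.
apply: (@le_trans _ _ (16 ^+ n.+1 * (n.+1)`!%:R ^+ 2)).
  apply: ler_pM; rewrite ?exprn_ge0//.
    by rewrite exprS ler_peMl ?exprn_ge0// ler1n.
  by rewrite lerXn2r ?nnegrE// ler_nat factS leq_pmull.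
by rewrite ler_peMl ?mulr_ge0 ?exprn_ge0// lerDl ltW.
Qed.

End cutoff.

(** * Solutions from a flat output *)

Section flat_output_solution.
Context {R : realType}.
Variables (a T : R) (w : nat -> R -> R) (C0 K0 : R).
Hypotheses (a0 : 0 <= a) (C00 : 0 <= C0) (K00 : 0 < K0).
Hypothesis w_fam : family `[0, T] w.
Hypothesis w_bound : forall n t, 0 <= t <= T -> `|w n t| <= C0 * (K0 ^+ n * n`!%:R ^+ 2).

Definition D2 k n x t : R := TS (fun j => flatc a (w ^~ t) (k + j) n) x.

(** Order 2 lies strictly below 3: in (K0 rho^3)^n n!^2 the power costs one n! and a constant, and
    n!^3 <= (3n)!. Hence [rho] is arbitrary. *)
Lemma fact2_fact3 (rho : R) : 0 < rho -> exists2 C1, 0 <= C1 & forall n,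
  C0 * (K0 ^+ n * n`!%:R ^+ 2) <= C1 * ((3 * n).+2`!%:R / rho ^+ (3 * n).+2).
Proof.
move=> rho0; have Kr : 0 <= K0 * rho ^+ 3 by rewrite mulr_ge0 ?exprn_ge0 ?(ltW K00) ?(ltW rho0).
exists (C0 * rho ^+ 2 * expR (K0 * rho ^+ 3)) => [|n].
  by rewrite mulr_ge0 ?expR_ge0// mulr_ge0// exprn_ge0// ltW.
rewrite [leRHS]mulrA ler_pdivlMr ?exprn_gt0//.
have h := @expr_le_fact_exp _ (K0 * rho ^+ 3) n Kr.
have -> : C0 * (K0 ^+ n * n`!%:R ^+ 2) * rho ^+ (3 * n).+2 =
    C0 * rho ^+ 2 * ((K0 * rho ^+ 3) ^+ n * n`!%:R ^+ 2).
  have -> : rho ^+ (3 * n).+2 = rho ^+ 3 ^+ n * rho ^+ 2 by rewrite -exprM -exprD addn2.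
  by move: (rho ^+ 3) => q; rewrite exprMn; ring.
rewrite -[leRHS]mulrA ler_wpM2l ?mulr_ge0 ?exprn_ge0 ?(ltW rho0)//.
apply: le_trans (ler_wpM2r (exprn_ge0 2 (ler0n _ _)) h) _.
have -> : n`!%:R * expR (K0 * rho ^+ 3) * n`!%:R ^+ 2 = expR (K0 * rho ^+ 3) * n`!%:R ^+ 3 :> R by ring.
rewrite ler_wpM2l ?expR_ge0//; apply: le_trans (fact3_ge n) _.
by rewrite ler_nat leq_fact// leqW.
Qed.

Lemma flatc_le : exists2 C1, 0 <= C1 & forall t, 0 <= t <= T -> forall k n,
  `|flatc a (w ^~ t) k n| <= C1 * ((k + 3 * n)`!%:R / 6 ^+ (k + 3 * n)).
Proof.
(* Splitting (k + 3n)! later costs 2^(k+3n); radius 6 leaves radius 3 for the series in x, well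
   above 1. *)
have [C1 C10 HC] := @fact2_fact3 6 (ltr0n R 6).
exists (C1 * expR (a * 6 ^+ 2)); first by rewrite mulr_ge0 ?expR_ge0.
move=> t tT k n; apply: flatc_bound => // m.
by apply: le_trans (w_bound m tT) (HC m).
Qed.

Lemma flatc_TS : exists2 C1, 0 <= C1 & forall t n k, 0 <= t <= T ->
  `|flatc a (w ^~ t) k n| <= C1 * (3 * n)`!%:R * (k`!%:R / 3 ^+ k).
Proof.
have [C1 C10 HC] := flatc_le; exists C1 => // t n k tT.
apply: le_trans (HC t tT k n) _; rewrite -mulrA ler_wpM2l//.
have h := @fact_addn_le R 1 k (3 * n) ler01; rewrite expr1n mulr1 in h.
have -> : 6 = 2 * 3 :> R by rewrite -natrM.
rewrite exprMn ler_pdivrMr ?mulr_gt0 ?exprn_gt0//.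
apply: le_trans h _; have -> : 1 + 1 = 2 :> R by [].
rewrite [3 ^+ (k + 3 * n)]exprD.
have -> : (3 * n)`!%:R * (k`!%:R / 3 ^+ k) * (2 ^+ (k + 3 * n) * (3 ^+ k * 3 ^+ (3 * n))) =
  k`!%:R * (3 * n)`!%:R * 2 ^+ (k + 3 * n) * 3 ^+ (3 * n) :> R.
  have X0 : 3 ^+ k != 0 :> R by rewrite expf_neq0.
  by move: (3 ^+ k) (3 ^+ (3 * n)) (2 ^+ (k + 3 * n)) X0 => u v z X0; field.
by rewrite ler_peMr ?mulr_ge0 ?exprn_ge0// exprn_ege1// ler1n.
Qed.

Let lt23 : 2 < 3 :> R. Proof. by rewrite ltr_nat. Qed.
Let lt02 : 0 < 2 :> R. Proof. by []. Qed.
Let lt13 : 1 < 3 :> R. Proof. by rewrite ltr1n. Qed.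
Let x1 (x : R) : -1 <= x <= 0 -> `|x| <= 1.
Proof. by move=> /andP[h1 h2]; rewrite ler_norml h1 (le_trans h2). Qed.

Lemma D2_bound : exists C K, [/\ 0 <= C, 0 < K & forall k n x t, -1 <= x <= 0 -> 0 <= t <= T ->
  `|D2 k n x t| <= C * (3 * n)`!%:R * (k`!%:R * K ^+ k)].
Proof.
have [C1 C10 HC] := flatc_TS.
exists (C1 * TS_B 1 3), (TS_K 1 3); split.
- by rewrite mulr_ge0// ltW// TS_B_gt0.
- exact: TS_K_gt0.
move=> k n x t xI tI; have h := HC t n ^~ tI.
rewrite (le_trans (TS_bound ltr01 lt13 k _ h (x1 xI)))//; first by rewrite mulr_ge0.
by rewrite le_eqVlt; apply/orP; left; apply/eqP; ring.
Qed.

Lemma D2_quad_x k n : exists M, forall t, 0 <= t <= T ->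
  quad `[-1, 0] (D2 k n ^~ t) (D2 k.+1 n ^~ t) M.
Proof.
have [C1 C10 HC] := flatc_TS.
have c0 : 0 <= C1 * (3 * n)`!%:R by rewrite mulr_ge0.
exists (C1 * (3 * n)`!%:R * TS_B 1 3 * ((k.+2)`!%:R * TS_K 1 3 ^+ k.+2)) => t tI.
have h := TS_quad ltr01 lt13 k c0 (HC t n ^~ tI).
by apply: quad_sub h => x /=; rewrite !in_itv/= => /andP[-> /le_trans->].
Qed.

Lemma flatc_fam k : family `[0, T] (fun n t => flatc a (w ^~ t) k n).
Proof.
suff H : [/\ family `[0, T] (fun n t => flatc a (w ^~ t) k n),
   family `[0, T] (fun n t => flatc a (w ^~ t) k.+1 n)
   & family `[0, T] (fun n t => flatc a (w ^~ t) k.+2 n)] by case: H.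
have z : family `[0, T] (fun (_ : nat) (_ : R) => 0 : R).
  by move=> n; exists 0 => x y _ _; rewrite mulr0 !subrr normr0 mul0r.
elim: k => [//|k [h1 h2 h3]]; split => // n.
have [M hM] := h1 n.+1; have [M' hM'] := h2 n.
exists (M + `|- a| * M'); apply: quad_eq (quadD hM (quadZ (- a) hM')) => x _ /=;
  by rewrite mulNr.
Qed.

(** Each coefficient has a remainder bounded through its second time derivative, by [family_quad];
    the sequence [g] collects these bounds and is summable against the monomials. *)
Lemma D2_quad_t k n : exists M, forall x, -1 <= x <= 0 ->
  quad `[0, T] (D2 k n x) (D2 k n.+1 x) M.
Proof.
have [C1 C10 HC] := flatc_TS.
have tE t : `[0, T]%classic t -> 0 <= t <= T by rewrite /= in_itv.
have c0 m : 0 <= C1 * (3 * m)`!%:R by rewrite mulr_ge0.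
pose g j := C1 * (3 * n.+2)`!%:R * (j`!%:R / 3 ^+ j).
have gb j : `|g j| <= C1 * (3 * n.+2)`!%:R * (j`!%:R / 3 ^+ j).
  by rewrite ger0_norm// mulr_ge0// divr_ge0.
have gs := TS_asum ltr01 lt13 k (c0 n.+2) gb.
exists (C1 * (3 * n.+2)`!%:R * TS_B 1 3 * (k`!%:R * TS_K 1 3 ^+ k)) => x xI.
rewrite /D2 /TS.
apply: (@quad_series _ `[0, T]%classic (fun j t => flatc a (w ^~ t) (k + j) n * mono j x)
  (fun j t => flatc a (w ^~ t) (k + j) n.+1 * mono j x)
  (fun j => g (k + j)%N * (1 ^+ j / j`!%:R)) _ (C1 * (3 * n)`!%:R * TS_B 1 3 * (k`!%:R * TS_K 1 3 ^+ k))
  (C1 * (3 * n.+1)`!%:R * TS_B 1 3 * (k`!%:R * TS_K 1 3 ^+ k))).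
- move=> j; have q : quad `[0, T] (fun t => flatc a (w ^~ t) (k + j) n) (fun t => flatc a (w ^~ t) (k + j) n.+1) (g (k + j)%N).
    apply: (@family_quad _ _ _ (fun n t => flatc a (w ^~ t) (k + j) n)).
    - move=> m; exists (C1 * (3 * m)`!%:R * ((k + j)`!%:R / 3 ^+ (k + j))) => t /tE tI.
      exact: HC.
    - exact: flatc_fam.
    - by move=> t /tE tI; exact: HC.
  have g0 : 0 <= g (k + j)%N by rewrite mulr_ge0// divr_ge0.
  apply: (@quad_le _ _ _ _ (`|mono j x| * g (k + j)%N)).
    by rewrite mulrC ler_wpM2l// mono_le// x1.
  by apply: quad_eq (quadZ (mono j x) q) => t _; rewrite mulrC.
- exact: gs.
- by move=> t /tE tI; exact: (TS_asum_le ltr01 lt13 k (c0 n) (HC t n ^~ tI) (x1 xI)).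
- by move=> t /tE tI; exact: (TS_asum_le ltr01 lt13 k (c0 n.+1) (HC t n.+1 ^~ tI) (x1 xI)).
Qed.

Lemma D2_rec k n x t : -1 <= x <= 0 -> 0 <= t <= T ->
  D2 k.+3 n x t = D2 k n.+1 x t - a * D2 k.+1 n x t.
Proof.
move=> xI tI; have [C1 C10 HC] := flatc_TS.
have c0 m : 0 <= C1 * (3 * m)`!%:R by rewrite mulr_ge0.
have s k' m := TS_asum_le ltr01 lt13 k' (c0 m) (HC t m ^~ tI) (x1 xI).
rewrite /D2 /TS -mulNr -(sumRZ _ (s k.+1 n)) -(sumRD (s k n.+1) (asumZ _ (s k.+1 n))).
by apply: eq_sumR => j; rewrite !addSn flatcS; ring.
Qed.

Lemma D2_0 k n t : D2 k n 0 t = flatc a (w ^~ t) k n.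
Proof. by rewrite /D2 TS0 addn0. Qed.

Lemma D2_eq0 k n x t : (forall n, w n t = 0) -> D2 k n x t = 0.
Proof.
move=> w0; have f0 j m : flatc a (w ^~ t) j m = 0.
  have h0 i : [/\ 0 = 0 :> R, 0 = 0 :> R & 0 = w i t] by rewrite w0.
  have hS (i i' : nat) : 0 = 0 - a * 0 by rewrite mulr0 subrr.
  by rewrite -(@flatc_unique _ a (fun _ _ => 0) (w ^~ t) h0 hS).
rewrite /D2 /TS -[RHS](@sumR0 R); apply: eq_sumR => j.
by rewrite f0 mul0r.
Qed.

End flat_output_solution.

(** * Classical solutions are solutions in the semigroup sense *)

Section weak_formulation.
Context {R : realType}.

(** Retraction onto [a, b]. Elements of [L2] are functions on the whole line, so functions on the
    rectangle are extended by composing with it, which keeps them bounded and Lipschitz. *)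
Definition clip (a b x : R) : R := Num.max a (Num.min x b).

Lemma clip_in a b x : a <= b -> a <= clip a b x <= b.
Proof. by move=> ab; rewrite /clip le_max lexx/= ge_max ab ge_min lexx orbT. Qed.

Lemma clip_id a b x : a <= x <= b -> clip a b x = x.
Proof. by move=> /andP[ax xb]; rewrite /clip min_l// max_r. Qed.

Lemma clip_lip a b x y : a <= b -> `|clip a b x - clip a b y| <= `|x - y|.
Proof.
move=> ab; rewrite /clip; wlog xy : x y / x <= y.
  by move=> H; have [/H//|/ltW/H] := leP x y; rewrite distrC [`|y - x|]distrC.
rewrite distrC [`|x - y|]distrC [`|y - x|]ger0_norm ?subr_ge0//.
have mono : Num.max a (Num.min x b) <= Num.max a (Num.min y b).
  rewrite ge_max le_max lexx/= le_max; apply/orP; right.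
  by rewrite le_min !ge_min xy lexx orbT.
rewrite ger0_norm ?subr_ge0//.
case: (leP x b) => xb; case: (leP y b) => yb.
- by case: (leP a x) => ax; case: (leP a y) => ay; lra.
- by case: (leP a x) => ax; case: (leP a b) => ay; lra.
- by case: (leP a b) => ax; case: (leP a y) => ay; lra.
- by case: (leP a b) => ax; lra.
Qed.

Lemma eqL2_of (f g : R -> R) : (forall x, -1 < x < 0 -> f x = g x) -> eqL2 f g.
Proof.
move=> fg; exists (~` unit_itv); split.
- by apply: measurableC; exact: measurable_unit_itv.
- by rewrite /leb/= /mfrestr /mrestr setICl measure0.
- move=> x /=; apply: contra_not => ux _; apply: fg.
  by move: ux; rewrite /unit_itv/= in_itv.
Qed.

Lemma continuous_measurableR (f : R -> R) : continuous f ->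
  measurable_fun [set: measurableTypeR R] f.
Proof. by move=> fc; exact: continuous_measurable_fun. Qed.

Lemma lipschitz_continuous (f : R -> R) L : (forall x y, `|f x - f y| <= L * `|x - y|) -> continuous f.
Proof.
move=> lip x; apply/cvgrPdist_le => e e0; near=> y.
apply: le_trans (lip x y) _.
apply: (@le_trans _ _ ((`|L| + 1) * `|x - y|)).
  by rewrite ler_wpM2r// (le_trans (ler_norm _))// lerDl.
rewrite mulrC -ler_pdivlMr ?ltr_wpDl//; near: y.
apply/nbhs_ballP; exists (e / (`|L| + 1)) => /=; first by rewrite divr_gt0// ltr_wpDl.
by move=> z /ltW.
Unshelve. all: by end_near.
Qed.

(** Passes from the restricted measure on the line, used in the definition of weak derivatives, to a
    closed interval, where the calculus of [Int] applies. *)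
Lemma Rint_leb (F : R -> R) : continuous F -> \int[leb]_x F x = Int (-1) 0 F.
Proof.
move=> Fc; have mF := continuous_measurableR Fc.
have mU := @measurable_unit_itv R.
rewrite /Rintegral (@ae_eq_integral _ _ _ leb _ ((EFin \o F) \_ unit_itv)); first last.
- apply: (@filterS _ _ (ae_filter_ringOfSetsType leb)) (eqL2_of (f := F) (g := fun x => if x \in unit_itv then F x else 0) _).
    by move=> x Fx _; rewrite /= patchE; case: ifP Fx => [_ _|_ ->].
  by move=> x xI; rewrite ifT// inE/= /unit_itv/= in_itv.
- by apply/(measurable_restrictT _ mU); apply: measurable_funTS; exact/measurable_EFinP.
- exact/measurable_EFinP.
- exact: measurableT.
rewrite -integral_mkcond (@eq_measure_integral _ _ _ _ lebesgue_measure); last first.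
  by move=> A mA AU; rewrite /leb/= /mfrestr /mrestr setIidl.
rewrite /Int /Rintegral; congr fine.
have cF : {within `[(-1), (0 : R)], continuous F} by exact: continuous_subspaceT.
rewrite /unit_itv [RHS](@integral_itv_bndoo _ (-1) 0 (EFin \o F) true false)//.
by apply: measurable_funTS; exact/measurable_EFinP.
Qed.

Lemma is_derive_near0 (F : R -> R) (x e : R) : 0 < e ->
  (forall y, `|y - x| < e -> F y = 0) -> is_derive x 1 F 0.
Proof.
move=> e0 H; apply: (@near_eq_is_derive _ _ _ (cst 0)).
apply/nbhs_ballP; exists e => //= y; rewrite /ball/= distrC => /H ->.
by [].
Qed.

Lemma weak_derivative_quad (f g : L2 R) M : quad `[-1, 0] f g M ->
  continuous f -> continuous g -> weak_derivative f g.
Proof.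
move=> q fc gc phi [dphi [b [c [b1 c0 supp]]]].
have d1 (x : R) : derivable phi x 1 by exact: (dphi 0%N x).
have d2 (x : R) : derivable (derive1 phi) x 1 by exact: (dphi 1%N x).
have phi_d (x : R) : is_derive x 1 phi (derive1 phi x) by rewrite derive1E; exact: DeriveDef.
have phic : continuous phi by move=> x; apply: differentiable_continuous; exact/derivable1_diffP.
have phi'c : continuous (derive1 phi) by move=> x; apply: differentiable_continuous; exact/derivable1_diffP.
(* [Int_FTC] wants a derivative of f * phi at every real number, while f has one only inside ]-1,
   0[. Around any other point phi vanishes identically. *)
have out x : x <= -1 \/ 0 <= x -> exists2 e, 0 < e & forall y, `|y - x| < e -> phi y = 0.
  case=> hx.
    exists (b + 1) => [|y]; first by lra.
    rewrite ltr_norml => /andP[h1 h2]; apply: supp; rewrite /= in_itv/= => /andP[h3 h4].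
    by lra.
  exists (- c) => [|y]; first by lra.
  rewrite ltr_norml => /andP[h1 h2]; apply: supp; rewrite /= in_itv/= => /andP[h3 h4].
  by lra.
have out0 x : x <= -1 \/ 0 <= x -> phi x = 0 /\ derive1 phi x = 0.
  move=> /out[e e0 He]; split; first by apply: He; rewrite subrr normr0.
  have h := is_derive_near0 e0 He; rewrite derive1E; exact: derive_val.
have FTC : Int (-1) 0 (fun x => f x * derive1 phi x + g x * phi x) = f 0 * phi 0 - f (-1) * phi (-1).
  apply: (Int_FTC (F := fun x => f x * phi x)).
  - by rewrite lerN10.
  - apply: continuous_subspaceT => x; apply: cvgD; apply: cvgM; by [exact: fc|exact: phi'c|exact: gc|exact: phic].
  - move=> x; have [xI|xI] := boolP (x \in `]-1, (0 : R)[).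
      have df := quad_is_derive xI q.
      apply: (is_derive_eq (is_deriveM df (phi_d x))).
      by rewrite /GRing.scale/= [phi x * _]mulrC.
    have xo : x <= -1 \/ 0 <= x.
      move: xI; rewrite in_itv/= negb_and -!leNgt => /orP[]; by [left|right].
    have [-> ->] := out0 x xo; rewrite !mulr0 addr0.
    have [e e0 He] := out x xo; apply: (is_derive_near0 e0) => y /He ->.
    by rewrite mulr0.
have [p0 _] := out0 0 (or_intror (lexx 0)).
have [p1 _] := out0 (-1) (or_introl (lexx (-1))).
rewrite !Rint_leb; first last.
- by move=> x; apply: cvgM; [exact: fc|exact: phi'c].
- by move=> x; apply: cvgM; [exact: gc|exact: phic].
rewrite IntD in FTC.
- by move: FTC; rewrite p0 p1 !mulr0 subrr => /eqP; rewrite addr_eq0 => /eqP.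
- by apply: continuous_subspaceT => x; apply: cvgM; [exact: fc|exact: phi'c].
- by apply: continuous_subspaceT => x; apply: cvgM; [exact: gc|exact: phic].
Qed.

Lemma trace_continuous (f : L2 R) (x : R) : continuous f -> trace f x (f x).
Proof.
move=> fc; exists f; split => //; first exact: continuous_subspaceT.
exact: eqL2_of.
Qed.

End weak_formulation.

(** * From a smooth family to the mild solution *)

Section classical_solution.
Context {R : realType}.
Variables (a T : R) (D : nat -> nat -> R -> R -> R).
Hypotheses (a0 : 0 <= a) (T0 : 0 < T).
Hypothesis fam : family2 (-1) 0 0 T D.
Hypothesis pde : forall k n x t, -1 <= x <= 0 -> 0 <= t <= T ->
  D k n.+1 x t = - D k.+3 n x t - a * D k.+1 n x t.
Hypothesis bc : forall n t, 0 <= t <= T -> D 0 n 0 t = 0 /\ D 1 n 0 t = 0.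
Hypothesis ic : forall x, -1 <= x <= 0 -> D 0 0 x 0 = 0.

Local Notation N := L2norm.
Let u n t := D 0 n (-1) t.
Let xA (x : R) : `[-1, 0]%classic x <-> -1 <= x <= 0.
Proof. by rewrite /= in_itv. Qed.
Let tA (t : R) : `[0, T]%classic t <-> 0 <= t <= T.
Proof. by rewrite /= in_itv. Qed.
Let N10 : (-1 : R) < 0. Proof. by rewrite ltrN10. Qed.
Let N1I : -1 <= (-1 : R) <= 0. Proof. by rewrite lexx ltW. Qed.
Let cx (x : R) : -1 <= clip (-1) 0 x <= 0. Proof. by apply: clip_in; exact: ltW. Qed.
Let ct (t : R) : 0 <= clip 0 T t <= T. Proof. by apply: clip_in; exact: ltW. Qed.

Let vf k n (t x : R) : R := D k n (clip (-1) 0 x) (clip 0 T t).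

Let vf_cts k n t : continuous (vf k n t).
Proof.
have [fx _ bd] := fam; have [M hM] := fx k n; have [B hB] := bd k.+1 n.
apply: (@lipschitz_continuous _ _ (B + `|M| * (0 - -1))) => x y.
have B0 : 0 <= B by apply: le_trans (normr_ge0 _) (hB _ _ (proj2 (xA _) (cx 0)) (proj2 (tA _) (ct t))).
have := quad_lipschitz (hM _ (proj2 (tA _) (ct t))) (fun s sI => hB s _ sI (proj2 (tA _) (ct t)))
  (proj2 (xA _) (cx y)) (proj2 (xA _) (cx x)).
move/le_trans; apply; apply: ler_wpM2l; last by apply: clip_lip; exact: ltW.
by rewrite addr_ge0// mulr_ge0// opprK add0r.
Qed.

Let vf_Lfun k n t : vf k n t \in Lfun leb 2%:E.
Proof.
have [_ _ bd] := fam; have [B hB] := bd k n.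
apply: (@Lfun_bounded _ _ B); first by apply: continuous_measurableR; exact: vf_cts.
by move=> x; apply: hB; [exact: (proj2 (xA _) (cx x))|exact: (proj2 (tA _) (ct t))].
Qed.

Let v k n t : L2 R := Lfun_Sub (lee1n 2) (vf_Lfun k n t).

Let vE k n t x : 0 <= t <= T -> -1 <= x <= 0 -> v k n t x = D k n x t.
Proof. by move=> tI xI; rewrite -[LHS]/(vf k n t x) /vf !clip_id. Qed.

Let W n t : L2 R := v 0 n t - u n t *: L2expn 2.

Let WE n t x : W n t x = vf 0 n t x - u n t * x ^+ 2. Proof. by []. Qed.

Let pow_cts (n : nat) : continuous (fun x : R => x ^+ n).
Proof. by move=> x; exact: exprn_continuous. Qed.

Let vpow_cts k n t (b : R) j : continuous (fun x => vf k n t x - b * x ^+ j).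
Proof. by move=> x; apply: cvgB; [exact: vf_cts|apply: cvgMr; exact: pow_cts]. Qed.

Let pow_quad j (b : R) : exists M, quad `[-1, 0] (fun x => b * x ^+ j.+1) (fun x => j.+1%:R * b * x ^+ j) M.
Proof.
have [M hM] : exists M, quad `[- (1 : R), 1] (mono j.+1) (dmono j.+1) M by eexists; exact: quad_mono.
exists (`|b * j.+1`!%:R| * M).
have h : quad `[-1, 0] (mono j.+1) (dmono j.+1) M.
  by move=> x y xI yI; apply: hM; move: xI yI; rewrite /= !in_itv/= => /andP[x1 x2] /andP[y1 y2];
    rewrite ?x1 ?y1 (le_trans _ (@ler01 R)).
have f0 : (j`!%:R : R) != 0 by rewrite gt_eqF// fact_gt0R.
have j0 : (j.+1%:R : R) != 0 by rewrite pnatr_eq0.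
apply: quad_eq (quadZ (b * j.+1`!%:R) h) => x _; rewrite /mono /dmono /mono factS natrM.
  by move: (j.+1%:R) (j`!%:R) j0 f0 => q q' q0 q0'; field; rewrite q0 q0'.
by move: (j.+1%:R) (j`!%:R) f0 => q q' q0'; field.
Qed.

Let v_quad k n t : 0 <= t <= T -> exists M, quad `[-1, 0] (vf k n t) (vf k.+1 n t) M.
Proof.
move=> tI; have [fx _ _] := fam; have [M hM] := fx k n; exists M.
by apply: quad_eq (hM t (proj2 (tA _) tI)) => x /xA xI; rewrite /vf !clip_id.
Qed.

(** [W n] is the n-th time derivative of w = y - u x^2. Time derivatives keep the boundary
    conditions, so all [W n t] lie in the domain; the lift u x^2 has no third derivative and
    contributes only 2 a u x. The cases n = 0 and n = 1 are used. *)
Let W_graph n t : 0 <= t <= T ->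
  graphA a (W n t) (v 0 n.+1 t + (2 * a * u n t) *: L2expn 1).
Proof.
move=> tI.
exists (v 1 n t - (2 * u n t) *: L2expn 1), (v 2 n t - (2 * u n t) *: L2expn 0), (v 3 n t).
split; [split|split|].
- have [M hM] := v_quad 0 n tI; have [M' hM'] := pow_quad 1 (- u n t).
  apply: (@weak_derivative_quad _ _ _ (M + M')); [|exact: vpow_cts|exact: vpow_cts].
  apply: quad_eq (quadD hM hM') => x _; first by rewrite WE /= mulNr.
  by rewrite -[RHS]/(vf 1 n t x - 2 * u n t * x ^+ 1) /= mulrN mulNr.
- have [M hM] := v_quad 1 n tI; have [M' hM'] := pow_quad 0 (- (2 * u n t)).
  apply: (@weak_derivative_quad _ _ _ (M + M')); [|exact: vpow_cts|exact: vpow_cts].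
  apply: quad_eq (quadD hM hM') => x _.
    by rewrite -[RHS]/(vf 1 n t x - 2 * u n t * x ^+ 1) /= mulNr.
  by rewrite -[RHS]/(vf 2 n t x - 2 * u n t * x ^+ 0) /= mul1r mulNr.
- have [M hM] := v_quad 2 n tI.
  apply: (@weak_derivative_quad _ _ _ (M + 0)); [|exact: vpow_cts|exact: vf_cts].
  have z : quad `[-1, 0] (fun=> - (2 * u n t)) (fun=> 0) 0.
    by move=> x y _ _; rewrite mulr0 !subrr normr0 mul0r.
  apply: quad_eq (quadD hM z) => x _; last by rewrite /= addr0.
  by rewrite -[RHS]/(vf 2 n t x - 2 * u n t * x ^+ 0) /= expr0 mulr1.
- have := @trace_continuous _ (W n t) (-1) (@vpow_cts 0 n t (u n t) 2).
  by rewrite WE -[vf 0 n t (-1)]/(v 0 n t (-1)) vE// sqrrN expr1n mulr1 subrr.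
- have := @trace_continuous _ (W n t) 0 (@vpow_cts 0 n t (u n t) 2).
  rewrite WE -[vf 0 n t 0]/(v 0 n t 0) vE//; last by rewrite lexx ltW.
  by rewrite (bc n tI).1 expr0n mulr0 subrr.
- have := @trace_continuous _ (v 1 n t - (2 * u n t) *: L2expn 1) 0 (@vpow_cts 1 n t (2 * u n t) 1).
  rewrite -[(v 1 n t - _) 0]/(v 1 n t 0 - 2 * u n t * 0 ^+ 1) vE//; last by rewrite lexx ltW.
  by rewrite (bc n tI).2 expr1 mulr0 subrr.
- apply: eqL2_of => x xI; have xI' : -1 <= x <= 0 by case/andP: xI => /ltW -> /ltW ->.
  rewrite -[LHS]/(v 0 n.+1 t x + 2 * a * u n t * x ^+ 1).
  rewrite -[RHS]/(- v 3 n t x - a * (v 1 n t x - 2 * u n t * x ^+ 1)).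
  by rewrite !vE// pde//; move: (D _ _ _ _) (D _ _ _ _) (u n t) => p q r; ring.
Qed.

Let u_fam : family `[0, T] u.
Proof. by move=> n; have [_ ft _] := fam; have [M hM] := ft 0%N n; exists M; apply: hM; apply/xA. Qed.

Let u_bound n : exists2 B, 0 <= B & forall t, 0 <= t <= T -> `|u n t| <= B.
Proof.
have [_ _ bd] := fam; have [B hB] := bd 0%N n.
have h t : 0 <= t <= T -> `|u n t| <= B by move=> tI; apply: hB; [apply/xA|apply/tA].
exists B => //; apply: le_trans (h 0 _) => //; by rewrite lexx ltW.
Qed.

Let u_lip n : exists2 L, 0 <= L & forall s t, 0 <= s <= T -> 0 <= t <= T ->
  `|u n t - u n s| <= L * `|t - s|.
Proof.
have [M hM] := u_fam n; have [B B0 hB] := u_bound n.+1.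
exists (B + `|M| * (T - 0)); first by rewrite addr_ge0// mulr_ge0// subr0 ltW.
move=> s t sI tI; apply: (quad_lipschitz hM) => [x /tA/hB//| |]; exact/tA.
Qed.

Let u_derive t : 0 <= t <= T -> derive_on `[0, T] (u 0) t = u 1%N t.
Proof. by move=> tI; apply: (family_derive_on T0 u_fam); apply/tA. Qed.

Lemma control_C1 : C1_on 0 T (u 0).
Proof.
split=> [t tI|].
  by have [M hM] := u_fam 0; exact: quad_derivable_on hM.
apply: (@subspace_eq_continuous _ _ _ (u 1%N)).
  by move=> t; rewrite inE => /tA tI; rewrite /from_subspace/= u_derive.
have [M hM] := u_fam 1; have [B B0 hB] := u_bound 2.
by apply: (quad_continuous hM) => x /tA; exact: hB.
Qed.

Let N1 : R := N (L2expn 0 : L2 R).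
Let N1_ge0 : 0 <= N1. Proof. exact: L2norm_ge0. Qed.

Let N_le (f : L2 R) B : 0 <= B -> (forall x, -1 <= x <= 0 -> `|f x| <= B) -> N f <= B * N1.
Proof.
move=> B0 fB; rewrite -[X in X * _](ger0_norm B0) -L2normZ; apply: L2norm_mono => x.
rewrite /unit_itv/= in_itv/= => /andP[x1 x2].
by rewrite -[X in _ <= `|X|]/(B * x ^+ 0) expr0 mulr1 (ger0_norm B0) fB// (ltW x1) ltW.
Qed.

Let x2_le (x : R) : -1 <= x <= 0 -> `|x ^+ 2| <= 1.
Proof.
move=> /andP[x1 x2]; rewrite normrX exprn_ile1//.
by rewrite ler_norml x1 (le_trans x2).
Qed.

Let W_le n : exists2 B, 0 <= B & forall t, 0 <= t <= T -> N (W n t) <= B.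
Proof.
have [B B0 hB] := u_bound n; have [_ _ bd] := fam; have [B' hB'] := bd 0%N n.
have b'0 : 0 <= `|B'| by [].
exists ((`|B'| + B) * N1); first by rewrite mulr_ge0// addr_ge0.
move=> t tI; apply: N_le; first by rewrite addr_ge0.
move=> x xI; rewrite WE (le_trans (ler_normB _ _))// lerD//.
  rewrite -[vf _ _ _ _]/(v 0 n t x) vE//; apply: le_trans (ler_norm _).
  by apply: hB'; [exact/xA|exact/tA].
by rewrite normrM -[leRHS]mulr1; apply: ler_pM => //; [exact: hB|exact: x2_le].
Qed.

Let x_le (x : R) : -1 <= x <= 0 -> `|x ^+ 1| <= 1.
Proof. by move=> /andP[x1 x2]; rewrite expr1 ler_norml x1 (le_trans x2). Qed.

Let h t : L2 R := - derive_on `[0, T] (u 0) t *: L2expn 2 - (2 * a * u 0 t) *: L2expn 1.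

Let hE t : 0 <= t <= T -> h t = - u 1%N t *: L2expn 2 - (2 * a * u 0 t) *: L2expn 1.
Proof. by move=> tI; rewrite /h u_derive. Qed.

Variable S : R -> L2 R -> L2 R.
Hypothesis S_gen : semigroup_generated_by_A a S.

Let cS : contraction_semigroup S. Proof. by case: S_gen. Qed.

Let S_small (f : L2 R) e : 0 < e -> exists2 d, 0 < d & forall k, 0 <= k -> k < d -> N (S k f - f) <= e.
Proof.
move=> e0; have [_ _ _ _ /(_ f)] := cS; move=> /cvgrPdist_lt/(_ e e0).
rewrite /at_right/= /within/= => /nbhs_ballP[d /= d0 Hd]; exists d => // k.
rewrite le_eqVlt => /predU1P[<- _|k0 kd]; first by rewrite (sg_0 cS) ltW.
have : ball 0 d k by rewrite /ball/= sub0r normrN gtr0_norm.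
by move=> /Hd /(_ k0); rewrite sub0r normrN ger0_norm ?L2norm_ge0// => /ltW.
Qed.

(** Uniformity in s holds since [h s] stays in the span of x^2 and x with bounded coefficients:
    strong continuity at two vectors is enough. *)
Let h_small e : 0 < e -> exists2 d, 0 < d &
  forall s k, 0 <= s <= T -> 0 <= k -> k < d -> N (S k (h s) - h s) <= e.
Proof.
move=> e0; have [B1 B10 hB1] := u_bound 1; have [B0 B00 hB0] := u_bound 0.
pose B := 1 + B1 + 2 * a * B0.
have B2 : 0 <= 2 * a * B0 by rewrite !mulr_ge0.
have Bp : 0 < B by rewrite /B -addrA ltr_pwDl ?addr_ge0.
have e1 : 0 < e / (2 * B) by rewrite divr_gt0// mulr_gt0.
have [d1 d10 H1] := S_small (L2expn 2) e1.
have [d2 d20 H2] := S_small (L2expn 1) e1.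
exists (Num.min d1 d2); first by rewrite lt_min d10.
move=> s k sI k0; rewrite lt_min => /andP[kd1 kd2].
rewrite hE//.
set al := - u 1%N s; set be := - (2 * a * u 0 s).
have alB : `|al| <= B by rewrite normrN (le_trans (hB1 s sI))// /B [1 + B1]addrC -addrA lerDl addr_ge0.
have beB : `|be| <= B.
  rewrite normrN normrM ger0_norm ?mulr_ge0//.
  have h3 : 2 * a * `|u 0 s| <= 2 * a * B0 by rewrite ler_wpM2l ?mulr_ge0// hB0.
  by rewrite (le_trans h3)// /B lerDr addr_ge0.
have L1 := sg_linear cS al (L2expn 2) (be *: L2expn 1) k0.
have L2' := sg_linear cS be (L2expn 1) 0 k0.
have L3 := sg_linear cS (-1) 0 0 k0.
have S0 : N (S k 0) = 0.
  by apply/eqP; rewrite eq_le L2norm_ge0 andbT (le_trans (sg_contract cS 0 k0))// L2norm0.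
have -> : al *: L2expn 2 - (2 * a * u 0 s) *: L2expn 1 = al *: L2expn 2 + be *: L2expn 1.
  by apply: L2ext => x; rewrite !L2_funE /be; ring.
rewrite addr0 in L2'.
set P := S k (al *: L2expn 2 + be *: L2expn 1) in L1 *.
have -> : P - (al *: L2expn 2 + be *: L2expn 1) =
   (P - (al *: S k (L2expn 2) + S k (be *: L2expn 1))) +
   (S k (be *: L2expn 1) - (be *: S k (L2expn 1) + S k 0)) +
   (al *: (S k (L2expn 2) - L2expn 2) + be *: (S k (L2expn 1) - L2expn 1)) + S k 0.
  by apply: L2ext => x; rewrite !L2_funE; ring.
rewrite (le_trans (L2normD _ _))// S0 addr0 (le_trans (L2normD _ _))//.
rewrite (le_trans (lerD (L2normD _ _) (L2normD _ _)))// L1 L2' addr0 add0r !L2normZ.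
have q1 : `|al| * N (S k (L2expn 2) - L2expn 2) <= B * (e / (2 * B)).
  by apply: ler_pM => //; [exact: L2norm_ge0|exact: H1].
have q2 : `|be| * N (S k (L2expn 1) - L2expn 1) <= B * (e / (2 * B)).
  by apply: ler_pM => //; [exact: L2norm_ge0|exact: H2].
rewrite (le_trans (lerD q1 q2))//; have -> : B * (e / (2 * B)) + B * (e / (2 * B)) = e.
  by field; rewrite gt_eqF.
by [].
Qed.

Lemma classical_is_solution : is_solution S a T (u 0) 0 (D 0 0).
Proof.
split; first exact: control_C1.
exists (W 0); split; last first.
  move=> t /tA tI; apply: eqL2_of => x /andP[/ltW x1 /ltW x2].
  by rewrite WE addrC subrK -[vf _ _ _ _]/(v 0 0 t x) vE// x1.
have [_ ft bd] := fam; have [M1 hM1] := ft 0%N 0%N.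
have [M2 hM2] := u_fam 0; have [B3 hB3] := bd 0%N 2%N.
have [B1 B10 hB1] := W_le 1; have [U1 U10 hU1] := u_bound 1.
have [L0 L00 hL0] := u_lip 0; have [L1 L10 hL1] := u_lip 1.
have a20 : 0 <= 2 * a by rewrite mulr_ge0.
(* The four requirements on the single constant M: [p1] for the Taylor remainder of w, [B1] for its
   time derivative, [p3] for the image of the latter under A, [p4] for the Lipschitz constant of the
   source. *)
pose p1 := (`|M1| + `|M2|) * N1; pose p3 := (`|B3| + 2 * a * U1) * N1.
pose p4 := (L1 + 2 * a * L0) * N1.
have p10 : 0 <= p1 by rewrite mulr_ge0// addr_ge0.
have p30 : 0 <= p3 by rewrite mulr_ge0// addr_ge0// mulr_ge0.
have p40 : 0 <= p4 by rewrite mulr_ge0// addr_ge0// mulr_ge0.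
pose M := p1 + B1 + (p3 + p4).
have m1 : p1 <= M by rewrite /M -addrA lerDl !addr_ge0.
have m2 : B1 <= M by rewrite /M -addrA addrCA lerDl !addr_ge0.
have m3 : p3 <= M by rewrite /M addrCA lerDl !addr_ge0.
have m4 : p4 <= M by rewrite /M addrA lerDr !addr_ge0.
have M0 : 0 <= M := le_trans p10 m1.
apply: (@mild_solution_of _ _ cS T M (W 0) (W 1)
  (fun s => v 0 2 s + (2 * a * u 1 s) *: L2expn 1)) => //.
- move=> s sI; apply: (S_gen.2 _ _).2.
  have -> : W 1 s - h s = v 0 1 s + (2 * a * u 0 s) *: L2expn 1.
    by apply: L2ext => x; rewrite hE// /W !L2_funE; ring.
  exact: W_graph.
- by move=> s sI; apply: (S_gen.2 _ _).2; exact: W_graph.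
- move=> s s' s0 ss sT.
  have sI : 0 <= s <= T by rewrite s0 (le_trans ss).
  have sI' : 0 <= s' <= T by rewrite (le_trans s0).
  have d20 : 0 <= (s' - s) ^+ 2 by rewrite sqr_ge0.
  apply: (@le_trans _ _ ((`|M1| + `|M2|) * (s' - s) ^+ 2 * N1)).
    apply: N_le => [|x xI]; first by rewrite mulr_ge0// addr_ge0.
    have -> : (W 0 s' - W 0 s - (s' - s) *: W 1 s) x =
        D 0 0 x s' - u 0 s' * x ^+ 2 - (D 0 0 x s - u 0 s * x ^+ 2) -
        (s' - s) * (D 0 1 x s - u 1 s * x ^+ 2).
      by rewrite -(vE 0 0 sI' xI) -(vE 0 0 sI xI) -(vE 0 1 sI xI).
    rewrite [leRHS]mulrDl.
    have q1 := hM1 x (proj2 (xA x) xI) s s' (proj2 (tA s) sI) (proj2 (tA s') sI').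
    have q2 := hM2 s s' (proj2 (tA s) sI) (proj2 (tA s') sI').
    have -> : D 0 0 x s' - u 0 s' * x ^+ 2 - (D 0 0 x s - u 0 s * x ^+ 2) -
        (s' - s) * (D 0 1 x s - u 1 s * x ^+ 2) =
      (D 0 0 x s' - D 0 0 x s - (s' - s) * D 0 1 x s) -
      (u 0 s' - u 0 s - (s' - s) * u 1 s) * x ^+ 2 by ring.
    rewrite (le_trans (ler_normB _ _))// lerD//.
      by rewrite (le_trans q1)// ler_wpM2r// ler_norm.
    rewrite normrM -[leRHS]mulr1; apply: ler_pM => //; last exact: x2_le.
    by rewrite (le_trans q2)// ler_wpM2r// ler_norm.
  by rewrite mulrAC ler_wpM2r.
- by move=> s sI; apply: le_trans (hB1 s sI) m2.
- move=> s sI; apply: le_trans m3; apply: N_le; first by rewrite addr_ge0// mulr_ge0.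
  move=> x xI; rewrite !L2_funE vE// (le_trans (ler_normD _ _))// lerD//.
    by apply: le_trans (ler_norm _); apply: hB3; [exact/xA|exact/tA].
  rewrite normrM -[leRHS]mulr1; apply: ler_pM => //; last exact: x_le.
  by rewrite normrM (ger0_norm a20) ler_wpM2l// hU1.
- move=> s s' s0 ss sT.
  have sI : 0 <= s <= T by rewrite s0 (le_trans ss).
  have sI' : 0 <= s' <= T by rewrite (le_trans s0).
  apply: (@le_trans _ _ ((L1 + 2 * a * L0) * (s' - s) * N1)); last first.
    by rewrite mulrAC ler_wpM2r ?subr_ge0.
  have d0 : 0 <= s' - s by rewrite subr_ge0.
  apply: N_le => [|x xI]; first by rewrite mulr_ge0// addr_ge0// mulr_ge0.
  rewrite -[X in `|X|]/((h s - h s') x) !hE// !L2_funE -![L2expn _ x]/(x ^+ _).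
  have -> : - u 1 s * x ^+ 2 - 2 * a * u 0 s * x ^+ 1 - (- u 1 s' * x ^+ 2 - 2 * a * u 0 s' * x ^+ 1) =
    (u 1 s' - u 1 s) * x ^+ 2 + 2 * a * (u 0 s' - u 0 s) * x ^+ 1 by ring.
  have l1 := hL1 s s' sI sI'; have l0 := hL0 s s' sI sI'.
  rewrite (ger0_norm d0) in l1 l0.
  rewrite [leRHS]mulrDl (le_trans (ler_normD _ _))// lerD//.
    by rewrite normrM -[leRHS]mulr1; apply: ler_pM => //; exact: x2_le.
  rewrite normrM -[leRHS]mulr1; apply: ler_pM => //; last exact: x_le.
  by rewrite normrM (ger0_norm a20) -[leRHS]mulrA ler_wpM2l.
- exact: ltW.
- have -> : W 0 0 - (0 - u 0 0 *: L2expn 2) = 0; last exact: L2norm0.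
  have v0 : v 0 0 0 = 0.
    apply: L2ext => x; rewrite -[LHS]/(vf 0 0 0 x) L2_funE.
    by rewrite /vf [clip 0 T 0]clip_id ?lexx ?ltW// ic.
  by rewrite /W v0 subrr.
Qed.

End classical_solution.

Local Notation cN := ComplexField.Normc.normc.
Local Notation Re := complex.Re.
Local Notation Im := complex.Im.
Local Open Scope complex_scope.

(** * Taylor expansion of holomorphic functions *)

Section complex_norm.
Context {R : realType}.
Implicit Types (z w : R[i]).

Lemma cN_ge0 z : 0 <= cN z. Proof. by case: z => a b; exact: sqrtr_ge0. Qed.

Lemma cN_normE z : `|z| = (cN z)%:C.
Proof. by case: z. Qed.

Lemma cND z w : cN (z + w) <= cN z + cN w.
Proof. by rewrite -lecR rmorphD/= -!cN_normE ler_normD. Qed.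

Lemma cNN z : cN (- z) = cN z.
Proof. by apply: complexI; rewrite -!cN_normE normrN. Qed.

Lemma cNB z w : cN (z - w) <= cN z + cN w.
Proof. by rewrite -(cNN w) cND. Qed.

Lemma cNM z w : cN (z * w) = cN z * cN w. Proof. exact: ComplexField.Normc.normcM. Qed.

Lemma cNX z n : cN (z ^+ n) = cN z ^+ n.
Proof. by elim: n => [|n IH]; rewrite ?expr0 ?ComplexField.Normc.normc1// !exprS cNM IH. Qed.

Lemma cNV z : cN z^-1 = (cN z)^-1. Proof. exact: ComplexField.Normc.normcV. Qed.

Lemma cN0 : cN (0 : R[i]) = 0. Proof. exact: ComplexField.Normc.normc0. Qed.

Lemma cN_eq0 z : (cN z == 0) = (z == 0).
Proof. by apply/eqP/eqP => [/ComplexField.Normc.eq0_normc|->]; rewrite ?cN0. Qed.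

Lemma cN_gt0 z : (0 < cN z) = (z != 0).
Proof. by rewrite lt_def cN_ge0 andbT cN_eq0. Qed.

Lemma cN_real (x : R) : cN x%:C = `|x|.
Proof. by rewrite /= expr0n/= addr0 sqrtr_sqr. Qed.

Lemma Re_le_cN z : `|Re z| <= cN z.
Proof.
by case: z => a b /=; rewrite -sqrtr_sqr ler_wsqrtr// lerDl sqr_ge0.
Qed.

Lemma Im_le_cN z : `|Im z| <= cN z.
Proof.
by case: z => a b /=; rewrite -sqrtr_sqr ler_wsqrtr// lerDr sqr_ge0.
Qed.

Lemma cN_le_ReIm z : cN z <= `|Re z| + `|Im z|.
Proof.
rewrite {1}[z]complexE (le_trans (cND _ _))// cNM !cN_real.
have -> : cN ('i : R[i]) = 1 by rewrite /= expr0n/= add0r expr1n sqrtr1.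
by rewrite mul1r.
Qed.

Lemma ReD z w : Re (z + w) = Re z + Re w. Proof. by case: z; case: w. Qed.
Lemma ImD z w : Im (z + w) = Im z + Im w. Proof. by case: z; case: w. Qed.
Lemma ReN z : Re (- z) = - Re z. Proof. by case: z. Qed.
Lemma ImN z : Im (- z) = - Im z. Proof. by case: z. Qed.
Lemma ReB z w : Re (z - w) = Re z - Re w. Proof. by rewrite ReD ReN. Qed.
Lemma ImB z w : Im (z - w) = Im z - Im w. Proof. by rewrite ImD ImN. Qed.
Lemma ReM z w : Re (z * w) = Re z * Re w - Im z * Im w. Proof. by case: z; case: w. Qed.
Lemma ImM z w : Im (z * w) = Re z * Im w + Im z * Re w.
Proof. by case: z => a b; case: w => c d. Qed.

Lemma C_derivable_cst (c z : R[i]) : derivable ((fun=> c) : R[i]^o -> R[i]^o) z (1 : R[i]^o).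
Proof.
have h : derivable (cst (c : R[i]^o) : R[i]^o -> R[i]^o) (z : R[i]^o) (1 : R[i]^o).
  exact: derivable_cst.
exact: h.
Qed.

Lemma C_derivable_idB (c z : R[i]) :
  derivable ((fun z => z - c) : R[i]^o -> R[i]^o) z (1 : R[i]^o).
Proof.
exact: (@derivableB _ _ _ (id : R[i]^o -> R[i]^o) (cst (c : R[i]^o)) z 1 (@derivable_id _ _ _ _) (@derivable_cst _ _ _ _ _ _)).
Qed.

Lemma C_derivableM (f g : R[i] -> R[i]) (z : R[i]) :
  derivable (f : R[i]^o -> R[i]^o) z (1 : R[i]^o) ->
  derivable (g : R[i]^o -> R[i]^o) z (1 : R[i]^o) ->
  derivable ((fun z => f z * g z) : R[i]^o -> R[i]^o) z (1 : R[i]^o).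
Proof.
move=> df dg.
exact: (@derivableM _ (R[i]^o : normedModType R[i]) f g z 1 df dg).
Qed.

Lemma C_derivableV (f : R[i] -> R[i]) (z : R[i]) : f z != 0 ->
  derivable (f : R[i]^o -> R[i]^o) z (1 : R[i]^o) ->
  derivable ((fun z => (f z)^-1) : R[i]^o -> R[i]^o) z (1 : R[i]^o).
Proof.
move=> fz df.
exact: (@derivableV _ (R[i]^o : normedModType R[i]) f z 1 fz df).
Qed.

Lemma C_derivableB_cst (f : R[i] -> R[i]) (c z : R[i]) :
  derivable (f : R[i]^o -> R[i]^o) z (1 : R[i]^o) ->
  derivable ((fun z => f z - c) : R[i]^o -> R[i]^o) z (1 : R[i]^o).
Proof.
move=> df.
exact: (@derivableB _ _ _ (f : R[i]^o -> R[i]^o) (cst (c : R[i]^o)) z 1 df (@derivable_cst _ _ _ _ _ _)).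
Qed.

Lemma C_derivableX (f : R[i] -> R[i]) (n : nat) (z : R[i]) :
  derivable (f : R[i]^o -> R[i]^o) z (1 : R[i]^o) ->
  derivable ((fun z => f z ^+ n) : R[i]^o -> R[i]^o) z (1 : R[i]^o).
Proof.
move=> df; elim: n => [|n IH].
  rewrite (_ : (fun z => f z ^+ 0) = fun=> 1); first exact: C_derivable_cst.
  by apply/funext => w; rewrite expr0.
under eq_fun do rewrite exprS; exact: C_derivableM.
Qed.

Lemma C_derivable_id (z : R[i]) : derivable (id : R[i]^o -> R[i]^o) z (1 : R[i]^o).
Proof. exact: derivable_id. Qed.

(** The exponential of x + i y. In these logarithmic polar coordinates circles around 0 are segments
    x = constant, and annuli are rectangles, as Goursat's lemma requires. *)
Definition cexp (x y : R) : R[i] := (expR x * cos y) +i* (expR x * sin y).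

Lemma cexpD x y x' y' : cexp (x + x') (y + y') = cexp x y * cexp x' y'.
Proof.
rewrite /cexp expRD cosD sinD; apply/eqP; rewrite eq_complex/=.
by apply/andP; split; apply/eqP; ring.
Qed.

Lemma cexp0 : cexp 0 0 = 1.
Proof. by rewrite /cexp expR0 cos0 sin0 mulr1 mulr0. Qed.

Lemma cexpX x y n : cexp x y ^+ n = cexp (n%:R * x) (n%:R * y).
Proof.
elim: n => [|n IH]; first by rewrite expr0 !mul0r cexp0.
by rewrite exprS IH -cexpD -[n.+1]addn1 natrD; congr cexp; ring.
Qed.

Lemma cexpV x y : (cexp x y)^-1 = cexp (- x) (- y).
Proof.
apply: (mulfI (x := cexp x y)).
  by apply/eqP => h; have := cexpD x y (- x) (- y); rewrite h mul0r !subrr cexp0 => /eqP; rewrite oner_eq0.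
rewrite mulfV -?cexpD ?subrr ?cexp0//.
by apply/eqP => h; have := cexpD x y (- x) (- y); rewrite h mul0r !subrr cexp0 => /eqP; rewrite oner_eq0.
Qed.

Lemma cN_cexp x y : cN (cexp x y) = expR x.
Proof.
rewrite /= !exprMn -mulrDr cos2Dsin2 mulr1 sqrtr_sqr ger0_norm// expR_ge0.
Qed.

Lemma cexp_neq0 x y : cexp x y != 0.
Proof. by rewrite -cN_gt0 cN_cexp expR_gt0. Qed.

Lemma derivable_eps (g : R[i] -> R[i]) z :
  derivable (g : R[i]^o -> R[i]^o) z (1 : R[i]^o) ->
  exists l : R[i], forall e : R, 0 < e -> exists2 dl : R, 0 < dl &
    forall h, cN h < dl -> cN (g (z + h) - g z - l * h) <= e * cN h.
Proof.
move=> /cvg_ex[l /= gl]; exists l => e e0.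
move/cvgrPdist_le : gl => /(_ e%:C).
rewrite ltcR => /(_ e0).
rewrite /within/= => /nbhs_ballP[dl /= dl0 H].
have [d Ed] : exists d, dl = d%:C.
  by exists (Re dl); move: dl0; rewrite ltcE/= => /andP[/eqP]; case: dl {H} => a b /= -> _.
subst dl; rewrite ltcR in dl0; exists d => // h hd.
have [->|h0] := eqVneq h 0; first by rewrite addr0 subrr mulr0 subr0 cN0 mulr0.
have := H h; rewrite /ball/= sub0r normrN cN_normE ltcR => /(_ hd h0).
rewrite /GRing.scale/= mulr1 cN_normE lecR => le.
have -> : g (z + h) - g z - l * h = - h * (l - h^-1 * (g (h + z) - g z)).
  by rewrite [z + h]addrC; field.
by rewrite cNM cNN mulrC ler_wpM2r// cN_ge0.
Qed.

Lemma cexp_approx : exists2 K : R, 0 < K & forall u v : R, `|u| <= 1 -> `|v| <= 1 ->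
  cN (cexp u v - 1 - (u +i* v)) <= K * (`|u| + `|v|) ^+ 2.
Proof.
pose e := expR (1 : R); have e0 : 0 < e by exact: expR_gt0.
have I0 : `[-1, 1]%classic (0 : R) by rewrite /= in_itv/= lerN10 ler01.
have I1 (x : R) : `|x| <= 1 -> `[-1, 1]%classic x by rewrite /= in_itv/= ler_norml.
have qe : quad `[-1, 1] (@expR R) (@expR R) e.
  apply: deriv_quad => // x; rewrite /= in_itv/= => /andP[_ x1].
  by rewrite ger0_norm ?expR_ge0// ler_expR.
have qc : quad `[-1, 1] (@cos R) (fun x => - sin x) 1.
  apply: (@deriv_quad _ _ _ _ _ (fun x => - cos x)) => x _.
  by rewrite normrN ler_norml cos_geN1 cos_le1.
have qs : quad `[-1, 1] (@sin R) cos 1.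
  apply: (@deriv_quad _ _ _ _ _ (fun x => - sin x)) => x _.
  by rewrite normrN ler_norml sin_geN1 sin_le1.
exists (3 * e + 3); first by rewrite addr_gt0// mulr_gt0.
move=> u v u1 v1.
have := qe 0 u I0 (I1 _ u1); rewrite expR0 subr0 mulr1 -(real_normK (num_real u)) => Hu.
have := qc 0 v I0 (I1 _ v1); rewrite cos0 sin0 !oppr0 !addr0 mulr0 subr0 mul1r -(real_normK (num_real v)) => Hc.
have := qs 0 v I0 (I1 _ v1); rewrite sin0 cos0 mulr1 !subr0 mul1r -(real_normK (num_real v)) => Hs.
have eu : expR u <= e by rewrite ler_expR (le_trans (ler_norm _)).
have eu0 := expR_ge0 u.
rewrite (le_trans (cN_le_ReIm _))// /cexp /=.
have -> : expR u * cos v - 1 - u = (expR u - 1 - u) + expR u * (cos v - 1) by ring.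
have -> : expR u * sin v - 0 - v = (expR u - 1) * sin v + (sin v - v) by ring.
have h1 : `|expR u * (cos v - 1)| <= e * `|v| ^+ 2.
  by rewrite normrM ger0_norm// ler_pM.
have u0 := normr_ge0 u; have v0 := normr_ge0 v.
have h2 : `|expR u - 1| <= (1 + e) * `|u|.
  have -> : expR u - 1 = (expR u - 1 - u) + u by ring.
  rewrite (le_trans (ler_normD _ _))// (mulrDl 1 e) mul1r addrC lerD//.
  by rewrite (le_trans Hu)// expr2 mulrA ler_piMr// mulr_ge0// ltW.
have h3 : `|sin v| <= 2 * `|v|.
  have -> : sin v = (sin v - v) + v by ring.
  rewrite (le_trans (ler_normD _ _))// mulr2n mulrDl mul1r lerD//.
  by rewrite (le_trans Hs)// expr2 ler_piMr.
have h4 : `|(expR u - 1) * sin v| <= (1 + e) * `|u| * (2 * `|v|).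
  by rewrite normrM ler_pM.
rewrite (le_trans (lerD (ler_normD _ _) (ler_normD _ _)))//.
apply: (@le_trans _ _ ((e * `|u| ^+ 2 + e * `|v| ^+ 2) +
   ((1 + e) * `|u| * (2 * `|v|) + `|v| ^+ 2))).
  by rewrite !lerD.
rewrite -subr_ge0.
have -> : (3 * e + 3) * (`|u| + `|v|) ^+ 2 - (e * `|u| ^+ 2 + e * `|v| ^+ 2 +
    ((1 + e) * `|u| * (2 * `|v|) + `|v| ^+ 2)) =
  (2 * e + 3) * `|u| ^+ 2 + (2 * e + 2) * `|v| ^+ 2 + (4 * e + 4) * (`|u| * `|v|) by ring.
by rewrite !addr_ge0// mulr_ge0// ?addr_ge0// ?mulr_ge0// ltW.
Qed.

End complex_norm.

(** * Cauchy-Riemann equations in logarithmic polar coordinates *)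

Section polar.
Context {R : realType}.
Variable g : R[i] -> R[i].

Definition polRe (x y : R) : R := Re (g (cexp x y)).
Definition polIm (x y : R) : R := Im (g (cexp x y)).

(** The form polIm dx + polRe dy is the imaginary part of g(z) dz / z with z = exp(x + i y). If L is
    the derivative of g o exp, the partial derivatives are those of L and i L, whence the common
    cross term Re L. *)
Lemma polar_closed_at (a b c d x y : R) :
  derivable (g : R[i]^o -> R[i]^o) (cexp x y) (1 : R[i]^o) ->
  closed_at polIm polRe a b c d x y.
Proof.
move=> /derivable_eps[l H]; have [K K0 HK] := @cexp_approx R.
set z := cexp x y in H *; pose L := l * z.
exists (Im L), (Re L), (- Im L) => e e0.
pose N := (1 + cN z * (1 + 2 * K)) * 2.
have Nz : 0 <= cN z * (1 + 2 * K) by rewrite mulr_ge0 ?cN_ge0// addr_ge0// mulr_ge0// ltW.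
have N0 : 0 < N by rewrite mulr_gt0// ltr_pwDl.
have [dl dl0 Hd] := H (e / N) ltac:(by rewrite divr_gt0).
pose N' := 2 * (1 + cN L * K) * 2.
have LK : 0 <= cN L * K by rewrite mulr_ge0 ?cN_ge0// ltW.
have N'0 : 0 < N' by rewrite !mulr_gt0// ltr_pwDl.
exists (Num.min (2^-1) (Num.min (dl / N) (e / N'))).
  by rewrite !lt_min invr_gt0 ltr0n !divr_gt0.
move=> x' y' _ _; rewrite !lt_min => /andP[x1 /andP[x2 x3]] /andP[y1 /andP[y2 y3]].
set u := x' - x in x1 x2 x3 *; set v := y' - y in y1 y2 y3 *; set S := `|u| + `|v|.
have S0 : 0 <= S by rewrite addr_ge0.
have S1 : S <= 1 by rewrite /S; lra.
have half1 : 2^-1 <= 1 :> R by rewrite invf_le1// ler1n.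
have HE := HK u v (le_trans (ltW x1) half1) (le_trans (ltW y1) half1).
set E := cexp u v - 1 - (u +i* v) in HE.
have zE : cexp x' y' = z + z * (cexp u v - 1).
  by rewrite mulrBr mulr1 addrC subrK -cexpD /u /v; congr cexp; ring.
have kE : cexp u v - 1 = (u +i* v) + E by rewrite /E [RHS]addrC subrK.
have nk : cN (cexp u v - 1) <= (1 + 2 * K) * S.
  rewrite kE (le_trans (cND _ _))// mulrDl mul1r lerD//.
    exact: (cN_le_ReIm (u +i* v)).
  rewrite (le_trans HE)// expr2 mulrA -/S ler_wpM2r//.
  rewrite (@le_trans _ _ (K * 1)) ?ler_wpM2l ?(ltW K0)// mulr1.
  by rewrite ler_peMl ?(ltW K0)// ler1n.
have hdl : cN (z * (cexp u v - 1)) <= N / 2 * S.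
  rewrite cNM (le_trans (ler_wpM2l (cN_ge0 z) nk))// mulrA ler_wpM2r//.
  by rewrite /N mulfK// lerDr.
have SN : S < 2 * (dl / N) by rewrite /S mulr2n mulrDl mul1r ltrD.
have hdl' : cN (z * (cexp u v - 1)) < dl.
  rewrite (le_lt_trans hdl)// -mulrA.
  have -> : dl = N * (2^-1 * (2 * (dl / N))) by field; rewrite gt_eqF.
  by rewrite ltr_pM2l// ltr_pM2l.
have := Hd _ hdl'; rewrite -zE; set D := g _ - g z - _ => HD.
have HD' : cN D <= e / 2 * S.
  rewrite (le_trans HD)//.
  have -> : e / 2 * S = e / N * (N / 2 * S) by field; rewrite gt_eqF.
  by rewrite ler_wpM2l// divr_ge0// ltW.
have HE' : cN (L * E) <= e / 2 * S.
  rewrite cNM (le_trans (ler_wpM2l (cN_ge0 L) HE))// -/S expr2 !mulrA ler_wpM2r//.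
  have SN' : S <= 2 * (e / N') by rewrite /S mulr2n mulrDl mul1r lerD// ltW.
  rewrite (le_trans (ler_wpM2l LK SN'))//.
  have -> : cN L * K * (2 * (e / N')) = e / 2 * (cN L * K * 4 / N') by field; rewrite gt_eqF.
  rewrite ler_piMr ?divr_ge0 ?(ltW e0)// ler_pdivrMr// mul1r /N'.
  by clear; move: (cN L * K) => t; lra.
have DE : g (cexp x' y') - g z - L * (u +i* v) = D + L * E.
  by rewrite /D /L kE; ring.
have Htot : cN (g (cexp x' y') - g z - L * (u +i* v)) <= e * S.
  rewrite DE (le_trans (cND _ _))// [e]splitr mulrDl lerD//.
split.
  rewrite (le_trans _ Htot)// (le_trans _ (Im_le_cN _))// le_eqVlt; apply/orP; left.
  apply/eqP; congr `|_|.
  rewrite ImB ImB [Im (L * _)]ImM [Re (u +i* v)]/= [Im (u +i* v)]/= /polIm -/z; ring.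
rewrite (le_trans _ Htot)// (le_trans _ (Re_le_cN _))// le_eqVlt; apply/orP; left.
apply/eqP; congr `|_|.
rewrite ReB ReB [Re (L * _)]ReM [Re (u +i* v)]/= [Im (u +i* v)]/= /polRe -/z; ring.
Qed.

End polar.

Local Notation C_derivable g z :=
  (derivable (g : _[i]^o -> _[i]^o) (z : _[i]^o) (1 : _[i]^o)).

(** * Mean values on circles and Cauchy's formula at negative points *)

Section holomorphic.
Context {R : realType}.

Lemma Re_realM (c : R) (z : R[i]) : Re (c%:C * z) = c * Re z.
Proof. by rewrite ReM /= mul0r subr0. Qed.

Lemma dist_chain (a b c d X Y : R) :
  a = b -> c = d -> `|b - c| <= X -> `|d| <= Y -> `|a| <= X + Y.
Proof. by move=> -> <- X1 Y1; rewrite -(subrK c b) (le_trans (ler_normD _ _))// lerD. Qed.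

Lemma mul_le_div (N e h : R) : 0 <= N -> 0 < e -> h <= e / (N + 1) -> N * h <= e.
Proof.
move=> N0 e0 hN; have N1 : 0 < N + 1 by rewrite ltr_wpDl.
rewrite (le_trans (ler_wpM2l N0 hN))// mulrA ler_pdivrMr// mulrC ler_wpM2l ?(ltW e0)//.
by rewrite lerDl.
Qed.

(** Differentiability gives a bound near each point of the open disc; near a point with |z| >= r,
    small rectangles miss the closed disc of radius rho and the claim is void. [rect_induction]
    glues these. *)
Lemma hol_bounded (f : R[i] -> R[i]) (r rho : R) : rho < r ->
  (forall z, cN z < r -> C_derivable f z) ->
  exists2 B, 0 <= B & forall z, cN z <= rho -> cN (f z) <= B.
Proof.
move=> rhor df.
have : exists B, forall x y, - `|rho| <= x <= `|rho| -> - `|rho| <= y <= `|rho| ->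
    cN (x +i* y) <= rho -> cN (f (x +i* y)) <= B.
  have rr : - `|rho| <= `|rho| by rewrite lerNl (le_trans _ (normr_ge0 _))// oppr_le0.
  apply: (@rect_induction R (fun a b c d => exists B, forall x y, a <= x <= b ->
    c <= y <= d -> cN (x +i* y) <= rho -> cN (f (x +i* y)) <= B)) => //.
    move=> a b c d [B1 H1] [B2 H2] [B3 H3] [B4 H4].
    exists (Num.max (Num.max B1 B2) (Num.max B3 B4)) => x y /andP[ax xb] /andP[cy yd] zr.
    rewrite !le_max; have [xm|xm] := leP x ((a + b) / 2); have [ym|ym] := leP y ((c + d) / 2).
    - by rewrite H1// ?ax ?cy.
    - by rewrite (H3 x y)// ?ax ?(ltW ym)// !orbT.
    - by rewrite (H2 x y)// ?cy ?(ltW xm)// !orbT.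
    - by rewrite (H4 x y)// ?(ltW ym) ?(ltW xm)// !orbT.
  move=> x y xI yI; set z := x +i* y.
  have near_z a' b' c' d' e x' y' : a' <= x <= b' -> c' <= y <= d' -> b' - a' < e / 2 -> d' - c' < e / 2 ->
      a' <= x' <= b' -> c' <= y' <= d' -> cN ((x' +i* y') - z) < e.
    move=> xI' yI' b'a' d'c' x'I y'I; rewrite (le_lt_trans (cN_le_ReIm _))//=.
    by rewrite (splitr e) ltrD//; [apply: le_lt_trans b'a'|apply: le_lt_trans d'c']; exact: itv_dist.
  have [zr|zr] := ltP (cN z) r.
    have [l /(_ 1 ltr01)[dl dl0 H]] := derivable_eps (df _ zr).
    exists (dl / 2); first by rewrite divr_gt0.
    move=> a' b' c' d' /andP[_ ax] /andP[xb _] /andP[_ cy] /andP[yd _] w h.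
    exists (cN (f z) + (cN l + 1) * dl) => x' y' x'I y'I _.
    have xI' : a' <= x <= b' by rewrite ax.
    have yI' : c' <= y <= d' by rewrite cy.
    have hd := near_z _ _ _ _ dl _ _ xI' yI' w h x'I y'I.
    have := H _ hd; rewrite mul1r addrCA subrr addr0 => le.
    set D := _ - z in hd le.
    have -> : f (x' +i* y') = f z + ((f (x' +i* y') - f z - l * D) + l * D) by ring.
    rewrite (le_trans (cND _ _))// lerD2l (le_trans (cND _ _))// cNM mulrDl mul1r addrC.
    by rewrite lerD ?ler_wpM2l ?cN_ge0 ?(ltW hd)// (le_trans le)// ltW.
  have e0 : 0 < r - rho by rewrite subr_gt0.
  exists ((r - rho) / 2); first by rewrite divr_gt0.
  move=> a' b' c' d' /andP[_ ax] /andP[xb _] /andP[_ cy] /andP[yd _] w h.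
  exists 0 => x' y' x'I y'I z'r.
  have xI' : a' <= x <= b' by rewrite ax.
  have yI' : c' <= y <= d' by rewrite cy.
  have hd := near_z _ _ _ _ (r - rho) _ _ xI' yI' w h x'I y'I.
  have : cN z <= cN (x' +i* y') + cN (x' +i* y' - z).
    rewrite -(cNN (_ - z)) (le_trans _ (cND _ _))//.
    by rewrite opprB addrCA subrr addr0.
  by move=> h1; exfalso; move: hd zr z'r h1; lra.
move=> [B H]; exists `|B| => // z zr.
have rho0 : 0 <= rho by rewrite (le_trans (cN_ge0 z)).
have zE : z = Re z +i* Im z by case: z {zr}.
rewrite zE (le_trans _ (ler_norm B))// H -?zE//; rewrite -ler_norml (ger0_norm rho0).
  by rewrite (le_trans (Re_le_cN _)).
by rewrite (le_trans (Im_le_cN _)).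
Qed.

Lemma polRe_cts (g : R[i] -> R[i]) (x a b : R) :
  (forall y, a <= y <= b -> C_derivable g (cexp x y)) ->
  {within `[a, b], continuous (polRe g x)}.
Proof.
move=> dg; apply: (@closed_ctsQ R (polIm g) (polRe g) x x a b); last by rewrite lexx.
move=> x' y; rewrite -eq_le => /eqP <- yI; apply: polar_closed_at; exact: dg.
Qed.

Lemma within_cstM (A : set R) (g : R -> R) (c : R) : {within A, continuous g} ->
  {within A, continuous (fun x => c * g x)}.
Proof. by move=> cg x; have := cvgMr (cg x); exact. Qed.

Lemma cexp_pi (x : R) : cexp x (- pi) = cexp x pi.
Proof. by rewrite /cexp cosN sinN sinpi oppr0. Qed.

Lemma polar_circ (g : R[i] -> R[i]) (s1 s2 c d : R) : s1 <= s2 -> c <= d ->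
  (forall s y, s1 <= s <= s2 -> c <= y <= d -> C_derivable g (cexp s y)) ->
  Int c d (fun y => polRe g s2 y - polRe g s1 y) =
  - Int s1 s2 (fun s => polIm g s c - polIm g s d).
Proof.
move=> s12 cd dg.
have := @goursat R (polIm g) (polRe g) s1 s2 c d (fun s y sI yI => polar_closed_at _ _ _ _ (dg s y sI yI)) s12 cd.
by rewrite /circ => /eqP; rewrite addrC addr_eq0 => /eqP.
Qed.

Lemma pi_sym : - pi <= pi :> R.
Proof. by rewrite lerNl (le_trans _ (pi_ge0 R))// oppr_le0 pi_ge0. Qed.

(** The sides at angles - pi and pi of the rectangle cancel by periodicity. *)
Lemma polar_const (g : R[i] -> R[i]) (s1 s2 : R) : s1 <= s2 ->
  (forall s y, s1 <= s <= s2 -> - pi <= y <= pi -> C_derivable g (cexp s y)) ->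
  Int (- pi) pi (polRe g s2) = Int (- pi) pi (polRe g s1).
Proof.
move=> s12 dg; apply/eqP; rewrite -subr_eq0 -IntB; last 2 first.
- by apply: polRe_cts => y yI; apply: dg; rewrite ?s12 ?lexx.
- by apply: polRe_cts => y yI; apply: dg; rewrite ?s12 ?lexx.
rewrite (polar_circ s12 pi_sym dg) oppr_eq0; apply/eqP.
rewrite (@eq_Int _ _ _ _ (fun=> 0)); first by rewrite Int_cst// mul0r.
by move=> s _; rewrite /polIm cexp_pi subrr.
Qed.

Section cauchy.
Variables (f : R[i] -> R[i]) (r rho x : R).
Hypotheses (df : forall z, cN z < r -> C_derivable f z).
Hypotheses (rhor : rho < r) (x0 : x < 0) (xrho : - x < rho).

(* [hh] is bounded near [x], so its mean over the circle |z| = exp s does not jump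
   when s crosses [ell], and Cauchy's formula at [x] follows. *)
Let hh z := z * (f z - f x%:C) / (z - x%:C).

Let nx : cN (x%:C : R[i]) = - x. Proof. by rewrite cN_real ltr0_norm. Qed.

Let hh_derivable z : cN z < r -> z != x%:C -> C_derivable hh z.
Proof.
move=> zr zx; apply: C_derivableM; last first.
  by apply: C_derivableV; [rewrite subr_eq0|exact: C_derivable_idB].
apply: C_derivableM; first exact: C_derivable_id.
by apply: C_derivableB_cst; exact: df.
Qed.

Let hh_bounded : exists2 M, 0 <= M & forall z, cN z <= rho -> z != x%:C -> cN (hh z) <= M.
Proof.
have [B B0 HB] := hol_bounded rhor df.
have [l /(_ 1 ltr01)[dl dl0 H]] := derivable_eps (df (z := x%:C) ltac:(by rewrite nx (lt_trans xrho))).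
have rho0 : 0 <= rho by rewrite (le_trans _ (ltW xrho))// oppr_ge0 ltW.
exists (rho * (cN l + 1) + rho * (2 * B) / dl).
  by rewrite addr_ge0// ?divr_ge0 ?mulr_ge0 ?addr_ge0 ?cN_ge0// ltW.
move=> z zr zx.
have zx0 : 0 < cN (z - x%:C) by rewrite cN_gt0 subr_eq0.
rewrite /hh cNM cNV cNM; have [zd|zd] := ltP (cN (z - x%:C)) dl.
  apply: (@le_trans _ _ (rho * (cN l + 1))); last first.
    by rewrite lerDl ?divr_ge0 ?mulr_ge0 ?(ltW dl0).
  rewrite -mulrA ler_pM ?cN_ge0 ?divr_ge0 ?cN_ge0// ler_pdivrMr//.
  have := H _ zd; rewrite mul1r addrCA subrr addr0; set D := z - _ => le.
  have -> : f z - f x%:C = (f z - f x%:C - l * D) + l * D by rewrite subrK.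
  by rewrite (le_trans (cND _ _))// cNM mulrDl mul1r addrC lerD2l.
apply: (@le_trans _ _ (rho * (2 * B) / dl)); last first.
  by rewrite lerDr mulr_ge0// addr_ge0// cN_ge0.
apply: ler_pM; rewrite ?mulr_ge0 ?invr_ge0 ?cN_ge0//; last by rewrite lef_pV2.
apply: ler_pM; rewrite ?cN_ge0//.
rewrite (le_trans (cNB _ _))// mulr2n mulrDl mul1r lerD ?HB// nx; exact: ltW.
Qed.

Let ell := ln (- x).
Let ellE : expR ell = - x. Proof. by rewrite lnK// posrE oppr_gt0. Qed.
Let lr := ln rho.
Let rho0 : 0 < rho. Proof. by rewrite (le_lt_trans _ xrho)// oppr_ge0 ltW. Qed.
Let lrE : expR lr = rho. Proof. by rewrite lnK// posrE. Qed.

Let le_lr s : s <= lr -> expR s <= rho. Proof. by rewrite -lrE ler_expR. Qed.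

Let neq_of_ell s y : s != ell -> cexp s y != x%:C.
Proof.
apply: contra_neq => /(congr1 (fun z => cN z)); rewrite cN_cexp nx -ellE.
exact: expR_inj.
Qed.

Let neq_of_angle s y : - pi < y < pi -> cexp s y != x%:C.
Proof.
move=> /andP[y1 y2]; apply/eqP => -[E1 E2].
have s0 := expR_gt0 s.
have sy : sin y = 0 by apply/eqP; move/eqP: E2; rewrite mulf_eq0 gt_eqF.
have [y0|y0|y0] := ltgtP y 0.
- have : 0 < sin (- y) by apply: sin_gt0_pi; rewrite oppr_gt0 y0/= ltrNl.
  by rewrite sinN sy oppr0 ltxx.
- by have := @sin_gt0_pi R y; rewrite y0 y2 => /(_ isT); rewrite sy ltxx.
- by move: E1; rewrite y0 cos0 mulr1 => E; move: s0; rewrite E ltNge ltW.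
Qed.

Let Phi s := Int (- pi) pi (polRe hh s).

Let Phi_cts s c d : s != ell -> s <= lr -> {within `[c, d], continuous (polRe hh s)}.
Proof.
move=> sl slr; apply: polRe_cts => y yI; apply: hh_derivable; last exact: neq_of_ell.
by rewrite cN_cexp (le_lt_trans (le_lr slr)).
Qed.

Let Phi_const s1 s2 : s1 <= s2 -> s2 <= lr -> (s2 < ell) || (ell < s1) -> Phi s2 = Phi s1.
Proof.
move=> s12 s2r H; apply: polar_const => // s y /andP[s1s ss2] yI.
apply: hh_derivable; first by rewrite cN_cexp (le_lt_trans _ rhor)// le_lr// (le_trans ss2).
apply: neq_of_ell; apply/eqP => sE; move: H; rewrite -sE !ltNge s1s ss2//.
Qed.

(** The point x lies at angle pi on the circle s = ell. Goursat's lemma applies away from that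
    angle; the two strips of width dl and the horizontal sides are estimated by the bound M on
    [hh]. *)
Let Phi_jump M s1 s2 dl : 0 <= M ->
  (forall z, cN z <= rho -> z != x%:C -> cN (hh z) <= M) ->
  s1 < ell < s2 -> s2 <= lr -> 0 < dl -> dl < pi ->
  `|Phi s2 - Phi s1| <= 2 * M * (s2 - s1) + 4 * M * dl.
Proof.
move=> M0 HM /andP[s1l ls2] s2r dl0 dlpi.
have s12 : s1 <= s2 by rewrite (le_trans (ltW s1l))// ltW.
have s1r : s1 <= lr by exact: le_trans s2r.
have n1 : s1 != ell by rewrite lt_eqF.
have n2 : s2 != ell by rewrite gt_eqF.
have pi0 := pi_gt0 R.
have cts c d : {within `[c, d], continuous (fun y => polRe hh s2 y - polRe hh s1 y)}.
  by move=> y; apply: cvgB; exact: Phi_cts.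
have Qb y : `|polRe hh s2 y - polRe hh s1 y| <= 2 * M.
  rewrite (le_trans (ler_normB _ _))// mulr2n mulrDl mul1r lerD//.
    by rewrite (le_trans (Re_le_cN _))// HM ?neq_of_ell// cN_cexp le_lr.
  by rewrite (le_trans (Re_le_cN _))// HM ?neq_of_ell// cN_cexp le_lr.
have a1 : - pi <= - pi + dl by rewrite lerDl ltW.
have a2 : - pi + dl <= pi - dl by lra.
have a3 : pi - dl <= pi by rewrite gerBl ltW.
have hd s y : s1 <= s <= s2 -> - pi + dl <= y <= pi - dl -> C_derivable hh (cexp s y).
  move=> /andP[_ ss2] /andP[y1 y2]; apply: hh_derivable.
    by rewrite cN_cexp (le_lt_trans _ rhor)// le_lr// (le_trans ss2).
  by apply: neq_of_angle; apply/andP; split; lra.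
rewrite /Phi -IntB; [|exact: Phi_cts|exact: Phi_cts].
rewrite (Int_add a1 (le_trans a2 a3) (cts _ _)) (Int_add a2 a3 (cts _ _)).
rewrite (polar_circ s12 a2 hd).
have b1 := Int_le_bound a1 (cts _ _) (fun y _ => Qb y).
have b3 := Int_le_bound a3 (cts _ _) (fun y _ => Qb y).
have b2 : `|Int s1 s2 (fun s => polIm hh s (- pi + dl) - polIm hh s (pi - dl))| <= 2 * M * (s2 - s1).
  apply: Int_le_bound => //.
    move=> s; apply: cvgB;
      apply: (@closed_ctsP R (polIm hh) (polRe hh) s1 s2 (- pi + dl) (pi - dl)); rewrite ?lexx ?a2//;
      by move=> s' y' sI' yI'; apply: polar_closed_at; exact: hd.
  move=> s /andP[s1s ss2]; rewrite (le_trans (ler_normB _ _))// mulr2n mulrDl mul1r.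
  by rewrite lerD// (le_trans (Im_le_cN _))// HM ?cN_cexp ?le_lr ?(le_trans ss2)//;
    apply: neq_of_angle; apply/andP; split; lra.
have e1 : - pi + dl - - pi = dl by ring.
have e3 : pi - (pi - dl) = dl by ring.
rewrite e1 in b1; rewrite e3 in b3.
rewrite (le_trans (ler_normD _ _))// addrC.
have -> : 2 * M * (s2 - s1) + 4 * M * dl = (2 * M * (s2 - s1) + 2 * M * dl) + 2 * M * dl by ring.
by rewrite lerD// (le_trans (ler_normD _ _))// normrN lerD.
Qed.

(** The factor z in [hh] makes the mean over a small circle of radius h of order h, as |z - x| >= -
    x / 2 there. *)
Let Phi_small B h s0 : 0 <= B -> (forall z, cN z <= rho -> cN (f z) <= B) ->
  expR s0 = h -> h <= - x / 2 -> s0 < ell ->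
  `|Phi s0| <= (4 * B / - x) * h * (pi - - pi).
Proof.
move=> B0 HB s0E hx s0l.
have x0' : 0 < - x by rewrite oppr_gt0.
have h0 : 0 < h by rewrite -s0E expR_gt0.
have ellr : ell < lr by rewrite -ltr_expR ellE lrE.
have s0r : s0 <= lr := ltW (lt_trans s0l ellr).
have s0n : s0 != ell by apply/negbT/lt_eqF.
apply: Int_le_bound; [exact: pi_sym|exact: Phi_cts|].
move=> y _; rewrite (le_trans (Re_le_cN _))// /hh !cNM cNV cN_cexp s0E.
have zx : - x / 2 <= cN (cexp s0 y - x%:C).
  have := cNB (cexp s0 y) (cexp s0 y - x%:C); rewrite opprB addrCA subrr addr0 nx cN_cexp s0E.
  lra.
have x20 : 0 < - x / 2 by exact: divr_gt0.
rewrite ler_pdivrMr; last exact: lt_le_trans zx.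
have AB : cN (f (cexp s0 y) - f x%:C) <= 2 * B.
  rewrite (le_trans (cNB _ _))// mulr2n mulrDl mul1r lerD// HB//.
    by rewrite cN_cexp; exact: le_lr.
  by rewrite nx ltW.
rewrite (le_trans (ler_wpM2l (ltW h0) AB))//.
have -> : h * (2 * B) = 4 * B / - x * h * (- x / 2) by field; rewrite lt_eqF.
by rewrite ler_wpM2l// mulr_ge0 ?divr_ge0 ?mulr_ge0// ltW.
Qed.

Let Phi0 : Phi lr = 0.
Proof.
have [M M0 HM] := hh_bounded; have [B B0 HB] := hol_bounded rhor df.
have pi0 := pi_gt0 R.
have ellr : ell < lr by rewrite -ltr_expR ellE lrE.
(* With dl = h and s2 - s1 <= 2 h the jump costs 8 M h; the circle of radius h accounts for the
   other term. *)
pose N := 8 * M + 2 * pi * (4 * B / - x).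
have x0' : 0 < - x by rewrite oppr_gt0.
have Bx0 : 0 <= 4 * B / - x by apply: divr_ge0; [exact: mulr_ge0|exact: ltW].
have pi2 : 0 <= 2 * pi :> R by apply: mulr_ge0 => //; exact: ltW.
have N0 : 0 <= N by apply: addr_ge0; apply: mulr_ge0.
apply/eqP; rewrite -normr_eq0 eq_le normr_ge0 andbT.
apply/ler_addgt0Pl => e e0; rewrite addr0.
have N1 : 0 < N + 1 by rewrite ltr_wpDl.
have [h [h0 hN hl hpi hx]] : exists h, [/\ 0 < h, h <= e / (N + 1), h <= lr - ell,
    h < pi & h <= - x / 2].
  pose h := Num.min (Num.min (e / (N + 1)) (lr - ell)) (Num.min (pi / 2) (- x / 2)).
  have g1 : 0 < e / (N + 1) by exact: divr_gt0.
  have g2 : 0 < lr - ell by rewrite subr_gt0.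
  have g3 : 0 < pi / 2 :> R by exact: divr_gt0.
  have g4 : 0 < - x / 2 by exact: divr_gt0.
  exists h; split.
  - by rewrite /h !lt_min g1 g2 g3 g4.
  - by rewrite /h !ge_min lexx.
  - by rewrite /h !ge_min lexx !orbT.
  - rewrite (@le_lt_trans _ _ (pi / 2))// ?ltr_pdivrMr ?ltr_pMr ?ltr1n//.
    by rewrite /h !ge_min lexx !orbT.
  - by rewrite /h !ge_min lexx !orbT.
have [s0 s0E] : exists s0, expR s0 = h by exists (ln h); rewrite lnK// posrE.
have hx2 : h < - x by rewrite (le_lt_trans hx)// ltr_pdivrMr// ltr_pMr// ltr1n.
have s0l : s0 < ell by rewrite -ltr_expR s0E ellE.
have [s1 [s01 s1ge s1l]] : exists s1, [/\ s0 <= s1, ell - h <= s1 & s1 < ell].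
  exists (Num.max s0 (ell - h)); rewrite !le_max !lexx orbT gt_max s0l; split=> //.
  by rewrite ltrBlDr ltrDl.
have [s2 s2E] : exists s2, s2 = ell + h by exists (ell + h).
have s1r : s1 <= lr := ltW (lt_trans s1l ellr).
have s2r : s2 <= lr by rewrite s2E -lerBrDl.
have ls2 : ell < s2 by rewrite s2E ltrDl.
have s1l' : (s1 < ell) || (ell < s0) by rewrite s1l.
have s2l' : (lr < ell) || (ell < s2) by rewrite ls2 orbT.
have E1 : Phi s1 = Phi s0 := Phi_const s01 s1r s1l'.
have E2 : Phi lr = Phi s2 := Phi_const s2r (lexx lr) s2l'.
have s12 : s1 < ell < s2 by rewrite s1l.
have J := Phi_jump M0 HM s12 s2r h0 hpi.
have s2s1 : s2 - s1 <= 2 * h.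
  have -> : 2 * h = (ell + h) - (ell - h) by ring.
  by rewrite s2E lerD2l lerN2.
have F := Phi_small B0 HB s0E hx s0l.
apply: (le_trans (dist_chain E2 E1 J F)).
apply: (@le_trans _ _ (N * h)).
  have -> : N * h = 8 * M * h + 4 * B / - x * h * (pi - - pi) by rewrite /N; ring.
  rewrite lerD2r; have -> : 8 * M * h = 2 * M * (2 * h) + 4 * M * h by ring.
  by rewrite lerD2r ler_wpM2l ?mulr_ge0.
exact: mul_le_div N0 e0 hN.
Qed.

Let wz z := z / (z - x%:C).

(** For [F] holomorphic on the disc this is 2 pi times the real part of its k-th Taylor coefficient
    at 0. *)
Definition ccoef (F : R[i] -> R[i]) (k : nat) : R :=
  Int (- pi) pi (polRe (fun z => F z * z^-1 ^+ k) lr).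

Section expansion.
Variables (F : R[i] -> R[i]) (B : R).
Hypothesis dF : forall z, cN z < r -> C_derivable F z.
Hypothesis FB : forall z, cN z <= rho -> cN (F z) <= B.

Let zr y : cN (cexp lr y) < r. Proof. by rewrite cN_cexp lrE. Qed.

Let lr_ell : lr != ell.
Proof. by rewrite gt_eqF// -ltr_expR ellE lrE. Qed.

Let cts_coef k : {within `[- pi, pi], continuous (polRe (fun z => F z * z^-1 ^+ k) lr)}.
Proof.
apply: polRe_cts => y _; apply: C_derivableM; first exact: dF.
by apply: C_derivableX; apply: (C_derivableV (cexp_neq0 _ _)); exact: C_derivable_id.
Qed.

(** What remains of [F z * wz z] after n terms of the geometric expansion z / (z - x) = sum (x/z)^k;
    its ratio on the circle is - x / rho < 1. *)
Let tailf n z := F z * (x%:C * z^-1) ^+ n * wz z.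

Let cts_tail n : {within `[- pi, pi], continuous (polRe (tailf n) lr)}.
Proof.
apply: polRe_cts => y _; apply: C_derivableM; last first.
  apply: C_derivableM; first exact: C_derivable_id.
  by apply: C_derivableV; [rewrite subr_eq0 neq_of_ell|exact: C_derivable_idB].
apply: C_derivableM; first exact: dF.
apply: C_derivableX; apply: C_derivableM; first exact: C_derivable_cst.
by apply: (C_derivableV (cexp_neq0 _ _)); exact: C_derivable_id.
Qed.

Let tailS n : Int (- pi) pi (polRe (tailf n) lr) =
  x ^+ n * ccoef F n + Int (- pi) pi (polRe (tailf n.+1) lr).
Proof.
rewrite /ccoef -IntZ// -IntD//; last first.
  by apply: within_cstM; exact: cts_coef.
apply: eq_Int => y _; rewrite /polRe /tailf.
set z := cexp lr y.
have z0 : z != 0 by exact: cexp_neq0.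
have zx : z - x%:C != 0 by rewrite subr_eq0 neq_of_ell.
have -> : F z * (x%:C * z^-1) ^+ n * wz z =
    (x ^+ n)%:C * (F z * z^-1 ^+ n) + F z * (x%:C * z^-1) ^+ n.+1 * wz z.
  by rewrite rmorphXn/= exprS exprMn /wz; field; rewrite zx z0.
by rewrite ReD ReM/= mul0r subr0.
Qed.

Let tail_le n : `|Int (- pi) pi (polRe (tailf n) lr)| <=
  B * (rho / (rho + x)) * (pi - - pi) * (- x / rho) ^+ n.
Proof.
have rx : 0 < rho + x by rewrite -ltrBlDr sub0r.
have -> : B * (rho / (rho + x)) * (pi - - pi) * (- x / rho) ^+ n =
  B * (rho / (rho + x)) * (- x / rho) ^+ n * (pi - - pi) by ring.
apply: Int_le_bound; [exact: pi_sym|exact: cts_tail|].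
move=> y _; rewrite (le_trans (Re_le_cN _))// /tailf /wz !cNM cNX !cNM !cNV cN_cexp lrE nx.
set X := (- x / rho) ^+ n.
have X0 : 0 <= X by rewrite exprn_ge0// divr_ge0 ?(ltW rho0)// oppr_ge0 ltW.
rewrite [leRHS]mulrAC ler_pM ?mulr_ge0 ?cN_ge0 ?invr_ge0 ?cN_ge0 ?(ltW rho0)//.
  by rewrite ler_wpM2r// FB// cN_cexp lrE.
rewrite ler_wpM2l ?(ltW rho0)// lef_pV2 ?posrE//; last first.
  by rewrite cN_gt0 subr_eq0 neq_of_ell.
have := cNB (cexp lr y) (cexp lr y - x%:C); rewrite opprB addrCA subrr addr0 nx cN_cexp lrE.
have := cND (cexp lr y - x%:C) x%:C; rewrite subrK nx cN_cexp lrE; lra.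
Qed.

Lemma ccoef_series : sumR (fun k => x ^+ k * ccoef F k) =
  Int (- pi) pi (polRe (fun z => F z * wz z) lr).
Proof.
apply: sumR_cvg.
set I0 := Int _ _ _.
have E n : series (fun k => x ^+ k * ccoef F k) n = I0 - Int (- pi) pi (polRe (tailf n) lr).
  elim: n => [|n IH].
    rewrite seriesEord/= big_ord0 /I0; apply/esym/eqP; rewrite subr_eq0; apply/eqP.
    by apply: eq_Int => y _; rewrite /polRe /tailf expr0 mulr1.
  rewrite seriesEord/= big_ord_recr/=; move: IH; rewrite seriesEord/= => ->.
  by rewrite tailS; ring.
rewrite (_ : series _ = fun n => I0 - Int (- pi) pi (polRe (tailf n) lr)); last exact/funext.
rewrite -[X in _ --> X]subr0; apply: cvgB; first exact: cvg_cst.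
have rx : 0 < rho + x by rewrite -ltrBlDr sub0r.
have q1 : `|- x / rho| < 1.
  by rewrite ger0_norm ?divr_ge0 ?(ltW rho0) ?oppr_ge0 ?(ltW x0)// ltr_pdivrMr// mul1r.
have := cvg_geometric (B * (rho / (rho + x)) * (pi - - pi)) q1.
move/cvgrPdist_le => H; apply/cvgrPdist_le => e e0; near=> n.
rewrite sub0r normrN (le_trans (tail_le n))//.
have : `|0 - geometric (B * (rho / (rho + x)) * (pi - - pi)) (- x / rho) n| <= e.
  by near: n; exact: H.
by rewrite sub0r normrN; exact: le_trans (ler_norm _).
Unshelve. all: by end_near.
Qed.

End expansion.

Lemma ccoef1 k : ccoef (fun=> 1) k = if k is 0%N then 2 * pi else 0.
Proof.
rewrite /ccoef; case: k => [|k].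
  rewrite (@eq_Int _ _ _ _ (fun=> 1)); last by move=> y _; rewrite /polRe expr0 mulr1.
  by rewrite Int_cst ?pi_sym//; ring.
rewrite (@eq_Int _ _ _ _ (fun y => rho^-1 ^+ k.+1 * cos (k.+1%:R * y))); last first.
  move=> y _; rewrite /polRe mul1r cexpV cexpX /cexp/= !mulrN cosN expRN.
  by rewrite expRM_natl lrE exprVn.
have k0 : k.+1%:R != 0 :> R by rewrite pnatr_eq0.
have D (y : R) : is_derive y 1 (fun y => rho^-1 ^+ k.+1 * (k.+1%:R^-1 * sin (k.+1%:R * y)))
   (rho^-1 ^+ k.+1 * cos (k.+1%:R * y)).
  apply: is_derive_eq; rewrite /GRing.scale/=; field.
  by rewrite ?pnatr_eq0.
rewrite (Int_FTC pi_sym _ D).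
  have s0 : sin (k.+1%:R * pi) = 0 :> R.
    elim: k.+1 => [|m IH]; first by rewrite mul0r sin0.
    by rewrite -natr1 mulrDl mul1r sinD IH sinpi mul0r mulr0 addr0.
  by rewrite mulrN sinN s0 oppr0 !mulr0 subrr.
apply: continuous_subspaceT => y; apply: cvgMr.
by apply: continuous_comp; [exact: mulrl_continuous|exact: continuous_cos].
Qed.

(** The vanishing of [Phi lr] equates the mean of f(z) z / (z - x) with f(x) times that of z / (z -
    x), and [ccoef_series] for the constant 1 evaluates the latter. *)
Lemma cauchy_expansion : Im (f x%:C) = 0 ->
  2 * pi * Re (f x%:C) = sumR (fun k => x ^+ k * ccoef f k).
Proof.
move=> fx0; have [B B0 HB] := hol_bounded rhor df.
rewrite (@ccoef_series f B)//.
have I1 : Int (- pi) pi (polRe (fun z => 1 * wz z) lr) = 2 * pi.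
  rewrite -(@ccoef_series (fun=> 1) 1) => [||z _]; first last.
  - by rewrite ComplexField.Normc.normc1.
  - by move=> z _; exact: C_derivable_cst.
  rewrite (sumR_cvg (l := 2 * pi))// -cvg_shiftS.
  rewrite (_ : [sequence _]_n = fun=> 2 * pi); first exact: cvg_cst.
  apply/funext => n; rewrite /= seriesEord/= big_ord_recl big1.
    by rewrite expr0 mul1r ccoef1 addr0.
  by move=> i _; rewrite ccoef1 mulr0.
have lr_ell : lr != ell by rewrite gt_eqF// -ltr_expR ellE lrE.
have cts (F : R[i] -> R[i]) : (forall z, cN z < r -> C_derivable F z) ->
    {within `[- pi, pi], continuous (polRe (fun z => F z * wz z) lr)}.
  move=> dF; apply: polRe_cts => y _; apply: C_derivableM.
    by apply: dF; rewrite cN_cexp lrE.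
  apply: C_derivableM; first exact: C_derivable_id.
  by apply: C_derivableV; [rewrite subr_eq0 neq_of_ell|exact: C_derivable_idB].
have := Phi0; rewrite /Phi.
rewrite (@eq_Int _ _ _ _ (fun y => polRe (fun z => f z * wz z) lr y -
    Re (f x%:C) * polRe (fun z => 1 * wz z) lr y)); last first.
  move=> y _; rewrite /polRe /hh /wz; set z := cexp lr y.
  have zx : z - x%:C != 0 by rewrite subr_eq0 neq_of_ell.
  have fxE : f x%:C = (Re (f x%:C))%:C by case: (f x%:C) fx0 => u v /= ->.
  have -> : z * (f z - f x%:C) / (z - x%:C) = f z * (z / (z - x%:C)) -
      (Re (f x%:C))%:C * (1 * (z / (z - x%:C))) by rewrite -fxE; field.
  by rewrite ReB Re_realM.
have c1 : {within `[- pi, pi], continuous (polRe (fun z => 1 * wz z) lr)}.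
  by apply: (cts (fun=> 1)) => z _; exact: C_derivable_cst.
rewrite IntB ?IntZ ?I1; [|exact: c1|exact: cts|].
  by move/eqP; rewrite subr_eq0 => /eqP ->; rewrite mulrC.
by apply: within_cstM; exact: c1.
Qed.

End cauchy.

Lemma holomorphic_taylor (f : R[i] -> R[i]) (y : R -> R) (r rho : R) :
  holomorphic_on_disc 0 r f -> 1 < rho -> rho < r ->
  {within `[(-1 : R), 0], continuous y} ->
  (forall x : R, `[-1, 0]%classic x -> f x%:C = (y x)%:C) ->
  exists (b : nat -> R) (C : R), [/\ 0 <= C,
    forall k, `|b k| <= C * (k`!%:R / rho ^+ k) &
    forall x : R, `[-1, 0]%classic x -> y x = TS b x].
Proof.
move=> hf rho1 rhor cy fy.
have rho0 : 0 < rho by exact: lt_trans rho1.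
have df z : cN z < r -> C_derivable f z.
  by move=> zr; apply: hf; rewrite subr0 cN_normE ltcR.
have [B B0 HB] := hol_bounded rhor df.
pose b k := k`!%:R * ccoef rho f k / (2 * pi).
have p2 : 0 < 2 * pi :> R by rewrite mulr_gt0// pi_gt0.
have lrE : expR (ln rho) = rho by rewrite lnK// posrE.
have bB k : `|b k| <= B * (k`!%:R / rho ^+ k).
  rewrite /b !normrM normfV [`|2 * pi|]gtr0_norm// ger0_norm// ler_pdivrMr//.
  have -> : B * (k`!%:R / rho ^+ k) * (2 * pi) = k`!%:R * (B / rho ^+ k * (2 * pi)) by ring.
  rewrite ler_wpM2l//; have -> : 2 * pi = pi - - pi :> R by ring.
  apply: Int_le_bound; first exact: pi_sym.
    apply: polRe_cts => t _; apply: C_derivableM.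
      by apply: df; rewrite cN_cexp lrE.
    by apply: C_derivableX; apply: (C_derivableV (cexp_neq0 _ _)); exact: C_derivable_id.
  move=> t _; rewrite (le_trans (Re_le_cN _))// cNM cNX cNV cN_cexp lrE exprVn.
  by rewrite ler_wpM2r ?invr_ge0 ?exprn_ge0 ?(ltW rho0)// HB// cN_cexp lrE.
have neg x : -1 <= x < 0 -> y x = TS b x.
  move=> /andP[x1 x0].
  have xI : `[-1, 0]%classic x by rewrite /= in_itv/= x1 ltW.
  have xrho : - x < rho by rewrite (le_lt_trans _ rho1)// lerNl.
  have := @cauchy_expansion f r rho x df rhor x0 xrho; rewrite fy//= => /(_ erefl) E.
  apply: (mulfI (lt0r_neq0 p2)); rewrite E /TS.
  have aB : asum (fun j => b j * mono j x) (B * TS_B 1 rho * (0`!%:R * TS_K 1 rho ^+ 0)).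
    have xle : `|x| <= 1 by rewrite ltr0_norm// lerNl.
    by have := TS_asum_le ltr01 rho1 0 B0 bB xle; exact.
  rewrite -(sumRZ _ aB); apply: eq_sumR => k; move: p2; rewrite /b /mono.
  move: (2 * pi) => P2 P20; field.
  by rewrite ?pnatr_eq0 -?lt0n ?fact_gt0 ?(gt_eqF P20).
exists b, B; split=> // x; rewrite /= in_itv/= => /andP[x1].
(* Cauchy's formula is available for x < 0; at the endpoint 0 the two continuous functions agree as
   limits from the left. *)
rewrite le_eqVlt => /orP[/eqP ->|x0]; last by apply: neg; rewrite x1.
have cT : {within `[(-1 : R), 0], continuous (TS b)}.
  have [M q] := TS_family ltr01 rho1 B0 bB 0.
  have q' : quad `[-1, 0] (TS b) (TS (fun j => b (1 + j)%N)) M.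
    move=> u v; rewrite /= !in_itv/= => /andP[u1 u0] /andP[v1 v0].
    by apply: q; rewrite /= in_itv/= ?u1 ?v1/= (le_trans _ ler01).
  apply: (quad_continuous q' (B := B * TS_B 1 rho * (1`!%:R * TS_K 1 rho ^+ 1))).
  move=> u; rewrite /= in_itv/= => /andP[u1 u0].
  apply: TS_bound => //; rewrite ler_norml u1/=; exact: le_trans u0 _.
have lim0 (g : R -> R) : {within `[(-1 : R), 0], continuous g} -> g z @[z --> 0^'-] --> g 0.
  have h : (-1 : R) < 0 by rewrite oppr_lt0.
  by move=> /(continuous_within_itvP _ h)[].
apply/eqP; rewrite -subr_eq0; apply/eqP.
have c1 : (y z - TS b z) @[z --> 0^'-] --> y 0 - TS b 0.
  by apply: cvgB; exact: lim0.
rewrite -(cvg_lim _ c1)//; apply: lim_near_cst => //.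
near=> z; rewrite /= neg ?subrr//; apply/andP; split; last by near: z; exact: nbhs_left_lt.
apply/ltW; near: z; apply: nbhs_left_gt; by rewrite oppr_lt0.
Unshelve. all: by end_near.
Qed.

End holomorphic.

(** * Exponentially decaying integrals *)

Section dominated_series.
Context {R : realType}.

Lemma asum_partial_le (M : nat -> R) B n : (forall k, 0 <= M k) -> asum M B ->
  \sum_(k < n) M k <= sumR M.
Proof.
move=> M0 MB.
have sE : series M n = \sum_(k < n) M k by rewrite seriesEord.
rewrite -sE; apply: nondecreasing_cvgn_le.
  by apply/nondecreasing_seqP => k; rewrite !seriesEord/= big_ord_recr/= lerDl.
by apply/cvg_ex; exists (sumR M); exact: asum_cvg MB.
Qed.

Lemma sumR_tail (u M : nat -> R) B n : (forall k, `|u k| <= M k) -> asum M B ->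
  `|sumR u - \sum_(k < n) u k| <= sumR M - \sum_(k < n) M k.
Proof.
elim: n u M B => [|n IH] u M B uM MB.
  rewrite !big_ord0 !subr0; apply: asum_le => n.
  have M0 k : 0 <= M k := le_trans (normr_ge0 _) (uM k).
  apply: le_trans (asum_partial_le n M0 MB); apply: ler_sum => k _; exact: uM.
rewrite (sumRS MB) (sumRS (asum_dom uM MB)) !big_ord_recl !opprD !addrA.
rewrite [u 0%N + _ - _]addrAC [M 0%N + _ - _]addrAC !subrr !add0r.
by apply: (IH _ _ B) => [k|]; [exact: uM|exact: asumS].
Qed.

Lemma cvg_sum_ord (T : Type) (F : set_system T) (FF : ProperFilter F)
    (f : nat -> T -> R) (l : nat -> R) n : (forall j, f j @ F --> l j) ->
  (fun x => \sum_(k < n) f k x) @ F --> \sum_(k < n) l k.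
Proof.
move=> fl; elim: n => [|n IH].
  by under eq_fun do rewrite big_ord0; rewrite big_ord0; exact: cvg_cst.
under eq_fun do rewrite big_ord_recr/=; rewrite big_ord_recr/=.
by apply: cvgD => //; exact: fl.
Qed.

(** Dominated convergence for series, by cutting at a common rank N. *)
Lemma cvg_sumR (T : Type) (F : set_system T) (FF : ProperFilter F)
    (f : nat -> T -> R) (l M : nat -> R) B :
  (forall j, f j @ F --> l j) -> (forall j, `|l j| <= M j) -> asum M B ->
  (\forall x \near F, forall j, `|f j x| <= M j) ->
  (fun x => sumR (f ^~ x)) @ F --> sumR l.
Proof.
move=> fl lM MB fM; apply/cvgrPdist_lt => e e0.
have e3 : 0 < e / 3 by rewrite divr_gt0.
have /cvgrPdist_lt/(_ _ e3) [N _ HN] := asum_cvg MB.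
have {HN} := HN N (leqnn N); rewrite seriesEord/= => HN.
have tail u : (forall k, `|u k| <= M k) -> `|sumR u - \sum_(k < N) u k| < e / 3.
  by move=> uM; apply: le_lt_trans HN; apply: le_trans (sumR_tail N uM MB) (ler_norm _).
have cN : (fun x => \sum_(k < N) f k x) @ F --> \sum_(k < N) l k.
  exact: cvg_sum_ord.
have /cvgrPdist_lt/(_ _ e3) Hc := cN.
near=> x.
have h1 := tail _ lM.
have h2 : `|sumR (f ^~ x) - \sum_(k < N) f k x| < e / 3.
  by apply: tail; near: x; exact: fM.
have h3 : `|\sum_(k < N) l k - \sum_(k < N) f k x| < e / 3 by near: x; exact: Hc.
move: h1 h2 h3; set a := \sum_(k < N) l k; set b := \sum_(k < N) f k x.
move: (sumR l) (sumR (f ^~ x)) => p q h1 h2 h3.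
have -> : p - q = (p - a) - (q - b) + (a - b) by ring.
rewrite (le_lt_trans (ler_normD _ _))// (le_lt_trans (lerD (ler_normB _ _) (lexx _)))//.
have -> : e = e / 3 + e / 3 + e / 3 by field.
by rewrite ltrD// ltrD.
Unshelve. all: by end_near.
Qed.

Lemma continuous_sumR (f : nat -> R -> R) : (forall j, continuous (f j)) ->
  (forall L, exists M B, asum M B /\ forall j x, `|x| <= L -> `|f j x| <= M j) ->
  continuous (fun x => sumR (f ^~ x)).
Proof.
move=> fc fM x; have [M [B [MB HM]]] := fM (`|x| + 1).
apply: (@cvg_sumR _ (nbhs x) _ f (f ^~ x) M B) => //.
- by move=> j; exact: fc.
- by move=> j; apply: HM; rewrite lerDl.
- apply/nbhs_ballP; exists 1 => //= y; rewrite /ball/= => xy j; apply: HM.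
  have -> : y = x - (x - y) by ring.
  by rewrite (le_trans (ler_normB _ _))// lerD2l ltW.
Qed.

Lemma within_continuous_sumR (a b : R) (f : nat -> R -> R) M B :
  (forall j, {within `[a, b], continuous (f j)}) -> asum M B ->
  (forall j x, a <= x <= b -> `|f j x| <= M j) ->
  {within `[a, b], continuous (fun x => sumR (f ^~ x))}.
Proof.
move=> fc MB HM; apply/subspace_continuousP => x xA.
have xA' : a <= x <= b by move: xA; rewrite /= in_itv.
have PF : ProperFilter (within `[a, b] (nbhs x)) by exact: within_nbhs_proper (subset_closure xA).
apply: (@cvg_sumR _ _ PF f (f ^~ x) M B) => //.
- by move=> j; have /subspace_continuousP := fc j; apply.
- by move=> j; exact: HM.
- by rewrite near_withinE; near=> y => yA j; apply: HM; move: yA; rewrite /= in_itv.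
Unshelve. all: by end_near.
Qed.

Lemma within_continuous_sum (a b : R) (f : nat -> R -> R) n :
  (forall j, {within `[a, b], continuous (f j)}) ->
  {within `[a, b], continuous (fun x => \sum_(j < n) f j x)}.
Proof.
move=> fc; apply/subspace_continuousP => x xA.
have PF : ProperFilter (within `[a, b] (nbhs x)) by exact: within_nbhs_proper (subset_closure xA).
apply: (@cvg_sum_ord _ _ PF f (f ^~ x)) => k.
by have /subspace_continuousP := fc k; apply.
Qed.

Lemma Int_sum (a b : R) (f : nat -> R -> R) n : a <= b ->
  (forall j, {within `[a, b], continuous (f j)}) ->
  Int a b (fun x => \sum_(j < n) f j x) = \sum_(j < n) Int a b (f j).
Proof.
move=> ab fc; elim: n => [|n IH].
  rewrite big_ord0 -[RHS](mul0r (b - a)) -(Int_cst 0 ab).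
  by apply: eq_Int => x _; rewrite big_ord0.
rewrite big_ord_recr/= -IH -IntD//; last exact: within_continuous_sum.
by apply: eq_Int => x _; rewrite big_ord_recr.
Qed.

Lemma Int_sumR (a b : R) (f : nat -> R -> R) M B : a <= b ->
  (forall j, {within `[a, b], continuous (f j)}) -> asum M B ->
  (forall j x, a <= x <= b -> `|f j x| <= M j) ->
  Int a b (fun x => sumR (f ^~ x)) = sumR (fun j => Int a b (f j)).
Proof.
move=> ab fc MB HM; apply/esym/sumR_cvg.
have sc := within_continuous_sumR fc MB HM.
apply/cvgrPdist_le => e e0.
have e3 : 0 < e / (b - a + 1) by rewrite divr_gt0// ltr_wpDl ?subr_ge0.
have /cvgrPdist_lt/(_ _ e3) [N _ HN] := asum_cvg MB.
exists N => // n /= Nn; have {HN} := HN n Nn; rewrite !seriesEord/= => HN.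
rewrite -Int_sum// -IntB//; last exact: within_continuous_sum.
apply: (@le_trans _ _ (e / (b - a + 1) * (b - a))).
  apply: Int_le_bound => //.
    apply/subspace_continuousP => x xA; apply: cvgB.
      by have /subspace_continuousP := sc; apply.
    by have /subspace_continuousP := @within_continuous_sum a b f n fc; apply.
  move=> x xab; apply: le_trans (ltW HN).
  by apply: le_trans (ler_norm _); apply: sumR_tail MB => k; exact: HM.
rewrite mulrAC -mulrA ler_piMr ?(ltW e0)// ler_pdivrMr ?ltr_wpDl ?subr_ge0//.
by rewrite mul1r lerDl.
Qed.

Lemma Int_quad (a b : R) (A : set R) (f g : R -> R -> R) M : a <= b ->
  (forall x, A x -> {within `[a, b], continuous (f x)}) ->
  (forall x, A x -> {within `[a, b], continuous (g x)}) ->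
  (forall s, a <= s <= b -> quad A (f ^~ s) (g ^~ s) M) ->
  quad A (fun x => Int a b (f x)) (fun x => Int a b (g x)) (M * (b - a)).
Proof.
move=> ab fc gc q x y Ax Ay; rewrite -(IntZ _ (gc x Ax)).
have c1 : {within `[a, b], continuous (fun s => f y s - f x s)}.
  by apply/subspace_continuousP => s sA; apply: cvgB;
    [have /subspace_continuousP := fc y Ay|have /subspace_continuousP := fc x Ax]; apply.
have c2 : {within `[a, b], continuous (fun s => (y - x) * g x s)}.
  by apply/subspace_continuousP => s sA; apply: cvgMr; have /subspace_continuousP := gc x Ax; apply.
rewrite -(IntB (fc y Ay) (fc x Ax)) -(IntB c1 c2) mulrAC; apply: Int_le_bound => //.
  by apply/subspace_continuousP => s sA; apply: cvgB;
    [have /subspace_continuousP := c1|have /subspace_continuousP := c2]; apply.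
by move=> s sab; apply: q.
Qed.

End dominated_series.

(** * Integrals of exponentially decaying functions over the half-line *)

Section half_line_integral.
Context {R : realType}.
Variable c : R.
Hypothesis c0 : 0 < c.

(** Summing over unit intervals reduces the improper integral to absolutely convergent series with
    geometric majorants. *)
Definition Iinf (f : R -> R) : R := sumR (fun j => Int j%:R j.+1%:R f).

Definition edec (B : R) (f : R -> R) : Prop :=
  continuous f /\ forall x, 0 <= x -> `|f x| <= B * expR (- (c * x)).

Definition edec_cst : R := (1 - expR (- c))^-1.

Lemma edec_within B f (a b : R) : edec B f -> {within `[a, b], continuous f}.
Proof. by case=> fc _; exact: continuous_subspaceT. Qed.

Let q01 : 0 <= expR (- c) < 1.
Proof. by rewrite expR_ge0 expR_lt1 oppr_lt0. Qed.

Lemma edec_B_ge0 B f : edec B f -> 0 <= B.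
Proof.
by move=> [_ /(_ 0 (lexx _))]; rewrite mulr0 oppr0 expR0 mulr1; exact: le_trans.
Qed.

Lemma Iinf_asum B f : edec B f -> asum (fun j => Int j%:R j.+1%:R f) (B * edec_cst).
Proof.
move=> fB; have B0 := edec_B_ge0 fB.
apply: asum_dom (asum_geometric B0 q01) => j.
have jj : j%:R <= j.+1%:R :> R by rewrite ler_nat.
have -> : B * expR (- c) ^+ j = B * expR (- c) ^+ j * (j.+1%:R - j%:R).
  by rewrite -natr1 addrAC subrr add0r mulr1.
apply: Int_le_bound => //; first exact: edec_within fB.
move=> x /andP[jx _]; rewrite -expRM_natl.
apply: le_trans (fB.2 x (le_trans (ler0n _ _) jx)) _.
by rewrite ler_wpM2l// ler_expR mulrN lerN2 mulrC ler_wpM2l// ltW.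
Qed.

Lemma Iinf_le B f : edec B f -> `|Iinf f| <= B * edec_cst.
Proof. by move=> fB; exact: asum_le (Iinf_asum fB). Qed.

Lemma eq_Iinf f g : (forall x, 0 <= x -> f x = g x) -> Iinf f = Iinf g.
Proof.
move=> fg; apply: eq_sumR => j; apply: eq_Int => x /andP[jx _].
by rewrite fg// (le_trans _ jx).
Qed.

Lemma edecD B B' f g : edec B f -> edec B' g -> edec (B + B') (fun x => f x + g x).
Proof.
move=> [fc fB] [gc gB]; split; first by move=> x; apply: cvgD; [exact: fc|exact: gc].
by move=> x x0; rewrite (le_trans (ler_normD _ _))// mulrDl lerD// ?fB// gB.
Qed.

Lemma edecZ B f (b : R) : edec B f -> edec (`|b| * B) (fun x => b * f x).
Proof.
move=> [fc fB]; split; first by move=> x; apply: cvgMr; exact: fc.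
by move=> x x0; rewrite normrM -mulrA ler_wpM2l// fB.
Qed.

Lemma IinfD B B' f g : edec B f -> edec B' g ->
  Iinf (fun x => f x + g x) = Iinf f + Iinf g.
Proof.
move=> fB gB; rewrite /Iinf -(sumRD (Iinf_asum fB) (Iinf_asum gB)).
by apply: eq_sumR => j; apply: IntD; [exact: edec_within fB|exact: edec_within gB].
Qed.

Lemma IinfZ B f (b : R) : edec B f -> Iinf (fun x => b * f x) = b * Iinf f.
Proof.
move=> fB; rewrite /Iinf -(sumRZ _ (Iinf_asum fB)).
by apply: eq_sumR => j; apply: IntZ; exact: edec_within fB.
Qed.

Lemma Iinf_quad (A : set R) (F G : R -> R -> R) B0 B1 B :
  (forall x, A x -> edec B0 (F x)) -> (forall x, A x -> edec B1 (G x)) ->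
  (forall s, 0 <= s -> quad A (F ^~ s) (G ^~ s) (B * expR (- (c * s)))) ->
  quad A (fun x => Iinf (F x)) (fun x => Iinf (G x)) (B * edec_cst).
Proof.
move=> HF HG q x y Ax Ay.
have d1 := edecD (HF y Ay) (edecZ (-1) (HF x Ax)).
have d2 := edecZ (- (y - x)) (HG x Ax).
have d3 := edecD d1 d2.
have -> : Iinf (F y) - Iinf (F x) - (y - x) * Iinf (G x) =
    Iinf (fun s => F y s + -1 * F x s + - (y - x) * G x s).
  rewrite (IinfD d1 d2) (IinfD (HF y Ay) (edecZ (-1) (HF x Ax))).
  by rewrite (IinfZ _ (HF x Ax)) (IinfZ _ (HG x Ax)) mulN1r mulNr.
rewrite mulrAC; apply: Iinf_le; split; first exact: d3.1.
by move=> s s0; rewrite mulN1r mulNr mulrAC; exact: q.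
Qed.

Lemma Iinf_FTC B B' f (F : R -> R) : edec B f ->
  (forall x : R, is_derive x 1 F (f x)) ->
  (forall x, 0 <= x -> `|F x| <= B' * expR (- (c * x))) -> Iinf f = - F 0.
Proof.
move=> fB dF FB; apply: sumR_cvg.
have -> : series (fun j => Int j%:R j.+1%:R f) = (fun n => F n%:R - F 0).
  apply/funext => n; rewrite seriesEord/=; elim: n => [|n IH].
    by rewrite big_ord0 subrr.
  rewrite big_ord_recr/= IH (Int_FTC _ _ dF); first by ring.
    by rewrite ler_nat.
  exact: edec_within fB.
rewrite -[X in _ --> X]add0r.
have F0 : F n%:R @[n --> \oo] --> (0 : R).
  apply: norm_cvg0; apply: (@squeeze_cvgr _ _ _ _ (fun=> 0) (geometric B' (expR (- c)))).
  - near=> n; rewrite normr_ge0/= /geometric/= -expRM_natl mulrN [n%:R * _]mulrC.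
    exact: FB.
  - exact: cvg_cst.
  - by apply: cvg_geometric; rewrite ger0_norm; case/andP: q01.
by apply: cvgB => //; exact: cvg_cst.
Unshelve. all: by end_near.
Qed.

End half_line_integral.

(** * The kernel G and its energy estimate *)

Section complex_valued.
Context {R : realType}.
Implicit Types (f g : R -> R[i]).

Definition ccont f : Prop :=
  continuous (fun x => Re (f x)) /\ continuous (fun x => Im (f x)).

Definition cder f (x : R) (l : R[i]) : Prop :=
  is_derive x 1 (fun y => Re (f y)) (Re l) /\
  is_derive x 1 (fun y => Im (f y)) (Im l).

Lemma ccont_cst c : ccont (fun=> c).
Proof. by split => x; exact: cvg_cst. Qed.

Lemma ccontD f g : ccont f -> ccont g -> ccont (fun x => f x + g x).
Proof.
move=> [f1 f2] [g1 g2]; split => x.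
  by under eq_fun do rewrite ReD; apply: cvgD; [exact: f1|exact: g1].
by under eq_fun do rewrite ImD; apply: cvgD; [exact: f2|exact: g2].
Qed.

Lemma ccontM f g : ccont f -> ccont g -> ccont (fun x => f x * g x).
Proof.
move=> [f1 f2] [g1 g2]; split => x.
  under eq_fun do rewrite ReM; apply: cvgB; apply: cvgM;
    by [exact: f1|exact: g1|exact: f2|exact: g2].
under eq_fun do rewrite ImM; apply: cvgD; apply: cvgM;
  by [exact: f1|exact: g1|exact: f2|exact: g2].
Qed.

Lemma ccontX f n : ccont f -> ccont (fun x => f x ^+ n).
Proof.
move=> fc; elim: n => [|n IH]; first by under eq_fun do rewrite expr0; exact: ccont_cst.
by under eq_fun do rewrite exprS; exact: ccontM.
Qed.

Lemma ccont_real (u : R -> R) : continuous u -> ccont (fun x => (u x)%:C).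
Proof. by move=> uc; split => // x; exact: cvg_cst. Qed.

Lemma ccont_cexp (u v : R -> R) : continuous u -> continuous v ->
  ccont (fun x => cexp (u x) (v x)).
Proof.
move=> uc vc; split => x /=.
  apply: cvgM; first by apply: continuous_comp; [exact: uc|exact: continuous_expR].
  by apply: continuous_comp; [exact: vc|exact: continuous_cos].
apply: cvgM; first by apply: continuous_comp; [exact: uc|exact: continuous_expR].
by apply: continuous_comp; [exact: vc|exact: continuous_sin].
Qed.

Lemma is_derive_continuous (f f' : R -> R) :
  (forall x : R, is_derive x 1 f (f' x)) -> continuous f.
Proof.
move=> ff' x; apply: differentiable_continuous; apply/derivable1_diffP.
by case: (ff' x).
Qed.

Lemma cder_ccont f f' : (forall x, cder f x (f' x)) -> ccont f.
Proof.
move=> ff'; split.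
  exact: (@is_derive_continuous _ (fun x => Re (f' x)) (fun x => (ff' x).1)).
exact: (@is_derive_continuous _ (fun x => Im (f' x)) (fun x => (ff' x).2)).
Qed.

Lemma cder_eq f x l l' : cder f x l -> l = l' -> cder f x l'.
Proof. by move=> ? <-. Qed.

Lemma cder_ext f g x l : (forall y, f y = g y) -> cder f x l -> cder g x l.
Proof. by move=> /funext ->. Qed.

Lemma cder_cst c x : cder (fun=> c) x 0.
Proof. by split; exact: is_derive_cst. Qed.

Lemma cderD f g x l l' : cder f x l -> cder g x l' -> cder (fun y => f y + g y) x (l + l').
Proof.
move=> [f1 f2] [g1 g2]; split.
  by under eq_fun do rewrite ReD; rewrite ReD; exact: is_deriveD.
by under eq_fun do rewrite ImD; rewrite ImD; exact: is_deriveD.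
Qed.

Lemma cderM f g x l l' : cder f x l -> cder g x l' ->
  cder (fun y => f y * g y) x (f x * l' + l * g x).
Proof.
move=> [f1 f2] [g1 g2]; split.
  under eq_fun do rewrite ReM.
  apply: (is_derive_eq (is_deriveB (is_deriveM f1 g1) (is_deriveM f2 g2))).
  by rewrite /GRing.scale/= ReD !ReM; ring.
under eq_fun do rewrite ImM.
apply: (is_derive_eq (is_deriveD (is_deriveM f1 g2) (is_deriveM f2 g1))).
by rewrite /GRing.scale/= ImD !ImM; ring.
Qed.

Lemma cderZ (c : R[i]) f x l : cder f x l -> cder (fun y => c * f y) x (c * l).
Proof.
by move=> fl; apply: (cder_eq (cderM (cder_cst c x) fl)); rewrite mul0r addr0.
Qed.

Lemma cder_real (u : R -> R) (x l : R) : is_derive x 1 u l -> cder (fun y => (u y)%:C) x l%:C.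
Proof. by move=> ul; split => //=; exact: is_derive_cst. Qed.

Lemma cder_cexp (u v x : R) :
  cder (fun y => cexp (u * y) (v * y)) x ((u +i* v) * cexp (u * x) (v * x)).
Proof.
have du : is_derive x 1 ( *%R u) u.
  apply: (is_derive_eq (is_deriveZ u (is_derive_id x 1))).
  by rewrite /GRing.scale/= mulr1.
have dv : is_derive x 1 ( *%R v) v.
  apply: (is_derive_eq (is_deriveZ v (is_derive_id x 1))).
  by rewrite /GRing.scale/= mulr1.
have de : is_derive x 1 (fun y => expR (u * y)) (u * expR (u * x)).
  apply: (is_derive_eq (is_derive1_comp (is_derive_expR (u * x)) du)).
  by rewrite mulrC.
have dc : is_derive x 1 (fun y => cos (v * y)) (- (v * sin (v * x))).
  apply: (is_derive_eq (is_derive1_comp (is_derive_cos (v * x)) dv)).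
  by ring.
have ds : is_derive x 1 (fun y => sin (v * y)) (v * cos (v * x)).
  apply: (is_derive_eq (is_derive1_comp (is_derive_sin (v * x)) dv)).
  by rewrite mulrC.
split.
  apply: (is_derive_eq (is_deriveM de dc)).
  by rewrite ReM /cexp /GRing.scale/=; ring.
apply: (is_derive_eq (is_deriveM de ds)).
by rewrite ImM /cexp /GRing.scale/=; ring.
Qed.

End complex_valued.

(** * Taylor series of the kernel and its dependence on the parameter *)

Section kernel.
Context {R : realType}.
Implicit Types (a x mu : R) (l : R[i]).

(* The derivatives at 0 of the solution G of G''' + a G' = l G with G(0) = G'(0) = 0
   and G''(0) = 1. *)
Fixpoint gam a l (k : nat) : R[i] :=
  match k with
  | 0 => 0 | 1 => 0 | 2 => 1
  | (k'.+1 as k1).+2 => l * gam a l k' - a%:C * gam a l k1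
  end.

Lemma gamS a l k : gam a l k.+3 = l * gam a l k - a%:C * gam a l k.+1.
Proof. by []. Qed.

(** With L = 1 + a + s one has s^3 + a L <= L^2 (s + a) <= L^3, so growth by a factor L per step is
    compatible with the recursion. *)
Lemma rec3_bound a s (b : nat -> R) C : 0 <= a -> 0 <= s -> 0 <= C ->
  b 0%N <= C -> b 1%N <= C -> b 2%N <= C ->
  (forall k, b k.+3 <= s ^+ 3 * b k + a * b k.+1) ->
  forall k, b k <= C * (1 + a + s) ^+ k.
Proof.
move=> a0 s0 C0 b0 b1 b2 bS; set L := 1 + a + s.
have L1 : 1 <= L by rewrite /L -addrA lerDl addr_ge0.
have sL : s <= L by rewrite lerDr addr_ge0.
have saL : s + a <= L by rewrite /L addrC -addrA lerDr.
clearbody L.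
have L0 : 0 <= L := le_trans ler01 L1.
have LX k : C <= C * L ^+ k by rewrite ler_peMr// exprn_ege1.
suff H k : [/\ b k <= C * L ^+ k, b k.+1 <= C * L ^+ k.+1 & b k.+2 <= C * L ^+ k.+2].
  by move=> k; case: (H k).
elim: k => [|k [h0 h1 h2]].
  by split; [exact: le_trans b0 (LX _)|exact: le_trans b1 (LX _)|exact: le_trans b2 (LX _)].
split=> //; rewrite (le_trans (bS k))//.
rewrite (le_trans (lerD (ler_wpM2l (exprn_ge0 _ s0) h0) (ler_wpM2l a0 h1)))//.
have -> : s ^+ 3 * (C * L ^+ k) + a * (C * L ^+ k.+1) = C * L ^+ k * (s ^+ 3 + a * L).
  by rewrite [L ^+ k.+1]exprS; ring.
have -> : C * L ^+ k.+3 = C * L ^+ k * (L ^+ 2 * L) by rewrite !exprS; ring.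
rewrite ler_wpM2l ?mulr_ge0 ?exprn_ge0//.
apply: (@le_trans _ _ (L ^+ 2 * (s + a))).
  rewrite mulrDr lerD//.
    rewrite exprSr ler_wpM2r// lerXn2r ?nnegrE//.
  by rewrite mulrC ler_wpM2r// expr2 ler_peMr.
by rewrite ler_wpM2l ?exprn_ge0.
Qed.

Lemma gam_bound a l s k : 0 <= a -> 0 <= s -> cN l <= s ^+ 3 ->
  cN (gam a l k) <= (1 + a + s) ^+ k.
Proof.
move=> a0 s0 ls; rewrite -[leRHS]mul1r.
apply: (@rec3_bound a s (fun k => cN (gam a l k)) 1) => // [|||j].
- by have -> : gam a l 0 = 0 by []; rewrite cN0.
- by have -> : gam a l 1 = 0 by []; rewrite cN0.
- by have -> : gam a l 2 = 1%:C by []; rewrite cN_real normr1.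
- rewrite gamS (le_trans (cNB _ _))// !cNM cN_real (ger0_norm a0) lerD2r.
  by rewrite ler_wpM2r// cN_ge0.
Qed.

Lemma exp_coef (L rho : R) j : 0 <= L -> 0 < rho -> L ^+ j <= expR (L * rho) * (j`!%:R / rho ^+ j).
Proof.
move=> L0 rho0; rewrite mulrA ler_pdivlMr ?exprn_gt0// -exprMn.
by rewrite [leRHS]mulrC expr_le_fact_exp// mulr_ge0// ltW.
Qed.

(** Real and imaginary parts of the k-th derivative in x of G(l, x), kept as real series so that the
    estimates on [TS] apply. *)
Definition GR a l k x : R := TS (fun j => Re (gam a l (k + j)%N)) x.
Definition GI a l k x : R := TS (fun j => Im (gam a l (k + j)%N)) x.
Definition GC a l k x : R[i] := GR a l k x +i* GI a l k x.

(** A crude growth rate, from |l| <= (1 + |l|)^3. It serves convergence and continuity only; the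
    sharp exponential rate comes from the energy. *)
Definition Lam a l : R := 1 + a + (1 + cN l).

Lemma gam_Lam a l k : 0 <= a -> cN (gam a l k) <= Lam a l ^+ k.
Proof.
move=> a0; apply: gam_bound => //; first by rewrite addr_ge0// cN_ge0.
have h : 1 <= 1 + cN l by rewrite lerDl cN_ge0.
have h0 := le_trans ler01 h.
by rewrite !exprS expr0 mulr1 (le_trans _ (ler_peMr h0 (mulr_ege1 h h)))// lerDr.
Qed.

Lemma Lam_ge0 a l : 0 <= a -> 0 <= Lam a l.
Proof. by move=> a0; rewrite /Lam !addr_ge0// cN_ge0. Qed.

Let coefR a l : 0 <= a ->
  forall j, `|Re (gam a l j)| <= expR (Lam a l * 3) * (j`!%:R / 3 ^+ j).
Proof.
move=> a0 j; apply: le_trans (exp_coef j (Lam_ge0 l a0) _) => //.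
exact: le_trans (Re_le_cN _) (gam_Lam _ _ a0).
Qed.

Let coefI a l : 0 <= a ->
  forall j, `|Im (gam a l j)| <= expR (Lam a l * 3) * (j`!%:R / 3 ^+ j).
Proof.
move=> a0 j; apply: le_trans (exp_coef j (Lam_ge0 l a0) _) => //.
exact: le_trans (Im_le_cN _) (gam_Lam _ _ a0).
Qed.

Let lt23 : 2 < 3 :> R. Proof. by rewrite ltr_nat. Qed.
Let lt02 : 0 < 2 :> R. Proof. by []. Qed.

Lemma GC_cder a l k x : 0 <= a -> `|x| < 2 -> cder (GC a l k) x (GC a l k.+1 x).
Proof.
move=> a0; rewrite ltr_norml => xx.
have xI : x \in `](-2), (2 : R)[ by rewrite in_itv.
split.
  exact: quad_is_derive xI (TS_quad lt02 lt23 k (expR_ge0 _) (coefR l a0)).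
exact: quad_is_derive xI (TS_quad lt02 lt23 k (expR_ge0 _) (coefI l a0)).
Qed.

Lemma TS_lin (g1 g2 g3 : nat -> R) (c1 c2 c3 C1 C2 C3 x : R) :
  asum (fun j => g1 j * mono j x) C1 -> asum (fun j => g2 j * mono j x) C2 ->
  asum (fun j => g3 j * mono j x) C3 ->
  TS (fun j => c1 * g1 j + c2 * g2 j + c3 * g3 j) x = c1 * TS g1 x + c2 * TS g2 x + c3 * TS g3 x.
Proof.
move=> h1 h2 h3; rewrite /TS -(sumRZ _ h1) -(sumRZ _ h2) -(sumRZ _ h3).
rewrite -(sumRD (asumZ c1 h1) (asumZ c2 h2)).
rewrite -(sumRD (asumD (asumZ c1 h1) (asumZ c2 h2)) (asumZ c3 h3)).
by apply: eq_sumR => j; ring.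
Qed.

Lemma GCS a l k x : 0 <= a -> `|x| <= 2 ->
  GC a l k.+3 x = l * GC a l k x - a%:C * GC a l k.+1 x.
Proof.
move=> a0 x2.
have hR k' := TS_asum_le lt02 lt23 k' (expR_ge0 _) (coefR l a0) x2.
have hI k' := TS_asum_le lt02 lt23 k' (expR_ge0 _) (coefI l a0) x2.
have eR : GR a l k.+3 x = Re l * GR a l k x + (- Im l) * GI a l k x + (- a) * GR a l k.+1 x.
  rewrite -(TS_lin _ _ _ (hR k) (hI k) (hR k.+1)) /GR; congr TS; apply/funext => j.
  by rewrite !addSn gamS ReB !ReM [Re a%:C]/= [Im a%:C]/=; ring.
have eI : GI a l k.+3 x = Re l * GI a l k x + Im l * GR a l k x + (- a) * GI a l k.+1 x.
  rewrite -(TS_lin _ _ _ (hI k) (hR k) (hI k.+1)) /GI; congr TS; apply/funext => j.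
  by rewrite !addSn gamS ImB !ImM [Re a%:C]/= [Im a%:C]/=; ring.
apply/eqP; rewrite eq_complex; apply/andP; split; apply/eqP.
  by rewrite ReB !ReM [LHS]eR -[RHS]/(Re l * GR a l k x - Im l * GI a l k x
    - (a * GR a l k.+1 x - 0 * GI a l k.+1 x)); ring.
by rewrite ImB !ImM [LHS]eI -[RHS]/(Re l * GI a l k x + Im l * GR a l k x
  - (a * GI a l k.+1 x + 0 * GR a l k.+1 x)); ring.
Qed.

Lemma GC0 a l k : GC a l k 0 = gam a l k.
Proof. by rewrite /GC /GR /GI !TS0 addn0; case: (gam a l k). Qed.

Lemma gam_ccont a (lam : R -> R[i]) k : ccont lam -> ccont (fun r => gam a (lam r) k).
Proof.
move=> lc; suff H : [/\ ccont (fun r => gam a (lam r) k), ccont (fun r => gam a (lam r) k.+1)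
  & ccont (fun r => gam a (lam r) k.+2)] by case: H.
elim: k => [|k [h1 h2 h3]]; first by split; exact: ccont_cst.
split=> //; under eq_fun do rewrite gamS -mulNr.
by apply: ccontD; apply: ccontM => //; exact: ccont_cst.
Qed.

(** Continuity in the contour variable: on bounded sets of r the coefficients are dominated by
    powers of one constant. *)
Lemma GC_ccont a (lam : R -> R[i]) k x : 0 <= a -> `|x| <= 2 ->
  (forall L, exists B, forall r, `|r| <= L -> cN (lam r) <= B) ->
  ccont lam -> ccont (fun r => GC a (lam r) k x).
Proof.
move=> a0 x2 lb lc.
have H L : exists M B, asum M B /\ forall j r, `|r| <= L ->
    cN (gam a (lam r) (k + j)%N) * `|mono j x| <= M j.
  have [B HB] := lb L; pose B1 := 1 + a + (1 + `|B|).
  have B10 : 0 <= B1 by rewrite /B1 !addr_ge0.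
  have B1b j : `|B1 ^+ j| <= expR (B1 * 3) * (j`!%:R / 3 ^+ j).
    by rewrite ger0_norm ?exprn_ge0// exp_coef.
  exists (fun j => B1 ^+ (k + j) * (2 ^+ j / j`!%:R)); eexists; split.
    exact: (TS_asum lt02 lt23 k (expR_ge0 (B1 * 3)) B1b).
  move=> j r rL; apply: ler_pM; [exact: cN_ge0|by []| |exact: mono_le].
  apply: le_trans (gam_Lam _ _ a0) _; rewrite lerXn2r ?nnegrE ?Lam_ge0//.
  by rewrite /Lam /B1 lerD2l lerD2l (le_trans (HB r rL))// ler_norm.
split; apply: continuous_sumR => [j r|L].
- by apply: cvgMl; exact: (gam_ccont a (k + j) lc).1.
- have [M [B [MB HM]]] := H L; exists M, B; split => // j r rL.
  by rewrite normrM (le_trans _ (HM j r rL))// ler_wpM2r// Re_le_cN.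
- by apply: cvgMl; exact: (gam_ccont a (k + j) lc).2.
- have [M [B [MB HM]]] := H L; exists M, B; split => // j r rL.
  by rewrite normrM (le_trans _ (HM j r rL))// ler_wpM2r// Im_le_cN.
Qed.

End kernel.

(** * Energy estimate for the kernel *)

Section energy.
Context {R : realType}.

(* The expression is [dEn + K * En] for the energy [En] of G defined below. *)
Lemma energy_sos (r t mu a p0 q0 p1 q1 p2 q2 s : R) : t ^+ 2 = 3 -> s = t * mu ->
  0 <= r -> 0 <= mu -> 0 <= a ->
  0 <= 2 * (p2 * (r ^+ 3 * ((1 - 3 * s ^+ 2) * p0 - (s ^+ 3 - 3 * s) * q0) - a * p1) +
            q2 * (r ^+ 3 * ((1 - 3 * s ^+ 2) * q0 + (s ^+ 3 - 3 * s) * p0) - a * q1)) +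
       2 * (r ^+ 2 * (1 + s ^+ 2) + 1) * (p1 * p2 + q1 * q2) +
       2 * (r ^+ 4 * (1 + s ^+ 2) ^+ 2 + 1) * (p0 * p1 + q0 * q1) +
       ((1 + 3 * mu) * r + a + 2) * (p2 ^+ 2 + q2 ^+ 2 + (r ^+ 2 * (1 + s ^+ 2) + 1) * (p1 ^+ 2 + q1 ^+ 2)
         + (r ^+ 4 * (1 + s ^+ 2) ^+ 2 + 1) * (p0 ^+ 2 + q0 ^+ 2)).
Proof.
move=> t2 sE r0 mu0 a0.
(* These are the parts of X0 = (tau r)^2 G and X1 = tau r G'; put X2 = G''. For a = 0 the system
   reads Xj' = tau r X(j+1), cyclically, and the discrete Fourier transform over the cube roots of
   unity w diagonalises it with eigenvalues tau r w. Adding K cancels the one of real part - kap r;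
   the other two leave squares of weights 1 + mu and 2 mu. All remaining terms are of lower
   order. *)
pose x0 := r ^+ 2 * ((1 - s ^+ 2) * p0 + 2 * s * q0).
pose y0 := r ^+ 2 * ((1 - s ^+ 2) * q0 - 2 * s * p0).
pose x1 := r * (p1 + s * q1).
pose y1 := r * (q1 - s * p1).
have -> : 2 * (p2 * (r ^+ 3 * ((1 - 3 * s ^+ 2) * p0 - (s ^+ 3 - 3 * s) * q0) - a * p1) +
            q2 * (r ^+ 3 * ((1 - 3 * s ^+ 2) * q0 + (s ^+ 3 - 3 * s) * p0) - a * q1)) +
       2 * (r ^+ 2 * (1 + s ^+ 2) + 1) * (p1 * p2 + q1 * q2) +
       2 * (r ^+ 4 * (1 + s ^+ 2) ^+ 2 + 1) * (p0 * p1 + q0 * q1) +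
       ((1 + 3 * mu) * r + a + 2) * (p2 ^+ 2 + q2 ^+ 2 + (r ^+ 2 * (1 + s ^+ 2) + 1) * (p1 ^+ 2 + q1 ^+ 2)
         + (r ^+ 4 * (1 + s ^+ 2) ^+ 2 + 1) * (p0 ^+ 2 + q0 ^+ 2)) =
   r * ((1 + mu) * ((x0 + x1 + p2) ^+ 2 + (y0 + y1 + q2) ^+ 2) +
     2 * mu * ((x0 - x1 / 2 + t / 2 * y1 - p2 / 2 - t / 2 * q2) ^+ 2 +
               (y0 - y1 / 2 - t / 2 * x1 - q2 / 2 + t / 2 * p2) ^+ 2)) +
   a * ((p2 - p1) ^+ 2 + (q2 - q1) ^+ 2 + r ^+ 2 * (1 + s ^+ 2) * (p1 ^+ 2 + q1 ^+ 2) +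
     (r ^+ 4 * (1 + s ^+ 2) ^+ 2 + 1) * (p0 ^+ 2 + q0 ^+ 2)) +
   (1 + 3 * mu) * r * (p1 ^+ 2 + q1 ^+ 2 + p0 ^+ 2 + q0 ^+ 2) +
   ((p1 + p2) ^+ 2 + (q1 + q2) ^+ 2 + (p0 + p1) ^+ 2 + (q0 + q1) ^+ 2 + p2 ^+ 2 + q2 ^+ 2 + p0 ^+ 2 + q0 ^+ 2 +
     2 * r ^+ 2 * (1 + s ^+ 2) * (p1 ^+ 2 + q1 ^+ 2) + 2 * r ^+ 4 * (1 + s ^+ 2) ^+ 2 * (p0 ^+ 2 + q0 ^+ 2)).
  by rewrite /x0 /y0 /x1 /y1 sE; field: t2.
by do ![exact: sqr_ge0 | exact: exprn_ge0 | apply: addr_ge0 | apply: mulr_ge0 | done].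
Qed.

Lemma is_derive_sq2 (p q : R -> R) (x p' q' : R) : is_derive x 1 p p' -> is_derive x 1 q q' ->
  is_derive x 1 (fun y => p y ^+ 2 + q y ^+ 2) (2 * (p x * p' + q x * q')).
Proof.
move=> dp dq; apply: (is_derive_eq (is_deriveD (is_deriveM dp dp) (is_deriveM dq dq))).
by rewrite /GRing.scale/=; ring.
Qed.

Variables (a mu r : R).
Hypotheses (a0 : 0 <= a) (mu0 : 0 <= mu) (r0 : 0 <= r).

(* For mu > 1/3 the real part of (tau r)^3 is negative, while the growth rate [kap]
   of G on [-1, 0] tends to 1 as mu tends to 1/3. *)
Definition tau : R[i] := 1 +i* (- (Num.sqrt 3 * mu)).
Definition lamr (q : R) : R[i] := (tau * q%:C) ^+ 3.

Let s := Num.sqrt 3 * mu.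
Let sqrt3 : (Num.sqrt 3 : R) ^+ 2 = 3. Proof. by rewrite sqr_sqrtr. Qed.

Lemma Re_lamr q : Re (lamr q) = q ^+ 3 * (1 - 3 * s ^+ 2).
Proof.
rewrite /lamr !exprS expr0 mulr1 !(ReM, ImM) /= -/s.
by move: s => s'; ring.
Qed.

Lemma Im_lamr q : Im (lamr q) = q ^+ 3 * (s ^+ 3 - 3 * s).
Proof.
rewrite /lamr !exprS expr0 mulr1 !(ReM, ImM) /= -/s.
by move: s => s'; ring.
Qed.

Local Notation l := (lamr r).
Local Notation p k := (GR a l k).
Local Notation q k := (GI a l k).
(** This is 2 kap r plus a constant, twice the rate because [En] is quadratic. The [+ 1] in [c1] and
    [c0] keep G and G' under control when r is small, and the constant in [K] pays for them. *)
Let K := (1 + 3 * mu) * r + a + 2.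
Let c1 := r ^+ 2 * (1 + s ^+ 2) + 1.
Let c0 := r ^+ 4 * (1 + s ^+ 2) ^+ 2 + 1.
Let En (x : R) := (p 2 x ^+ 2 + q 2 x ^+ 2) + c1 * (p 1 x ^+ 2 + q 1 x ^+ 2)
  + c0 * (p 0 x ^+ 2 + q 0 x ^+ 2).
Let dEn (x : R) := 2 * (p 2 x * p 3 x + q 2 x * q 3 x) + c1 * (2 * (p 1 x * p 2 x + q 1 x * q 2 x))
  + c0 * (2 * (p 0 x * p 1 x + q 0 x * q 1 x)).

Lemma energy_derive (x : R) : `|x| < 2 -> is_derive x 1 (fun y => En y * expR (K * y)) ((dEn x + K * En x) * expR (K * x)).
Proof.
move=> x2.
have d k := GC_cder l k a0 x2.
have dq k := is_derive_sq2 (d k).1 (d k).2.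
have dK : is_derive x 1 ( *%R K) K.
  by apply: (is_derive_eq (is_deriveZ K (is_derive_id x 1))); rewrite /GRing.scale/= mulr1.
have de := is_derive1_comp (is_derive_expR (K * x)) dK.
have dE := is_deriveD (is_deriveD (dq 2%N) (is_deriveZ c1 (dq 1%N))) (is_deriveZ c0 (dq 0%N)).
apply: (is_derive_eq (is_deriveM dE de)).
rewrite -[LHS]/(En x * (expR (K * x) * K) + expR (K * x) * dEn x).
by move: (En x) (dEn x) (expR (K * x)) => u v w; move: K => K'; ring.
Qed.

Lemma energy_dissip (x : R) : `|x| < 2 -> 0 <= dEn x + K * En x.
Proof.
move=> x2; have := GCS l 0 a0 (ltW x2) => /eqP; rewrite eq_complex => /andP[/eqP h1 /eqP h2].
rewrite ReB (ReM l) (ReM a%:C) Re_lamr Im_lamr in h1.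
rewrite ImB (ImM l) (ImM a%:C) Re_lamr Im_lamr in h2.
rewrite -[LHS]/(p 3 x) in h1; rewrite -[LHS]/(q 3 x) in h2.
have := @energy_sos r (Num.sqrt 3) mu a (p 0 x) (q 0 x) (p 1 x) (q 1 x) (p 2 x) (q 2 x) s sqrt3 erefl r0 mu0 a0.
move/le_trans; apply; rewrite le_eqVlt; apply/orP; left; apply/eqP.
rewrite /dEn /En h1 h2 /= /K /c1 /c0; clearbody s.
by ring.
Qed.

(** By [energy_dissip] the function En(y) exp(K y) is nondecreasing, and at y = 0 it equals 1. *)
Lemma energy_le (x : R) : -1 <= x <= 0 -> En x <= expR (K * - x).
Proof.
move=> /andP[x1 x0].
have near2 y : y \in `]x, 0[ -> `|y| < 2.
  rewrite in_itv/= => /andP[xy y0]; rewrite ltr_norml (lt_trans y0)// andbT.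
  by apply: (lt_trans _ xy); apply: (lt_le_trans _ x1); rewrite ltrN2 ltr1n.
have near2' y : y \in `[x, 0] -> `|y| < 2.
  rewrite in_itv/= => /andP[xy y0]; rewrite ltr_norml (le_lt_trans y0)// andbT.
  by apply: (lt_le_trans _ xy); apply: (lt_le_trans _ x1); rewrite ltrN2 ltr1n.
have cE : {within `[x, 0], continuous (fun y => En y * expR (K * y))}.
  apply/subspace_continuousP => y yI; apply: cvg_within_filter.
  apply: differentiable_continuous; apply/derivable1_diffP.
  by case: (energy_derive (near2' y yI)).
have [c cI] := MVT_segment x0 (fun y yI => energy_derive (near2 y yI)) cE.
rewrite mulr0 expR0 mulr1 => h.
have E0 : En 0 = 1.
  rewrite /En; have g0 k : p k 0 = Re (gam a l k) by rewrite -GC0.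
  have h0 k : q k 0 = Im (gam a l k) by rewrite -GC0.
  by rewrite !g0 !h0 /= !expr0n/= expr1n !addr0 !mulr0 !addr0.
have : 0 <= En 0 - En x * expR (K * x).
  rewrite h mulr_ge0 ?subr_ge0// mulr_ge0 ?expR_ge0// energy_dissip// near2'//.
by rewrite E0 subr_ge0 -ler_pdivlMr ?expR_gt0// mulrN expRN div1r.
Qed.

Definition kap : R := (1 + 3 * mu) / 2.

Lemma GC_bound k (x : R) : -1 <= x <= 0 ->
  cN (GC a l k x) <= expR (kap * r + (a + 2) / 2) * (1 + a + cN tau * r) ^+ k.
Proof.
move=> xI; have [x1 x0] := andP xI.
have x2 : `|x| <= 2 by rewrite ler_norml (le_trans x0)// (le_trans _ x1)// lerN2 ler1n.
have K0 : 0 <= K by rewrite /K !addr_ge0// mulr_ge0// addr_ge0// mulr_ge0.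
have EK : En x <= expR (kap * r + (a + 2) / 2) ^+ 2.
  apply: le_trans (energy_le xI) _; rewrite -expRM_natl ler_expR.
  have -> : 2%:R * (kap * r + (a + 2) / 2) = K * 1 by rewrite /kap /K; field.
  by rewrite ler_wpM2l// lerNl.
have sqN (z : R[i]) (B : R) : 0 <= B -> Re z ^+ 2 + Im z ^+ 2 <= B ^+ 2 -> cN z <= B.
  by move=> B0 h; case: z h => u v /= h; rewrite -(ger0_norm B0) -sqrtr_sqr ler_wsqrtr.
have s10 : 0 <= r ^+ 2 * (1 + s ^+ 2).
  by rewrite mulr_ge0 ?sqr_ge0// addr_ge0 ?sqr_ge0.
have s20 : 0 <= r ^+ 4 * (1 + s ^+ 2) ^+ 2.
  by rewrite mulr_ge0 ?sqr_ge0// exprn_ge0.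
have q0 k' : 0 <= p k' x ^+ 2 + q k' x ^+ 2 by rewrite addr_ge0 ?sqr_ge0.
have m1 := mulr_ge0 s10 (q0 1%N); have m2 := mulr_ge0 s20 (q0 0%N).
have base j : (j < 3)%N -> cN (GC a l j x) <= expR (kap * r + (a + 2) / 2).
  move=> j3; apply: sqN; first exact: expR_ge0.
  apply: le_trans EK; rewrite /En /c1 /c0.
  have := q0 0%N; have := q0 1%N; have := q0 2%N.
  move: m1 m2; rewrite !mulrDl !mul1r.
  case: j j3 => [|[|[|//]]] _; rewrite [Re _]/= [Im _]/=; clearbody s.
  - by move=> *; lra.
  - by move=> *; lra.
  - by move=> *; lra.
apply: (@rec3_bound _ a (cN tau * r) (fun k => cN (GC a l k x))) => //.
- by rewrite mulr_ge0// cN_ge0.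
- exact: base.
- exact: base.
- exact: base.
- move=> j; rewrite GCS// (le_trans (cNB _ _))// (cNM l) (cNM a%:C) cN_real (ger0_norm a0) lerD2r.
  by rewrite /lamr cNX cNM cN_real (ger0_norm r0).
Qed.

End energy.

(** * The contour density *)

Section complex_integral.
Context {R : realType}.
Implicit Types (f g : R -> R[i]).

Definition CInt (a b : R) f : R[i] :=
  Int a b (fun x => Re (f x)) +i* Int a b (fun x => Im (f x)).

Lemma ccont_withinR f (a b : R) : ccont f -> {within `[a, b], continuous (fun x => Re (f x))}.
Proof. by case=> h _; exact: continuous_subspaceT. Qed.

Lemma ccont_withinI f (a b : R) : ccont f -> {within `[a, b], continuous (fun x => Im (f x))}.
Proof. by case=> _ h; exact: continuous_subspaceT. Qed.

Lemma CIntZ (a b : R) c f : ccont f -> CInt a b (fun x => c * f x) = c * CInt a b f.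
Proof.
move=> fc; have f1 := ccont_withinR (a := a) (b := b) fc.
have f2 := ccont_withinI (a := a) (b := b) fc.
have w (u : R -> R) k : {within `[a, b], continuous u} ->
    {within `[a, b], continuous (fun x => k * u x)}.
  move=> uc; apply/subspace_continuousP => x xA; apply: cvgMr.
  by have /subspace_continuousP := uc; apply.
apply/eqP; rewrite eq_complex; apply/andP; split; apply/eqP.
  rewrite ReM -(IntZ _ f1) -(IntZ _ f2) -IntB; [|exact: w|exact: w].
  by apply: eq_Int => x _; rewrite ReM.
rewrite ImM -(IntZ _ f1) -(IntZ _ f2) -IntD; [|exact: w|exact: w].
by apply: eq_Int => x _; rewrite ImM.
Qed.

Lemma CInt_le (a b : R) f M : a <= b -> ccont f -> (forall x, a <= x <= b -> cN (f x) <= M) ->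
  cN (CInt a b f) <= 2 * (M * (b - a)).
Proof.
move=> ab fc fM; apply: le_trans (cN_le_ReIm _) _.
have -> : 2 * (M * (b - a)) = M * (b - a) + M * (b - a) by ring.
by apply: lerD; apply: Int_le_bound => //;
  [exact: ccont_withinR|move=> x /fM|exact: ccont_withinI|move=> x /fM]; apply: le_trans;
  [exact: Re_le_cN|exact: Im_le_cN].
Qed.

(** Differentiation under the integral sign: the bound on the second derivative gives remainders
    uniform in s, and these integrate. *)
Lemma Int_derive (a b : R) (F F1 F2 : R -> R -> R) : a <= b ->
  (forall r, {within `[a, b], continuous (F r)}) ->
  (forall r, {within `[a, b], continuous (F1 r)}) ->
  (forall (r : R) s, a <= s <= b -> is_derive r 1 (F ^~ s) (F1 r s)) ->
  (forall (r : R) s, a <= s <= b -> is_derive r 1 (F1 ^~ s) (F2 r s)) ->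
  (forall L, exists M, forall r s, `|r| <= L -> a <= s <= b -> `|F2 r s| <= M) ->
  forall r : R, is_derive r 1 (fun r => Int a b (F r)) (Int a b (F1 r)).
Proof.
move=> ab Fc F1c dF dF1 F2b r; have [M HM] := F2b (`|r| + 1).
have rI : r \in `](- (`|r| + 1)), (`|r| + 1)[ by rewrite in_itv/= -ltr_norml ltrDl.
apply: (@quad_is_derive _ _ _ _ (fun r => Int a b (F1 r)) (M * (b - a)) r rI).
apply: Int_quad => // s sab.
have h1 x : `[- (`|r| + 1), `|r| + 1]%classic x -> is_derive x 1 (F ^~ s) (F1 x s).
  by move=> _; exact: dF.
have h2 x : `[- (`|r| + 1), `|r| + 1]%classic x -> is_derive x 1 (F1 ^~ s) (F2 x s).
  by move=> _; exact: dF1.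
apply: (deriv_quad h1 h2) => x xI.
by apply: HM => //; exact: itvN_norm.
Qed.

Lemma CInt_cder (a b : R) (F F1 F2 : R -> R -> R[i]) : a <= b ->
  (forall r, ccont (F r)) -> (forall r, ccont (F1 r)) ->
  (forall r s, a <= s <= b -> cder (F ^~ s) r (F1 r s)) ->
  (forall r s, a <= s <= b -> cder (F1 ^~ s) r (F2 r s)) ->
  (forall L, exists M, forall r s, `|r| <= L -> a <= s <= b -> cN (F2 r s) <= M) ->
  forall r, cder (fun r => CInt a b (F r)) r (CInt a b (F1 r)).
Proof.
move=> ab Fc F1c dF dF1 F2b r; split.
  apply: (@Int_derive a b (fun r s => Re (F r s)) (fun r s => Re (F1 r s)) (fun r s => Re (F2 r s))) => //.
  - by move=> r'; exact: ccont_withinR.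
  - by move=> r'; exact: ccont_withinR.
  - by move=> r' s sab; exact: (dF r' s sab).1.
  - by move=> r' s sab; exact: (dF1 r' s sab).1.
  - move=> L; have [M HM] := F2b L; exists M => r' s rL sab.
    by rewrite (le_trans (Re_le_cN _))// HM.
apply: (@Int_derive a b (fun r s => Im (F r s)) (fun r s => Im (F1 r s)) (fun r s => Im (F2 r s))) => //.
- by move=> r'; exact: ccont_withinI.
- by move=> r'; exact: ccont_withinI.
- by move=> r' s sab; exact: (dF r' s sab).2.
- by move=> r' s sab; exact: (dF1 r' s sab).2.
- move=> L; have [M HM] := F2b L; exists M => r' s rL sab.
  by rewrite (le_trans (Im_le_cN _))// HM.
Qed.

End complex_integral.

(** * Primitives of r^m exp(-p r) *)

Section exponential_moments.
Context {R : realType}.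
Implicit Types (p : R[i]) (r : R).

Definition ee p (m : nat) r : R[i] := (r ^+ m)%:C * cexp (- Re p * r) (- Im p * r).

(** The primitive of [ee p m] that decays at infinity, by parts. Minus its value at 0 is the moment
    m! / p^(m+1). *)
Fixpoint EE p (m : nat) r : R[i] :=
  if m is j.+1 then p^-1 * ((j.+1%:R)%:C * EE p j r - ee p m r) else - (p^-1 * ee p 0 r).

Lemma ee_cder p m r : cder (ee p m) r
  ((if m is j.+1 then (j.+1%:R)%:C * ee p j r else 0) - p * ee p m r).
Proof.
have dX : is_derive r 1 (fun x : R => x ^+ m) (m%:R * r ^+ m.-1).
  have -> : (fun x : R => x ^+ m) = (id : R -> R) ^+ m.
    by apply/funext => y; rewrite exprfctE.
  apply: is_derive_eq; case: m => [|j]; first by rewrite ?(mul0r, scale0r, scaler0).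
  by rewrite /GRing.scale/= mulr1 mulr_natl.
apply: (cder_eq (cderM (cder_real dX) (cder_cexp (- Re p) (- Im p) r))).
rewrite /ee; have -> : (- Re p) +i* (- Im p) = - p by case: p.
case: m {dX} => [|j] /=; first by rewrite mul0r; ring.
by rewrite rmorphM/= exprS; move: (cexp _ _) => e; rewrite rmorphM/=; ring.
Qed.

Lemma EE_cder p m r : p != 0 -> cder (EE p m) r (ee p m r).
Proof.
move=> p0; elim: m => [|m IH].
  apply: cder_ext (cder_eq (cderZ (- p^-1) (ee_cder p 0 r)) _).
    by move=> y /=; rewrite mulNr.
  by rewrite sub0r mulrNN mulrA mulVf// mul1r.
have h := cderZ p^-1 (cderD (cderZ (m.+1%:R)%:C IH) (cderZ (-1) (ee_cder p m.+1 r))).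
apply: cder_ext (cder_eq h _); first by move=> y /=; rewrite mulN1r.
by move: (ee p m r) (ee p m.+1 r) => u v /=; field.
Qed.

Lemma EE0 p m : p != 0 -> EE p m 0 = - (m`!%:R)%:C / p ^+ m.+1.
Proof.
move=> p0; elim: m => [|m IH].
  by rewrite /= /ee expr0 !mulr0 cexp0 fact0 expr1 mulNr; congr (- _); ring.
rewrite [LHS]/= IH /ee expr0n/= mul0r subr0 factS natrM rmorphM/=.
by rewrite [p ^+ m.+2]exprS; field; rewrite p0 expf_neq0.
Qed.

Lemma cN_ee p m r (P c : R) : 0 <= r -> c < P -> P <= Re p ->
  cN (ee p m r) <= m`!%:R / (P - c) ^+ m * expR (- (c * r)).
Proof.
move=> r0 cP Pp; have d0 : 0 < P - c by rewrite subr_gt0.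
rewrite /ee cNM cN_real cN_cexp (ger0_norm (exprn_ge0 _ r0)).
have h := @expr_le_fact_exp _ ((P - c) * r) m (mulr_ge0 (ltW d0) r0).
rewrite exprMn mulrC -ler_pdivlMr ?exprn_gt0// mulrAC in h.
apply: le_trans (ler_wpM2r (expR_ge0 _) h) _.
rewrite -[leLHS]mulrA ler_wpM2l ?divr_ge0 ?exprn_ge0 ?(ltW d0)//.
rewrite -expRD ler_expR mulrBl mulNr.
have : P * r <= Re p * r by rewrite ler_wpM2r.
by move: (Re p * r) (P * r) (c * r) => u v w; lra.
Qed.

Lemma cN_EE (P c : R) m : 0 < P -> c < P -> exists B, forall p r, 0 <= r -> P <= Re p ->
  cN (EE p m r) <= B * expR (- (c * r)).
Proof.
move=> P0 cP.
have pV p : P <= Re p -> cN p^-1 <= P^-1.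
  move=> Pp; rewrite cNV lef_pV2 ?posrE//.
    by apply: le_trans Pp _; apply: le_trans (ler_norm _) (Re_le_cN _).
  by apply: lt_le_trans P0 _; apply: le_trans Pp _; apply: le_trans (ler_norm _) (Re_le_cN _).
elim: m => [|m [B IH]].
  exists (P^-1 * (0`!%:R / (P - c) ^+ 0)) => p r r0 Pp.
  rewrite [EE _ _ _]/= cNN cNM -mulrA; apply: ler_pM; rewrite ?cN_ge0//; first exact: pV.
  exact: cN_ee.
exists (P^-1 * (m.+1%:R * B + (m.+1)`!%:R / (P - c) ^+ m.+1)) => p r r0 Pp.
rewrite [EE _ _ _]/= cNM -mulrA; apply: ler_pM; rewrite ?cN_ge0//; first exact: pV.
rewrite (le_trans (cNB _ _))// mulrDl lerD//; last exact: cN_ee.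
by rewrite cNM cN_real ger0_norm// -mulrA ler_wpM2l// IH.
Qed.

End exponential_moments.

(** * Trigonometry on the arc from 0 to pi/3 *)

Section third_of_pi.
Context {R : realType}.

Lemma pi3_gt0 : 0 < pi / 3 :> R. Proof. by rewrite divr_gt0// pi_gt0. Qed.

Lemma cos_pi3 : cos (pi / 3) = 1 / 2 :> R.
Proof.
have c0 : 0 < cos (pi / 3) :> R.
  apply: cos_gt0_pihalf; have := pi_gt0 R; move: (pi : R) => p p0.
  by apply/andP; split; lra.
have e : cos (pi / 3 + (pi / 3 + pi / 3)) = -1 :> R.
  by rewrite -cospi; congr cos; field.
have s2 := cos2Dsin2 (pi / 3 : R).
rewrite cosD (sinD (pi / 3) (pi / 3)) (cosD (pi / 3) (pi / 3)) in e.
move: (cos _) (sin _) c0 e s2 => c s c0 e s2.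
(* The triple angle formula 4 c^3 - 3 c = cos pi = -1, factored; c > 0 excludes the root -1. *)
have : (c + 1) * (2 * c - 1) ^+ 2 = 0.
  have -> : (c + 1) * (2 * c - 1) ^+ 2 = 1 + (c * (c * c - s * s) - s * (s * c + c * s)) - 3 * c * (1 - (c ^+ 2 + s ^+ 2)) by ring.
  by rewrite e s2; ring.
move=> /eqP; rewrite mulf_eq0 expf_eq0/= gt_eqF ?addr_gt0//= => /eqP h.
by lra.
Qed.

Lemma cos_third (b : R) : 0 <= b <= pi / 3 -> 1 / 2 <= cos b.
Proof.
move=> /andP[b0 bp]; rewrite -cos_pi3 leNgt ltr_cos ?in_itv/=.
- by rewrite -leNgt.
- have := pi_gt0 R; move: (pi : R) b0 bp => p b0 bp p0; apply/andP; split; lra.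
- have := pi_gt0 R; move: (pi : R) b0 bp => p b0 bp p0; apply/andP; split; lra.
Qed.

(** For s = 1 / sqrt 3 the right-hand side is (2 / sqrt 3) cos (b - pi/6), which reaches 1 exactly
    at the ends of the arc. In the proof, cos b >= 1/2 yields (1 - cos b)^2 <= (1 - cos b ^2) /
    3. *)
Lemma cos_sin_third (b s : R) : 0 <= b <= pi / 3 -> 0 <= s -> 1 <= 3 * s ^+ 2 ->
  1 <= cos b + s * sin b.
Proof.
move=> bI s0 s1; have c2 := cos_third bI.
have sb0 : 0 <= sin b.
  apply: sin_ge0_pi; case/andP: bI => b0 bp; have := pi_gt0 R.
  by move: (pi : R) b0 bp => p b0 bp p0; apply/andP; split; lra.
have c1 := cos_le1 b; have e := cos2Dsin2 b.
move: (cos b) (sin b) c2 sb0 c1 e => c q c2 q0 c1 e {bI}.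
have h : (1 - c) ^+ 2 <= (s * q) ^+ 2.
  have -> : (s * q) ^+ 2 = s ^+ 2 * (1 - c ^+ 2) by rewrite -e; ring.
  have h1 : 3^-1 <= s ^+ 2 by lra.
  apply: (@le_trans _ _ (3^-1 * (1 - c ^+ 2))); first by nra.
  by rewrite ler_wpM2r//; nra.
have : 1 - c <= s * q.
  by rewrite -(ler_pXn2r (n := 2))// nnegrE ?mulr_ge0//; lra.
by lra.
Qed.

Lemma is_derive_sin_lin (k : R) (x : R) : k != 0 ->
  is_derive x 1 (fun y => sin (k * y) / k) (cos (k * x)).
Proof.
move=> k0; have dk : is_derive x 1 ( *%R k) k.
  by apply: (is_derive_eq (is_deriveZ k (is_derive_id x 1))); rewrite /GRing.scale/= mulr1.
have h := is_deriveZ k^-1 (is_derive1_comp (is_derive_sin (k * x)) dk).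
have -> : (fun y => sin (k * y) / k) = k^-1 \*: (sin \o *%R k).
  by apply/funext => y; rewrite /= /GRing.scale/= mulrC.
by apply: (is_derive_eq h); rewrite /GRing.scale/= mulrCA mulVf// mulr1.
Qed.

Lemma sin_natpi n : sin (n%:R * pi) = 0 :> R.
Proof.
elim: n => [|n IH]; first by rewrite mul0r sin0.
by rewrite -natr1 mulrDl mul1r sinDpi IH oppr0.
Qed.

Lemma Int_cos3 (j n : nat) :
  Int 0 (pi / 3) (fun b => cos ((3%:R * (j%:R - n%:R)) * b)) = if j == n then pi / 3 else 0 :> R.
Proof.
have [->|jn] := eqVneq j n.
  rewrite -[RHS](_ : 1 * (pi / 3 - 0) = _); last by rewrite mul1r subr0.
  rewrite -(Int_cst 1 (ltW pi3_gt0)); apply: eq_Int => x _.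
  by rewrite subrr mulr0 mul0r cos0.
have k0 : 3%:R * (j%:R - n%:R) != 0 :> R by rewrite mulf_neq0// subr_eq0 eqr_nat.
rewrite (Int_FTC (ltW pi3_gt0) _ (fun x => is_derive_sin_lin x k0)).
  have -> : 3%:R * (j%:R - n%:R) * (pi / 3) = (j%:R * pi - n%:R * pi) :> R by field.
  by rewrite mulr0 sin0 mul0r sinB !sin_natpi mulr0 !mul0r subrr mul0r subr0.
apply: continuous_subspaceT => x; apply: continuous_comp; last exact: continuous_cos.
by apply: cvgMr; exact: cvg_id.
Qed.

End third_of_pi.

Lemma sumR_delta {R : realType} (v : nat -> R) n : sumR (fun j => if j == n then v j else 0) = v n.
Proof.
apply: sumR_cvg; apply/cvgrPdist_lt => e e0; exists n.+1 => // N /= nN.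
rewrite seriesEord/= -big_mkcond/= (big_pred1 (Ordinal nN)); last first.
  by move=> i; rewrite /= -val_eqE.
by rewrite subrr normr0.
Qed.

(** * A density with prescribed moments *)

Section density.
Context {R : realType}.
Variables (mu P H c : R) (A : nat -> R).
Hypotheses (mu3 : 1 < 3 * mu) (c0 : 0 < c) (cP : c < P).
Hypothesis AH : asum (fun m => A m * P ^+ (3 * m + 3)) H.

Let P0 : 0 < P := lt_trans c0 cP.
Local Notation tau := (tau mu).

Definition xi (b : R) : R[i] := P%:C * cexp 0 b.
(** The series sum A_m z^(3m+3) on the circle |z| = P. Real coefficients and exponents divisible by
    3 allow its coefficients to be recovered from one sixth of the circle. *)
Definition hh (b : R) : R[i] :=
  sumR (fun m => A m * Re (xi b ^+ (3 * m + 3))) +i* sumR (fun m => A m * Im (xi b ^+ (3 * m + 3))).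
Definition pp (b : R) : R[i] := xi b * tau.

Lemma xiX b n : xi b ^+ n = (P ^+ n)%:C * cexp 0 (n%:R * b).
Proof. by rewrite /xi exprMn cexpX mulr0 rmorphXn. Qed.

Lemma cN_xiX b n : cN (xi b ^+ n) = P ^+ n.
Proof. by rewrite xiX cNM cN_real cN_cexp expR0 mulr1 ger0_norm// exprn_ge0// ltW. Qed.

Lemma xi_ccont : ccont xi.
Proof.
apply: ccontM; first exact: ccont_cst.
by apply: ccont_cexp => x; [exact: cvg_cst|exact: cvg_id].
Qed.

Lemma pp_ccont : ccont pp.
Proof. by apply: ccontM; [exact: xi_ccont|exact: ccont_cst]. Qed.

Let hR b m : `|A m * Re (xi b ^+ (3 * m + 3))| <= `|A m * P ^+ (3 * m + 3)|.
Proof.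
rewrite !normrM ler_wpM2l// (le_trans (Re_le_cN _))// cN_xiX.
exact: ler_norm.
Qed.

Let hI b m : `|A m * Im (xi b ^+ (3 * m + 3))| <= `|A m * P ^+ (3 * m + 3)|.
Proof.
rewrite !normrM ler_wpM2l// (le_trans (Im_le_cN _))// cN_xiX.
exact: ler_norm.
Qed.

Let AH' : asum (fun m => `|A m * P ^+ (3 * m + 3)|) H.
Proof. by move=> n; under eq_bigr do rewrite normr_id; exact: AH. Qed.

Lemma hh_ccont : ccont hh.
Proof.
split; apply: continuous_sumR => [m|L].
- by move=> b; apply: cvgMr; exact: (ccontX (3 * m + 3) xi_ccont).1.
- by exists (fun m => `|A m * P ^+ (3 * m + 3)|), H; split => // j b _; exact: hR.
- by move=> b; apply: cvgMr; exact: (ccontX (3 * m + 3) xi_ccont).2.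
- by exists (fun m => `|A m * P ^+ (3 * m + 3)|), H; split => // j b _; exact: hI.
Qed.

Lemma hh_le b : cN (hh b) <= 2 * H.
Proof.
apply: le_trans (cN_le_ReIm _) _; have -> : 2 * H = H + H by ring.
by apply: lerD; apply: asum_le; [exact: asum_dom (hR b) AH'|exact: asum_dom (hI b) AH'].
Qed.

(** Here 3 mu > 1 meets the choice of the arc: every exponential entering [Wb] decays at least like
    exp(- P r). *)
Lemma Re_pp_ge b : 0 <= b <= pi / 3 -> P <= Re (pp b).
Proof.
move=> bI; have -> : Re (pp b) = P * (cos b + Num.sqrt 3 * mu * sin b).
  by rewrite /pp /xi !(ReM, ImM) /= expR0; move: (Num.sqrt 3) => t; ring.
rewrite ler_peMr ?(ltW P0)// cos_sin_third//.
  rewrite mulr_ge0 ?sqrtr_ge0// ltW// -(pmulr_rgt0 mu (ltr0n R 3)).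
  exact: lt_trans ltr01 mu3.
rewrite exprMn sqr_sqrtr//; have -> : 3 * (3 * mu ^+ 2) = (3 * mu) ^+ 2 by ring.
exact: exprn_ege1 (ltW mu3).
Qed.

Lemma pp_neq0 b : 0 <= b <= pi / 3 -> pp b != 0.
Proof.
move=> bI; apply/negP => /eqP h; have := Re_pp_ge bI; rewrite h /=.
by rewrite leNgt P0.
Qed.

Lemma cN_pp b : cN (pp b) = P * cN tau.
Proof. by rewrite /pp cNM -[xi b]expr1 cN_xiX expr1. Qed.

Lemma ee_ccont m r : ccont (fun b => ee (pp b) m r).
Proof.
apply: ccontM; first exact: ccont_cst.
apply: ccont_cexp => b; apply: cvgMl; apply: cvgN; first exact: pp_ccont.1.
exact: pp_ccont.2.
Qed.

Lemma tau_neq0 : tau != 0.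
Proof. by rewrite eq_complex/= oner_eq0. Qed.

Lemma xiV b : (xi b)^-1 = (P^-1)%:C * cexp 0 (- b).
Proof. by rewrite /xi invfM cexpV oppr0 fmorphV. Qed.

Lemma ppV_ccont : ccont (fun b => (pp b)^-1).
Proof.
under eq_fun do rewrite /pp invfM xiV.
apply: ccontM; last exact: ccont_cst.
apply: ccontM; first exact: ccont_cst.
by apply: ccont_cexp => b; [exact: cvg_cst|apply: cvgN; exact: cvg_id].
Qed.

Lemma EE_ccont m r : ccont (fun b => EE (pp b) m r).
Proof.
elim: m => [|m IH] /=.
  under eq_fun do rewrite -mulNr -mulN1r.
  apply: ccontM; last exact: ee_ccont.
  by apply: ccontM; [exact: ccont_cst|exact: ppV_ccont].
apply: ccontM; first exact: ppV_ccont.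
apply: ccontD; first by apply: ccontM; [exact: ccont_cst|].
by under eq_fun do rewrite -mulN1r; apply: ccontM; [exact: ccont_cst|exact: ee_ccont].
Qed.

Definition Wb (r : R) : R[i] := CInt 0 (pi / 3) (fun b => hh b * ee (pp b) 0 r).

Lemma cN_ee_le (p : R[i]) (m : nat) (r L Q : R) : `|r| <= L -> cN p <= Q -> cN (ee p m r) <= L ^+ m * expR (Q * L).
Proof.
move=> rL pQ; have L0 := le_trans (normr_ge0 _) rL.
rewrite /ee cNM cN_real cN_cexp; apply: ler_pM => //.
  by rewrite normrX lerXn2r// nnegrE.
rewrite ler_expR (le_trans (ler_norm _))// normrM normrN ler_pM//.
by rewrite (le_trans (Re_le_cN _)).
Qed.

(** Continuity comes from differentiability under the integral sign, through [CInt_cder]. *)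
Lemma Wb_ccont : ccont Wb.
Proof.
have h2 := hh_ccont; have h0 := ltW (@pi3_gt0 R).
apply: (@cder_ccont _ _ (fun r => CInt 0 (pi / 3) (fun b => hh b * (0 - pp b * ee (pp b) 0 r)))).
have hF r : ccont (fun b => hh b * ee (pp b) 0 r).
  by apply: ccontM => //; exact: ee_ccont.
have hF1 r : ccont (fun b => hh b * (0 - pp b * ee (pp b) 0 r)).
  apply: ccontM => //; under eq_fun do rewrite sub0r -mulNr.
  apply: ccontM; last exact: ee_ccont.
  by under eq_fun do rewrite -mulN1r; apply: ccontM; [exact: ccont_cst|exact: pp_ccont].
have d1 r b : 0 <= b <= pi / 3 -> cder (fun r => hh b * ee (pp b) 0 r) r (hh b * (0 - pp b * ee (pp b) 0 r)).
  by move=> _; exact: cderZ (ee_cder (pp b) 0 r).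
have d2 r b : 0 <= b <= pi / 3 -> cder (fun r => hh b * (0 - pp b * ee (pp b) 0 r)) r
    (hh b * (- pp b * (0 - pp b * ee (pp b) 0 r))).
  move=> _; apply: cderZ; have h := cderZ (- pp b) (ee_cder (pp b) 0 r).
  by apply: cder_ext h => y; rewrite sub0r mulNr.
have bd L : exists M, forall r b, `|r| <= L -> 0 <= b <= pi / 3 ->
    cN (hh b * (- pp b * (0 - pp b * ee (pp b) 0 r))) <= M.
  exists (2 * H * (P * cN tau * (P * cN tau * (L ^+ 0 * expR (P * cN tau * L))))).
  move=> r b rL _; rewrite cNM; apply: ler_pM; [exact: cN_ge0|exact: cN_ge0|exact: hh_le|].
  have PT : 0 <= P * cN tau by rewrite mulr_ge0 ?cN_ge0 ?(ltW P0).
  rewrite cNM cNN cN_pp ler_wpM2l// sub0r cNN cNM cN_pp ler_wpM2l//.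
  by apply: cN_ee_le => //; rewrite cN_pp.
exact: (@CInt_cder R 0 (pi / 3) (fun r b => hh b * ee (pp b) 0 r)
   (fun r b => hh b * (0 - pp b * ee (pp b) 0 r)) _ h0 hF hF1 d1 d2 bd).
Qed.

Lemma cN_Wb r : 0 <= r -> cN (Wb r) <= 2 * (2 * H * expR (- (P * r)) * (pi / 3 - 0)).
Proof.
move=> r0; apply: CInt_le; first exact: ltW pi3_gt0.
  by apply: ccontM; [exact: hh_ccont|exact: ee_ccont].
move=> b bI; rewrite cNM; apply: ler_pM; rewrite ?cN_ge0 ?hh_le//.
rewrite /ee expr0 mul1r cN_cexp ler_expR mulNr lerN2 ler_wpM2r//.
exact: Re_pp_ge.
Qed.

(* Integrating over r first, the orthogonality of the cos (3 j b) on [0, pi / 3] gives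
   the real parts (3 n + 2)! A n for the moments of [W] against the powers of [lamr]. *)
Definition W (r : R) : R[i] := (3 / pi)%:C * tau ^+ 3 * (r ^+ 2)%:C * Wb r.

Lemma continuous_X n : continuous (fun r : R => r ^+ n).
Proof. by move=> r; apply: exprn_continuous. Qed.

Lemma W_ccont : ccont W.
Proof.
apply: ccontM; last exact: Wb_ccont.
by apply: ccontM; [exact: ccont_cst|apply: ccont_real; exact: continuous_X].
Qed.

Lemma lamr_ccont : ccont (lamr mu).
Proof.
apply: ccontX; apply: ccontM; first exact: ccont_cst.
by apply: ccont_real => r; exact: cvg_id.
Qed.

Lemma W_le : exists2 CW, 0 <= CW & forall r, 0 <= r -> cN (W r) <= CW * r ^+ 2 * expR (- (P * r)).
Proof.
have H0 := asum_ge0 AH.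
exists (`|3 / pi| * cN tau ^+ 3 * (2 * (2 * H * (pi / 3 - 0)))).
  by rewrite !mulr_ge0 ?exprn_ge0 ?cN_ge0// subr0 ltW// pi3_gt0.
move=> r r0; rewrite /W (cNM _ (Wb r)) (cNM _ (r ^+ 2)%:C) (cNM _ (tau ^+ 3)) cNX !cN_real (ger0_norm (exprn_ge0 _ r0)).
have h := cN_Wb r0.
have k0 : 0 <= `|3 / pi| * cN tau ^+ 3 * r ^+ 2 by rewrite !mulr_ge0 ?exprn_ge0 ?cN_ge0.
apply: le_trans (ler_wpM2l k0 h) _; rewrite le_eqVlt; apply/orP; left; apply/eqP.
by move: (`|3 / pi|) => q; ring.
Qed.

Lemma W_moment_integrand n r : W r * lamr mu r ^+ n =
  CInt 0 (pi / 3) (fun b => (3 / pi)%:C * tau ^+ (3 * n + 3) * hh b * ee (pp b) (3 * n + 2) r).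
Proof.
have -> : (fun b => (3 / pi)%:C * tau ^+ (3 * n + 3) * hh b * ee (pp b) (3 * n + 2) r) =
  (fun b => ((3 / pi)%:C * tau ^+ (3 * n + 3) * (r ^+ (3 * n + 2))%:C) * (hh b * ee (pp b) 0 r)).
  apply/funext => b; rewrite /ee expr0; move: (cexp _ _) (3 / pi)%:C => e q.
  by rewrite rmorph1; ring.
rewrite CIntZ; last by apply: ccontM; [exact: hh_ccont|exact: ee_ccont].
rewrite -/(Wb r) /W /lamr -exprM exprMn (exprD tau (3 * n)) !rmorphXn/= (exprD _ (3 * n)).
by move: (3 / pi)%:C => q; ring.
Qed.

(** The powers of tau cancel against those in [pp], leaving hh / xi^(3n+3), whose real part is a
    cosine series in 3 (j - n) b. *)
Lemma moment_density_series n b : pp b != 0 ->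
  -1 * Re ((3 / pi)%:C * tau ^+ (3 * n + 3) * hh b *
    (- ((3 * n + 2)`!%:R)%:C / pp b ^+ (3 * n + 2).+1)) =
  sumR (fun j => (3 * n + 2)`!%:R * (3 / pi) * (A j * P ^+ (3 * j + 3) / P ^+ (3 * n + 3)) *
    cos ((3%:R * (j%:R - n%:R)) * b)).
Proof.
move=> pp0; set m := (3 * n + 2)%N.
have -> : m.+1 = (3 * n + 3)%N by rewrite /m -addnS.
have T0 : tau ^+ (3 * n + 3) != 0 by rewrite expf_neq0// tau_neq0.
pose q := (xi b ^+ (3 * n + 3))^-1.
have -> : (3 / pi)%:C * tau ^+ (3 * n + 3) * hh b * (- (m`!%:R)%:C / pp b ^+ (3 * n + 3)) =
    (- (m`!%:R * (3 / pi)))%:C * (hh b * q).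
  rewrite /pp exprMn invfM -/q; move: (3 / pi : R) => u.
  by rewrite rmorphN rmorphM/=; move: (tau ^+ _) T0 => t t0; field.
rewrite ReM [Im _%:C]/= [Re _%:C]/= mul0r subr0 mulN1r mulNr opprK.
have s1 : asum (fun j => A j * Re (xi b ^+ (3 * j + 3))) H by exact: asum_dom (hR b) AH'.
have s2 : asum (fun j => A j * Im (xi b ^+ (3 * j + 3))) H by exact: asum_dom (hI b) AH'.
rewrite ReM [Re (hh b)]/= [Im (hh b)]/= [_ * Re q]mulrC [_ * Im q]mulrC -mulNr.
rewrite -(sumRZ _ s1) -(sumRZ _ s2) -(sumRD (asumZ _ s1) (asumZ _ s2)).
rewrite -(sumRZ _ (asumD (asumZ _ s1) (asumZ _ s2))); apply: eq_sumR => j.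
have qE : q = ((P ^+ (3 * n + 3))^-1)%:C * cexp 0 (- ((3 * n + 3)%:R * b)).
  by rewrite /q xiX invfM cexpV oppr0 fmorphV.
have : Re (xi b ^+ (3 * j + 3) * q) = P ^+ (3 * j + 3) / P ^+ (3 * n + 3) * cos (3%:R * (j%:R - n%:R) * b).
  rewrite qE xiX mulrACA -cexpD addr0 -rmorphM/= expR0 mul1r mul0r subr0.
  have nE k : (3 * k + 3)%:R = 3%:R * k%:R + 3%:R :> R by rewrite natrD natrM.
  by congr (_ * cos _); rewrite !nE; ring.
rewrite ReM => h; move: (m`!%:R * (3 / pi)) => u.
rewrite -[A j * _ / _]mulrA -[RHS]mulrA -[A j * _ * _]mulrA -h; ring.
Qed.

(** No Fubini theorem: integrating [EE] over the arc gives a decaying primitive in r of the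
    integrand, so the integral over r is a value at r = 0. There the orthogonality of the cosines
    keeps only j = n. *)
Lemma moment_density n B : edec c B (fun r => Re (W r * lamr mu r ^+ n)) ->
  Iinf (fun r => Re (W r * lamr mu r ^+ n)) = (3 * n + 2)`!%:R * A n.
Proof.
move=> dW; have h2 := hh_ccont; have h0 := ltW (@pi3_gt0 R).
set m := (3 * n + 2)%N.
pose k : R[i] := (3 / pi)%:C * tau ^+ (3 * n + 3).
have kh : ccont (fun b => k * hh b) by apply: ccontM => //; exact: ccont_cst.
have hF r : ccont (fun b => k * hh b * EE (pp b) m r) by apply: ccontM => //; exact: EE_ccont.
have hF1 r : ccont (fun b => k * hh b * ee (pp b) m r) by apply: ccontM => //; exact: ee_ccont.
have d1 r b : 0 <= b <= pi / 3 -> cder (fun r => k * hh b * EE (pp b) m r) r (k * hh b * ee (pp b) m r).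
  by move=> bI; apply: cderZ; apply: EE_cder; exact: pp_neq0.
have mE : m = (3 * n).+1.+1 by rewrite /m addn2.
have d2 r b : 0 <= b <= pi / 3 -> cder (fun r => k * hh b * ee (pp b) m r) r
    (k * hh b * (((m%:R)%:C * ee (pp b) (3 * n).+1 r) - pp b * ee (pp b) m r)).
  by move=> _; apply: cderZ; rewrite mE; exact: (ee_cder (pp b) (3 * n).+2 r).
have kH b : cN (k * hh b) <= cN k * (2 * H) by rewrite cNM ler_wpM2l ?cN_ge0 ?hh_le.
have PT : 0 <= P * cN tau by rewrite mulr_ge0 ?cN_ge0 ?(ltW P0).
have bd L : exists M, forall r b, `|r| <= L -> 0 <= b <= pi / 3 ->
    cN (k * hh b * (((m%:R)%:C * ee (pp b) (3 * n).+1 r) - pp b * ee (pp b) m r)) <= M.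
  exists (cN k * (2 * H) * (m%:R * (L ^+ (3 * n).+1 * expR (P * cN tau * L)) + P * cN tau * (L ^+ m * expR (P * cN tau * L)))).
  move=> r b rL _; rewrite cNM; apply: ler_pM; [exact: cN_ge0|exact: cN_ge0|exact: kH|].
  rewrite (le_trans (cNB _ _))// (cNM _%:C) (cNM (pp b)) cN_real ger0_norm// cN_pp lerD// ler_wpM2l//.
    by apply: cN_ee_le => //; rewrite cN_pp.
  by apply: cN_ee_le => //; rewrite cN_pp.
have dF r := (@CInt_cder R 0 (pi / 3) (fun r b => k * hh b * EE (pp b) m r)
   (fun r b => k * hh b * ee (pp b) m r) _ h0 hF hF1 d1 d2 bd r).1.
have [B1 HB1] := cN_EE m P0 cP.
have Fb r : 0 <= r -> `|Re (CInt 0 (pi / 3) (fun b => k * hh b * EE (pp b) m r))| <=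
    (2 * (cN k * (2 * H) * B1 * (pi / 3 - 0))) * expR (- (c * r)).
  move=> r0; apply: le_trans (Re_le_cN _) _.
  have h b : 0 <= b <= pi / 3 -> cN (k * hh b * EE (pp b) m r) <= cN k * (2 * H) * (B1 * expR (- (c * r))).
    move=> bI; rewrite cNM; apply: ler_pM; [exact: cN_ge0|exact: cN_ge0|exact: kH|].
    by apply: HB1 => //; exact: Re_pp_ge.
  apply: le_trans (CInt_le h0 (hF r) h) _; rewrite le_eqVlt; apply/orP; left; apply/eqP.
  by move: (pi / 3 - 0) => q; ring.
have fE : (fun r => Re (W r * lamr mu r ^+ n)) = (fun r => Re (CInt 0 (pi / 3) (fun b => k * hh b * ee (pp b) m r))).
  by apply/funext => r; rewrite W_moment_integrand.
rewrite fE in dW *; rewrite (Iinf_FTC c0 dW dF Fb) /=.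
rewrite -mulN1r -(IntZ _ (ccont_withinR (hF 0))).
pose f j b := (m`!%:R * (3 / pi) * (A j * P ^+ (3 * j + 3) / P ^+ (3 * n + 3))) * cos ((3%:R * (j%:R - n%:R)) * b).
have fM j b : `|f j b| <= m`!%:R * (3 / pi) / P ^+ (3 * n + 3) * `|A j * P ^+ (3 * j + 3)|.
  have pi0 : 0 <= 3 / pi :> R by rewrite divr_ge0// pi_ge0.
  rewrite /f normrM (le_trans (ler_piMr _ (cos_max _)))//.
  have -> : m`!%:R * (3 / pi) * (A j * P ^+ (3 * j + 3) / P ^+ (3 * n + 3)) =
    m`!%:R * (3 / pi) / P ^+ (3 * n + 3) * (A j * P ^+ (3 * j + 3)).
    by move: (3 / pi : R) (_^-1) => u v; ring.
  by rewrite normrM ger0_norm// divr_ge0 ?exprn_ge0 ?(ltW P0)// mulr_ge0.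
have kp : 0 <= m`!%:R * (3 / pi) / P ^+ (3 * n + 3).
  by rewrite divr_ge0 ?exprn_ge0 ?(ltW P0)// mulr_ge0// divr_ge0// pi_ge0.
have Mb := asumZ (m`!%:R * (3 / pi) / P ^+ (3 * n + 3)) AH'.
have -> : Int 0 (pi / 3) (fun b => -1 * Re (k * hh b * EE (pp b) m 0)) = Int 0 (pi / 3) (fun b => sumR (f ^~ b)).
  apply: eq_Int => b bI; rewrite /f EE0 ?pp_neq0//.
  exact: (moment_density_series n (pp_neq0 bI)).
have fc j : {within `[0, (pi / 3)], continuous (f j)}.
  apply: continuous_subspaceT => x; apply: cvgMr; apply: continuous_comp; last exact: continuous_cos.
  by apply: cvgMr; exact: cvg_id.
rewrite (Int_sumR h0 fc Mb (fun j b _ => fM j b)).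
have -> : (fun j => Int 0 (pi / 3) (f j)) = (fun j => if j == n then m`!%:R * A j else 0).
  apply/funext => j; rewrite /f IntZ.
    rewrite Int_cos3; case: eqVneq => [->|_]; last by rewrite mulr0.
    have X0 : P ^+ (3 * n + 3) != 0 by rewrite expf_neq0 ?gt_eqF.
    move: (P ^+ (3 * n + 3)) (pi : R) X0 (lt0r_neq0 (pi_gt0 R)) => X q X0 q0.
    by field; rewrite X0 q0.
  apply: continuous_subspaceT => x; apply: continuous_comp; last exact: continuous_cos.
  by apply: cvgMr; exact: cvg_id.
exact: sumR_delta.
Qed.

End density.

(** The exponential exp(c r) is split into halves, one absorbing r^2 and the other the N-th
    power. *)
Lemma sqr_poly_exp {R : realType} (a q c : R) : 0 <= a -> 1 <= q -> 0 < c ->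
  exists C K : R, [/\ 0 <= C, 0 < K & forall N r, 0 <= r ->
    r ^+ 2 * (1 + a + q * r) ^+ N <= C * (K ^+ N * N`!%:R) * expR (c * r)].
Proof.
move=> a0 q1 c0; have q0 : 0 < q := lt_le_trans ltr01 q1.
have k0 : 0 < 2 * q / c by rewrite divr_gt0// mulr_gt0.
exists (2`!%:R * (2 / c) ^+ 2 * expR (c / 2 * (1 + a) / q)), (2 * q / c); split => //.
  by rewrite mulr_ge0 ?expR_ge0// mulr_ge0 ?exprn_ge0// divr_ge0// ltW.
move=> N r r0.
have h1 := @expr_le_fact_exp _ (c / 2 * r) 2 (mulr_ge0 (ltW (divr_gt0 c0 (ltr0n _ 2))) r0).
have L0 : 0 <= 1 + a + q * r by rewrite !addr_ge0// mulr_ge0// ltW.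
have h2 := @expr_le_fact_exp _ ((2 * q / c)^-1 * (1 + a + q * r)) N (mulr_ge0 (ltW (eqbRL (invr_gt0 _) k0)) L0).
have e1 : r ^+ 2 = (2 / c) ^+ 2 * (c / 2 * r) ^+ 2 by field; rewrite gt_eqF.
have e2 : (1 + a + q * r) ^+ N = (2 * q / c) ^+ N * ((2 * q / c)^-1 * (1 + a + q * r)) ^+ N.
  by rewrite -exprMn mulrA divff ?mul1r// gt_eqF.
rewrite {1}e1 e2; apply: (@le_trans _ _ ((2 / c) ^+ 2 * (2`!%:R * expR (c / 2 * r)) * ((2 * q / c) ^+ N * (N`!%:R * expR ((2 * q / c)^-1 * (1 + a + q * r)))))).
  apply: ler_pM.
  - by rewrite mulr_ge0// exprn_even_ge0.
  - by rewrite mulr_ge0// ?exprn_ge0 ?(ltW k0)// mulr_ge0// invr_ge0 ltW.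
  - by rewrite ler_wpM2l// exprn_even_ge0.
  - by rewrite ler_wpM2l// exprn_ge0// ltW.
have -> : (2 * q / c)^-1 * (1 + a + q * r) = c / 2 * (1 + a) / q + c / 2 * r.
  by field; rewrite !gt_eqF.
have -> : c * r = c / 2 * r + c / 2 * r by field.
rewrite !expRD le_eqVlt; apply/orP; left; apply/eqP.
by move: (_ ^+ N) (expR _) (expR _) (_ / c) => u v w x; ring.
Qed.

(** * Solutions as superpositions of exponentials *)

Section contour_solution.
Context {R : realType}.
Variables (mu P H a : R) (A : nat -> R).
Hypotheses (mu3 : 1 < 3 * mu) (kP : kap mu < P) (a0 : 0 <= a).
Hypothesis AH : asum (fun m => A m * P ^+ (3 * m + 3)) H.

(** Half the gap between the decay P of W and the growth kap of G: the other half absorbs the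
    polynomial factors produced by derivatives. *)
Let c := (P - kap mu) / 2.
Let c0 : 0 < c. Proof. by rewrite divr_gt0// subr_gt0. Qed.
Let mu0 : 0 < mu.
Proof. by rewrite -(pmulr_rgt0 mu (ltr0n R 3)); exact: lt_trans ltr01 mu3. Qed.
Let kap0 : 0 < kap mu.
Proof. by rewrite divr_gt0// addr_gt0// mulr_gt0. Qed.
Let P0 : 0 < P := lt_trans kap0 kP.
Let cP : c < P.
Proof. by rewrite ltr_pdivrMr// ltrBlDr mulr_natr mulr2n -addrA ltrDl addr_gt0. Qed.
Let eta := 3 * (Num.sqrt 3 * mu) ^+ 2 - 1.
Let eta0 : 0 < eta.
Proof.
rewrite subr_gt0 exprMn sqr_sqrtr//; have -> : 3 * (3 * mu ^+ 2) = (3 * mu) ^+ 2 by ring.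
exact: exprn_egt1.
Qed.

Let Re_lam r : Re (lamr mu r) = - (eta * r ^+ 3).
Proof. by rewrite Re_lamr /eta; move: (Num.sqrt 3 * mu) => s; ring. Qed.

Let tau1 : 1 <= cN (tau mu).
Proof. by rewrite (le_trans _ (Re_le_cN _))//= normr1. Qed.

Definition ff k n x t r : R[i] := W mu P A r * lamr mu r ^+ n *
  cexp (Re (lamr mu r) * t) (Im (lamr mu r) * t) * GC a (lamr mu r) k x.

Definition D1 k n x t : R := Iinf (fun r => Re (ff k n x t r)).

Lemma cN_lamr r : 0 <= r -> cN (lamr mu r) = (cN (tau mu) * r) ^+ 3.
Proof. by move=> r0; rewrite /lamr cNX cNM cN_real ger0_norm. Qed.

Lemma ff_ccont k n x t : -1 <= x <= 0 -> ccont (ff k n x t).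
Proof.
move=> /andP[x1 x0]; have lc := lamr_ccont mu.
apply: ccontM.
  apply: ccontM; first by apply: ccontM; [exact: (W_ccont mu c0 cP AH)|exact: ccontX].
  by apply: ccont_cexp => r; apply: cvgMl; [exact: lc.1|exact: lc.2].
apply: GC_ccont => //.
  by rewrite ler_norml (le_trans x0)// (le_trans _ x1)// lerN2 ler1n.
move=> L; exists ((cN (tau mu) * L) ^+ 3) => r rL; rewrite /lamr cNX cNM cN_real.
rewrite lerXn2r ?nnegrE ?mulr_ge0 ?cN_ge0//; first exact: le_trans (normr_ge0 _) rL.
by rewrite ler_wpM2l// cN_ge0.
Qed.

Lemma ff_bound : exists C K : R, [/\ 0 <= C, 0 < K &
  forall k n x t r, -1 <= x <= 0 -> 0 <= t -> 0 <= r ->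
    cN (ff k n x t r) <= C * (K ^+ (3 * n + k) * (3 * n + k)`!%:R) * expR (- (c * r))].
Proof.
have [CW CW0 HW] := W_le mu3 c0 cP AH.
have [C [K [C0 K0 HC]]] := sqr_poly_exp a0 tau1 c0.
exists (CW * expR ((a + 2) / 2) * C), K; split => //.
  by rewrite mulr_ge0// mulr_ge0// expR_ge0.
move=> k n x t r xI t0 r0.
have hG := GC_bound a0 (ltW mu0) r0 k xI.
have hl : cN (lamr mu r ^+ n) <= (1 + a + cN (tau mu) * r) ^+ (3 * n).
  rewrite cNX cN_lamr// -exprM; apply: lerXn2r; rewrite ?nnegrE.
  - by rewrite mulr_ge0// cN_ge0.
  - by rewrite !addr_ge0// mulr_ge0// cN_ge0.
  - by rewrite lerDr addr_ge0.
have he : cN (cexp (Re (lamr mu r) * t) (Im (lamr mu r) * t)) <= 1.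
  rewrite cN_cexp -[leRHS]expR0 ler_expR Re_lam mulNr oppr_le0.
  by rewrite mulr_ge0// mulr_ge0 ?(ltW eta0)// exprn_ge0.
have hW := HW r r0.
rewrite /ff (cNM _ (GC _ _ _ _)) (cNM _ (cexp _ _)) (cNM _ (_ ^+ n)).
set L := 1 + a + cN (tau mu) * r in hG hl.
have L0 : 0 <= L by rewrite !addr_ge0// mulr_ge0// cN_ge0.
apply: (@le_trans _ _ (CW * r ^+ 2 * expR (- (P * r)) * L ^+ (3 * n) * 1 *
   (expR (kap mu * r + (a + 2) / 2) * L ^+ k))).
  apply: ler_pM; rewrite ?mulr_ge0 ?cN_ge0//.
  apply: ler_pM; rewrite ?mulr_ge0 ?cN_ge0//.
  by apply: ler_pM; rewrite ?cN_ge0.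
have h := HC (3 * n + k)%N r r0; rewrite -/L in h.
have -> : CW * r ^+ 2 * expR (- (P * r)) * L ^+ (3 * n) * 1 * (expR (kap mu * r + (a + 2) / 2) * L ^+ k) =
   CW * expR ((a + 2) / 2) * (expR (- (P * r)) * expR (kap mu * r)) * (r ^+ 2 * L ^+ (3 * n + k)).
  by rewrite expRD exprD; ring.
have -> : CW * expR ((a + 2) / 2) * C * (K ^+ (3 * n + k) * (3 * n + k)`!%:R) * expR (- (c * r)) =
   CW * expR ((a + 2) / 2) * (expR (- (P * r)) * expR (kap mu * r)) *
     (C * (K ^+ (3 * n + k) * (3 * n + k)`!%:R) * expR (c * r)).
  have -> : expR (- (c * r)) = expR (- (P * r)) * expR (kap mu * r) * expR (c * r).
    by rewrite -!expRD; congr expR; rewrite /c; field.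
  by ring.
by rewrite ler_wpM2l// !mulr_ge0// expR_ge0.
Qed.

(** For t >= T0 the factor exp(- eta T0 r^3) absorbs |lambda|^n, a constant times r^3 to the power
    n, at the price of n! only; without it the power r^(3n) would cost (3n)!. *)
Lemma flat_bound T0 : 0 < T0 -> exists C K : R, [/\ 0 <= C, 0 < K &
  forall n t, T0 <= t -> `|D1 2 n 0 t| <= C * (K ^+ n * n`!%:R)].
Proof.
move=> T00.
have [CW CW0 HW] := W_le mu3 c0 cP AH.
have [C [K [C0 K0 HC]]] := sqr_poly_exp a0 tau1 c0.
have kt0 : 0 < eta * T0 by rewrite mulr_gt0.
pose Kz := cN (tau mu) ^+ 3 / (eta * T0).
exists (CW * C * edec_cst c), Kz; split.
- by rewrite mulr_ge0 ?mulr_ge0// invr_ge0 subr_ge0 ltW// expR_lt1 oppr_lt0.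
- by rewrite divr_gt0// exprn_gt0// (lt_le_trans ltr01).
move=> n t Tt; have t0 : 0 < t := lt_le_trans T00 Tt.
have -> : CW * C * edec_cst c * (Kz ^+ n * n`!%:R) = (CW * C * (Kz ^+ n * n`!%:R)) * edec_cst c by ring.
apply: Iinf_le => //; split.
  by apply: (ff_ccont 2 n t _).1; rewrite lexx lerN10.
move=> r r0; apply: le_trans (Re_le_cN _) _.
rewrite /ff GC0 mulr1 (cNM _ (cexp _ _)) (cNM _ (_ ^+ n)) cN_cexp Re_lam cNX cN_lamr//.
have h := HC 0%N r r0; rewrite !expr0 fact0 !mulr1 in h.
have h2 := @expr_le_fact_exp _ (eta * T0 * r ^+ 3) n (mulr_ge0 (ltW kt0) (exprn_ge0 3 r0)).
have h3 : ((cN (tau mu) * r) ^+ 3) ^+ n * expR (- (eta * r ^+ 3) * t) <= Kz ^+ n * n`!%:R.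
  apply: (@le_trans _ _ (((cN (tau mu) * r) ^+ 3) ^+ n * expR (- (eta * T0 * r ^+ 3)))).
    rewrite ler_wpM2l ?exprn_ge0 ?mulr_ge0 ?cN_ge0// ler_expR mulNr lerN2.
    have -> : eta * T0 * r ^+ 3 = eta * r ^+ 3 * T0 by ring.
    by rewrite ler_wpM2l// mulr_ge0 ?(ltW eta0)// exprn_ge0.
  rewrite expRN ler_pdivrMr ?expR_gt0//.
  have -> : ((cN (tau mu) * r) ^+ 3) ^+ n = Kz ^+ n * (eta * T0 * r ^+ 3) ^+ n.
    by rewrite -exprMn /Kz; congr (_ ^+ n); field; rewrite !gt_eqF.
  by rewrite -[leRHS]mulrA ler_wpM2l// exprn_ge0// divr_ge0 ?(ltW kt0)// exprn_ge0// cN_ge0.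
rewrite -mulrA; apply: (@le_trans _ _ (CW * r ^+ 2 * expR (- (P * r)) * (Kz ^+ n * n`!%:R))).
  by apply: ler_pM; rewrite ?cN_ge0 ?HW// mulr_ge0 ?expR_ge0// exprn_ge0// exprn_ge0// mulr_ge0 ?cN_ge0.
have -> : CW * C * (Kz ^+ n * n`!%:R) * expR (- (c * r)) = CW * (C * expR (- (c * r))) * (Kz ^+ n * n`!%:R) by ring.
apply: ler_wpM2r; first by rewrite mulr_ge0// exprn_ge0// divr_ge0 ?(ltW kt0)// exprn_ge0// cN_ge0.
rewrite -mulrA ler_wpM2l//; apply: le_trans (ler_wpM2r (expR_ge0 _) h) _.
rewrite -mulrA ler_wpM2l// -expRD ler_expR.
have -> : c * r - P * r = - (kap mu * r) - c * r by rewrite /c; field.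
by rewrite -opprD lerN2 lerDr mulr_ge0// ltW.
Qed.

Lemma Re_ff_edec C K k n x t : -1 <= x <= 0 -> 0 <= t ->
  (forall k n x t r, -1 <= x <= 0 -> 0 <= t -> 0 <= r ->
    cN (ff k n x t r) <= C * (K ^+ (3 * n + k) * (3 * n + k)`!%:R) * expR (- (c * r))) ->
  edec c (C * (K ^+ (3 * n + k) * (3 * n + k)`!%:R)) (fun r => Re (ff k n x t r)).
Proof.
move=> xI t0 hC; split; first exact: (ff_ccont k n t xI).1.
by move=> r r0; apply: le_trans (Re_le_cN _) (hC _ _ _ _ _ xI t0 r0).
Qed.

Lemma D1_bound : exists C K : R, [/\ 0 <= C, 0 < K &
  forall k n x t, -1 <= x <= 0 -> 0 <= t ->
    `|D1 k n x t| <= C * (K ^+ (3 * n + k) * (3 * n + k)`!%:R)].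
Proof.
have [C [K [C0 K0 hC]]] := ff_bound.
exists (C * edec_cst c), K; split => //.
  by rewrite mulr_ge0// invr_ge0 subr_ge0 ltW// expR_lt1 oppr_lt0.
move=> k n x t xI t0; rewrite mulrAC.
by rewrite /D1; exact: (Iinf_le c0 (Re_ff_edec k n xI t0 hC)).
Qed.

Lemma D1_quad_x k n : exists M, forall t, 0 <= t ->
  quad `[-1, 0] (D1 k n ^~ t) (D1 k.+1 n ^~ t) M.
Proof.
have [C [K [C0 K0 hC]]] := ff_bound.
exists (C * (K ^+ (3 * n + k.+2) * (3 * n + k.+2)`!%:R) * edec_cst c) => t t0.
have xE (x : R) : `[-1, 0]%classic x -> -1 <= x <= 0 by rewrite /= in_itv.
apply: (@Iinf_quad _ c c0 _ (fun x r => Re (ff k n x t r)) (fun x r => Re (ff k.+1 n x t r))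
   (C * (K ^+ (3 * n + k) * (3 * n + k)`!%:R)) (C * (K ^+ (3 * n + k.+1) * (3 * n + k.+1)`!%:R))).
- by move=> x /xE xI; exact: Re_ff_edec.
- by move=> x /xE xI; exact: Re_ff_edec.
move=> r r0.
have d j (x : R) : `[-1, 0]%classic x -> is_derive x 1 (fun x => Re (ff j n x t r)) (Re (ff j.+1 n x t r)).
  move=> /xE /andP[x1 x0]; have x2 : `|x| < 2.
    by rewrite ltr_norml (le_lt_trans x0)// andbT (lt_le_trans _ x1)// ltrN2 ltr1n.
  exact: (cderZ _ (GC_cder (lamr mu r) j a0 x2)).1.
apply: (deriv_quad (d k) (d k.+1)) => x /xE xI.
by apply: le_trans (Re_le_cN _) _; exact: hC.
Qed.

Lemma D1_quad_t (T : R) k n : exists M, forall x, -1 <= x <= 0 ->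
  quad `[0, T] (D1 k n x) (D1 k n.+1 x) M.
Proof.
have [C [K [C0 K0 hC]]] := ff_bound.
exists (C * (K ^+ (3 * n.+2 + k) * (3 * n.+2 + k)`!%:R) * edec_cst c) => x xI.
have tE t : `[0, T]%classic t -> 0 <= t by rewrite /= in_itv/= => /andP[].
apply: (@Iinf_quad _ c c0 _ (fun t r => Re (ff k n x t r)) (fun t r => Re (ff k n.+1 x t r))
   (C * (K ^+ (3 * n + k) * (3 * n + k)`!%:R)) (C * (K ^+ (3 * n.+1 + k) * (3 * n.+1 + k)`!%:R))).
- by move=> t /tE t0; exact: Re_ff_edec.
- by move=> t /tE t0; exact: Re_ff_edec.
move=> r r0.
have d j t : `[0, T]%classic t -> is_derive t 1 (fun t => Re (ff k j x t r)) (Re (ff k j.+1 x t r)).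
  move=> _; have h := cderM (cderZ (W mu P A r * lamr mu r ^+ j) (cder_cexp (Re (lamr mu r)) (Im (lamr mu r)) t)) (cder_cst (GC a (lamr mu r) k x) t).
  apply: (is_derive_eq h.1); congr Re; rewrite /ff.
  have -> : Re (lamr mu r) +i* Im (lamr mu r) = lamr mu r by case: (lamr mu r).
  by move: (lamr mu r) (cexp _ _) (GC _ _ _ _) => w u v; rewrite exprS; ring.
apply: (deriv_quad (d n) (d n.+1)) => t /tE t0.
by apply: le_trans (Re_le_cN _) _; exact: hC.
Qed.

Lemma D1_rec k n x t : -1 <= x <= 0 -> 0 <= t -> D1 k.+3 n x t = D1 k n.+1 x t - a * D1 k.+1 n x t.
Proof.
move=> xI t0; have [C [K [C0 K0 hC]]] := ff_bound.
have e1 := Re_ff_edec k n.+1 xI t0 hC; have e2 := Re_ff_edec k.+1 n xI t0 hC.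
rewrite /D1 -mulNr -(IinfZ c0 _ e2) -(IinfD c0 e1 (edecZ _ e2)).
apply: eq_Iinf => r _; rewrite /ff GCS//; last first.
  by case/andP: xI => x1 x0; rewrite ler_norml (le_trans x0)// (le_trans _ x1)// lerN2 ler1n.
set E := cexp _ _; set g := GC _ _ k x; set g' := GC _ _ k.+1 x; set l := lamr mu r.
have -> : W mu P A r * l ^+ n * E * (l * g - a%:C * g') =
  W mu P A r * l ^+ n.+1 * E * g + (- a)%:C * (W mu P A r * l ^+ n * E * g').
  by rewrite exprS rmorphN/=; ring.
by rewrite ReD (ReM (- a)%:C) [Re (- a)%:C]/= [Im (- a)%:C]/= mul0r subr0.
Qed.

Lemma D1_0 n t : D1 0 n 0 t = 0 /\ D1 1 n 0 t = 0.
Proof.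
have I0 : Iinf (fun _ : R => 0) = 0.
  rewrite /Iinf -[RHS](@sumR0 R); apply: eq_sumR => j.
  by rewrite Int_cst ?mul0r// ler_nat.
by split; rewrite -[RHS]I0; apply: eq_Iinf => r _; rewrite /ff GC0 mulr0.
Qed.

Lemma D1_moment n : D1 2 n 0 0 = (3 * n + 2)`!%:R * A n.
Proof.
have [C [K [C0 K0 hC]]] := ff_bound.
have N10 : -1 <= (0 : R) <= 0 by rewrite lexx lerN10.
have e := Re_ff_edec 2 n N10 (lexx 0) hC.
have fE : (fun r => Re (ff 2 n 0 0 r)) = (fun r => Re (W mu P A r * lamr mu r ^+ n)).
  by apply/funext => r; rewrite /ff GC0 !mulr0 cexp0 !mulr1.
by rewrite /D1 fE; rewrite fE in e; exact: (moment_density mu3 c0 cP AH e).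
Qed.

End contour_solution.

(** * Steering from zero to a reachable state *)

Section controlled_solution.
Context {R : realType}.

Lemma analytic_zero01 (phi : nat -> R -> R) (C K : R) : 0 <= C -> 0 < K ->
  family `[-1, 0] phi -> (forall k x, -1 <= x <= 0 -> `|phi k x| <= C * (k`!%:R * K ^+ k)) ->
  (forall k, phi k 0 = 0) -> forall x, -1 <= x <= 0 -> phi 0%N x = 0.
Proof.
move=> c0 k0 fam bd jets x xI.
have bd' k s : `[-1, 0]%classic s -> `|phi k s| <= C * (k`!%:R * K ^+ k).
  by rewrite /= in_itv/=; exact: bd.
by apply: (analytic_zero fam c0 k0 bd' jets); rewrite /= in_itv.
Qed.

(* [D k n] stands for d_x^k d_t^n y. *)
Lemma solution_family (a T r : R) (y1 : R -> R) : 0 <= a -> 0 < T -> 1 < r -> reachR a r y1 ->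
  exists (D : nat -> nat -> R -> R -> R) (C K : R), [/\ 0 < C, 0 < K,
    family2 (-1) 0 0 T D,
    (forall k n x t, -1 <= x <= 0 -> 0 <= t <= T ->
       `|D k n x t| <= C * (k`!%:R * n`!%:R ^+ 3 * (K ^+ k * K ^+ n))) &
    [/\ forall k n x t, -1 <= x <= 0 -> 0 <= t <= T ->
          D k n.+1 x t = - D k.+3 n x t - a * D k.+1 n x t,
        forall n t, 0 <= t <= T -> D 0 n 0 t = 0 /\ D 1 n 0 t = 0,
        forall x, -1 <= x <= 0 -> D 0 0 x 0 = 0 &
        forall x, -1 <= x <= 0 -> D 0 0 x T = y1 x]].
Proof.
move=> a0 T0 r1 [y1c [f [hf fy hz]]].
pose rho := (1 + r) / 2.
have rho1 : 1 < rho by rewrite /rho; lra.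
have rhor : rho < r by rewrite /rho; lra.
have rho0 : 0 < rho := lt_trans ltr01 rho1.
have [b [Cb [Cb0 bb yb]]] := holomorphic_taylor hf rho1 rhor y1c fy.
have famb : family `[-1, 0] (fun k => TS (fun j => b (k + j)%N)).
  move=> k; have [M hM] := TS_family ltr01 rho1 Cb0 bb k; exists M.
  by apply: quad_sub hM => x /=; rewrite !in_itv/= => /andP[-> /le_trans->].
have b_at k n : popc a ((fun k : nat => TS (fun j => b (k + j)%N))^~ 0) n k = popc a b n k.
  by congr popc; apply/funext => j; rewrite TS0 addn0.
have z0 : `[-1, 0]%classic (0 : R) by rewrite /= in_itv/= lexx lerN10.
have popz n : popc a b n 0 = 0 /\ popc a b n 1 = 0.
  have [h1 h2] := iter_Pop a n famb yb z0; have [h3 h4] := hz n.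
  by rewrite -!b_at -h1 -h2.
(* Here 3 * mu = P, so that kap mu = (1 + P) / 2 lies strictly between 1 and P. *)
pose P := (1 + rho) / 2; pose mu := 3^-1 + (P - 1) / 3.
have P1 : 1 < P by rewrite /P; lra.
have Prho : P < rho by rewrite /P; lra.
have P0 : 0 < P := lt_trans ltr01 P1.
have mu3 : 1 < 3 * mu by rewrite /mu; lra.
have kP : kap mu < P by rewrite /kap /mu; lra.
(* For the reversed equation a time derivative acts as P, so [d n] is the value at 0 that the n-th
   derivative of the flat output must take to match y1. *)
pose d n := popc a b n 2.
pose A n : R := d n / (3 * n + 2)`!%:R.
pose L := expR (a * rho ^+ 2).
have A_le n : `|A n * P ^+ (3 * n + 3)| <= Cb * L * P * ((P / rho) ^+ 2) * ((P / rho) ^+ 3) ^+ n.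
  rewrite normrM [`|P ^+ _|]ger0_norm ?exprn_ge0 ?(ltW P0)// /A normrM normfV.
  have hd : `|d n| <= Cb * L * ((3 * n + 2)`!%:R / rho ^+ (3 * n + 2)).
    have := popc_bound n 2 a0 rho0 Cb0 bb; rewrite [(2 + 3 * n)%N]addnC => /le_trans; apply.
    rewrite ler_wpM2r ?divr_ge0 ?exprn_ge0 ?(ltW rho0)// ler_wpM2l// lam_seq_le//.
    by rewrite mulr_ge0// exprn_ge0// ltW.
  rewrite [`|_%:R|]ger0_norm//.
  have f0 : ((3 * n + 2)`!%:R : R) != 0 by rewrite gt_eqF// fact_gt0R.
  have r0 : rho ^+ (3 * n + 2) != 0 by rewrite expf_neq0// gt_eqF.
  apply: (@le_trans _ _ (Cb * L * ((3 * n + 2)`!%:R / rho ^+ (3 * n + 2)) / (3 * n + 2)`!%:R * P ^+ (3 * n + 3))).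
    by rewrite ler_wpM2r ?exprn_ge0 ?(ltW P0)// ler_wpM2r.
  rewrite -[(P / rho) ^+ 3 ^+ n]exprM -[leRHS]mulrA -exprD [(2 + _)%N]addnC.
  rewrite [(P / rho) ^+ (3 * n + 2)]exprMn [rho^-1 ^+ _]exprVn.
  have -> : P ^+ (3 * n + 3) = P * P ^+ (3 * n + 2) by rewrite -exprS addnS.
  rewrite le_eqVlt; apply/orP; left; apply/eqP.
  move: (P ^+ (3 * n + 2)) (rho ^+ (3 * n + 2)) r0 ((3 * n + 2)`!%:R : R) f0 => u v v0 q q0.
  clearbody L P; by field; rewrite v0 q0.
have [H AH] : exists H, asum (fun m => A m * P ^+ (3 * m + 3)) H.
  have pr0 : 0 <= P / rho by rewrite divr_ge0 ?(ltW P0) ?(ltW rho0).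
  have pr1 : P / rho < 1 by rewrite ltr_pdivrMr// mul1r.
  eexists; apply: asum_dom A_le _; apply: asum_geometric.
    exact: (mulr_ge0 (mulr_ge0 (mulr_ge0 Cb0 (expR_ge0 _)) (ltW P0)) (exprn_ge0 2 pr0)).
  by rewrite exprn_ge0//= exprn_ilt1.
(* [E1] and [E2] solve the time-reversed equation z_t = z_xxx + a z_x; [E1] starts
   from [y1], and [E2] starts from 0 and agrees with [E1] at time T. *)
pose E1 := D1 mu P a A.
have [Cz [Kz [Cz0 Kz0 hz2]]] := flat_bound mu3 kP a0 AH (divr_gt0 T0 (ltr0n R 2)).
have [C1 [K1 [C10 K10 D1b]]] := D1_bound mu3 kP a0 AH.
have E1z n t : E1 0%N n 0 t = 0 /\ E1 1%N n 0 t = 0 := D1_0 mu P a A n t.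
have E1m n : E1 2%N n 0 0 = d n.
  by rewrite /E1 (D1_moment mu3 kP a0 AH) /A mulrCA divff ?mulr1// gt_eqF// fact_gt0R.
have D1r : forall k n x t, -1 <= x <= 0 -> 0 <= t -> E1 k.+3 n x t = E1 k n.+1 x t - a * E1 k.+1 n x t := D1_rec mu3 kP a0 AH.
have D1x : forall k n, exists M, forall t, 0 <= t -> quad `[-1, 0] (E1 k n ^~ t) (E1 k.+1 n ^~ t) M :=
  D1_quad_x mu3 kP a0 AH.
have D1t : forall k n, exists M, forall x, -1 <= x <= 0 -> quad `[0, T] (E1 k n x) (E1 k n.+1 x) M :=
  D1_quad_t mu3 kP a0 AH T.
rewrite -/E1 in hz2 D1b; clearbody E1; clear A A_le AH H mu mu3 kP L P P1 Prho P0.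
have x0I : -1 <= (0 : R) <= 0 by rewrite lexx lerN10.
(* Both sides solve the recursion of [flatc] with flat output d; for the jets of y1 the two zero
   rows are the conditions on P^n y1 at 0 in the reachable space. *)
have E1d k n : E1 k n 0 0 = popc a b n k.
  have h0 n' : [/\ E1 0%N n' 0 0 = 0, E1 1%N n' 0 0 = 0 & E1 2%N n' 0 0 = d n'].
    by have [h1 h2] := E1z n' 0; split => //; exact: E1m.
  have hS k' n' : E1 k'.+3 n' 0 0 = E1 k' n'.+1 0 0 - a * E1 k'.+1 n' 0 0.
    exact: (D1r k' n' 0 0 x0I (lexx 0)).
  rewrite (@flatc_unique _ a (fun k n => E1 k n 0 0) d h0 hS).
  have h0' n' : [/\ popc a b n' 0 = 0, popc a b n' 1 = 0 & popc a b n' 2 = d n'].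
    by have [h1 h2] := popz n'.
  rewrite -(@flatc_unique _ a (fun k n => popc a b n k) d h0')// => k' n' /=.
  by rewrite addrK.
pose z n t := E1 2%N n 0 t.
have [Ct [Ct0 hth]] := theta_bound T0.
have z_fam : family `[0, T] z.
  by move=> n; have [M hM] := D1t 2%N n; exists M; exact: hM.
pose w n := prodd z (theta T) n 0 0.
have tE t : `[0, T]%classic t -> 0 <= t <= T by rewrite /= in_itv.
have w_fam : family `[0, T] w.
  apply: (family_prodd 0 0 _ _ z_fam (theta_family T0)) => k.
    exists (C1 * (K1 ^+ (3 * k + 2) * (3 * k + 2)`!%:R)) => t /tE /andP[t0 _].
    exact: D1b.
  by exists (Ct * (16 ^+ k * k`!%:R ^+ 2)) => t /tE; exact: hth.
pose Km := Kz + 16.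
have Km1 : 1 <= Km by rewrite /Km ler_wpDl ?ler1n// ltW.
have w_bound n t : 0 <= t <= T -> `|w n t| <= Cz * Ct * ((2 * Km) ^+ n * n`!%:R ^+ 2).
  (* Up to T/2 the cutoff and all its derivatives vanish, so the order 1 bound on z is called upon
     only for t > T/2. *)
  move=> tT; have [tT2|tT2] := leP t (T / 2).
    rewrite /w prodd_0r; first by rewrite normr0 !mulr_ge0 ?exprn_ge0 ?mulr_ge0 ?(le_trans ler01 Km1).
    by move=> j; apply: theta_eq0 => //; case/andP: tT.
  have hphi j : `|z j t| <= Cz * (Km ^+ j * j`!%:R ^+ 2).
    apply: le_trans (hz2 j t (ltW tT2)) _; rewrite ler_wpM2l//; apply: ler_pM => //.
    - by rewrite exprn_ge0// ltW.
    - by rewrite lerXn2r ?nnegrE ?(ltW Kz0) ?(le_trans ler01 Km1)// lerDl.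
    - by rewrite expr2 ler_peMr// fact_ge1.
  have hpsi j : `|theta T j t| <= Ct * (Km ^+ j * j`!%:R ^+ 2).
    apply: le_trans (hth j t tT) _; rewrite ler_wpM2l// ler_wpM2r ?exprn_ge0//.
    by rewrite lerXn2r ?nnegrE ?(le_trans ler01 Km1)// lerDr ltW.
  have := prodd_bound n 0 0 Km1 Cz0 Ct0 hphi hpsi.
  by rewrite !addn0 expr0 mulr1.
have CC0 : 0 <= Cz * Ct by rewrite mulr_ge0.
have KK0 : 0 < 2 * Km by rewrite mulr_gt0// (lt_le_trans ltr01).
pose E2 := D2 a w.
have [C2 [K2 [C20 K20 D2b]]] := D2_bound a0 CC0 KK0 w_bound.
have D2r : forall k n x t, -1 <= x <= 0 -> 0 <= t <= T -> E2 k.+3 n x t = E2 k n.+1 x t - a * E2 k.+1 n x t :=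
  D2_rec a0 CC0 KK0 w_bound.
have D2x : forall k n, exists M, forall t, 0 <= t <= T -> quad `[-1, 0] (E2 k n ^~ t) (E2 k.+1 n ^~ t) M :=
  D2_quad_x a0 CC0 KK0 w_bound.
have D2t : forall k n, exists M, forall x, -1 <= x <= 0 -> quad `[0, T] (E2 k n x) (E2 k n.+1 x) M :=
  D2_quad_t a0 CC0 KK0 w_fam w_bound.
have E2z k n t : E2 k n 0 t = flatc a (w ^~ t) k n := D2_0 a w k n t.
have w_T n : w n T = z n T.
  rewrite /w prodd_1r ?add0n ?theta_T0// => j; exact: theta_TS.
have w_0 n : w n 0 = 0.
  by rewrite /w prodd_0r// => j; apply: theta_eq0 => //; rewrite divr_ge0// ltW.
have E20 k n x : E2 k n x 0 = 0 by exact: (D2_eq0 a k n x w_0).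
rewrite -/E2 in D2b; clearbody E2 w; clear w_bound w_fam.
pose F k n x t := E1 k n x t - E2 k n x t.
(* Undoes the time reversal, each time derivative contributing a sign. *)
pose D k n x t := (-1) ^+ n * F k n x (T - t).
have refl t : 0 <= t <= T -> 0 <= T - t <= T.
  by move=> /andP[h1 h2]; rewrite subr_ge0 h2 gerBl.
have [C [K [C0 K0 hC]]] : exists C K, [/\ 0 < C, 0 < K & forall k n x t, -1 <= x <= 0 -> 0 <= t <= T ->
       `|F k n x t| <= C * (k`!%:R * n`!%:R ^+ 3 * (K ^+ k * K ^+ n))].
  (* One rate above all those needed: 2 K1 and 27 (2 K1)^3 from splitting (3n+k)! in the bound on
     E1, K2 and 27 from the bound on E2. *)
  pose K := 1 + 2 * K1 + 27 * (2 * K1) ^+ 3 + K2 + 27.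
  have k10 : 0 <= 2 * K1 by rewrite mulr_ge0// ltW.
  have k30 : 0 <= 27 * (2 * K1) ^+ 3 by rewrite mulr_ge0// exprn_ge0.
  have K0 : 0 < K by rewrite /K !ltr_wpDr ?addr_ge0// ltW.
  have hK q : 0 <= q -> q <= K -> forall m, q ^+ m <= K ^+ m.
    by move=> q0 qK m; rewrite lerXn2r ?nnegrE// ltW.
  have K2K : K2 <= K by rewrite /K; move: k10 k30 => h1 h2; lra.
  have K1K : 2 * K1 <= K by rewrite /K; move: k30 K20 => h1 h2; lra.
  have K3K : 27 * (2 * K1) ^+ 3 <= K by rewrite /K; move: k10 K20 => h1 h2; lra.
  have K4K : 27 <= K by rewrite /K; move: k10 k30 K20 => h1 h2 h3; lra.
  exists (C1 + C2 + 1), K; split => //; first by rewrite ltr_wpDl ?addr_ge0.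
  move=> k n x t xI tI; have t0 : 0 <= t by case/andP: tI.
  set X := k`!%:R * n`!%:R ^+ 3 * (K ^+ k * K ^+ n).
  have X0 : 0 <= X by rewrite !mulr_ge0 ?exprn_ge0 ?(ltW K0).
  have e1 : `|E1 k n x t| <= C1 * X.
    apply: le_trans (D1b k n x t xI t0) _; rewrite ler_wpM2l//.
    have h := @fact_addn_le R 1 (3 * n) k ler01; rewrite expr1n mulr1 in h.
    apply: le_trans (ler_wpM2l (exprn_ge0 _ (ltW K10)) h) _.
    have -> : K1 ^+ (3 * n + k) * ((3 * n)`!%:R * k`!%:R * (1 + 1) ^+ (3 * n + k)) =
        k`!%:R * (3 * n)`!%:R * ((2 * K1) ^+ k * ((2 * K1) ^+ 3) ^+ n).
      rewrite -exprM [RHS]mulrA [k`!%:R * _ * _]mulrC -[RHS]mulrA.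
      have -> : (1 + 1 = 2 :> R) by [].
      rewrite exprD [2 ^+ _]exprD !exprMn; ring.
    apply: (@le_trans _ _ (k`!%:R * (27 ^+ n * n`!%:R ^+ 3) * ((2 * K1) ^+ k * ((2 * K1) ^+ 3) ^+ n))).
      by rewrite ler_wpM2r ?mulr_ge0 ?exprn_ge0// ler_wpM2l// fact3_le.
    have -> : k`!%:R * (27 ^+ n * n`!%:R ^+ 3) * ((2 * K1) ^+ k * ((2 * K1) ^+ 3) ^+ n) =
       k`!%:R * n`!%:R ^+ 3 * ((2 * K1) ^+ k * (27 * (2 * K1) ^+ 3) ^+ n).
      by rewrite [(27 * _) ^+ n]exprMn; ring.
    rewrite ler_wpM2l ?mulr_ge0 ?exprn_ge0//; apply: ler_pM; rewrite ?exprn_ge0//; exact: hK.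
  have e2 : `|E2 k n x t| <= C2 * X.
    apply: le_trans (D2b k n x t xI tI) _; rewrite -[leLHS]mulrA ler_wpM2l//.
    apply: (@le_trans _ _ (27 ^+ n * n`!%:R ^+ 3 * (k`!%:R * K2 ^+ k))).
      by rewrite ler_wpM2r ?mulr_ge0 ?exprn_ge0 ?(ltW K20)// fact3_le.
    have -> : 27 ^+ n * n`!%:R ^+ 3 * (k`!%:R * K2 ^+ k) = k`!%:R * n`!%:R ^+ 3 * (K2 ^+ k * 27 ^+ n) by ring.
    rewrite ler_wpM2l ?mulr_ge0 ?exprn_ge0//; apply: ler_pM; rewrite ?exprn_ge0 ?(ltW K20)//.
      exact: (hK K2 (ltW K20) K2K k).
    exact: (hK 27 (ler0n R 27) K4K n).
  rewrite /F (le_trans (ler_normB _ _))// (le_trans (lerD e1 e2))//.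
  by rewrite -mulrDl ler_wpM2r// lerDl.
have F_rec k n x t : -1 <= x <= 0 -> 0 <= t <= T -> F k.+3 n x t = F k n.+1 x t - a * F k.+1 n x t.
  move=> xI tI; rewrite /F D1r//; last by case/andP: tI.
  by rewrite D2r//; ring.
have F_0 n t : 0 <= t <= T -> F 0%N n 0 t = 0 /\ F 1%N n 0 t = 0.
  have [h1 h2] := E1z n t.
  by move=> tI; rewrite /F h1 h2 !E2z/= subrr.
have F_x k n : exists M, forall t, 0 <= t <= T -> quad `[-1, 0] (F k n ^~ t) (F k.+1 n ^~ t) M.
  have [M hM] := D1x k n.
  have [M' hM'] := D2x k n.
  exists (M + `|-1| * M') => t tI; have t0 : 0 <= t by case/andP: tI.
  by apply: quad_eq (quadD (hM t t0) (quadZ (-1) (hM' t tI))) => x _; rewrite /F /= mulN1r.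
have F_t k n : exists M, forall x, -1 <= x <= 0 -> quad `[0, T] (F k n x) (F k n.+1 x) M.
  have [M hM] := D1t k n.
  have [M' hM'] := D2t k n.
  exists (M + `|-1| * M') => x xI.
  by apply: quad_eq (quadD (hM x xI) (quadZ (-1) (hM' x xI))) => t _; rewrite /F /= mulN1r.
have N10 : (-1 : R) < 0 by rewrite ltrN10.
have TT : 0 <= T <= T by rewrite lexx ltW.
have T00 : 0 <= (0 : R) <= T by rewrite lexx ltW.
(* At time T the flat outputs of E1 and E2 agree to infinite order, so all jets of the difference at
   x = 0 vanish, and it is analytic in x. *)
have FT x : -1 <= x <= 0 -> F 0%N 0%N x T = 0.
  apply: (analytic_zero01 (phi := fun k => F k 0%N ^~ T) (ltW C0) K0).
  - by move=> k; have [M hM] := F_x k 0%N; exists M; exact: hM.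
  - move=> k s sI; apply: le_trans (hC k 0%N s T sI TT) _.
    by rewrite fact0 expr1n expr0 !mulr1.
  - move=> k; have h0 n : [/\ F 0%N n 0 T = 0, F 1%N n 0 T = 0 & F 2%N n 0 T = 0].
      have [h1 h2] := F_0 n T TT; split => //.
      by rewrite /F E2z /= w_T subrr.
    rewrite (@flatc_unique _ a (fun k n => F k n 0 T) (fun=> 0) h0 (fun k n => F_rec k n 0 T x0I TT)).
    rewrite -(@flatc_unique _ a (fun _ _ => 0) (fun _ => 0))// => k' n.
    by rewrite mulr0 subrr.
have F0 x : -1 <= x <= 0 -> F 0%N 0%N x 0 = y1 x.
  move=> xI; apply/eqP; rewrite -subr_eq0; apply/eqP.
  have FE k s : F k 0%N s 0 = E1 k 0%N s 0 by rewrite /F E20 subr0.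
  rewrite yb /=; last by rewrite in_itv.
  (* At time 0 the correction E2 is absent; E1 and the Taylor series of y1 have the same jets at 0,
     and the added constants bound their difference. *)
  apply: (analytic_zero01 (phi := fun k s => F k 0%N s 0 - TS (fun j => b (k + j)%N) s) (C := C + Cb * TS_B 1 rho) (K := K + TS_K 1 rho)) => //.
  - by rewrite addr_ge0 ?(ltW C0)// mulr_ge0// ltW// TS_B_gt0.
  - by rewrite addr_gt0// TS_K_gt0.
  - move=> k; have [M hM] := F_x k 0%N; have [M' hM'] := famb k.
    exists (M + `|-1| * M').
    by apply: quad_eq (quadD (hM 0 T00) (quadZ (-1) hM')) => s _ /=; rewrite mulN1r.
  - move=> k s sI; rewrite (le_trans (ler_normB _ _))// mulrDl lerD//.
      apply: le_trans (hC k 0%N s 0 sI T00) _; rewrite fact0 expr1n expr0 !mulr1.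
      by rewrite ler_wpM2l ?(ltW C0)// ler_wpM2l// lerXn2r ?nnegrE ?addr_ge0 ?(ltW K0) ?(ltW (TS_K_gt0 ltr01 rho1))// lerDl ltW// TS_K_gt0.
    have s1 : `|s| <= 1 by case/andP: sI => s1 s0; rewrite ler_norml s1 (le_trans s0).
    apply: le_trans (TS_bound ltr01 rho1 k Cb0 bb s1) _.
    rewrite ler_wpM2l ?mulr_ge0 ?(ltW (TS_B_gt0 ltr01 rho1))// ler_wpM2l// lerXn2r ?nnegrE ?addr_ge0 ?(ltW K0) ?(ltW (TS_K_gt0 ltr01 rho1))//.
    by rewrite lerDr ltW.
  - by move=> k; rewrite FE E1d TS0 addn0 /= subrr.
exists D, C, K; split => //.
- split.
  + move=> k n; have [M hM] := F_x k n; exists (`|(-1) ^+ n| * M) => t /tE tI.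
    exact: quadZ (hM _ (refl t tI)).
  + move=> k n; have [M hM] := F_t k n; exists (`|(-1) ^+ n| * M) => x; rewrite /= in_itv/= => xI.
    have s1 : (-1) ^+ 2 = 1 :> R by rewrite sqrrN expr1n.
    have h : quad `[0, T] (fun t => F k n x (-1 * t + T)) (fun t => -1 * F k n.+1 x (-1 * t + T)) M.
      apply: (quad_reparam s1 (hM x xI)) => t /tE tI; rewrite /= in_itv/= mulN1r addrC.
      exact: refl.
    apply: quad_eq (quadZ ((-1) ^+ n) h) => t _; rewrite /D (_ : -1 * t + T = T - t) //; try by ring.
    by rewrite exprS; ring.
  + move=> k n; exists (C * (k`!%:R * n`!%:R ^+ 3 * (K ^+ k * K ^+ n))) => x t; rewrite /= in_itv/= => xI /tE tI.
    by rewrite /D normrM normrX normrN normr1 expr1n mul1r hC// refl.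
- move=> k n x t xI tI; rewrite /D normrM normrX normrN normr1 expr1n mul1r hC// refl//.
- split.
  + move=> k n x t xI tI; rewrite /D F_rec ?refl// exprS; ring.
  + by move=> n t tI; have [h1 h2] := F_0 n _ (refl t tI); rewrite /D h1 h2 mulr0.
  + by move=> x xI; rewrite /D subr0 expr0 mul1r FT.
  + by move=> x xI; rewrite /D subrr expr0 mul1r F0.
Qed.

End controlled_solution.

Theorem theorem1p2 (R : realType) (a T r : R) (S : R -> L2 R -> L2 R)
  (a_ge0 : 0 <= a) (T_gt0 : 0 < T) (r_gt : R0 a < r)
  (S_gen : semigroup_generated_by_A a S)
  (y1 : R -> R) (y1_reach : reachR a r y1) :
  exists u : R -> R, gevrey 3 0 T u /\
    exists y : R -> R -> R,
      [/\ is_solution S a T u 0 y,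
          forall x : R, `[-1, 0]%classic x -> y x T = y1 x
        & gevrey2 (-1) 0 0 T 1 3 y].
Proof.
have r1 : 1 < r := lt_trans (R0_gt1 a_ge0) r_gt.
have [D [C [K [C0 K0 fam bd [pde bc ic fc]]]]] := solution_family a_ge0 T_gt0 r1 y1_reach.
have N10 : (-1 : R) < 0 by rewrite ltrN10.
have N1I : `[-1, 0]%classic (-1 : R) by rewrite /= in_itv/= lexx ltW.
have ftE n : n`!%:R `^ 3 = n`!%:R ^+ 3 :> R by rewrite powR_mulrn.
exists (D 0%N 0%N (-1)); split.
  apply: (@family_gevrey _ 0 T (fun n => D 0%N n (-1))) (ltW C0) K0 _ => //.
    by move=> n; have [_ ft _] := fam; have [M hM] := ft 0%N n; exists M; exact: hM.
  move=> n t; rewrite /= in_itv/= => tI.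
  have := bd 0%N n (-1) t; rewrite lexx lerN10 => /(_ isT tI).
  by rewrite fact0 mul1r expr0 mul1r ftE mulrA.
exists (D 0%N 0%N); split.
- exact: classical_is_solution.
- by move=> x; rewrite /= in_itv/=; exact: fc.
- apply: (family2_gevrey2 N10 T_gt0 fam _ C0 K0 K0) => //.
  move=> k n x t; rewrite /= !in_itv/= => xI tI.
  by rewrite (le_trans (bd k n x t xI tI))// ftE powRr1// !mulrA.
Qed.
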